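(* Let $E_2,E_3\subset\mathbb{R}$ be measurable sets of finite measure and $f_2,f_3$ functions with $|f_2|\le1_{E_2}$, $|f_3|\le1_{E_3}$. Let $\mathbb{P}$ and $\mathbb{Q}$ be as in a $\Lambda_2$-model, let $\mathbb{P}^0\subset\mathbb{P}$ be a subcollection such that the tiles $\{P_2:\vec P\in\mathbb{P}^0\}$ are pairwise disjoint (as subsets of the time–frequency plane $I_{\vec P}\times\omega_{P_2}$), and let $\tilde{\mathbb{Q}}\subset\mathbb{Q}$. For $\mathfrak b\in\mathbb{Z}$ let $$\mathbb{P}^0_{\mathfrak b}(\tilde{\mathbb{Q}})=\Big\{\vec P\in\mathbb{P}^0:\ 2^{-\mathfrak b-1}<|I_{\vec P}|^{-1/2}\Big|\Big\langle\int_0^1BHT^{\alpha,\tilde{\mathbb{Q}}}_{\omega_{P_2}}(f_2,f_3)\,d\alpha,\ \Phi_{P_2,0}\Big\rangle\Big|\le2^{-\mathfrak b}\Big\}.$$ Then for every $0<\tilde\epsilon<1$, $$\sum_{\vec P\in\mathbb{P}^0_{\mathfrak b}(\tilde{\mathbb{Q}})}|I_{\vec P}|\le C_{\tilde\epsilon}\,2^{\frac{\mathfrak b}{1-\tilde\epsilon}}|E_2|^{1/2}|E_3|^{1/2},$$ with $C_{\tilde\epsilon}$ independent of $\mathfrak b$, $E_2,E_3$, the collections and the wave packets.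
   Context: Tiles, tri-tiles, wave packets, adapted, rank-1, $\subset\subset$ as follows. For $\sigma\in\{0,\frac13,\frac23\}$, $D_\sigma=\{2^j(k+[0,1)+(-1)^j\sigma)\}$. A tile is $P=(I_P,\omega_P)$ with $I_P\in D_0$, $\omega_P\in D_\sigma$, $|I_P||\omega_P|=1$; a tri-tile is a triple of tiles sharing the time interval $I_{\vec P}$. $\chi_I(x)=(1+|x-c_I|/|I|)^{-1}$. A wave packet on $P$ is $\Phi_P$ with $\mathrm{supp}\hat\Phi_P\subset\frac9{10}\omega_P$ and $|\frac{d^k}{dx^k}[e^{-2\pi ic_{\omega_P}x}\Phi_P(x)]|\le C_k|I_P|^{-1/2-k}\chi_{I_P}^L(x)$, $0\le k\le K$ ($K,L$ large fixed). $\vec P$ adapted to $\Gamma$: $\mathrm{dist}(\omega_{\vec P},\Gamma)\simeq|I_{\vec P}|^{-1}$. Orders: $P'\le P$ iff $P'=P$ or ($I_{P'}\subsetneq I_P$ and $3\omega_P\subseteq3\omega_{P'}$); $P'\lesssim P$ iff $I_{P'}\subseteq I_P$ and $10^7\omega_P\subseteq10^7\omega_{P'}$; $P'\lesssim'P$ iff $P'\lesssim P$ and not $P'\le P$. Rank-1 collection: distinct tri-tiles differ in every component; $P'_j\le P_j$ for some $j$ implies $P'_i\lesssim P_i$ for all $i$, and if also $|I_{\vec P'}|>10^9|I_{\vec P}|$ then $P'_i\lesssim'P_i$ for $i\ne j$. $\omega_1\subset\subset\omega_2$: $|\omega_1|\le c|\omega_2|$ (fixed small $c$) and $\omega_1\subset\frac9{10}\omega_2$.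 $BHT^{\alpha,\tilde{\mathbb{Q}}}_\omega(f_2,f_3)=\sum_{\vec Q\in\tilde{\mathbb{Q}}:\omega_{Q_3}\subset\subset\omega}|I_{\vec Q}|^{-1/2}\langle f_2,\Phi^\alpha_{Q_1,2}\rangle\langle f_3,\Phi^\alpha_{Q_2,3}\rangle\Phi^\alpha_{Q_3,5}$ with wave packets $\Phi^\alpha_{Q_k,j}$ on $Q_k$, $\alpha\in[0,1]$. In a $\Lambda_2$-model, $\mathbb{P}$ is a finite collection of tri-tiles $(P_1,P_2,P_4)$ adapted to $\{\xi_1=-\xi_2,\xi_3=0\}$ with wave packets $\Phi_{P_2,0}$ on $P_2$, and $\mathbb{Q}$ is a finite rank-1 collection of tri-tiles adapted to $\{\xi_1=-\xi_2/2=-\xi_3\}$; both collections are assumed sparse: all tri-tiles have the same shift and for distinct frequency cubes $Q\ne Q'$, $|Q|<|Q'|$ implies $|10^9Q|<|Q'|$ and $|Q|=|Q'|$ implies $10^9Q\cap10^9Q'=\emptyset$.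
   Formalization: In the definition of a rank-1 collection the condition $|I_{\vec P'}|>10^9|I_{\vec P}|$, which can never hold when $P'_j\le P_j$, is corrected to $|I_{\vec P}|>10^9|I_{\vec P'}|$; without this correction the stated estimate fails. *)

(* Defs.v *)
(* MathComp + MathComp-Analysis (R : realType), complex numbers R[i]
   from mathcomp-real-closed. *)
From mathcomp Require Import all_boot all_order all_algebra.
From mathcomp Require Import all_classical all_reals all_analysis.
From mathcomp Require Import complex.
From Stdlib Require List.
Set Implicit Arguments.
Unset Strict Implicit.
Unset Printing Implicit Defensive.
Import Order.TTheory GRing.Theory Num.Theory ComplexField.
Local Open Scope classical_set_scope.
Local Open Scope ring_scope.

Section Defs.
Variable R : realType.

Local Notation C := R[i].
Local Notation mu := (@lebesgue_measure R).

(** * Complex numbers: modulus, exponential, integrals *)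
Definition cabs (z : C) : R := Num.sqrt (complex.Re z ^+ 2 + complex.Im z ^+ 2).
Definition expi (t : R) : C := (cos t +i* sin t)%C.

(** Lebesgue integral over [D] of a complex valued function
    (real and imaginary part separately). *)
Definition cint_on (D : set R) (g : R -> C) : C :=
  (Rintegral mu D (fun x => complex.Re (g x)) +i*
   Rintegral mu D (fun x => complex.Im (g x)))%C.
Definition cint (g : R -> C) : C := cint_on setT g.

(** L^2 pairing <f, g> = \int f \bar g *)
Definition ip (f g : R -> C) : C := cint (fun x => f x * (g x)^*).

(** Fourier transform  \hat f (xi) = \int f(x) e^{-2 pi i x xi} dx *)
Definition ft (f : R -> C) (xi : R) : C :=
  cint (fun x => f x * expi (- (2 * pi * x * xi))).

Definition cmeasurable (f : R -> C) : Prop :=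
  measurable_fun setT (fun x => complex.Re (f x)) /\
  measurable_fun setT (fun x => complex.Im (f x)).

(** * Intervals [left, left + len) *)
Record itv := Itv { ileft : R; ilen : R }.
Definition inI (I : itv) (x : R) : Prop := ileft I <= x < ileft I + ilen I.
Definition ctr (I : itv) : R := ileft I + ilen I / 2.
(** dilation [l I]: same ctr, length multiplied by l *)
Definition dil (l : R) (I : itv) : itv := Itv (ctr I - l * ilen I / 2) (l * ilen I).
Definition itv_sub (I J : itv) : Prop := forall x, inI I x -> inI J x.
Definition itv_ssub (I J : itv) : Prop := itv_sub I J /\ ~ itv_sub J I.

(** D_sigma = { 2^j (k + [0,1) + (-1)^j sigma) : j, k in Z } *)
Definition dyadic (s : R) (I : itv) : Prop :=
  exists j k : int, ilen I = 2%:R ^ j /\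
                    ileft I = 2%:R ^ j * (k%:~R + (-1) ^ j * s).

Definition shift_ok (s : R) : Prop := s = 0 \/ s = 1/3%:R \/ s = 2%:R/3%:R.

(** * Tiles *)
Record tile := Tile { tI : itv; tw : itv }.
Definition is_tile (s : R) (P : tile) : Prop :=
  dyadic 0 (tI P) /\ dyadic s (tw P) /\ ilen (tI P) * ilen (tw P) = 1.

(** * Tri-tiles: common time interval and three frequency intervals *)
Record tritile := TriTile { TI : itv; W1 : itv; W2 : itv; W3 : itv }.
Definition tw_of (T : tritile) (i : 'I_3) : itv :=
  match val i with 0 => W1 T | 1 => W2 T | _ => W3 T end.
Definition tcomp (T : tritile) (i : 'I_3) : tile := Tile (TI T) (tw_of T i).
Definition i0 : 'I_3 := @Ordinal 3 0 isT.
Definition i1 : 'I_3 := @Ordinal 3 1 isT.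
Definition i2 : 'I_3 := @Ordinal 3 2 isT.

(** a tri-tile with shift vector s *)
Definition is_tritile (s : 'I_3 -> R) (T : tritile) : Prop :=
  forall i, shift_ok (s i) /\ is_tile (s i) (tcomp T i).

(** frequency cube omega_T = W1 x W2 x W3 in R^3 *)
Definition in_cube (T : tritile) (xi : 'I_3 -> R) : Prop :=
  forall i, inI (tw_of T i) (xi i).
Definition in_dil_cube (l : R) (T : tritile) (xi : 'I_3 -> R) : Prop :=
  forall i, inI (dil l (tw_of T i)) (xi i).
Definition side (T : tritile) : R := ilen (W1 T).

Definition eucl (xi ga : 'I_3 -> R) : R :=
  Num.sqrt (\sum_(i < 3) (xi i - ga i) ^+ 2).
Definition dist_set (A B : set ('I_3 -> R)) : R :=
  inf [set d | exists xi ga, A xi /\ B ga /\ d = eucl xi ga].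

(** Gamma_1 = {xi1 = -xi2, xi3 = 0}, Gamma_2 = {xi1 = -xi2/2 = -xi3} *)
Definition Gamma1 : set ('I_3 -> R) :=
  [set xi | xi i0 = - xi i1 /\ xi i2 = 0].
Definition Gamma2 : set ('I_3 -> R) :=
  [set xi | xi i0 = - (xi i1 / 2%:R) /\ - (xi i1 / 2%:R) = - xi i2].

(** adapted: a1 |I|^{-1} <= dist(omega_T, Gamma) <= a2 |I|^{-1} *)
Definition adapted (a1 a2 : R) (G : set ('I_3 -> R)) (T : tritile) : Prop :=
  a1 / ilen (TI T) <= dist_set (in_cube T) G <= a2 / ilen (TI T).

(** * Orders on tiles *)
Definition tle (P' P : tile) : Prop :=
  P' = P \/ (itv_ssub (tI P') (tI P) /\ itv_sub (dil 3%:R (tw P)) (dil 3%:R (tw P'))).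
Definition tlsim (P' P : tile) : Prop :=
  itv_sub (tI P') (tI P) /\ itv_sub (dil (10%:R ^+ 7) (tw P)) (dil (10%:R ^+ 7) (tw P')).
Definition tlsim' (P' P : tile) : Prop := tlsim P' P /\ ~ tle P' P.

Definition rank1 (Q : seq tritile) : Prop :=
  (forall T T', List.In T Q -> List.In T' Q -> T <> T' ->
     forall i, tcomp T i <> tcomp T' i) /\
  (forall T T', List.In T Q -> List.In T' Q -> forall j,
     tle (tcomp T' j) (tcomp T j) ->
     (forall i, tlsim (tcomp T' i) (tcomp T i)) /\
     (10%:R ^+ 9 * ilen (TI T') < ilen (TI T) ->
        forall i, i != j -> tlsim' (tcomp T' i) (tcomp T i))).

(** sparse collection (the common shift is part of the collection data) *)
Definition sparse (s : 'I_3 -> R) (Q : seq tritile) : Prop :=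
  (forall T, List.In T Q -> is_tritile s T) /\
  (forall T T', List.In T Q -> List.In T' Q -> in_cube T <> in_cube T' ->
     (side T < side T' -> 10%:R ^+ 9 * side T < side T') /\
     (side T = side T' ->
        ~ exists xi, in_dil_cube (10%:R ^+ 9) T xi /\ in_dil_cube (10%:R ^+ 9) T' xi)).

(** * Wave packets *)
Definition chi (I : itv) (x : R) : R := (1 + `|x - ctr I| / ilen I)^-1.

Definition cderiv (k : nat) (g : R -> C) (x : R) : C :=
  (derive1n k (fun y => complex.Re (g y) : R^o) x +i*
   derive1n k (fun y => complex.Im (g y) : R^o) x)%C.

Definition wave_packet (K L : nat) (Ck : nat -> R) (P : tile) (Phi : R -> C) : Prop :=
  let g := fun x => expi (- (2 * pi * ctr (tw P) * x)) * Phi x in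
  cmeasurable Phi /\
  (forall xi, ~ inI (dil (9%:R / 10%:R) (tw P)) xi -> ft Phi xi = 0) /\
  (forall k, (k < K)%N -> forall x,
     derivable (derive1n k (fun y => complex.Re (g y) : R^o)) x 1 /\
     derivable (derive1n k (fun y => complex.Im (g y) : R^o)) x 1) /\
  (forall k, (k <= K)%N -> forall x,
     cabs (cderiv k g x) <=
       Ck k * ilen (tI P) `^ (- (1 / 2%:R) - k%:R) * chi (tI P) x ^+ L).

(** omega_1 ⊂⊂ omega_2 *)
Definition ssubsub (c : R) (w1 w2 : itv) : Prop :=
  ilen w1 <= c * ilen w2 /\ itv_sub w1 (dil (9%:R / 10%:R) w2).

(** BHT^{alpha, Qt}_omega (f2, f3) (x); Phi T i is the wave packet
    Phi^alpha_{Q_{i+1}, (2,3,5)_i} *)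
Definition BHT (c : R) (Qt : seq tritile) (Phi : tritile -> 'I_3 -> R -> C)
  (w : itv) (f2 f3 : R -> C) (x : R) : C :=
  \sum_(T <- Qt | `[< ssubsub c (W3 T) w >])
     ((ilen (TI T) `^ (- (1 / 2%:R)) +i* 0)%C * ip f2 (Phi T i0) * ip f3 (Phi T i1)
       * Phi T i2 x).

(** < \int_0^1 BHT^{alpha,Qt}_{omega_{P2}}(f2,f3) d alpha , Phi_{P2,0} > *)
Definition coefP (c : R) (Qt : seq tritile) (Phiq : R -> tritile -> 'I_3 -> R -> C)
  (f2 f3 : R -> C) (T : tritile) (PhiP : R -> C) : C :=
  ip (fun x => cint_on `[0, 1] (fun a => BHT c Qt (Phiq a) (W2 T) f2 f3 x)) PhiP.

End Defs.

(* Main.v *)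
(* Pairing the averaged bilinear operator with coefficients of modulus |I_P|^(1/2) turns
   X = sum |I_P| into at most 2^b times a model sum over Q of |I_Q|^(-1/2) A_1 A_2 A_3, where
   A_1, A_2 are the coefficients of f_2, f_3 and A_3 those of the function
   g = sum_P z_P Phi_P, truncated to the P with omega_(Q_3) inside 9/10 omega_(P_2).
   Since the tiles P_2 are disjoint, the size of A_3 on a set of tri-tiles is O(1), and even
   O(delta) if around their time intervals J, at every scale r >= |J|, the I_P have total length
   at most delta r; the energy of A_3 is O(X^(1/2)).
   Split Q by the dyadic value 2^-d of this density delta: at level d the time intervals
   live in a set of measure O(2^d X), so that the energies of A_1 and A_2 improve to the square
   roots of min(|E_j|, 2^d X). Interpolating between the size and energy bounds of each of the
   three sequences and summing the geometric series in d gives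
   X <= C 2^b (|E_2| |E_3|)^(q/2) X^(1 - q) with q = 1 - eps. *)

Require Import Defs.
From mathcomp Require Import all_boot all_order all_algebra.
From mathcomp Require Import reals exp ring lra.
Set Implicit Arguments.
Unset Strict Implicit.
Unset Printing Implicit Defensive.
Import Order.TTheory GRing.Theory Num.Theory.
Local Open Scope ring_scope.

(** * Spatial decay and sums over disjoint intervals *)

Section Decay.
Variable R : realType.
Implicit Types (r z a b k : R).

Definition dk r z : R := (1 + `|z| / r)^-1.

Lemma dk_den r z : 0 < r -> 1 <= 1 + `|z| / r.
Proof. by move=> r0; rewrite lerDl divr_ge0 // ltW. Qed.

Lemma dk_den0 r z : 0 < r -> 0 < 1 + `|z| / r.
Proof. by move=> r0; exact: lt_le_trans ltr01 (dk_den z r0). Qed.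

Lemma dk_gt0 r z : 0 < r -> 0 < dk r z.
Proof. by move=> r0; rewrite invr_gt0 dk_den0. Qed.

Lemma dk_ge0 r z : 0 < r -> 0 <= dk r z.
Proof. by move=> r0; exact/ltW/dk_gt0. Qed.

Lemma dk_le1 r z : 0 < r -> dk r z <= 1.
Proof. by move=> r0; rewrite invf_le1 ?dk_den ?dk_den0. Qed.

Lemma dkN r z : dk r (- z) = dk r z.
Proof. by rewrite /dk normrN. Qed.

Lemma dkC r a b : dk r (a - b) = dk r (b - a).
Proof. by rewrite -dkN opprB. Qed.

Lemma dkX_ge0 r z n : 0 < r -> 0 <= dk r z ^+ n.
Proof. by move=> r0; rewrite exprn_ge0 // dk_ge0. Qed.

Lemma dkX_le1 r z n : 0 < r -> dk r z ^+ n <= 1.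
Proof. by move=> r0; rewrite exprn_ile1 // ?dk_ge0 ?dk_le1. Qed.

Lemma dkX_le r z m n : 0 < r -> (m <= n)%N -> dk r z ^+ n <= dk r z ^+ m.
Proof. by move=> r0 mn; apply: ler_wiXn2l => //; rewrite ?dk_ge0 ?dk_le1. Qed.

Lemma dk_le_norm r a b : 0 < r -> `|a| <= `|b| -> dk r b <= dk r a.
Proof.
move=> r0 ab; rewrite lef_pV2 ?posrE ?dk_den0 //.
by rewrite lerD2l ler_pM2r ?invr_gt0.
Qed.

Lemma dk_le_scale r r' z : 0 < r -> r <= r' -> dk r z <= dk r' z.
Proof.
move=> r0 rr'; have r'0 := lt_le_trans r0 rr'.
rewrite lef_pV2 ?posrE ?dk_den0 //.
by rewrite lerD2l ler_wpM2l // lef_pV2.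
Qed.

Lemma dkM r r' a b : 0 < r' -> r' <= r -> dk r' a * dk r b <= dk r (a + b).
Proof.
move=> r'0 r'r; have r0 := lt_le_trans r'0 r'r.
rewrite /dk -invfM lef_pV2 ?posrE; last 2 first.
- by rewrite mulr_gt0 ?dk_den0.
- by rewrite dk_den0.
apply: (@le_trans _ _ (1 + `|a| / r + `|b| / r)).
  by rewrite -addrA lerD2l -mulrDl ler_pM2r ?invr_gt0 // ler_normD.
have aa : `|a| / r <= `|a| / r' by rewrite ler_wpM2l // lef_pV2.
have : 0 <= `|a| / r' * (`|b| / r).
  by rewrite mulr_ge0 // divr_ge0 // ltW.
nra.
Qed.

Lemma dk_small r z e : 0 < r -> 0 < e -> e <= `|z| -> dk r z <= r / e.
Proof.
move=> r0 e0 ez; rewrite /dk -[r / e]invrK invf_div lef_pV2 ?posrE.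
- by apply: (@le_trans _ _ (`|z| / r)); rewrite ?ler_pM2r ?invr_gt0 // lerDr.
- by rewrite dk_den0.
- by rewrite divr_gt0.
Qed.

Lemma dk_shift r a b : 0 < r -> `|b| <= r -> dk r (a + b) <= 2 * dk r a.
Proof.
move=> r0 br; have b2 : 1 <= 2 * dk r b.
  rewrite /dk ler_pdivlMr ?dk_den0 // mul1r.
  by rewrite -lerBrDl ler_pdivrMr //; lra.
have := dkM (a + b) (- b) r0 (lexx r); rewrite addrK dkN.
have := dk_gt0 (a+b) r0; nra.
Qed.
End Decay.

Section DisjointSums.
Variables (R : realType) (X : finType).
Implicit Types (S : {set X}) (a l : X -> R).

Definition itv_disj a l x y := (a x + l x <= a y) || (a y + l y <= a x).

Lemma itv_disjC a l x y : itv_disj a l x y = itv_disj a l y x.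
Proof. by rewrite /itv_disj orbC. Qed.

Lemma sum_incr_disj (F : R -> R) a l M S :
  {homo F : x y / x <= y} -> (forall x, F x <= M) -> (forall x, x \in S -> 0 < l x) ->
  {in S &, forall x y, x != y -> itv_disj a l x y} ->
  forall A, F A <= M -> (forall x, x \in S -> A <= a x) ->
  \sum_(x in S) (F (a x + l x) - F (a x)) <= M - F A.
Proof.
move=> Fm FM; move: {2}#|S| (leqnn #|S|) => n; elim: n S => [|n IH] S.
  rewrite leqn0 cards_eq0 => /eqP -> _ _ A FA _; rewrite big_set0 subr_ge0 //.
move=> Sn l0 disj A FA Aa.
have [->|[x0 x0S]] := set_0Vmem S; first by rewrite big_set0 subr_ge0.
case: (arg_minP a x0S) => x xS' xmin; have {xS'} xS : x \in S by [].
rewrite (big_setD1 x) //=.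
have H : \sum_(y in S :\ x) (F (a y + l y) - F (a y)) <= M - F (a x + l x).
  apply: IH => //.
  - by move: Sn; rewrite (cardsD1 x S) xS add1n ltnS.
  - by move=> y; rewrite !inE => /andP[_ /l0].
  - by move=> y z; rewrite !inE => /andP[_ yS] /andP[_ zS]; exact: disj.
  - move=> y; rewrite !inE => /andP[yx yS]; have := disj _ _ xS yS.
    rewrite eq_sym yx /itv_disj => /(_ isT) /orP[//|h].
    have := xmin _ yS; have := l0 _ yS => /=; lra.
have := Fm _ _ (Aa _ xS); lra.
Qed.

Definition sgf (t : R) : R := t / (1 + `|t|).

Lemma sgf_den (t : R) : 0 < 1 + `|t|.
Proof. by rewrite ltr_pwDl. Qed.

Lemma sgf_incr (a b M : R) : a <= b -> `|a| <= M -> `|b| <= M ->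
  (b - a) / (1 + M) ^+ 2 <= sgf b - sgf a.
Proof.
move=> ab aM bM; have M0 : 0 < 1 + M by have := normr_ge0 a; lra.
rewrite /sgf.
have E : b / (1 + `|b|) - a / (1 + `|a|) =
   (b * (1 + `|a|) - a * (1 + `|b|)) / ((1 + `|a|) * (1 + `|b|)).
  by field; rewrite !gt_eqF ?sgf_den.
rewrite E.
have D0 : 0 < (1 + `|a|) * (1 + `|b|) by rewrite mulr_gt0 ?sgf_den.
have DM : (1 + `|a|) * (1 + `|b|) <= (1 + M) ^+ 2.
  by rewrite expr2; apply: ler_pM; rewrite ?lerD2l // ltW // sgf_den.
have N : b - a <= b * (1 + `|a|) - a * (1 + `|b|).
  case: (lerP 0 a) => a0; case: (lerP 0 b) => b0;
    rewrite ?(ger0_norm a0) ?(ger0_norm b0) ?(ltr0_norm a0) ?(ltr0_norm b0); nra.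
apply: (@le_trans _ _ ((b - a) / ((1 + `|a|) * (1 + `|b|)))).
  by rewrite ler_wpM2l ?subr_ge0 // lef_pV2 ?posrE ?exprn_gt0.
by rewrite ler_pM2r ?invr_gt0.
Qed.

Lemma sgf_mono : {homo sgf : x y / x <= y}.
Proof.
move=> x y xy; rewrite -subr_ge0.
set M := Num.max `|x| `|y|.
apply: le_trans (@sgf_incr x y M xy _ _); rewrite ?le_max ?lexx ?orbT //.
rewrite divr_ge0 ?subr_ge0 // exprn_ge0 // addr_ge0 //.
by rewrite le_max normr_ge0.
Qed.

Lemma sgf_le1 t : sgf t <= 1.
Proof. by rewrite ler_pdivrMr ?sgf_den // mul1r; have := ler_norm t; lra. Qed.

Lemma sgf_geN1 t : -1 <= sgf t.
Proof. by rewrite ler_pdivlMr ?sgf_den //; have := ler_norm (- t); rewrite normrN; lra. Qed.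

Lemma sum_dk_disj a l S (r k z : R) : 0 < r -> 0 <= k ->
  (forall x, x \in S -> 0 < l x <= k * r) ->
  {in S &, forall x y, x != y -> itv_disj a l x y} ->
  \sum_(x in S) l x * dk r (a x + l x / 2 - z) ^+ 2 <= 2 * (1 + k) ^+ 2 * r.
Proof.
move=> r0 k0 hl disj.
have k10 : 0 < 1 + k by lra.
have [->|[x0 x0S]] := set_0Vmem S.
  by rewrite big_set0 mulr_ge0 ?ltW // mulr_gt0 // exprn_gt0.
case: (arg_minP a x0S) => xm xmS xmin.
pose F t := sgf ((t - z) / r).
have Fm : {homo F : x y / x <= y}.
  by move=> x y xy; apply: sgf_mono; rewrite ler_pM2r ?invr_gt0 // lerD2r.
have := @sum_incr_disj F a l 1 S Fm (fun t => sgf_le1 _) _ disj (a xm) (sgf_le1 _) xmin.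
move=> /(_ (fun x xS => proj1 (andP (hl x xS)))) H.
have {H} H : \sum_(x in S) (F (a x + l x) - F (a x)) <= 2.
  by apply: (le_trans H); have := sgf_geN1 ((a xm - z) / r); rewrite -/(F (a xm)); lra.
apply: (@le_trans _ _ (((1 + k) ^+ 2 * r) * \sum_(x in S) (F (a x + l x) - F (a x)))); last first.
  have h : 0 <= (1 + k) ^+ 2 * r by rewrite mulr_ge0 ?exprn_ge0 // ltW.
  by have := ler_wpM2l h H; lra.
rewrite mulr_sumr; apply: ler_sum => x xS.
have /andP[lx0 lxk] := hl x xS.
set c := a x + l x / 2 - z.
have E1 : (a x + l x - z) / r = (c + l x / 2) / r by rewrite /c; field; lra.
have E2 : (a x - z) / r = (c - l x / 2) / r by rewrite /c; field; lra.
have := @sgf_incr ((a x - z) / r) ((a x + l x - z) / r) (`|c| / r + k / 2).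
have nr (t : R) : `|t / r| = `|t| / r by rewrite normrM normfV (gtr0_norm r0).
have lkr : l x / 2 / r <= k / 2 by rewrite ler_pdivrMr //; lra.
have n1 : `|(a x - z) / r| <= `|c| / r + k / 2.
  rewrite E2 nr; apply: (@le_trans _ _ (`|c| / r + l x / 2 / r)); last by rewrite lerD2l.
  rewrite -mulrDl ler_pM2r ?invr_gt0 //; apply: (le_trans (ler_normB _ _)).
  by rewrite lerD2l ger0_norm //; lra.
have n2 : `|(a x + l x - z) / r| <= `|c| / r + k / 2.
  rewrite E1 nr; apply: (@le_trans _ _ (`|c| / r + l x / 2 / r)); last by rewrite lerD2l.
  rewrite -mulrDl ler_pM2r ?invr_gt0 //; apply: (le_trans (ler_normD _ _)).
  by rewrite lerD2l ger0_norm //; lra.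
have n3 : (a x - z) / r <= (a x + l x - z) / r.
  by rewrite ler_pM2r ?invr_gt0 //; lra.
move=> /(_ n3 n1 n2); rewrite -/(F _) -/(F _) => H2.
apply: (@le_trans _ _ ((1 + k) ^+ 2 * r * (((a x + l x - z) / r - (a x - z) / r) / (1 + (`|c| / r + k / 2)) ^+ 2))).
  have -> : (a x + l x - z) / r - (a x - z) / r = l x / r by field; lra.
  have -> : (1 + k) ^+ 2 * r * (l x / r / (1 + (`|c| / r + k / 2)) ^+ 2) =
     l x * ((1 + k) / (1 + (`|c| / r + k / 2))) ^+ 2.
    have h0 : 0 <= `|c| / r by rewrite divr_ge0 // ltW.
    field; rewrite gt_eqF /=; [|lra].
    have := normr_ge0 c; nra.
  have h0 : 0 <= `|c| / r by rewrite divr_ge0 // ltW.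
  rewrite ler_pM2l // ler_pXn2r ?nnegrE //; [|by rewrite dk_ge0|by rewrite divr_ge0 //; lra].
  rewrite /dk -/c -[X in X <= _]mul1r ler_pdivrMr; last lra.
  rewrite mulrAC ler_pdivlMr; last lra.
  nra.
by rewrite ler_wpM2l // mulr_ge0 ?exprn_ge0 // ltW.
Qed.

Lemma geo_sum_up (S : {set X}) (g l : X -> R) (A r0 : R) : 0 <= A -> 0 <= r0 ->
  {in S, forall x, 0 <= l x <= r0} ->
  {in S &, forall x y, l x < l y -> 2 * l x <= l y} ->
  {in S, forall y, \sum_(x in S | l x == l y) g x <= A * l y} ->
  \sum_(x in S) g x <= 2 * A * r0.
Proof.
move=> A0; move: {2}#|S| (leqnn #|S|) r0 => n; elim: n S => [|n IH] S.
  rewrite leqn0 cards_eq0 => /eqP -> r0 r00 *; rewrite big_set0 !mulr_ge0 //.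
move=> Sn r0 r00 lr half hg.
have [->|[x0 x0S]] := set_0Vmem S; first by rewrite big_set0 !mulr_ge0.
case: (arg_maxP l x0S) => y yS' ymax; have {yS'} yS : y \in S by [].
rewrite (bigID (fun x => l x == l y)) /=.
pose S' := [set x in S | l x != l y].
have S'S : {subset S' <= S} by move=> x; rewrite inE => /andP[].
have H : \sum_(x in S') g x <= 2 * A * (l y / 2).
  apply: IH.
  - rewrite -ltnS; apply: leq_trans Sn; apply: proper_card.
    apply/properP; split; first by apply/subsetP.
    by exists y => //; rewrite inE eqxx andbF.
  - by have /andP[] := lr y yS; lra.
  - move=> x xS'; have xS := S'S _ xS'; have /andP[-> /= _] := lr x xS.
    have xy : l x < l y.
      rewrite lt_neqAle; apply/andP; split; last exact: ymax.
      by move: xS'; rewrite inE => /andP[].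
    by have := half x y xS yS xy; lra.
  - by move=> x z /S'S xS /S'S zS; exact: half.
  - move=> z zS'; apply: le_trans (hg z (S'S _ zS')).
    rewrite le_eqVlt; apply/orP; left; apply/eqP; apply: eq_bigl => x.
    rewrite inE; case: (eqVneq (l x) (l z)) => [e|]; last by rewrite !andbF.
    by move: zS'; rewrite inE -e => /andP[_ ->]; rewrite !andbT.
have -> : \sum_(i in S | l i != l y) g i = \sum_(x in S') g x.
  by apply: eq_bigl => x; rewrite inE.
have := hg y yS; have /andP[_ ly] := lr y yS; nra.
Qed.

Lemma geo_sum_down (S : {set X}) (g l : X -> R) (A k : R) : 0 <= A -> 0 < k ->
  {in S, forall x, k <= l x} ->
  {in S &, forall x y, l x < l y -> 2 * l x <= l y} ->
  {in S, forall y, \sum_(x in S | l x == l y) g x <= A / l y} ->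
  \sum_(x in S) g x <= 2 * A / k.
Proof.
move=> A0 k0 lk half hg.
have l0 x : x \in S -> 0 < l x by move=> /lk; exact: lt_le_trans.
apply: (@geo_sum_up S g (fun x => (l x)^-1)) => //.
- by rewrite invr_ge0 ltW.
- by move=> x xS; rewrite invr_ge0 ltW ?l0 //= lef_pV2 ?posrE ?l0 // lk.
- move=> x y xS yS; rewrite ltf_pV2 ?posrE ?l0 // => /(half _ _ yS xS) h.
  rewrite -[leLHS]invrK lef_pV2 ?posrE ?invr_gt0 ?mulr_gt0 ?invr_gt0 ?l0 //.
  by rewrite invfM invrK; lra.
- move=> y yS; apply: le_trans (hg y yS); rewrite le_eqVlt; apply/orP; left.
  by apply/eqP/eq_bigl => x; rewrite (inj_eq invr_inj).
Qed.

End DisjointSums.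

(** * Almost orthogonality over forests *)

Section Forest.
Variables (R : realType) (X : finType) (a l u : X -> R).

Definition cen x := a x + l x / 2.
Definition fmeet x y := `|u x - u y| < ((l x)^-1 + (l y)^-1) / 2.
Definition isub x t := (a t <= a x) && (a x + l x <= a t + l t).

Lemma fmeetC x y : fmeet x y = fmeet y x.
Proof. by rewrite /fmeet distrC (addrC (l x)^-1). Qed.

Record forest (U : {set X}) (tau : X -> X) : Prop := Forest {
  forest_gt0 : {in U, forall x, 0 < l x};
  forest_sub : {in U, forall x, isub x (tau x)};
  forest_half : {in U &, forall x y, l x < l y -> 2 * l x <= l y};
  forest_same : {in U &, forall x y, tau x = tau y -> l x < l y -> ~~ fmeet x y};
  forest_inj : {in U &, forall x y, tau x = tau y -> x != y -> l x = l y -> itv_disj a l x y};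
  forest_sep : {in U &, forall x y, tau x != tau y -> l y < l x -> fmeet x y ->
    itv_disj a l y (tau x)};
  forest_eq : {in U &, forall x y, x != y -> l x = l y -> fmeet x y -> itv_disj a l x y};
  forest_grid : {in U & &, forall x y z, l y <= l x -> l z <= l x -> fmeet x y -> fmeet x z ->
    fmeet y z} }.

Variables (U : {set X}) (tau : X -> X).
Hypothesis FU : forest U tau.

Lemma isub_len x t : isub x t -> l x <= l t.
Proof. by move=> /andP[]; lra. Qed.

Lemma isub_disj x y t : isub x t -> itv_disj a l y t -> itv_disj a l y x.
Proof. by move=> /andP[h1 h2] /orP[h|h]; apply/orP; [left|right]; lra. Qed.

Lemma forest_disj : {in U &, forall x y, x != y -> fmeet x y -> itv_disj a l x y}.
Proof.
move=> x y xU yU xy m.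
wlog le : x y xU yU xy m / l y <= l x.
  move=> H; case/orP: (le_total (l y) (l x)) => h; first exact: H.
  by rewrite itv_disjC; apply: H => //; rewrite 1?eq_sym // fmeetC.
move: le; rewrite le_eqVlt => /orP[/eqP e|lt]; first exact: (forest_eq FU).
have [e|ne] := eqVneq (tau x) (tau y).
  by have := forest_same FU yU xU (esym e) lt; rewrite fmeetC m.
rewrite itv_disjC; apply: isub_disj (forest_sub FU xU) _.
exact: (forest_sep FU).
Qed.

Lemma len_cen_sep x y t : 0 < l x -> 0 < l y -> isub x t -> itv_disj a l y t ->
  (`|cen x - a t| <= `|cen y - cen x|) \/ (`|cen x - (a t + l t)| <= `|cen y - cen x|).
Proof.
move=> lx ly; rewrite /cen => /andP[h1 h2] /orP[h|h].
  by left; rewrite ger0_norm ?ler0_norm; lra.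
by right; rewrite ler0_norm ?ger0_norm; lra.
Qed.


Lemma tree_top_gt0 x : x \in U -> 0 < l (tau x).
Proof.
move=> xU; apply: lt_le_trans (forest_gt0 FU xU) _.
exact/isub_len/(forest_sub FU).
Qed.

Lemma sum_tree_edge (t : X) (z : R) : t \in tau @: U ->
  \sum_(x in U | tau x == t) l x * dk (l x) (cen x - z) ^+ 2 <= 16 * l t.
Proof.
move=> /imsetP[x0 x0U ->]; set t0 := tau x0.
have lt0 : 0 < l t0 by exact: tree_top_gt0.
pose S := [set x in U | tau x == t0].
have SU x : x \in S -> x \in U by rewrite inE => /andP[].
have St x : x \in S -> tau x = t0 by rewrite inE => /andP[_ /eqP].
rewrite (eq_bigl (fun x => x \in S)); last by move=> x; rewrite inE.
apply: (le_trans (@geo_sum_up _ _ S _ l 8 (l t0) _ _ _ _ _)) => //; last lra.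
- exact: ltW.
- move=> x xS; rewrite ltW ?(forest_gt0 FU) ?SU //= -(St _ xS).
  exact/isub_len/(forest_sub FU)/SU.
- by move=> x y /SU xU /SU yU; exact: (forest_half FU).
- move=> y yS.
  rewrite (eq_bigr (fun x => l x * dk (l y) (cen x - z) ^+ 2)); last first.
    by move=> x /andP[_ /eqP ->].
  rewrite (eq_bigl (fun x => x \in [set x in S | l x == l y])); last by move=> x; rewrite [RHS]inE.
  apply: (le_trans (@sum_dk_disj _ _ a l _ (l y) 1 z _ _ _ _)) => //.
  + exact/(forest_gt0 FU)/SU.
  + by move=> x; rewrite inE => /andP[/SU /(forest_gt0 FU) -> /eqP ->]; rewrite mul1r lexx.
  + move=> x w; rewrite [_ \in _]inE => /andP[xS /eqP xy].
    rewrite [_ \in _]inE => /andP[wS /eqP wy] xw.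
    apply: (forest_inj FU) => //; [exact: SU|exact: SU|by rewrite !St|by rewrite xy wy].
  + lra.
Qed.

Section Bessel.
Variables (g : X -> X -> R) (al : X -> R) (A s : R).
Hypotheses (A0 : 0 <= A) (s0 : 0 <= s).
Hypothesis gC : {in U &, forall x y, g x y = g y x}.
Hypothesis g0 : {in U &, forall x y, ~~ fmeet x y -> g x y = 0}.
Hypothesis gA : {in U &, forall x y, l y <= l x ->
  0 <= g x y <= A * (Num.sqrt (l y) / Num.sqrt (l x)) * dk (l x) (cen y - cen x) ^+ 4}.
Hypothesis al0 : {in U, forall x, 0 <= al x <= s * Num.sqrt (l x)}.

Lemma bessel_eq : {in U &, forall x y, l x = l y -> al x * al y * g x y <=
  A / 2 * (al x ^+ 2 + al y ^+ 2) * ((fmeet x y)%:R * dk (l x) (cen y - cen x) ^+ 2)}.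
Proof.
move=> x y xU yU e; case: (boolP (fmeet x y)) => m; last by rewrite g0 // mul0r !mulr0.
have lx := forest_gt0 FU xU.
have := gA xU yU; rewrite e lexx => /(_ isT); rewrite divff ?mulr1; last first.
  by rewrite gt_eqF // sqrtr_gt0 -e.
move=> /andP[gg0 gg]; rewrite mul1r -e in gg *.
have D : dk (l x) (cen y - cen x) ^+ 4 <= dk (l x) (cen y - cen x) ^+ 2 by exact: dkX_le.
have D0 := dkX_ge0 (cen y - cen x) 2 lx.
have D40 := dkX_ge0 (cen y - cen x) 4 lx.
have /andP[x0 _] := al0 xU; have /andP[y0 _] := al0 yU.
apply: (@le_trans _ _ (al x * al y * (A * dk (l x) (cen y - cen x) ^+ 2))).
  rewrite ler_wpM2l ?mulr_ge0 //; apply: le_trans gg _; exact: ler_wpM2l.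
rewrite mulrCA -!mulrA ler_wpM2l // mulrA (mulrA 2^-1) ler_wpM2r //.
by have := sqr_ge0 (al x - al y); nra.
Qed.

Lemma card_eq (x : X) : x \in U ->
  \sum_(y in U | l y == l x) (fmeet x y)%:R * dk (l x) (cen y - cen x) ^+ 2 <= 8.
Proof.
move=> xU; have lx := forest_gt0 FU xU.
pose S := [set y in U | (l y == l x) && fmeet x y].
rewrite -(ler_pM2r lx) mulr_suml.
apply: (@le_trans _ _ (\sum_(y in S) l y * dk (l x) (cen y - cen x) ^+ 2)).
  rewrite [leLHS](bigID (fmeet x)) /= [X in _ + X]big1 ?addr0; last first.
    by move=> y /andP[_ /negbTE ->]; rewrite !mul0r.
  rewrite le_eqVlt; apply/orP; left; apply/eqP/eq_big.
    by move=> y; rewrite inE andbA.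
  by move=> y /andP[/andP[_ /eqP ->] ->]; rewrite mul1r mulrC.
apply: (le_trans (@sum_dk_disj _ _ a l S (l x) 1 (cen x) lx _ _ _)) => //; last lra.
  by move=> y; rewrite inE => /and3P[/(forest_gt0 FU) -> /eqP -> _]; rewrite mul1r lexx.
move=> y z; rewrite !inE => /and3P[yU /eqP ey my] /and3P[zU /eqP ez mz] yz.
apply: forest_disj => //.
by apply: (@forest_grid _ _ FU x y z) => //; rewrite ?ey ?ez.
Qed.

Lemma bessel_lt (x : X) : x \in U ->
  \sum_(y in U | l y < l x) al x * al y * g x y <=
  8 * A * s ^+ 2 * (l x * dk (l x) (cen x - a (tau x)) ^+ 2 +
                    l x * dk (l x) (cen x - (a (tau x) + l (tau x))) ^+ 2).
Proof.
move=> xU; have lx := forest_gt0 FU xU.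
set e1 := dk _ (cen x - a _); set e2 := dk _ (cen x - (a _ + _)).
have e10 : 0 <= e1 ^+ 2 by exact: dkX_ge0.
have e20 : 0 <= e2 ^+ 2 by exact: dkX_ge0.
pose S := [set y in U | (l y < l x) && fmeet x y].
rewrite (bigID (fmeet x)) /= [X in _ + X]big1 ?addr0; last first.
  by move=> y /andP[/andP[yU _] m]; rewrite g0 // mulr0.
rewrite (eq_bigl (fun y => y \in S)); last by move=> y; rewrite inE andbA.
apply: (@le_trans _ _ (\sum_(y in S) (A * s ^+ 2 * (e1 ^+ 2 + e2 ^+ 2)) *
    (l y * dk (l x) (cen y - cen x) ^+ 2))).
  apply: ler_sum => y; rewrite inE => /and3P[yU lyx m].
  have ly := forest_gt0 FU yU.
  have /andP[gg0 gg] := gA xU yU (ltW lyx).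
  have /andP[x0 xs] := al0 xU; have /andP[y0 ys] := al0 yU.
  set d := dk _ _ in gg *.
  have d0 : 0 <= d ^+ 2 by exact: dkX_ge0.
  have ne : tau x != tau y.
    by apply/eqP => e; have := forest_same FU yU xU (esym e) lyx; rewrite fmeetC m.
  have dj := forest_sep FU xU yU ne lyx m.
  have dd : d ^+ 2 <= e1 ^+ 2 + e2 ^+ 2.
    have [h|h] := len_cen_sep lx ly (forest_sub FU xU) dj.
      have h1 : d <= e1 by exact: dk_le_norm.
      by rewrite -[leLHS]addr0 lerD // ler_pXn2r // nnegrE dk_ge0.
    have h1 : d <= e2 by exact: dk_le_norm.
    by rewrite -[leLHS]add0r lerD // ler_pXn2r // nnegrE dk_ge0.
  have sx : 0 < Num.sqrt (l x) by rewrite sqrtr_gt0.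
  apply: (@le_trans _ _ (s * Num.sqrt (l x) * (s * Num.sqrt (l y)) *
      (A * (Num.sqrt (l y) / Num.sqrt (l x)) * d ^+ 4))).
    by apply: ler_pM => //; rewrite ?mulr_ge0 //; exact: ler_pM.
  have -> : s * Num.sqrt (l x) * (s * Num.sqrt (l y)) *
      (A * (Num.sqrt (l y) / Num.sqrt (l x)) * d ^+ 4) =
      A * s ^+ 2 * (Num.sqrt (l y) ^+ 2 * d ^+ 2) * d ^+ 2.
    by field; rewrite gt_eqF.
  rewrite sqr_sqrtr ?(ltW ly) //.
  have h : 0 <= A * s ^+ 2 * (l y * d ^+ 2).
    by rewrite mulr_ge0 // mulr_ge0 ?sqr_ge0 // ltW.
  by have := ler_wpM2l h dd; lra.
rewrite -mulr_sumr.
have H : \sum_(y in S) l y * dk (l x) (cen y - cen x) ^+ 2 <= 8 * l x.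
  apply: (le_trans (@sum_dk_disj _ _ a l S (l x) 1 (cen x) lx _ _ _)) => //; last lra.
    by move=> y; rewrite inE => /and3P[/(forest_gt0 FU) -> /ltW yx _]; rewrite mul1r.
  move=> y z; rewrite !inE => /and3P[yU ey my] /and3P[zU ez mz] yz.
  apply: forest_disj => //.
  by apply: (@forest_grid _ _ FU x y z) => //; rewrite ?ltW.
have h : 0 <= A * s ^+ 2 * (e1 ^+ 2 + e2 ^+ 2) by rewrite !mulr_ge0 ?addr_ge0 ?sqr_ge0.
by have := ler_wpM2l h H; lra.
Qed.

Lemma forest_bessel :
  \sum_(x in U) \sum_(y in U) al x * al y * g x y <=
  A * (8 * \sum_(x in U) al x ^+ 2 + 512 * s ^+ 2 * \sum_(t in tau @: U) l t).
Proof.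
pose p x y := al x * al y * g x y.
have pC x y : x \in U -> y \in U -> p x y = p y x.
  by move=> xU yU; rewrite /p gC // (mulrC (al x)).
have split x : \sum_(y in U) p x y = \sum_(y in U | l y == l x) p x y +
    (\sum_(y in U | l y < l x) p x y + \sum_(y in U | l x < l y) p x y).
  rewrite (bigID (fun y => l y == l x)) /=; congr (_ + _).
  rewrite (bigID (fun y => l y < l x)) /=; congr (_ + _); apply: eq_bigl => y.
    by case: (ltgtP (l y) (l x)); rewrite ?andbT ?andbF.
  by case: (ltgtP (l y) (l x)); rewrite ?andbT ?andbF.
rewrite (eq_bigr _ (fun x _ => split x)) !big_split /=.
have -> : \sum_(x in U) \sum_(y in U | l x < l y) p x y =
          \sum_(x in U) \sum_(y in U | l y < l x) p x y.
  rewrite (exchange_big_dep (mem U)) /=; last by move=> x y _ /andP[].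
  apply: eq_bigr => y yU; apply: eq_big => [x|x /andP[xU _]]; first by rewrite yU.
  exact: pC.
have E : \sum_(x in U) \sum_(y in U | l y == l x) p x y <= A * (8 * \sum_(x in U) al x ^+ 2).
  pose w x y := (fmeet x y)%:R * dk (l x) (cen y - cen x) ^+ 2.
  apply: (@le_trans _ _ (\sum_(x in U) \sum_(y in U | l y == l x)
     (A / 2 * (al x ^+ 2 * w x y) + A / 2 * (al y ^+ 2 * w x y)))).
    apply: ler_sum => x xU; apply: ler_sum => y /andP[yU /eqP e].
    apply: le_trans (bessel_eq xU yU (esym e)) _; rewrite /w; lra.
  under eq_bigr do rewrite big_split /=.
  rewrite big_split /=.
  have -> : \sum_(x in U) \sum_(y in U | l y == l x) A / 2 * (al y ^+ 2 * w x y) =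
            \sum_(x in U) \sum_(y in U | l y == l x) A / 2 * (al x ^+ 2 * w x y).
    rewrite (exchange_big_dep (mem U)) /=; last by move=> x y _ /andP[].
    apply: eq_bigr => y yU; apply: eq_big => [x|x /and3P[xU _ /eqP e]].
      by rewrite yU /= eq_sym.
    by rewrite /w fmeetC e dkC.
  suff H : \sum_(x in U) \sum_(y in U | l y == l x) A / 2 * (al x ^+ 2 * w x y) <=
           4 * A * \sum_(x in U) al x ^+ 2 by lra.
  rewrite [leRHS]mulr_sumr; apply: ler_sum => x xU.
  rewrite -!mulr_sumr.
  have h : 0 <= A / 2 * al x ^+ 2 by rewrite mulr_ge0 ?sqr_ge0 ?divr_ge0.
  by have := ler_wpM2l h (card_eq xU); rewrite /w; lra.
have L : \sum_(x in U) \sum_(y in U | l y < l x) p x y <=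
    A * (256 * s ^+ 2 * \sum_(t in tau @: U) l t).
  apply: (le_trans (ler_sum _ bessel_lt)).
  rewrite -mulr_sumr (partition_big_imset tau) /= !mulr_sumr; apply: ler_sum => t tT.
  rewrite big_split /=.
  have h : 0 <= 8 * A * s ^+ 2 by rewrite !mulr_ge0 ?sqr_ge0.
  have H1 := sum_tree_edge (a t) tT.
  have H2 := sum_tree_edge (a t + l t) tT.
  rewrite (eq_bigr (fun x => l x * dk (l x) (cen x - a t) ^+ 2)); last first.
    by move=> x /andP[_ /eqP ->].
  rewrite [X in _ * (_ + X)](eq_bigr (fun x => l x * dk (l x) (cen x - (a t + l t)) ^+ 2)); last first.
    by move=> x /andP[_ /eqP ->].
  by have := ler_wpM2l h (lerD H1 H2); lra.
lra.
Qed.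
End Bessel.
End Forest.

(** * Selection of trees *)

Section Selection.
Variables (R : realType) (X : finType) (a l : X -> R) (u : 'I_3 -> X -> R).

Definition ltt i x t := [&& l x < l t, isub a l x t &
  `|u i x - u i t| <= 3 / 2 * ((l x)^-1 - (l t)^-1)].

Record tilesys : Prop := TileSys {
  ts_gt0 : forall x, 0 < l x;
  ts_dyad : forall x y, l x <= l y -> isub a l x y || itv_disj a l x y;
  ts_gap : forall x y, l x < l y -> 10 ^+ 9 * l x < l y;
  ts_lac : forall i j x t, j != i -> ltt i x t ->
    7 / 5 * (l x)^-1 <= `|u j x - u j t| <= 5 * 10 ^+ 6 * (l x)^-1;
  ts_inj : forall i x y t, ltt i x t -> ltt i y t -> x != y -> l x = l y -> itv_disj a l x y;
  ts_eq : forall j x y, x != y -> l x = l y -> fmeet l (u j) x y -> itv_disj a l x y;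
  ts_grid : forall j x y z, l y <= l x -> l z <= l x -> fmeet l (u j) x y ->
    fmeet l (u j) x z -> fmeet l (u j) y z }.

Hypothesis TS : tilesys.
Let l0 := ts_gt0 TS.

Lemma ts_half x y : l x < l y -> 2 * l x <= l y.
Proof. by move=> /(ts_gap TS); have := l0 x; lra. Qed.

Lemma ts_inv x y : l x < l y -> 0 < (l y)^-1 /\ 10 ^+ 9 * (l y)^-1 < (l x)^-1.
Proof.
move=> /(ts_gap TS) h; split; first by rewrite invr_gt0.
rewrite ltr_pdivrMr // mulrC ltr_pdivlMr //.
Qed.

Definition rem x t := (x == t) || [exists i, ltt i x t].

Section Pass.
Variables (j : 'I_3) (mem : X -> X -> bool) (key : X -> R) (be : X -> R) (sg : R).
Hypotheses (be0 : forall x, 0 <= be x) (sg0 : 0 < sg).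
Hypothesis mem_rem : forall x t, mem x t -> rem x t.
Hypothesis mem_sub : forall x t, mem x t -> isub a l x t.
Hypothesis mem_same : forall x y t, mem x t -> mem y t -> l x < l y -> ~~ fmeet l (u j) x y.
Hypothesis mem_inj : forall x y t, mem x t -> mem y t -> x != y -> l x = l y -> itv_disj a l x y.
Hypothesis mem_cross : forall x t y t', mem x t -> mem y t' -> ~~ rem y t -> ~~ rem t' t ->
  key t' <= key t -> fmeet l (u j) x y ->
  (l y < l x -> itv_disj a l y t) /\ (l x < l y -> itv_disj a l x t').

Definition tsum (Q : {set X}) t := \sum_(x in Q | mem x t) be x.

Lemma tsum_sub (Q Q' : {set X}) t : Q' \subset Q -> tsum Q' t <= tsum Q t.
Proof.
move=> /subsetP QQ; rewrite /tsum big_mkcond [leRHS]big_mkcond; apply: ler_sum => x _.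
case: (boolP (x \in Q')) => [/QQ -> //|_] /=; by case: ifP.
Qed.

Lemma pass (Q : {set X}) : exists (Q' U T : {set X}) (tau : X -> X),
  [/\ [/\ Q' \subset Q, U \subset Q, T \subset Q & tau @: U = T],
   forest a l (u j) U tau,
   {in U, forall x, mem x (tau x)},
   {in T, forall t, sg * l t < tsum Q t /\ sg * l t <= \sum_(x in U | tau x == t) be x} &
   (forall x, x \in Q -> x \notin Q' -> exists2 t, t \in T & rem x t) /\
   {in Q', forall t, tsum Q' t <= sg * l t}].
Proof.
move: {2}#|Q| (leqnn #|Q|) => n; elim: n Q => [|n IH] Q Qn.
  have Q0 : Q = set0 by move: Qn; rewrite leqn0 cards_eq0 => /eqP.
  exists set0, set0, set0, id; split.
  - by rewrite imset0 !sub0set.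
  - by split => x; rewrite inE.
  - by move=> x; rewrite inE.
  - by move=> x; rewrite inE.
  - by rewrite Q0; split => x; rewrite inE.
have [/existsP[t0 t0b]|nob] := boolP [exists t in Q, sg * l t < tsum Q t]; last first.
  exists Q, set0, set0, id; split.
  - by rewrite imset0 !sub0set.
  - by split => x; rewrite inE.
  - by move=> x; rewrite inE.
  - by move=> x; rewrite inE.
  - split => [x ->//|t tQ]; rewrite leNgt; apply: contra nob => h.
    by apply/existsP; exists t; rewrite tQ.
pose bad t := (t \in Q) && (sg * l t < tsum Q t).
have {}t0b : bad t0 by [].
case: (arg_maxP key t0b) => t /andP[tQ tb] tmax.
pose S := [set x in Q | mem x t].
pose Q1 := [set x in Q | ~~ rem x t].
have Q1Q : Q1 \subset Q by apply/subsetP => x; rewrite inE => /andP[].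
have SQ : S \subset Q by apply/subsetP => x; rewrite inE => /andP[].
have tQ1 : t \notin Q1 by rewrite inE /rem eqxx andbF.
have Q1n : (#|Q1| <= n)%N.
  rewrite -ltnS; apply: leq_trans Qn; apply: proper_card; apply/properP; split => //.
  by exists t.
have [Q' [U1 [T1 [tau1 [[Q'Q1 U1Q1 T1Q1 tauT] F1 mem1 lb1 [cov1 end1]]]]]] := IH _ Q1n.
have SU1 x : x \in S -> x \notin U1.
  rewrite inE => /andP[xQ /mem_rem xt]; apply/negP => /(subsetP U1Q1).
  by rewrite inE xt andbF.
pose tau x := if x \in S then t else tau1 x.
have tauS x : x \in S -> tau x = t by rewrite /tau => ->.
have tauU x : x \in U1 -> tau x = tau1 x.
  by move=> xU; rewrite /tau ifN //; apply: contraL xU; exact: SU1.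
have T1t x : x \in U1 -> tau1 x \in T1 by move=> xU; rewrite -tauT imset_f.
have tneq x : x \in U1 -> tau1 x != t.
  move=> /T1t /(subsetP T1Q1) h; apply: contraNneq tQ1 => <- //.
have key1 x : x \in U1 -> key (tau1 x) <= key t.
  move=> xU; apply: tmax; have tT := T1t _ xU.
  rewrite /bad (subsetP Q1Q) ?(subsetP T1Q1) //=.
  by have [h _] := lb1 _ tT; apply: lt_le_trans h _; exact: tsum_sub.
have nrem x : x \in Q1 -> ~~ rem x t by rewrite inE => /andP[].
have memS x : x \in S -> mem x t by rewrite inE => /andP[].
have SN0 : exists x, x \in S.
  have [S0|[x xS]] := set_0Vmem S; last by exists x.
  exfalso; move: tb; rewrite /tsum big_pred0 ?ltNge ?mulr_ge0 ?ltW //.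
  by move=> x; have := in_set0 x; rewrite -S0 inE.
exists Q', (S :|: U1), (t |: T1), tau; split.
- rewrite (subset_trans Q'Q1) // !subUset SQ (subset_trans U1Q1) // sub1set tQ.
  rewrite (subset_trans T1Q1) //; split => //.
  rewrite imsetU; congr (_ :|: _).
    apply/setP => z; rewrite inE; apply/imsetP/eqP => [[x xS ->]|->]; first exact: tauS.
    by have [x xS] := SN0; exists x; rewrite ?tauS.
  by rewrite -tauT; apply: eq_in_imset => x; exact: tauU.
- split.
  + by move=> x _.
  + move=> x; rewrite in_setU => /orP[xS|xU].
      by rewrite tauS //; exact/mem_sub/memS.
    by rewrite tauU //; exact/mem_sub/mem1.
  + by move=> x y _ _; exact: ts_half.
  + move=> x y; rewrite !in_setU => /orP[xS|xU] /orP[yS|yU].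
    * by rewrite !tauS // => _; apply: mem_same; exact: memS.
    * by rewrite tauS // tauU // => e; have := tneq _ yU; rewrite e eqxx.
    * by rewrite tauU // tauS // => e; have := tneq _ xU; rewrite -e eqxx.
    * by rewrite !tauU //; exact: (forest_same F1).
  + move=> x y; rewrite !in_setU => /orP[xS|xU] /orP[yS|yU].
    * by rewrite !tauS // => _; apply: mem_inj; exact: memS.
    * by rewrite tauS // tauU // => e; have := tneq _ yU; rewrite e eqxx.
    * by rewrite tauU // tauS // => e; have := tneq _ xU; rewrite -e eqxx.
    * by rewrite !tauU //; exact: (forest_inj F1).
  + move=> x y; rewrite !in_setU => /orP[xS|xU] /orP[yS|yU].
    * by rewrite !tauS // eqxx.
    * rewrite tauS // tauU // => _ lt m.
      have [h _] := mem_cross (memS _ xS) (mem1 _ yU) (nrem _ (subsetP U1Q1 _ yU))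
        (nrem _ (subsetP T1Q1 _ (T1t _ yU))) (key1 _ yU) m; exact: h.
    * rewrite tauU // tauS // => _ lt m.
      have [_ h] := mem_cross (memS _ yS) (mem1 _ xU) (nrem _ (subsetP U1Q1 _ xU))
        (nrem _ (subsetP T1Q1 _ (T1t _ xU))) (key1 _ xU) (etrans (fmeetC _ _ _ _) m); exact: h.
    * by rewrite !tauU //; exact: (forest_sep F1).
  + by move=> x y _ _; exact: (ts_eq TS).
  + by move=> x y z _ _ _; exact: (ts_grid TS).
- move=> x; rewrite in_setU => /orP[xS|xU]; first by rewrite tauS //; exact: memS.
  by rewrite tauU //; exact: mem1.
- move=> z; rewrite in_setU => /orP[/set1P ->|zT].
    split => //; apply: (le_trans (ltW tb)).
    rewrite /tsum big_mkcond [leRHS]big_mkcond; apply: ler_sum => x _.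
    case: (boolP ((x \in Q) && mem x t)) => [h|_]; last by case: ifP.
    have xS : x \in S by rewrite inE.
    by rewrite in_setU xS tauS // eqxx.
  have [h1 h2] := lb1 _ zT; split; first by apply: lt_le_trans h1 _; exact: tsum_sub.
  apply: (le_trans h2); rewrite big_mkcond [leRHS]big_mkcond; apply: ler_sum => x _.
  case: (boolP ((x \in U1) && _)) => [/andP[xU e]|_]; last by case: ifP.
  by rewrite in_setU xU orbT tauU // e.
- split => // x xQ xQ'; have [xr|xr] := boolP (rem x t).
    by exists t => //; rewrite !inE eqxx.
  have [|t' t'T] := cov1 x _ xQ'; first by rewrite inE xQ.
  by exists t' => //; rewrite inE t'T orbT.
Qed.
End Pass.

Lemma ltt_sub i x t : ltt i x t -> isub a l x t.
Proof. by case/and3P. Qed.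

Lemma ltt_len i x t : ltt i x t -> l x < l t.
Proof. by case/and3P. Qed.

Lemma ltt_rem i x t : ltt i x t -> rem x t.
Proof. by move=> h; apply/orP; right; apply/existsP; exists i. Qed.

Lemma ltt_same i j x y t : j != i -> ltt i x t -> ltt i y t -> l x < l y ->
  ~~ fmeet l (u j) x y.
Proof.
move=> ji xt yt xy; rewrite /fmeet -leNgt.
have /andP[x1 x2] := ts_lac TS ji xt; have /andP[y1 y2] := ts_lac TS ji yt.
have [h0 h1] := ts_inv xy.
have T : `|u j x - u j t| <= `|u j x - u j y| + `|u j y - u j t|.
  by apply: le_trans (ler_normD _ _); rewrite subrKA.
lra.
Qed.

Lemma norm_tri (p q r : R) : `|p - r| <= `|p - q| + `|q - r|.
Proof. by apply: le_trans (ler_normD _ _); rewrite subrKA. Qed.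

Lemma meet_ltt j x y t : l y < l x -> l x <= l t -> fmeet l (u j) x y ->
  `|u j x - u j t| <= 5 * 10 ^+ 6 * (l x)^-1 -> ~~ rem y t -> itv_disj a l y t.
Proof.
move=> yx xt m xt2 yr.
have yt : l y < l t by lra.
have := ts_dyad TS (ltW yt) => /orP[s|//]; exfalso.
move/negP: yr; apply; apply: (@ltt_rem j); rewrite /ltt yt s /=.
have [p0 p1] := ts_inv yx.
have p2 : (l t)^-1 <= (l x)^-1 by rewrite lef_pV2 ?posrE.
have := norm_tri (u j y) (u j x) (u j t).
move: m; rewrite /fmeet distrC => m; lra.
Qed.

Definition forest_top_bound j (be : X -> R) (sg : R) (Q : {set X}) (B : R) :=
  forall (U : {set X}) (tau : X -> X), U \subset Q -> {in U, forall x, tau x \in Q} -> forest a l (u j) U tau ->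
  {in tau @: U, forall t, sg * l t <= \sum_(x in U | tau x == t) be x} ->
  \sum_(t in tau @: U) l t <= B.

Section OneIndex.
Variables (j : 'I_3) (be : X -> R) (sg : R).
Hypotheses (be0 : forall x, 0 <= be x) (sg0 : 0 < sg).

Lemma pass_single (Q : {set X}) B : forest_top_bound j be sg Q B ->
  exists (Q' T : {set X}), [/\ Q' \subset Q, T \subset Q, \sum_(t in T) l t <= B,
   (forall x, x \in Q -> x \notin Q' -> exists2 t, t \in T & rem x t) &
   {in Q', forall t, be t <= sg * l t}].
Proof.
move=> FB.
have [|||||Q' [U [T [tau [[Q'Q UQ TQ tauT] F _ lb [cov en]]]]]] :=
  @pass j (fun x t => x == t) l be sg be0 sg0 _ _ _ _ _ Q.
- by move=> x t /eqP ->; rewrite /rem eqxx.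
- by move=> x t /eqP ->; rewrite /isub !lexx.
- by move=> x y t /eqP -> /eqP ->; rewrite ltxx.
- by move=> x y t /eqP -> /eqP ->; rewrite eqxx.
- move=> x t y t' /eqP -> /eqP -> tr _ key m; split=> lt.
    have p0 : 0 < (l t)^-1 by rewrite invr_gt0.
    by apply: (@meet_ltt j t t' t) => //; rewrite subrr normr0; lra.
  by have := lt_le_trans lt key; rewrite ltxx.
exists Q', T; split => //.
- rewrite -tauT; apply: (FB U) => //.
    by move=> x xU; apply: (subsetP TQ); rewrite -tauT imset_f.
  by move=> t; rewrite tauT => /lb[].
- move=> t tQ; apply: le_trans (en _ tQ); rewrite /tsum (bigD1 t) ?tQ ?eqxx //=.
  by rewrite lerDl sumr_ge0.
Qed.

Lemma pass_tree (i : 'I_3) (e : bool) (Q : {set X}) B : j != i -> forest_top_bound j be sg Q B ->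
  exists (Q' T : {set X}), [/\ Q' \subset Q, T \subset Q, \sum_(t in T) l t <= B,
   (forall x, x \in Q -> x \notin Q' -> exists2 t, t \in T & rem x t) &
   {in Q', forall t, \sum_(x in Q' | ltt i x t && (0 < (-1) ^+ e * (u j x - u j t))) be x
      <= sg * l t}].
Proof.
move=> ji FB; set sn := (-1) ^+ e.
have [|||||Q' [U [T [tau [[Q'Q UQ TQ tauT] F _ lb [cov en]]]]]] :=
  @pass j (fun x t => ltt i x t && (0 < sn * (u j x - u j t))) (fun t => sn * u j t)
    be sg be0 sg0 _ _ _ _ _ Q.
- by move=> x t /andP[/ltt_rem].
- by move=> x t /andP[/ltt_sub].
- by move=> x y t /andP[xt _] /andP[yt _]; exact: (ltt_same ji xt yt).
- by move=> x y t /andP[xt _] /andP[yt _]; exact: (ts_inj TS xt yt).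
- move=> x t y t' /andP[xt xs] /andP[yt ys] yr tr key m.
  have /andP[x1 x2] := ts_lac TS ji xt; have /andP[y1 y2] := ts_lac TS ji yt.
  split=> lt.
    by apply: (@meet_ltt j x y t) => //; exact/ltW/(ltt_len xt).
  exfalso; have [p0 p1] := ts_inv lt; move: m; rewrite /fmeet => m.
  have N z : `|z| = `|sn * z| by rewrite normrM normr_sign mul1r.
  move: x1 y2 m key xs; rewrite (N (_ j x - _ j t)) (N (_ j y - _ j t')) (N (_ j x - _ j y)).
  rewrite !mulrBr => x1 y2 m key xs.
  rewrite gtr0_norm // in x1.
  move: y2 m; rewrite ler_norml ltr_norml => /andP[y2 y3] /andP[m1 m2].
  lra.
exists Q', T; split => //.
rewrite -tauT; apply: (FB U) => //.
  by move=> x xU; apply: (subsetP TQ); rewrite -tauT imset_f.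
by move=> t; rewrite tauT => /lb[].
Qed.

Lemma forest_top_boundS (Q Q' : {set X}) B : Q' \subset Q ->
  forest_top_bound j be sg Q B -> forest_top_bound j be sg Q' B.
Proof.
move=> QQ FB U tau UQ tQ F; apply: FB => //; first exact: subset_trans UQ QQ.
by move=> x /tQ /(subsetP QQ).
Qed.

Lemma forest_top_bound_ge0 (Q : {set X}) B : forest_top_bound j be sg Q B -> 0 <= B.
Proof.
move=> FB; have := FB set0 id; rewrite imset0 big_set0; apply.
- by rewrite sub0set.
- by move=> x; rewrite inE.
- by split => x; rewrite inE.
- by move=> x; rewrite inE.
Qed.

(* The two signs account for the two sides on which the lacunary intervals
   of a tree can lie relative to its top *)
Lemma pass_all (Q : {set X}) B : forest_top_bound j be sg Q B ->
  exists (Q' : {set X}) (T : seq X), [/\ Q' \subset Q, {subset T <= Q},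
   \sum_(t <- T) l t <= 7 * B,
   (forall x, x \in Q -> x \notin Q' -> exists2 t, t \in T & rem x t) &
   {in Q', forall t, be t <= sg * l t /\
      forall i, i != j -> \sum_(x in Q' | ltt i x t) be x <= 2 * sg * l t}].
Proof.
move=> FB.
have [Q0 [T0 [Q0Q T0Q l0B cov0 en0]]] := pass_single FB.
have step (s : seq ('I_3 * bool)) (Q1 : {set X}) : Q1 \subset Q ->
  exists (Q' : {set X}) (T : seq X), [/\ Q' \subset Q1, {subset T <= Q},
   \sum_(t <- T) l t <= (size s)%:R * B,
   (forall x, x \in Q1 -> x \notin Q' -> exists2 t, t \in T & rem x t) &
   forall p : 'I_3 * bool, p \in s -> j != p.1 -> {in Q', forall t,
      \sum_(x in Q' | ltt p.1 x t && (0 < (-1) ^+ p.2 * (u j x - u j t))) be x <= sg * l t}].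
  elim: s Q1 => [|p s IH] Q1 Q1Q.
    exists Q1, [::]; split => //; first by rewrite big_nil mul0r.
    by move=> x ->.
  have [Q2 [T2 [Q2Q T2Q l2 cov2 en2]]] := IH _ Q1Q.
  have Q2Q' := subset_trans Q2Q Q1Q.
  have [pj|pj] := eqVneq j p.1.
    exists Q2, T2; split => //.
      apply: (le_trans l2); rewrite ler_wpM2r //; last by rewrite ler_nat leqnSn.
      exact: forest_top_bound_ge0 FB.
    move=> q; rewrite inE => /orP[/eqP ->|]; first by rewrite pj eqxx.
    exact: en2.
  have [Q3 [T3 [Q3Q T3Q l3 cov3 en3]]] := pass_tree p.2 pj (forest_top_boundS Q2Q' FB).
  exists Q3, (enum T3 ++ T2); split.
  - exact: subset_trans Q3Q Q2Q.
  - move=> t; rewrite mem_cat mem_enum => /orP[/(subsetP T3Q)/(subsetP Q2Q') //|]; exact: T2Q.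
  - by rewrite big_cat /= big_enum /= -natr1 mulrDl mul1r addrC; exact: lerD.
  - move=> x xQ xQ3; have [x2|x2] := boolP (x \in Q2).
      have [t tT tr] := cov3 _ x2 xQ3; exists t => //.
      by rewrite mem_cat mem_enum tT.
    have [t tT tr] := cov2 _ xQ x2; exists t => //.
    by rewrite mem_cat tT orbT.
  - move=> q; rewrite inE => /orP[/eqP -> _|qs jq] t tQ3; first exact: en3.
    apply: le_trans (en2 _ qs jq t (subsetP Q3Q _ tQ3)).
    rewrite big_mkcond [leRHS]big_mkcond; apply: ler_sum => x _.
    case: (boolP (x \in Q3)) => [/(subsetP Q3Q) -> //|_] /=; by case: ifP.
have [Q1 [T1 [Q1Q T1Q l1 cov1 en1]]] := step (enum {: 'I_3 * bool}) _ Q0Q.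
have sz : size (enum {: 'I_3 * bool}) = 6%N by rewrite -cardE card_prod card_ord card_bool.
exists Q1, (enum T0 ++ T1); split.
- exact: subset_trans Q1Q Q0Q.
- move=> t; rewrite mem_cat mem_enum => /orP[/(subsetP T0Q) //|]; exact: T1Q.
- by rewrite big_cat /= big_enum /=; move: l1; rewrite sz; lra.
- move=> x xQ xQ3; have [x2|x2] := boolP (x \in Q0).
    have [t tT tr] := cov1 _ x2 xQ3; exists t => //.
    by rewrite mem_cat tT orbT.
  have [t tT tr] := cov0 _ xQ x2; exists t => //.
  by rewrite mem_cat mem_enum tT.
move=> t tQ; split; first exact/en0/(subsetP Q1Q).
move=> i ij; rewrite eq_sym in ij.
have h (e : bool) : \sum_(x in Q1 | ltt i x t && (0 < (-1) ^+ e * (u j x - u j t))) be x <= sg * l t.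
  by apply: (en1 (i, e)) => //; rewrite mem_enum.
apply: (@le_trans _ _ (sg * l t + sg * l t)); last lra.
apply: le_trans (lerD (h false) (h true)).
rewrite (bigID (fun x => 0 < u j x - u j t)) /=; apply: lerD.
  by rewrite le_eqVlt; apply/orP; left; apply/eqP/eq_bigl => x; rewrite expr0 mul1r andbA.
rewrite le_eqVlt; apply/orP; left; apply/eqP/eq_bigl => x; rewrite expr1 mulN1r -andbA.
case: (boolP (ltt i x t)) => //= xt; rewrite oppr_gt0 -leNgt le_eqVlt.
case: eqP => // e; have /andP[h1 _] := ts_lac TS ij xt; move: h1; rewrite e normr0.
by rewrite pmulr_rle0 ?divr_gt0 // leNgt invr_gt0 l0.
Qed.

End OneIndex.

End Selection.

(** * Tree estimate and the model sum *)

Lemma prod3 (R : realType) (f : 'I_3 -> R) (i : 'I_3) :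
  \prod_(j < 3) f j = f i * f (i + 1) * f (i + 2).
Proof.
rewrite !big_ord_recl big_ord0 mulr1 mulrA.
case: i => [[|[|[|//]]]] lt.
- by congr (f _ * f _ * f _); apply/val_inj.
- by rewrite [RHS]mulrC mulrA; congr (f _ * f _ * f _); apply/val_inj.
- by rewrite -[RHS]mulrA [RHS]mulrC; congr (f _ * f _ * f _); apply/val_inj.
Qed.

Section Model.
Variables (R : realType) (X : finType) (a l : X -> R) (u : 'I_3 -> X -> R).
Hypothesis TS : tilesys a l u.
Variable al : 'I_3 -> X -> R.
Hypothesis al0 : forall j x, 0 <= al j x.
Let l0 := ts_gt0 TS.

Definition lam x := (\prod_(j < 3) al j x) / Num.sqrt (l x).

Definition has_size j (Q : {set X}) s := {in Q, forall t, al j t ^+ 2 <= s ^+ 2 * l t /\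
  forall i, i != j -> \sum_(x in Q | ltt a l u i x t) al j x ^+ 2 <= s ^+ 2 * l t}.

Definition has_energy j (Q : {set X}) (e : R) := forall s : R, 0 < s ->
  {in Q, forall x, al j x ^+ 2 <= s ^+ 2 * l x} ->
  forest_top_bound a l u j (fun x => al j x ^+ 2) (s ^+ 2 / 8) Q (e ^+ 2 / s ^+ 2).

Lemma lam_ge0 x : 0 <= lam x.
Proof. by rewrite divr_ge0 ?sqrtr_ge0 // prodr_ge0. Qed.

Lemma sum_subset_le (Q Q' : {set X}) (P : pred X) (f : X -> R) : (forall x, 0 <= f x) ->
  Q' \subset Q -> \sum_(x in Q' | P x) f x <= \sum_(x in Q | P x) f x.
Proof.
move=> f0 /subsetP QQ; rewrite big_mkcond [leRHS]big_mkcond; apply: ler_sum => x _.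
case: (boolP (x \in Q')) => [/QQ -> //|_] /=; by case: ifP.
Qed.

Lemma has_sizeS j (Q Q' : {set X}) s : Q' \subset Q -> has_size j Q s -> has_size j Q' s.
Proof.
move=> QQ sz t tQ; have [h1 h2] := sz t (subsetP QQ _ tQ); split => // i ij.
by apply: le_trans (h2 i ij); apply: sum_subset_le => // x; exact: sqr_ge0.
Qed.

Section Sized.
Variables (s : 'I_3 -> R) (Q : {set X}).
Hypotheses (s0 : forall j, 0 < s j) (sz : forall j, has_size j Q (s j)).

Lemma al_le j x : x \in Q -> al j x <= s j * Num.sqrt (l x).
Proof.
move=> xQ; have [h _] := sz j xQ.
rewrite -(@ler_pXn2r _ 2) ?nnegrE ?al0 ?mulr_ge0 ?sqrtr_ge0 ?(ltW (s0 j)) //.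
by rewrite exprMn sqr_sqrtr // ltW.
Qed.

Lemma tree_est i t : t \in Q ->
  \sum_(x in Q | ltt a l u i x t) lam x <= l t * \prod_(j < 3) s j.
Proof.
move=> tQ; rewrite (prod3 _ i).
have [_ h1] := sz (i + 1) tQ; have [_ h2] := sz (i + 2) tQ.
have {}h1 := h1 i; have {}h2 := h2 i.
have n1 : i != i + 1 by case: (i) => [[|[|[|]]]].
have n2 : i != i + 2 by case: (i) => [[|[|[|]]]].
move: h1 h2 => /(_ n1) h1 /(_ n2) h2.
set s1 := s (i + 1) in h1 *; set s2 := s (i + 2) in h2 *.
have s10 : 0 < s1 by exact: s0.
have s20 : 0 < s2 by exact: s0.
apply: (@le_trans _ _ (\sum_(x in Q | ltt a l u i x t)
   (s i * (s2 / s1) / 2 * al (i + 1) x ^+ 2 + s i * (s1 / s2) / 2 * al (i + 2) x ^+ 2))).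
  apply: ler_sum => x /andP[xQ _]; rewrite /lam (prod3 _ i).
  have lx : 0 < Num.sqrt (l x) by rewrite sqrtr_gt0.
  apply: (@le_trans _ _ (s i * (al (i + 1) x * al (i + 2) x))).
    rewrite ler_pdivrMr // -!mulrA [leRHS]mulrC -mulrA mulrC -mulrA mulrC -mulrA.
    have := al_le i xQ.
    have := mulr_ge0 (al0 (i + 1) x) (al0 (i + 2) x); nra.
  have -> : s i * (s2 / s1) / 2 * al (i + 1) x ^+ 2 + s i * (s1 / s2) / 2 * al (i + 2) x ^+ 2
    = s i * ((s2 * al (i + 1) x) ^+ 2 + (s1 * al (i + 2) x) ^+ 2) / (2 * s1 * s2).
    by field; rewrite !gt_eqF.
  rewrite ler_pdivlMr ?mulr_gt0 // -!mulrA ler_wpM2l ?(ltW (s0 i)) //.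
  by have := sqr_ge0 (s2 * al (i + 1) x - s1 * al (i + 2) x); lra.
rewrite big_split /= -!mulr_sumr.
have c1 : 0 <= s i * (s2 / s1) / 2 by rewrite !mulr_ge0 ?invr_ge0 // ltW.
have c2 : 0 <= s i * (s1 / s2) / 2 by rewrite !mulr_ge0 ?invr_ge0 // ltW.
apply: (le_trans (lerD (ler_wpM2l c1 h1) (ler_wpM2l c2 h2))).
rewrite le_eqVlt; apply/orP; left; apply/eqP; field; rewrite !gt_eqF //.
Qed.

Lemma top_est t : t \in Q -> lam t <= l t * \prod_(j < 3) s j.
Proof.
move=> tQ; rewrite /lam !(prod3 _ 0).
have lt : 0 < Num.sqrt (l t) by rewrite sqrtr_gt0.
rewrite ler_pdivrMr //.
have -> : l t * (s 0 * s (0 + 1) * s (0 + 2)) * Num.sqrt (l t) =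
   (s 0 * Num.sqrt (l t)) * (s (0 + 1) * Num.sqrt (l t)) * (s (0 + 2) * Num.sqrt (l t)).
  by rewrite -{1}(sqr_sqrtr (ltW (l0 t))); ring.
apply: ler_pM; rewrite ?mulr_ge0 ?al_le //.
by apply: ler_pM; rewrite ?al_le.
Qed.

Lemma rem_est t : t \in Q ->
  \sum_(x in Q | rem a l u x t) lam x <= 4 * l t * \prod_(j < 3) s j.
Proof.
move=> tQ.
apply: (@le_trans _ _ (lam t + \sum_(i < 3) \sum_(x in Q | ltt a l u i x t) lam x)); last first.
  have -> : 4 * l t * \prod_(j < 3) s j =
     l t * (\prod_(j < 3) s j) + \sum_(i < 3) l t * \prod_(j < 3) s j.
    by rewrite sumr_const card_ord -mulr_natl; ring.
  by apply: lerD; [exact: top_est|apply: ler_sum => i _; exact: tree_est].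
have -> : lam t = \sum_(x in Q | x == t) lam x.
  by rewrite (big_pred1 t) // => x; rewrite /= andb_idl // => /eqP ->.
rewrite (eq_bigr (fun i => \sum_(x in Q) (if ltt a l u i x t then lam x else 0))); last first.
  by move=> i _; rewrite -big_mkcondr.
rewrite exchange_big /= !big_mkcondr -big_split /=; apply: ler_sum => x xQ.
have h0 : 0 <= \sum_(i < 3) (if ltt a l u i x t then lam x else 0).
  by apply: sumr_ge0 => i _; case: ifP => // _; exact: lam_ge0.
rewrite /rem; case: (x == t) => /=; first by rewrite lerDl.
case: existsP => [[i xi]|_]; rewrite ?add0r //.
rewrite (bigD1 i) //= xi lerDl; apply: sumr_ge0 => k _; case: ifP => // _; exact: lam_ge0.
Qed.

Lemma cover_est (Q' : {set X}) (T : seq X) : Q' \subset Q -> {subset T <= Q} ->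
  (forall x, x \in Q -> x \notin Q' -> exists2 t, t \in T & rem a l u x t) ->
  \sum_(x in Q) lam x <= \sum_(x in Q') lam x + 4 * (\prod_(j < 3) s j) * \sum_(t <- T) l t.
Proof.
move=> /subsetP Q'Q TQ cov.
apply: (@le_trans _ _ (\sum_(x in Q') lam x + \sum_(t <- T) \sum_(x in Q | rem a l u x t) lam x)).
  have -> : \sum_(t <- T) \sum_(x in Q | rem a l u x t) lam x = \sum_(t <- T) \sum_x
     (if (x \in Q) && rem a l u x t then lam x else 0).
    by apply: eq_bigr => t _; rewrite big_mkcond.
  rewrite [X in _ <= X + _]big_mkcond.
  rewrite exchange_big /= -big_split big_mkcond /=; apply: ler_sum => x _.
  have h0 : 0 <= \sum_(t <- T) (if (x \in Q) && rem a l u x t then lam x else 0).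
    by apply: sumr_ge0 => t _; case: ifP => // _; exact: lam_ge0.
  case: (boolP (x \in Q)) => xQ; last first.
    by rewrite addr_ge0 //; [case: ifP => // _; exact: lam_ge0|move: h0; rewrite (negbTE xQ)].
  rewrite xQ in h0; case: (boolP (x \in Q')) => xQ'; first by rewrite lerDl.
  rewrite add0r; have [t tT tr] := cov x xQ xQ'.
  rewrite (big_rem t) //= tr lerDl; apply: sumr_ge0 => k _; case: ifP => // _; exact: lam_ge0.
rewrite lerD2l mulr_sumr big_seq [leRHS]big_seq; apply: ler_sum => t tT.
by have := rem_est (TQ _ tT); lra.
Qed.
End Sized.

Variables (S E : 'I_3 -> R).
Hypotheses (S0 : forall j, 0 < S j) (E0 : forall j, 0 < E j).

Lemma stage_one (s : 'I_3 -> R) j (Q : {set X}) t : 0 < t -> (forall i, 0 < s i) ->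
  (forall i, has_size i Q (s i)) -> has_size j Q (t * E j) -> has_energy j Q (E j) ->
  exists Q' : {set X}, [/\ Q' \subset Q, has_size j Q' (t / 2 * E j) &
    \sum_(x in Q) lam x <= \sum_(x in Q') lam x + 28 * (\prod_(i < 3) s i) / t ^+ 2].
Proof.
move=> t0 s0 sz szj en.
have tE : 0 < t * E j by rewrite mulr_gt0.
have FB := en _ tE (fun x xQ => proj1 (szj x xQ)).
have sg0 : 0 < (t * E j) ^+ 2 / 8 by rewrite divr_gt0 // exprn_gt0.
have [Q' [T [Q'Q TQ lT cov en']]] := pass_all TS (fun x => sqr_ge0 (al j x)) sg0 FB.
exists Q'; split => //.
  move=> x xQ; have [h1 h2] := en' x xQ.
  have e : (t / 2 * E j) ^+ 2 = (t * E j) ^+ 2 / 4 by field.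
  rewrite e; have := l0 x; split => [|i ij]; last first.
    by apply: le_trans (h2 i ij) _; rewrite ler_pM2r //; lra.
  by apply: (le_trans h1); rewrite ler_pM2r //; lra.
apply: (le_trans (cover_est s0 sz Q'Q TQ cov)); rewrite lerD2l.
have e : E j ^+ 2 / (t * E j) ^+ 2 = (t ^+ 2)^-1.
  by field; rewrite !gt_eqF.
rewrite e in lT.
have p0 : 0 <= 4 * \prod_(i < 3) s i by rewrite mulr_ge0 // prodr_ge0 // => i _; exact: ltW.
by have := ler_wpM2l p0 lT; lra.
Qed.

Definition stage_cost t := t ^- 2 * \prod_(j < 3) Num.min (S j) (t * E j).

Lemma stage (Q : {set X}) t : 0 < t ->
  (forall j, has_size j Q (S j)) -> (forall j, has_size j Q (t * E j)) ->
  (forall j (Q' : {set X}), Q' \subset Q -> has_energy j Q' (E j)) ->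
  exists Q' : {set X}, [/\ Q' \subset Q, forall j, has_size j Q' (t / 2 * E j) &
    \sum_(x in Q) lam x <= \sum_(x in Q') lam x + 84 * stage_cost t].
Proof.
move=> t0 szS szt en.
pose m j := Num.min (S j) (t * E j).
have m0 j : 0 < m j by rewrite lt_min S0 mulr_gt0.
have szm (Q' : {set X}) j : Q' \subset Q -> has_size j Q' (m j).
  by move=> QQ; rewrite /m; case: (leP (S j) (t * E j)) => _; apply: has_sizeS QQ _.
have [Q0 [Q0Q z0 e0]] := stage_one t0 m0 (fun j => szm Q j (subxx _)) (szt 0) (en 0 _ (subxx _)).
have [Q1 [Q1Q z1 e1]] := stage_one t0 m0 (fun j => szm Q0 j Q0Q)
  (has_sizeS Q0Q (szt 1)) (en 1 _ Q0Q).
have Q1Q' := subset_trans Q1Q Q0Q.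
have [Q2 [Q2Q z2 e2]] := stage_one t0 m0 (fun j => szm Q1 j Q1Q')
  (has_sizeS Q1Q' (szt 2)) (en 2 _ Q1Q').
have Q2Q' := subset_trans Q2Q Q1Q.
exists Q2; split; first exact: subset_trans Q2Q Q1Q'.
  move=> j; have : (j == 0) || (j == 1) || (j == 2) by case: j => [[|[|[|]]]].
  move=> /orP[/orP[]|] /eqP -> //; [exact: has_sizeS Q2Q' _|exact: has_sizeS Q2Q _].
have -> : 84 * stage_cost t = 3 * (28 * (\prod_(i < 3) m i) / t ^+ 2).
  by rewrite /stage_cost; field; rewrite gt_eqF.
lra.
Qed.

Lemma model_bound (Q : {set X}) t : 0 < t ->
  (forall j, has_size j Q (S j)) -> (forall j, has_size j Q (t * E j)) ->
  (forall j (Q' : {set X}), Q' \subset Q -> has_energy j Q' (E j)) -> forall n,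
  \sum_(x in Q) lam x <= 84 * \sum_(k < n) stage_cost (t / 2 ^+ k) +
     (\sum_(x in Q) l x) * \prod_(j < 3) E j * (t / 2 ^+ n) ^+ 3.
Proof.
move=> t0 szS szt en n.
suff [Q' [Q'Q szQ eQ]] : exists Q' : {set X}, [/\ Q' \subset Q,
   forall j, has_size j Q' (t / 2 ^+ n * E j) &
   \sum_(x in Q) lam x <= \sum_(x in Q') lam x + 84 * \sum_(k < n) stage_cost (t / 2 ^+ k)].
  apply: (le_trans eQ); rewrite addrC lerD2l.
  have tn : 0 < t / 2 ^+ n by rewrite divr_gt0 // exprn_gt0.
  have s0 j : 0 < t / 2 ^+ n * E j by rewrite mulr_gt0.
  apply: (@le_trans _ _ (\sum_(x in Q') l x * \prod_(j < 3) (t / 2 ^+ n * E j))).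
    by apply: ler_sum => x xQ; exact: (top_est s0 szQ).
  rewrite -mulr_suml big_split /= prodr_const card_ord.
  have sQ : \sum_(x in Q') l x <= \sum_(x in Q) l x.
    rewrite big_mkcond [leRHS]big_mkcond; apply: ler_sum => x _.
    by case: (boolP (x \in Q')) => [/(subsetP Q'Q) -> //|_]; case: ifP => // _; exact: ltW.
  have h : 0 <= (t / 2 ^+ n) ^+ 3 * \prod_(j < 3) E j.
    by rewrite mulr_ge0 ?exprn_ge0 ?prodr_ge0 // ?ltW // => j _; exact: ltW.
  by have := ler_wpM2r h sQ; lra.
elim: n => [|n [Q1 [Q1Q sz1 e1]]].
  by exists Q; split => //; [move=> j; rewrite expr0 divr1|rewrite big_ord0 mulr0 addr0].
have tn : 0 < t / 2 ^+ n by rewrite divr_gt0 // exprn_gt0.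
have [|||Q2 [Q2Q sz2 e2]] := stage (Q := Q1) tn.
- by move=> j; exact: has_sizeS Q1Q _.
- exact: sz1.
- by move=> j Q' Q'Q; apply: en; exact: subset_trans Q'Q Q1Q.
exists Q2; split; first exact: subset_trans Q2Q Q1Q.
  move=> j; have -> : t / 2 ^+ n.+1 = t / 2 ^+ n / 2 by rewrite exprSr invfM mulrA.
  exact: sz2.
rewrite big_ord_recr /=; lra.
Qed.
End Model.

(** * Interpolation *)

Lemma geo_two_sided (R : realType) (q r : R) n : 0 < q < 1 -> 0 < r ->
  \sum_(k < n) Num.min (r * q ^+ k) (r * q ^+ k)^-1 <= 2 / (1 - q).
Proof.
move=> /andP[q0 q1] r0; have q10 : 0 < 1 - q by lra.
pose Phi x := if x <= 1 then x / (1 - q) else 2 / (1 - q) - q / (x * (1 - q)).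
have PhiB x : 0 < x -> Phi x <= 2 / (1 - q).
  move=> x0; rewrite /Phi; case: ifP => x1; first by rewrite ler_pM2r ?invr_gt0 //; lra.
  by rewrite gerBl divr_ge0 ?mulr_ge0 // ltW.
apply: le_trans (PhiB _ r0).
elim: n r r0 => [|n IH] r r0.
  rewrite big_ord0 /Phi; case: ifPn => x1; first by rewrite divr_ge0 // ltW.
  rewrite -ltNge in x1; rewrite subr_ge0 invfM mulrA ler_pM2r ?invr_gt0 //.
  by rewrite ler_pdivrMr //; lra.
rewrite big_ord_recl expr0 mulr1.
have rq0 : 0 < r * q by rewrite mulr_gt0.
have := IH _ rq0.
rewrite (eq_bigr (fun k : 'I_n => Num.min (r * q ^+ (lift ord0 k)) (r * q ^+ (lift ord0 k))^-1)); last first.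
  by move=> k _; rewrite lift0 exprS mulrA.
move=> H; apply: (le_trans (lerD (lexx _) H)).
rewrite /Phi; case: (leP r 1) => r1.
  have rq1 : r * q <= 1 by nra.
  rewrite rq1; apply: (@le_trans _ _ (r + r * q / (1 - q))).
    by rewrite lerD2r ge_min lexx.
  rewrite le_eqVlt; apply/orP; left; apply/eqP; field; lra.
have rN : Num.min r r^-1 <= r^-1 by rewrite ge_min lexx orbT.
apply: (le_trans (lerD rN (lexx _))).
have ri : 0 < r^-1 by rewrite invr_gt0.
have ri1 : r^-1 < 1 by rewrite invf_lt1.
case: ifPn => rq1.
  have -> : r^-1 + r * q / (1 - q) = (r^-1 * (1 - q) + r * q) / (1 - q).
    by field; rewrite gt_eqF // gt_eqF.
  have -> : 2 / (1 - q) - q / (r * (1 - q)) = (2 - q * r^-1) / (1 - q).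
    by field; rewrite gt_eqF // gt_eqF.
  by rewrite ler_pM2r ?invr_gt0 //; lra.
rewrite le_eqVlt; apply/orP; left; apply/eqP; field.
by rewrite !gt_eqF.
Qed.

Lemma min_powR (R : realType) (x y t : R) : 0 < x -> 0 < y -> 0 <= t <= 1 ->
  Num.min x y <= x `^ (1 - t) * y `^ t.
Proof.
move=> x0 y0 /andP[t0 t1].
have m0 : 0 < Num.min x y by rewrite lt_min x0.
have -> : Num.min x y = Num.min x y `^ (1 - t) * Num.min x y `^ t.
  by rewrite -powRD ?(gt_eqF m0) ?implybT // subrK powRr1 // ltW.
apply: ler_pM; rewrite ?powR_ge0 //; apply: ge0_ler_powR;
  rewrite ?nnegrE ?subr_ge0 ?(ltW m0) ?(ltW x0) ?(ltW y0) // ge_min lexx ?orbT //.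
Qed.

Section Interp.
Variables (R : realType) (X : finType) (a l : X -> R) (u : 'I_3 -> X -> R).
Hypothesis TS : tilesys a l u.
Variable al : 'I_3 -> X -> R.
Hypothesis al0 : forall j x, 0 <= al j x.
Variables (S E : 'I_3 -> R).
Hypotheses (S0 : forall j, 0 < S j) (E0 : forall j, 0 < E j).
Variable th : R.
Hypothesis th01 : 0 < th <= 1 / 3.

Definition interp := (S 0 `^ th * E 0 `^ (1 - th)) * (S 1 `^ th * E 1 `^ (1 - th)) *
  (S 2 `^ (1 - 2 * th) * E 2 `^ (2 * th)).

Lemma stage_cost_le t : 0 < t ->
  stage_cost S E t <= interp * Num.min ((t * E 2 / S 2) `^ th) ((t * E 2 / S 2) `^ th)^-1.
Proof.
move=> t0; have /andP[th0 th1] := th01.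
have p j : 0 < t * E j by rewrite mulr_gt0.
have r0 : 0 < t * E 2 / S 2 by rewrite divr_gt0.
have key s : 0 <= s <= 1 ->
  stage_cost S E t <= interp * (t * E 2 / S 2) `^ (s - 2 * th).
  move=> s01; rewrite /stage_cost (prod3 _ 0).
  have -> : (0 + 1 : 'I_3) = 1 by apply/val_inj.
  have -> : (0 + 2 : 'I_3) = 2 by apply/val_inj.
  have h0 := @min_powR _ (S 0) (t * E 0) (1 - th) (S0 0) (p 0).
  have h1 := @min_powR _ (S 1) (t * E 1) (1 - th) (S0 1) (p 1).
  have h2 := @min_powR _ (S 2) (t * E 2) s (S0 2) (p 2) s01.
  have q1 : 0 <= 1 - th <= 1 by lra.
  move: h0 h1 => /(_ q1) h0 /(_ q1) h1.
  have e1 : 1 - (1 - th) = th by lra.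
  rewrite e1 in h0 h1.
  have mn j : 0 <= Num.min (S j) (t * E j) by rewrite le_min !ltW.
  have H := ler_pM (mulr_ge0 (mn 0) (mn 1)) (mn 2) (ler_pM (mn 0) (mn 1) h0 h1) h2.
  have ti : 0 <= t ^- 2 by rewrite invr_ge0 exprn_ge0 // ltW.
  apply: (le_trans (ler_wpM2l ti H)).
  have pm (j : 'I_3) e : (t * E j) `^ e = t `^ e * E j `^ e by rewrite powRM // ltW.
  rewrite !pm /interp powRM ?invr_ge0 ?(ltW (p 2)) ?(ltW (S0 2)) // pm.
  rewrite -powR_inv1 ?(ltW (S0 2)) // -powRrM mulN1r opprB.
  have pD x e f : 0 < x -> x `^ (e + f) = x `^ e * x `^ f.
    by move=> x0; rewrite powRD // (gt_eqF x0) implybT.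
  have -> : E 2 `^ (s - 2 * th) = E 2 `^ s / E 2 `^ (2 * th) by rewrite pD // powRN.
  have -> : S 2 `^ (1 - s) = S 2 `^ (1 - 2 * th) * S 2 `^ (2 * th - s).
    by rewrite -pD //; congr (_ `^ _); lra.
  have -> : t `^ (s - 2 * th) = t `^ (1 - th) * t `^ (1 - th) * t `^ s / t ^+ 2.
    rewrite -powR_mulrn ?(ltW t0) // -powRN -!pD //; congr (_ `^ _); lra.
  have e20 : E 2 `^ (2 * th) != 0 by rewrite gt_eqF // powR_gt0.
  rewrite le_eqVlt; apply/orP; left; apply/eqP; field.
  by rewrite e20 gt_eqF.
have i0 : 0 <= interp by rewrite /interp !mulr_ge0 ?powR_ge0.
rewrite -powRN; case: (leP ((t * E 2 / S 2) `^ th) _) => _.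
  have -> : th = 3 * th - 2 * th by lra.
  by apply: key; lra.
have -> : - th = th - 2 * th by lra.
by apply: key; lra.
Qed.

Lemma model_interp (Q : {set X}) :
  (forall j, has_size a l u al j Q (S j)) ->
  (forall j (Q' : {set X}), Q' \subset Q -> has_energy a l u al j Q' (E j)) ->
  \sum_(x in Q) lam l al x <= 168 / (1 - 2 `^ (- th)) * interp.
Proof.
move=> sz en; have /andP[th0 th1] := th01; have l0 := ts_gt0 TS.
pose t := \sum_(j < 3) S j / E j.
have tS j : S j <= t * E j.
  rewrite -ler_pdivrMr // /t (bigD1 j) //= lerDl; apply: sumr_ge0 => i _.
  by rewrite divr_ge0 // ltW.
have t0 : 0 < t by have := lt_le_trans (S0 0) (tS 0); rewrite pmulr_lgt0.
have szt j : has_size a l u al j Q (t * E j).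
  move=> x xQ; have [h1 h2] := sz j x xQ.
  have h : S j ^+ 2 * l x <= (t * E j) ^+ 2 * l x.
    by rewrite ler_pM2r // ler_pXn2r // nnegrE ltW // mulr_gt0.
  by split => [|i ij]; [exact: le_trans h1 h|exact: le_trans (h2 i ij) h].
have B := model_bound TS al0 S0 E0 t0 sz szt en.
pose q : R := 2 `^ (- th).
have q01 : 0 < q < 1.
  rewrite /q powR_gt0 //= powRN invf_lt1 ?powR_gt0 //.
  have := @gt0_ltr_powR R th th0 1 2; rewrite powR1; apply; rewrite ?nnegrE //; lra.
pose r := (t * E 2 / S 2) `^ th.
have r0 : 0 < r by rewrite powR_gt0 // divr_gt0 // mulr_gt0.
have i0 : 0 <= interp by rewrite /interp !mulr_ge0 ?powR_ge0.
have G n : \sum_(k < n) stage_cost S E (t / 2 ^+ k) <= interp * (2 / (1 - q)).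
  apply: le_trans (ler_wpM2l i0 (geo_two_sided n q01 r0)); rewrite mulr_sumr.
  apply: ler_sum => k _.
  have k0 : 0 < t / 2 ^+ k by rewrite divr_gt0 // exprn_gt0.
  apply: (le_trans (stage_cost_le k0)).
  suff -> : (t / 2 ^+ k * E 2 / S 2) `^ th = r * q ^+ k by [].
  have -> : t / 2 ^+ k * E 2 / S 2 = (t * E 2 / S 2) * 2 `^ (- k%:R).
    rewrite powRN powR_mulrn //; field; rewrite gt_eqF ?exprn_gt0 //= gt_eqF //.
  rewrite powRM ?powR_ge0 // ?divr_ge0 ?mulr_ge0 ?ltW //; congr (_ * _).
  rewrite -powRrM /q -powR_mulrn ?powR_ge0 // -powRrM; congr (_ `^ _); lra.
apply/ler_addgt0Pr => e e0.
set W := (\sum_(x in Q) l x) * \prod_(j < 3) E j.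
have W0 : 0 <= W.
  by rewrite mulr_ge0 ?sumr_ge0 ?prodr_ge0 // => j _; exact: ltW.
pose n := Num.bound (W * t ^+ 3 / e).
have := B n; rewrite -/W => Bn; apply: (le_trans Bn); apply: lerD.
  by have := G n; rewrite -/q; lra.
have h : W * t ^+ 3 / e < n%:R.
  by apply: archi_boundP; rewrite mulr_ge0 ?invr_ge0 ?(ltW e0) // mulr_ge0 // exprn_ge0 // ltW.
have n2 : n%:R <= (2 ^+ n) ^+ 3 :> R.
  apply: (@le_trans _ _ (2 ^+ n)); first by rewrite -natrX ler_nat ltnW // ltn_expl.
  by rewrite -exprM ler_eXn2l ?ltr1n // leq_pmulr.
rewrite expr_div_n mulrA ler_pdivrMr ?exprn_gt0 //.
have h2 := lt_le_trans h n2; rewrite ltr_pdivrMr // in h2.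
by rewrite [leRHS]mulrC; exact: ltW h2.
Qed.
End Interp.

(** * Complex integrals *)

(* Imported only here: classical_sets hides the finset lemmas used above. *)
From mathcomp Require Import all_classical all_reals all_analysis.
From mathcomp Require Import measurable_realfun lebesgue_Rintegral complex ring lra zify.
From Stdlib Require List.
Import Order.TTheory GRing.Theory Num.Theory ComplexField.
Import numFieldNormedType.Exports.
Local Open Scope classical_set_scope.
Local Open Scope ring_scope.

Section ComplexIntegral.
Variable R : realType.
Local Notation mu := (@lebesgue_measure R).
Local Notation C := R[i].
Local Notation Re := complex.Re.
Local Notation Im := complex.Im.
Implicit Types (z w : C) (f g : R -> C) (h : R -> R).

Lemma cReD z w : Re (z + w) = Re z + Re w. Proof. by case: z; case: w. Qed.
Lemma cImD z w : Im (z + w) = Im z + Im w. Proof. by case: z; case: w. Qed.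
Lemma cReN z : Re (- z) = - Re z. Proof. by case: z. Qed.
Lemma cImN z : Im (- z) = - Im z. Proof. by case: z. Qed.
Lemma cReM z w : Re (z * w) = Re z * Re w - Im z * Im w. Proof. by case: z; case: w. Qed.
Lemma cImM z w : Im (z * w) = Re z * Im w + Im z * Re w. Proof. by case: z; case: w. Qed.
Lemma cReJ z : Re z^* = Re z. Proof. by case: z. Qed.
Lemma cImJ z : Im z^* = - Im z. Proof. by case: z. Qed.
Lemma complex_ext z w : Re z = Re w -> Im z = Im w -> z = w.
Proof. by case: z w => ? ? [? ?] /= -> ->. Qed.
Lemma cRe_sum (I : Type) (r : seq I) (P : pred I) (F : I -> C) :
  Re (\sum_(i <- r | P i) F i) = \sum_(i <- r | P i) Re (F i).
Proof. by elim/big_rec2: _ => // i y1 y2 _ <-; rewrite cReD. Qed.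
Lemma cIm_sum (I : Type) (r : seq I) (P : pred I) (F : I -> C) :
  Im (\sum_(i <- r | P i) F i) = \sum_(i <- r | P i) Im (F i).
Proof. by elim/big_rec2: _ => // i y1 y2 _ <-; rewrite cImD. Qed.

Lemma cJM z w : (z * w)^* = z^* * w^*.
Proof. by apply: complex_ext; rewrite ?cReJ ?cImJ ?cReM ?cImM ?cReJ ?cImJ ?mulrNN // opprD mulrN mulNr. Qed.
Lemma cJD z w : (z + w)^* = z^* + w^*.
Proof. by apply: complex_ext; rewrite ?cReJ ?cImJ ?cReD ?cImD ?cReJ ?cImJ // opprD. Qed.
Lemma cJN z : (- z)^* = - z^*.
Proof. by apply: complex_ext; rewrite ?cReJ ?cImJ ?cReN ?cImN ?cReJ ?cImJ. Qed.
Lemma cJK z : z^*^* = z.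
Proof. by apply: complex_ext; rewrite !(cReJ, cImJ) ?opprK. Qed.
Lemma cJ0 : (0 : C)^* = 0.
Proof. by apply: complex_ext; rewrite ?cReJ ?cImJ //= oppr0. Qed.
Lemma cJ_sum (I : Type) (r : seq I) (P : pred I) (F : I -> C) :
  (\sum_(i <- r | P i) F i)^* = \sum_(i <- r | P i) (F i)^*.
Proof. by elim/big_rec2: _ => [|i y1 y2 _ <-]; [exact: cJ0|exact: cJD]. Qed.

Lemma cabsE z : cabs z = Normc.normc z. Proof. by case: z. Qed.
Lemma cabs_ge0 z : 0 <= cabs z. Proof. exact: sqrtr_ge0. Qed.
Lemma cabsM z w : cabs (z * w) = cabs z * cabs w.
Proof. by rewrite !cabsE Normc.normcM. Qed.
Lemma cabsD z w : cabs (z + w) <= cabs z + cabs w.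
Proof. by rewrite !cabsE; exact: (@le_normcD R z w). Qed.
Lemma cabsN z : cabs (- z) = cabs z.
Proof. by rewrite /cabs cReN cImN !sqrrN. Qed.
Lemma cabsJ z : cabs z^* = cabs z.
Proof. by rewrite /cabs cReJ cImJ sqrrN. Qed.
Lemma cabs0 : cabs (0 : C) = 0. Proof. by rewrite /cabs /= expr0n addr0 sqrtr0. Qed.
Lemma cabs_real (r : R) : cabs (r +i* 0)%C = `|r|.
Proof. by rewrite /cabs /= expr0n addr0 sqrtr_sqr. Qed.
Lemma cabs_sqr z : cabs z ^+ 2 = Re z ^+ 2 + Im z ^+ 2.
Proof. by rewrite sqr_sqrtr // addr_ge0 // sqr_ge0. Qed.
Lemma Re_le_cabs z : `|Re z| <= cabs z.
Proof. by rewrite -sqrtr_sqr ler_wsqrtr // lerDl sqr_ge0. Qed.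
Lemma Im_le_cabs z : `|Im z| <= cabs z.
Proof. by rewrite -sqrtr_sqr ler_wsqrtr // lerDr sqr_ge0. Qed.
Lemma cabs_le_ReIm z : cabs z <= `|Re z| + `|Im z|.
Proof.
rewrite -(@ler_pXn2r _ 2) ?nnegrE ?cabs_ge0 ?addr_ge0 // cabs_sqr.
rewrite sqrrD !real_normK ?num_real // -addrA lerD2l addrC lerDl.
by rewrite mulrn_wge0 // mulr_ge0.
Qed.
Lemma cabs_sum (I : Type) (r : seq I) (P : pred I) (F : I -> C) :
  cabs (\sum_(i <- r | P i) F i) <= \sum_(i <- r | P i) cabs (F i).
Proof.
elim/big_rec2: _ => [|i y1 y2 _ H]; first by rewrite cabs0.
by apply: le_trans (cabsD _ _) _; rewrite lerD2l.
Qed.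
Lemma expi_unit (t : R) : cabs (expi t) = 1.
Proof. by rewrite /cabs /= cos2Dsin2 sqrtr1. Qed.
Lemma expiD (s t : R) : expi (s + t) = expi s * expi t.
Proof. by apply: complex_ext; rewrite ?cReM ?cImM /= ?cosD ?sinD // addrC (mulrC (cos s)). Qed.
Lemma expiN (t : R) : expi (- t) = (expi t)^*.
Proof. by apply: complex_ext; rewrite ?cReJ ?cImJ /= ?cosN ?sinN. Qed.
Lemma expi0 : expi (0 : R) = 1.
Proof. by apply: complex_ext; rewrite /= ?cos0 ?sin0. Qed.

Definition intg h := mu.-integrable setT (EFin \o h).
Definition cintg f := intg (fun x => Re (f x)) /\ intg (fun x => Im (f x)).

Lemma intgD h1 h2 : intg h1 -> intg h2 -> intg (fun x => h1 x + h2 x).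
Proof. by move=> i1 i2; have := integrableD measurableT i1 i2. Qed.
Lemma intgZ c h : intg h -> intg (fun x => c * h x).
Proof. by move=> i1; have := integrableZl measurableT c i1. Qed.
Lemma intgN h : intg h -> intg (fun x => - h x).
Proof. by move=> i1; have := integrableN i1. Qed.
Lemma intg_le h1 h2 : measurable_fun setT h1 -> intg h2 -> (forall x, `|h1 x| <= h2 x) ->
  intg h1.
Proof.
move=> m1 i2 le; apply: (le_integrable measurableT _ _ i2); first exact/measurable_EFinP.
move=> x _ /=; rewrite lee_fin (le_trans (le x)) //; exact: ler_norm.
Qed.
Lemma intg_meas h : intg h -> measurable_fun setT h.
Proof. by move=> /integrableP[/measurable_EFinP]. Qed.

Lemma Rint_le h1 h2 : intg h1 -> intg h2 -> (forall x, h1 x <= h2 x) ->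
  Rintegral mu setT h1 <= Rintegral mu setT h2.
Proof. by move=> i1 i2 le; apply: le_Rintegral. Qed.

Lemma cintg_le f h : cmeasurable f -> intg h -> (forall x, cabs (f x) <= h x) -> cintg f.
Proof.
move=> [mr mi] ih le; split; apply: (intg_le _ ih) => // x; apply: le_trans (le x).
  exact: Re_le_cabs.
exact: Im_le_cabs.
Qed.

Lemma cint_le f h : cmeasurable f -> intg h -> (forall x, cabs (f x) <= h x) ->
  cabs (cint f) <= 2 * Rintegral mu setT h.
Proof.
move=> mf ih le; have [ir ii] := cintg_le mf ih le.
apply: (le_trans (cabs_le_ReIm _)); rewrite mulr_natl mulr2n; apply: lerD => /=.
  apply: (le_trans (le_normr_Rintegral measurableT ir)); apply: Rint_le => //.
    by have := integrable_norm ir.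
  by move=> x; apply: le_trans (le x); exact: Re_le_cabs.
apply: (le_trans (le_normr_Rintegral measurableT ii)); apply: Rint_le => //.
  by have := integrable_norm ii.
by move=> x; apply: le_trans (le x); exact: Im_le_cabs.
Qed.

Lemma cintgD f g : cintg f -> cintg g -> cintg (fun x => f x + g x).
Proof.
move=> [r1 i1] [r2 i2]; split.
  rewrite (_ : (fun x => _) = (fun x => Re (f x) + Re (g x))); first exact: intgD.
  by apply/funext => x; rewrite cReD.
rewrite (_ : (fun x => _) = (fun x => Im (f x) + Im (g x))); first exact: intgD.
by apply/funext => x; rewrite cImD.
Qed.

Lemma cintgZ z f : cintg f -> cintg (fun x => z * f x).
Proof.
move=> [r1 i1]; split.
  rewrite (_ : (fun x => _) = (fun x => Re z * Re (f x) + - (Im z * Im (f x)))).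
    by apply: intgD; [exact: intgZ|exact/intgN/intgZ].
  by apply/funext => x; rewrite cReM.
rewrite (_ : (fun x => _) = (fun x => Re z * Im (f x) + Im z * Re (f x))).
  by apply: intgD; exact: intgZ.
by apply/funext => x; rewrite cImM.
Qed.

Lemma cintD f g : cintg f -> cintg g -> cint (fun x => f x + g x) = cint f + cint g.
Proof.
move=> [r1 i1] [r2 i2]; rewrite /cint /cint_on; apply: complex_ext => /=.
  rewrite -RintegralD //; congr (Rintegral _ _ _); apply/funext => x; exact: cReD.
rewrite -RintegralD //; congr (Rintegral _ _ _); apply/funext => x; exact: cImD.
Qed.

Lemma cintZ z f : cintg f -> cint (fun x => z * f x) = z * cint f.
Proof.
move=> [r1 i1]; rewrite /cint /cint_on; apply: complex_ext => /=; rewrite ?cReM ?cImM /=.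
  rewrite -!RintegralZl // -RintegralB //; [|exact: intgZ|exact: intgZ].
  by congr (Rintegral _ _ _); apply/funext => x; exact: cReM.
rewrite -!RintegralZl // -RintegralD //; [|exact: intgZ|exact: intgZ].
by congr (Rintegral _ _ _); apply/funext => x; exact: cImM.
Qed.

Lemma cintJ f : cintg f -> cint (fun x => (f x)^*) = (cint f)^*.
Proof.
move=> [r1 i1]; rewrite /cint /cint_on; apply: complex_ext => /=; rewrite ?cReJ ?cImJ /=.
  by congr (Rintegral _ _ _); apply/funext => x; rewrite cReJ.
rewrite -[RHS]mulN1r -RintegralZl //; congr (Rintegral _ _ _).
by apply/funext => x; rewrite cImJ mulN1r.
Qed.

Lemma intg0 : intg (fun=> 0).
Proof. by rewrite /intg (_ : EFin \o _ = cst 0%E) //; exact: integrable0. Qed.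
Lemma cintg0 : cintg (fun=> 0).
Proof. by split; exact: intg0. Qed.
Lemma cint0 : cint (fun=> 0 : C) = 0.
Proof.
rewrite -[RHS](mul0r (cint (fun=> 0 : C))) -(cintZ 0 cintg0).
by congr cint; apply/funext => x; rewrite mul0r.
Qed.

Lemma cmeasD f g : cmeasurable f -> cmeasurable g -> cmeasurable (fun x => f x + g x).
Proof.
move=> [r1 i1] [r2 i2]; split.
  rewrite (_ : (fun x => _) = (fun x => Re (f x) + Re (g x))); first exact: measurable_funD.
  by apply/funext => x; rewrite cReD.
rewrite (_ : (fun x => _) = (fun x => Im (f x) + Im (g x))); first exact: measurable_funD.
by apply/funext => x; rewrite cImD.
Qed.

Lemma cmeasM f g : cmeasurable f -> cmeasurable g -> cmeasurable (fun x => f x * g x).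
Proof.
move=> [r1 i1] [r2 i2]; split.
  rewrite (_ : (fun x => _) = (fun x => Re (f x) * Re (g x) - Im (f x) * Im (g x))).
    by apply: measurable_funB; exact: measurable_funM.
  by apply/funext => x; rewrite cReM.
rewrite (_ : (fun x => _) = (fun x => Re (f x) * Im (g x) + Im (f x) * Re (g x))).
  by apply: measurable_funD; exact: measurable_funM.
by apply/funext => x; rewrite cImM.
Qed.

Lemma cmeasJ f : cmeasurable f -> cmeasurable (fun x => (f x)^*).
Proof.
move=> [r1 i1]; split.
  by rewrite (_ : (fun x => _) = (fun x => Re (f x))) //; apply/funext => x; rewrite cReJ.
rewrite (_ : (fun x => _) = (fun x => - Im (f x))).
  exact: measurable_funN.
by apply/funext => x; rewrite cImJ.
Qed.

Lemma cmeas_cst z : cmeasurable (fun=> z).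
Proof. by split; exact: measurable_cst. Qed.

Lemma cmeasR h : measurable_fun setT h -> cmeasurable (fun x => (h x +i* 0)%C).
Proof. by move=> mh; split => //=; exact: measurable_cst. Qed.

Lemma cmeas_expi h : measurable_fun setT h -> cmeasurable (fun x => expi (h x)).
Proof.
move=> mh; split.
  exact: (measurableT_comp (continuous_measurable_fun (@continuous_cos R)) mh).
exact: (measurableT_comp (continuous_measurable_fun (@continuous_sin R)) mh).
Qed.

Lemma meas_cabs f : cmeasurable f -> measurable_fun setT (fun x => cabs (f x)).
Proof.
move=> [r1 i1].
have m : measurable_fun setT (fun x => Re (f x) ^+ 2 + Im (f x) ^+ 2).
  by apply: measurable_funD; exact: measurable_funX.
exact: (measurableT_comp (continuous_measurable_fun (@sqrt_continuous R)) m).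
Qed.

(** * Square integrable functions *)

Definition sqi f := cmeasurable f /\ intg (fun x => cabs (f x) ^+ 2).

Lemma sqi_prod f g : sqi f -> sqi g -> cintg (fun x => f x * (g x)^*).
Proof.
move=> [mf i1] [mg i2].
apply: (@cintg_le _ (fun x => cabs (f x) ^+ 2 + cabs (g x) ^+ 2)); last first.
- move=> x; rewrite cabsM cabsJ; have := cabs_ge0 (f x); have := cabs_ge0 (g x).
  by have := sqr_ge0 (cabs (f x) - cabs (g x)); nra.
- exact: intgD.
- by apply: cmeasM => //; exact: cmeasJ.
Qed.

Lemma sqiD f g : sqi f -> sqi g -> sqi (fun x => f x + g x).
Proof.
move=> [mf i1] [mg i2]; split; first exact: cmeasD.
apply: (@intg_le _ (fun x => 2 * cabs (f x) ^+ 2 + 2 * cabs (g x) ^+ 2)).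
- exact: measurable_funX (meas_cabs (cmeasD mf mg)).
- by apply: intgD; exact: intgZ.
- move=> x; rewrite ger0_norm ?sqr_ge0 //.
  have h1 := cabsD (f x) (g x); have h2 := cabs_ge0 (f x + g x).
  have h3 : cabs (f x + g x) ^+ 2 <= (cabs (f x) + cabs (g x)) ^+ 2 by rewrite ler_pXn2r // nnegrE addr_ge0 ?cabs_ge0.
  by have := sqr_ge0 (cabs (f x) - cabs (g x)); nra.
Qed.

Lemma sqiZ z f : sqi f -> sqi (fun x => z * f x).
Proof.
move=> [mf i1]; split; first by apply: cmeasM => //; exact: cmeas_cst.
rewrite (_ : (fun x => _) = fun x => cabs z ^+ 2 * cabs (f x) ^+ 2); first exact: intgZ.
by apply/funext => x; rewrite cabsM exprMn.
Qed.

Lemma sqi0 : sqi (fun=> 0).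
Proof.
split; first exact: cmeas_cst.
rewrite (_ : (fun x => _) = fun=> 0); first exact: intg0.
by apply/funext => x; rewrite cabs0 expr0n.
Qed.

Lemma sqi_sum (I : Type) (r : seq I) (P : pred I) (F : I -> R -> C) :
  (forall i, P i -> sqi (F i)) -> sqi (fun x => \sum_(i <- r | P i) F i x).
Proof.
move=> H; elim: r => [|i r IH].
  by rewrite (_ : (fun x => _) = fun=> 0); [exact: sqi0|apply/funext => x; rewrite big_nil].
case: (boolP (P i)) => Pi; last first.
  rewrite (_ : (fun x => _) = fun x => \sum_(i <- r | P i) F i x) //.
  by apply/funext => x; rewrite big_cons (negbTE Pi).
rewrite (_ : (fun x => _) = fun x => F i x + \sum_(i <- r | P i) F i x).
  by apply: sqiD => //; exact: H.
by apply/funext => x; rewrite big_cons Pi.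
Qed.

Lemma ipJ f g : sqi f -> sqi g -> (ip f g)^* = ip g f.
Proof.
move=> sf sg; rewrite /ip -cintJ; last exact: sqi_prod.
by congr cint; apply/funext => x; rewrite cJM cJK mulrC.
Qed.

Lemma ipDl f g k : sqi f -> sqi g -> sqi k -> ip (fun x => f x + g x) k = ip f k + ip g k.
Proof.
move=> sf sg sk; rewrite /ip -cintD; [|exact: sqi_prod|exact: sqi_prod].
by congr cint; apply/funext => x; rewrite mulrDl.
Qed.

Lemma ipZl z f k : sqi f -> sqi k -> ip (fun x => z * f x) k = z * ip f k.
Proof.
move=> sf sk; rewrite /ip -cintZ; last exact: sqi_prod.
by congr cint; apply/funext => x; rewrite mulrA.
Qed.

Lemma ip0l (k : R -> C) : ip (fun=> 0) k = 0.
Proof.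
rewrite /ip (_ : (fun x => _) = fun=> 0) ?cint0 //.
by apply/funext => x; rewrite mul0r.
Qed.

Lemma ip_suml (I : Type) (r : seq I) (P : pred I) (z : I -> C) (F : I -> R -> C) k :
  (forall i, P i -> sqi (F i)) -> sqi k ->
  ip (fun x => \sum_(i <- r | P i) z i * F i x) k = \sum_(i <- r | P i) z i * ip (F i) k.
Proof.
move=> H sk; elim: r => [|i r IH].
  rewrite big_nil (_ : (fun x => _) = fun=> 0) ?ip0l //.
  by apply/funext => x; rewrite big_nil.
rewrite big_cons; case: (boolP (P i)) => Pi; last first.
  rewrite -IH (_ : (fun x => _) = fun x => \sum_(i <- r | P i) z i * F i x) //.
  by apply/funext => x; rewrite big_cons (negbTE Pi).
rewrite -IH -ipZl //; last exact: H.
rewrite -ipDl //; [|by apply/sqiZ/H|by apply: sqi_sum => j Pj; exact/sqiZ/H].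
rewrite (_ : (fun x => _) = fun x => z i * F i x + \sum_(i <- r | P i) z i * F i x) //.
by apply/funext => x; rewrite big_cons Pi.
Qed.

Lemma ip_sumr (I : Type) (r : seq I) (P : pred I) (z : I -> C) (F : I -> R -> C) k :
  (forall i, P i -> sqi (F i)) -> sqi k ->
  ip k (fun x => \sum_(i <- r | P i) z i * F i x) = \sum_(i <- r | P i) (z i)^* * ip k (F i).
Proof.
move=> H sk; rewrite -ipJ //; last by apply: sqi_sum => j Pj; exact/sqiZ/H.
rewrite ip_suml // cJ_sum; apply: eq_bigr => i Pi.
by rewrite cJM ipJ //; exact: H.
Qed.

Lemma ip_ge0 f : 0 <= Re (ip f f).
Proof.
apply: Rintegral_ge0 => x _; rewrite cReM cReJ cImJ mulrN opprK -!expr2.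
by rewrite addr_ge0 // sqr_ge0.
Qed.

Lemma ip_norm f : Re (ip f f) = Rintegral mu setT (fun x => cabs (f x) ^+ 2).
Proof.
congr (Rintegral _ _ _); apply/funext => x.
by rewrite cReM cReJ cImJ mulrN opprK -!expr2 cabs_sqr.
Qed.

Lemma ip_le f g h : cmeasurable f -> cmeasurable g -> intg h ->
  (forall x, cabs (f x) * cabs (g x) <= h x) -> cabs (ip f g) <= 2 * Rintegral mu setT h.
Proof.
move=> mf mg ih le; apply: cint_le => //; first by apply: cmeasM => //; exact: cmeasJ.
by move=> x; rewrite cabsM cabsJ.
Qed.

Lemma bessel_quad (I : finType) (U : {set I}) (z : I -> C) (F : I -> R -> C) f (t : R) :
  sqi f -> (forall i, i \in U -> sqi (F i)) ->
  2 * t * Re (\sum_(i in U) (z i)^* * ip f (F i)) <= Re (ip f f) +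
    t ^+ 2 * \sum_(i in U) \sum_(j in U) cabs (z i) * cabs (z j) * cabs (ip (F i) (F j)).
Proof.
move=> sf sF.
pose G x := \sum_(i in U) z i * F i x.
have sG : sqi G by apply: sqi_sum => i iU; exact/sqiZ/sF.
pose T : C := (t +i* 0)%C.
have TJ : T^* = T by apply: complex_ext; rewrite ?cReJ ?cImJ //= oppr0.
have sTG : sqi (fun x => - T * G x) by exact: sqiZ.
have sfG : sqi (fun x => f x + - T * G x) by exact: sqiD.
have ipDZr g : sqi g -> ip g (fun x => f x + - T * G x) = ip g f + - T * ip g G.
  by move=> sg; rewrite -ipJ // ipDl // ipZl // cJD cJM cJN TJ !ipJ.
have := ip_ge0 (fun x => f x + - T * G x).
rewrite ipDl // ipZl // !ipDZr //.
have E : Re (ip G G) <= \sum_(i in U) \sum_(j in U) cabs (z i) * cabs (z j) * cabs (ip (F i) (F j)).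
  rewrite ip_suml // cRe_sum; apply: ler_sum => i iU.
  rewrite ip_sumr //; last exact: sF.
  rewrite mulr_sumr cRe_sum; apply: ler_sum => j jU.
  apply: (le_trans (ler_norm _)); apply: (le_trans (Re_le_cabs _)).
  by rewrite !cabsM cabsJ mulrA.
have GJ : Im (ip G G) = 0.
  have := congr1 (@complex.Im R) (ipJ sG sG); rewrite cImJ; lra.
have FE : Re (ip G f) = Re (ip f G) by rewrite -(ipJ sf sG) cReJ.
have -> : \sum_(i in U) (z i)^* * ip f (F i) = ip f G by rewrite ip_sumr.
have [RT IT] : Re T = t /\ Im T = 0 by [].
have h := ler_wpM2l (sqr_ge0 t) E.
rewrite !(cReD, cReM, cReN, cImN, cImM, cImD) RT IT FE GJ; lra.
Qed.
End ComplexIntegral.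

(** * Integrals of decaying weights *)

Section DecayIntegral.
Variable R : realType.
Local Notation mu := (@lebesgue_measure R).

Lemma dk_continuous (r c : R) : 0 < r -> continuous (fun x : R => dk r (x - c)).
Proof.
move=> r0 x; rewrite /dk; apply: cvgV.
  by rewrite gt_eqF // dk_den0.
apply: cvgD; first exact: cvg_cst.
apply: cvgM; last exact: cvg_cst.
apply: cvg_norm; apply: cvgB; [exact: cvg_id|exact: cvg_cst].
Qed.

Lemma dk_meas (r c : R) n : 0 < r -> measurable_fun setT (fun x : R => dk r (x - c) ^+ n).
Proof.
by move=> r0; have := measurable_funX n (continuous_measurable_fun (dk_continuous (c := c) r0)).
Qed.

Lemma dk2_continuous (r c : R) : 0 < r -> continuous (fun x : R => dk r (x - c) ^+ 2).
Proof. by move=> r0 x; apply: cvgM; exact: dk_continuous. Qed.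

Lemma dk_int1 : (\int[mu]_x (dk 1 (x - 0) ^+ 2)%:E)%E = 2%:E.
Proof.
rewrite ge0_symfun_integralT //; first last.
- by move=> x; rewrite /= !subr0 dkN.
- exact: dk2_continuous.
- by move=> x; exact: sqr_ge0.
rewrite -set_itvcy.
rewrite (@ge0_continuous_FTC2y R (fun x => dk 1 (x - 0) ^+ 2) (fun x => - (1 + x)^-1) 0 0).
- by rewrite addr0 invr1 -EFinB -EFinM; congr _%:E; lra.
- by move=> x _; exact: sqr_ge0.
- by apply/continuous_subspaceT; exact: dk2_continuous.
- rewrite -oppr0; apply: cvgN.
  apply/gtr0_cvgV0; first by near=> x; rewrite ltr_pwDl.
  exact: cvg_addrl.
- by move=> x x0; apply: derivableN; apply: derivableV; [rewrite gt_eqF //; lra|].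
- apply: cvg_at_right_filter; apply: cvgN; apply: cvgV.
    by rewrite addr0 oner_eq0.
  by apply: cvgD; [exact: cvg_cst|exact: cvg_id].
- move=> x; rewrite in_itv /= andbT => x0.
  have H : is_derive x 1 (fun x : R => - (1 + x)^-1) (- (- (1 + x) ^- 2 * (0 + 1))).
    apply: is_deriveN; apply: is_deriveV; rewrite gt_eqF //; lra.
  rewrite derive1E (@derive_val _ _ _ _ _ _ _ H) /dk subr0 divr1 ger0_norm ?(ltW x0) //.
  by rewrite add0r mulr1 opprK exprVn.
Unshelve. all: by end_near.
Qed.

Lemma dk_int (r c : R) : 0 < r ->
  (\int[mu]_x (dk r (x - c) ^+ 2)%:E)%E = (2 * r)%:E.
Proof.
move=> r0.
pose F (x : R) := (x - c) / r.
have dF (x : R) : is_derive x (1 : R) F r^-1.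
  rewrite /F; apply: is_derive_eq.
  by rewrite subr0 scaler0 add0r /GRing.scale /= mulr1.
have dF1 : derive1 F = fun=> r^-1.
  by apply/funext => x; rewrite derive1E (@derive_val _ _ _ _ _ _ _ (dF x)).
have := @increasing_ge0_integration_by_substitutionT R F (fun x => dk 1 (x - 0) ^+ 2).
rewrite dk_int1 dF1 => H.
have {}H : 2%:E = (\int[mu]_x (r^-1 * (dk r (x - c) ^+ 2))%:E)%E.
  rewrite H.
  - apply: eq_integral => x _; congr _%:E; rewrite /= mulrC; congr (_ * _ ^+ 2).
    by rewrite /F subr0 /dk divr1 normrM normfV (gtr0_norm r0).
  - by move=> x y xy; rewrite /F ltr_pM2r ?invr_gt0 // ltrD2r.
  - by move=> x; exact: cvg_cst.
  - exact: is_cvg_cst.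
  - exact: is_cvg_cst.
  - by move=> x.
  - apply/cvgrNyPle => A; near=> x.
    rewrite /F ler_pdivrMr // lerBlDr; near: x; apply: nbhs_ninfty_le; exact: num_real.
  - apply/cvgryPge => A; near=> x.
    rewrite /F ler_pdivlMr // lerBrDr; near: x; apply: nbhs_pinfty_ge; exact: num_real.
  - exact: dk2_continuous.
  - by move=> x; exact: sqr_ge0.
have m : measurable_fun setT (fun x : R => dk r (x - c) ^+ 2) by exact: dk_meas.
rewrite (_ : (2 * r)%:E = r%:E * 2%:E)%E; last by rewrite -EFinM mulrC.
rewrite H -ge0_integralZl //.
- by apply: eq_integral => x _; rewrite -EFinM mulrA mulfV ?mul1r // gt_eqF.
- by apply/measurable_EFinP; apply: measurable_funM.
- by move=> x _; rewrite lee_fin mulr_ge0 ?sqr_ge0 // invr_ge0 ltW.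
- by rewrite lee_fin ltW.
Unshelve. all: by end_near.
Qed.

Lemma dk2_intg (r c : R) : 0 < r -> intg (fun x => dk r (x - c) ^+ 2).
Proof.
move=> r0; apply/integrableP; split; first by apply/measurable_EFinP; exact: dk_meas.
apply: (@le_lt_trans _ _ (2 * r)%:E); last by rewrite ltry.
rewrite -(dk_int c r0) le_eqVlt; apply/orP; left; apply/eqP; apply: eq_integral => x _.
by rewrite /= ger0_norm // sqr_ge0.
Qed.

Lemma dk_intg (r c : R) n : 0 < r -> (2 <= n)%N -> intg (fun x => dk r (x - c) ^+ n).
Proof.
move=> r0 n2; apply: (intg_le _ (dk2_intg c r0)); first exact: dk_meas.
by move=> x; rewrite ger0_norm ?dkX_ge0 // dkX_le.
Qed.

Lemma dk2_Rint (r c : R) : 0 < r -> Rintegral mu setT (fun x => dk r (x - c) ^+ 2) = 2 * r.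
Proof. by move=> r0; rewrite /Rintegral dk_int. Qed.

Lemma dk_Rint (r c : R) n : 0 < r -> (2 <= n)%N ->
  Rintegral mu setT (fun x => dk r (x - c) ^+ n) <= 2 * r.
Proof.
move=> r0 n2; rewrite -(dk2_Rint c r0); apply: Rint_le; [exact: dk_intg|exact: dk2_intg|].
by move=> x; exact: dkX_le.
Qed.

Definition packet (A r c : R) (N : nat) (f : R -> R[i]) := cmeasurable f /\
  forall x, cabs (f x) <= A / Num.sqrt r * dk r (x - c) ^+ N.

Lemma packet_le A r c N N' f : 0 < r -> 0 <= A -> (N' <= N)%N ->
  packet A r c N f -> packet A r c N' f.
Proof.
move=> r0 A0 NN [m H]; split => // x; apply: (le_trans (H x)).
by rewrite ler_wpM2l ?dkX_le // divr_ge0 // sqrtr_ge0.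
Qed.

Lemma packet_sqi A r c N f : 0 < r -> 0 <= A -> (1 <= N)%N -> packet A r c N f -> sqi f.
Proof.
move=> r0 A0 N1 [m H]; split => //.
apply: (intg_le _ (intgZ (A ^+ 2 / r) (dk2_intg c r0))).
  exact: measurable_funX (meas_cabs m).
move=> x; rewrite ger0_norm ?sqr_ge0 //.
have h : cabs (f x) <= A / Num.sqrt r * dk r (x - c).
  apply: (le_trans (H x)); rewrite -[X in _ <= _ * X]expr1.
  by rewrite ler_wpM2l ?dkX_le // divr_ge0 // sqrtr_ge0.
have h2 : cabs (f x) ^+ 2 <= (A / Num.sqrt r * dk r (x - c)) ^+ 2.
  by rewrite ler_pXn2r // nnegrE ?cabs_ge0 // mulr_ge0 ?dk_ge0 // divr_ge0 // sqrtr_ge0.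
by apply: (le_trans h2); rewrite exprMn expr_div_n sqr_sqrtr ?(ltW r0).
Qed.

Lemma packet_gram A A' r r' c c' N f g : 0 < r -> r <= r' -> 0 <= A -> 0 <= A' ->
  packet A r c (N + 2) f -> packet A' r' c' N g ->
  cabs (ip f g) <= 4 * A * A' * (Num.sqrt r / Num.sqrt r') * dk r' (c - c') ^+ N.
Proof.
move=> r0 rr A0 A0' [mf Hf] [mg Hg]; have r0' := lt_le_trans r0 rr.
have sr : 0 < Num.sqrt r by rewrite sqrtr_gt0.
have sr' : 0 < Num.sqrt r' by rewrite sqrtr_gt0.
set B := A / Num.sqrt r * (A' / Num.sqrt r') * dk r' (c - c') ^+ N.
have B0 : 0 <= B.
  by rewrite /B !mulr_ge0 ?dkX_ge0 // ?invr_ge0 ?ltW.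
have ib := intgZ B (dk2_intg c r0).
apply: (le_trans (ip_le mf mg ib _)).
  move=> x; apply: (@le_trans _ _ ((A / Num.sqrt r * dk r (x - c) ^+ (N + 2)) *
     (A' / Num.sqrt r' * dk r' (x - c') ^+ N))).
    by apply: ler_pM; rewrite ?cabs_ge0.
  have h : dk r (x - c) ^+ N * dk r' (x - c') ^+ N <= dk r' (c - c') ^+ N.
    have h1 := dkM (c - x) (x - c') r0 rr; rewrite subrKA (dkC _ c x) in h1.
    by rewrite -exprMn; apply: lerXn2r; rewrite ?nnegrE ?mulr_ge0 ?dk_ge0.
  have p0 : 0 <= A / Num.sqrt r * (A' / Num.sqrt r') * dk r (x - c) ^+ 2.
    by rewrite mulr_ge0 ?dkX_ge0 // !mulr_ge0 // ?invr_ge0 ?sqrtr_ge0.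
  have := ler_wpM2l p0 h; rewrite /B exprD; lra.
rewrite RintegralZl // ?dk2_Rint //; last exact: dk2_intg.
apply: (@le_trans _ _ (2 * (B * (2 * Num.sqrt r ^+ 2)))); first by rewrite sqr_sqrtr // ltW.
rewrite /B le_eqVlt; apply/orP; left; apply/eqP.
by field; rewrite !gt_eqF.
Qed.

Definition wgt (c r x : R) : R := 1 + ((x - c) / r) ^+ 2.

Lemma wgt_ge1 c r x : 1 <= wgt c r x.
Proof. by rewrite lerDl sqr_ge0. Qed.

Lemma wgt_gt0 c r x : 0 < wgt c r x.
Proof. exact: lt_le_trans ltr01 (wgt_ge1 _ _ _). Qed.

Lemma wgt_continuous c r : continuous (wgt c r).
Proof.
move=> x; apply: cvgD; first exact: cvg_cst.
by apply: cvgM; (apply: cvgM; [apply: cvgB; [exact: cvg_id|exact: cvg_cst]|exact: cvg_cst]).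
Qed.

Lemma wgt_meas c r : measurable_fun setT (wgt c r).
Proof. exact: (continuous_measurable_fun (@wgt_continuous c r)). Qed.

Lemma wgt_dk c r c' r' x : 0 < r' -> r' <= r -> `|c' - c| <= 3 * r ->
  wgt c r x * dk r' (x - c') ^+ 2 <= 10.
Proof.
move=> r0 rr cc; have r0' := lt_le_trans r0 rr.
have D0 := dk_den0 (x - c') r0.
rewrite /dk exprVn ler_pdivrMr ?exprn_gt0 // /wgt.
set t := `|x - c'| / r' in D0 *.
have t0 : 0 <= t by rewrite divr_ge0 // ltW.
have h : `|(x - c) / r| <= t + 3.
  rewrite normrM normfV (gtr0_norm r0') ler_pdivrMr // mulrDl.
  have -> : x - c = (x - c') + (c' - c) by lra.
  apply: (le_trans (ler_normD _ _)); apply: lerD => //.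
  by rewrite /t -mulrA ler_peMr // mulrC ler_pdivlMr // mul1r.
have : `|(x - c) / r| ^+ 2 <= (t + 3) ^+ 2 by rewrite ler_pXn2r // nnegrE addr_ge0.
rewrite real_normK ?num_real //; nra.
Qed.

Lemma packet_wgt A c r c' r' N f : 0 <= A -> 0 < r' -> r' <= r -> `|c' - c| <= 3 * r ->
  packet A r' c' (N + 2) f -> packet (10 * A) r' c' N (fun x => (wgt c r x +i* 0)%C * f x).
Proof.
move=> A0 r0 rr cc [m H]; split.
  by apply: cmeasM => //; apply: cmeasR; exact: wgt_meas.
move=> x; rewrite cabsM cabs_real gtr0_norm ?wgt_gt0 //.
apply: (le_trans (ler_wpM2l (ltW (wgt_gt0 _ _ _)) (H x))).
have p0 : 0 <= A / Num.sqrt r' * dk r' (x - c') ^+ N.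
  by rewrite !mulr_ge0 ?dkX_ge0 // ?invr_ge0 sqrtr_ge0.
have := ler_wpM2l p0 (wgt_dk x r0 rr cc); rewrite exprD; lra.
Qed.

Lemma wave_packet_packet K L Ck P Phi : 0 < ilen (tI P) ->
  @wave_packet R K L Ck P Phi -> packet (Ck 0%N) (ilen (tI P)) (ctr (tI P)) L Phi.
Proof.
move=> l0 [m [_ [_ H]]]; split => // x.
have := H 0%N (leq0n _) x; rewrite /cderiv /=.
have E (z : R[i]) : (complex.Re z +i* complex.Im z)%C = z by case: z.
rewrite E cabsM expi_unit mul1r mulr0n subr0 mul1r powRN powR12_sqrt ?(ltW l0) //.
Qed.

End DecayIntegral.

(** * Fubini for complex integrands *)

Section ComplexFubini.
Variable R : realType.
Local Notation mu := (@lebesgue_measure R).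
Local Notation C := R[i].
Local Notation Re := complex.Re.
Local Notation Im := complex.Im.

Definition cmeas2 (F : R -> R -> C) :=
  measurable_fun setT (fun p : R * R => Re (F p.1 p.2)) /\
  measurable_fun setT (fun p : R * R => Im (F p.1 p.2)).

Lemma meas_slice1 (G : R * R -> R) x : measurable_fun setT G ->
  measurable_fun setT (fun y => G (x, y)).
Proof. by move=> mG; apply: measurableT_comp mG _; exact: measurable_pair1. Qed.

Lemma cmeas2_1 F x : cmeas2 F -> cmeasurable (F x).
Proof. by move=> [m1 m2]; split; [exact: (meas_slice1 x m1)|exact: (meas_slice1 x m2)]. Qed.

Lemma meas_slice2 (G : R * R -> R) y : measurable_fun setT G ->
  measurable_fun setT (fun x => G (x, y)).
Proof. by move=> mG; apply: measurableT_comp mG _; exact: measurable_pair2. Qed.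

Lemma cmeas2_2 F y : cmeas2 F -> cmeasurable (fun x => F x y).
Proof. by move=> [m1 m2]; split; [exact: (meas_slice2 y m1)|exact: (meas_slice2 y m2)]. Qed.

Lemma Fubini_real (G : R * R -> R) (p q : R -> R) : measurable_fun setT G ->
  intg p -> intg q -> (forall x y, `|G (x, y)| <= p x * q y) ->
  Rintegral mu setT (fun x => Rintegral mu setT (fun y => G (x, y))) =
  Rintegral mu setT (fun y => Rintegral mu setT (fun x => G (x, y))) /\
  intg (fun x => Rintegral mu setT (fun y => G (x, y))).
Proof.
move=> mG ip iq le.
have iG1 x : intg (fun y => G (x, y)).
  exact: (intg_le (meas_slice1 x mG) (intgZ (p x) iq) (le x)).
have iG2 y : intg (fun x => G (x, y)).
  apply: (intg_le (meas_slice2 y mG) (intgZ (q y) ip)) => x.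
  by rewrite mulrC; exact: le.
have mE : measurable_fun setT (EFin \o G) by exact/measurable_EFinP.
have pq0 x y : 0 <= p x * q y by exact: le_trans (le x y).
have iG : (mu \x mu)%E.-integrable setT (EFin \o G).
  apply: (proj2 (@integrable12ltyP _ _ _ _ R mu mu _ mE)).
  pose c := Rintegral mu setT q.
  apply: (@le_lt_trans _ _ (\int[mu]_x (`|c * p x|)%:E)%E).
    apply: ge0_le_integral => //.
    - by move=> x _; exact: integral_ge0.
    - apply: (measurable_fun_fubini_tonelli_F (m2 := mu) (abse \o (EFin \o G))) => //=.
      exact: measurableT_comp.
    - by have /integrableP[] := integrable_norm (intgZ c ip).
    - move=> x _; apply: (@le_trans _ _ (\int[mu]_y (p x * q y)%:E)%E).
        apply: ge0_le_integral => //.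
        + by have /integrableP[] := integrable_abse (iG1 x).
        + by apply/measurable_EFinP; apply: measurable_funM => //; exact: intg_meas.
        + by move=> y _; rewrite /= lee_fin.
      have := integrable_fin_num measurableT (intgZ (p x) iq) => /fineK /= <-.
      rewrite lee_fin; apply: le_trans (ler_norm _).
      have := RintegralZl (p x) measurableT iq; rewrite /Rintegral => ->.
      by rewrite mulrC.
  by have /integrableP[_] := intgZ c ip.
have E1 : (fun x => \int[mu]_y (EFin \o G) (x, y))%E =
   EFin \o (fun x => Rintegral mu setT (fun y => G (x, y))).
  apply/funext => x; rewrite /= /Rintegral fineK //.
  exact: (integrable_fin_num measurableT (iG1 x)).
have E2 : (fun y => \int[mu]_x (EFin \o G) (x, y))%E =
   EFin \o (fun y => Rintegral mu setT (fun x => G (x, y))).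
  apply/funext => y; rewrite /= /Rintegral fineK //.
  exact: (integrable_fin_num measurableT (iG2 y)).
split.
- suff : (\int[mu]_x (EFin \o (fun x => Rintegral mu setT (fun y => G (x, y)))) x =
     \int[mu]_y (EFin \o (fun y => Rintegral mu setT (fun x => G (x, y)))) y)%E.
    exact: congr1.
  by rewrite -E1 -E2; exact: Fubini iG.
- by rewrite /intg -E1; exact: (integrable_fubini_F iG).
Qed.

Lemma cFubini F (p q : R -> R) : cmeas2 F -> intg p -> intg q ->
  (forall x y, cabs (F x y) <= p x * q y) ->
  cint (fun x => cint (F x)) = cint (fun y => cint (fun x => F x y)).
Proof.
move=> [m1 m2] ip iq le; apply: complex_ext.
  have [] := @Fubini_real (fun z => Re (F z.1 z.2)) p q m1 ip iq; last by [].
  by move=> x y; apply: le_trans (le x y); exact: Re_le_cabs.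
have [] := @Fubini_real (fun z => Im (F z.1 z.2)) p q m2 ip iq; last by [].
by move=> x y; apply: le_trans (le x y); exact: Im_le_cabs.
Qed.

Lemma cFubini_meas F (p q : R -> R) : cmeas2 F -> intg p -> intg q ->
  (forall x y, cabs (F x y) <= p x * q y) -> cmeasurable (fun x => cint (F x)).
Proof.
move=> [m1 m2] ip iq le; split.
  have [|_ h] := @Fubini_real (fun z => Re (F z.1 z.2)) p q m1 ip iq.
    by move=> x y; apply: le_trans (le x y); exact: Re_le_cabs.
  exact: intg_meas h.
have [|_ h] := @Fubini_real (fun z => Im (F z.1 z.2)) p q m2 ip iq.
  by move=> x y; apply: le_trans (le x y); exact: Im_le_cabs.
exact: intg_meas h.
Qed.

Lemma cmeas2M F G : cmeas2 F -> cmeas2 G -> cmeas2 (fun x y => F x y * G x y).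
Proof.
move=> [r1 i1] [r2 i2]; split.
  rewrite (_ : (fun x => _) = (fun p => Re (F p.1 p.2) * Re (G p.1 p.2) -
      Im (F p.1 p.2) * Im (G p.1 p.2))).
    by apply: measurable_funB; exact: measurable_funM.
  by apply/funext => x; rewrite cReM.
rewrite (_ : (fun x => _) = (fun p => Re (F p.1 p.2) * Im (G p.1 p.2) +
      Im (F p.1 p.2) * Re (G p.1 p.2))).
  by apply: measurable_funD; exact: measurable_funM.
by apply/funext => x; rewrite cImM.
Qed.

Lemma cmeas2_fst f : cmeasurable f -> cmeas2 (fun x y => f x).
Proof.
by move=> [m1 m2]; split;
  [apply: measurableT_comp m1 _|apply: measurableT_comp m2 _]; exact: measurable_fst.
Qed.

Lemma cmeas2_snd f : cmeasurable f -> cmeas2 (fun x y => f y).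
Proof.
by move=> [m1 m2]; split;
  [apply: measurableT_comp m1 _|apply: measurableT_comp m2 _]; exact: measurable_snd.
Qed.

Lemma cmeas2_expi (h : R * R -> R) : measurable_fun setT h ->
  cmeas2 (fun x y => expi (h (x, y))).
Proof.
move=> mh; split.
  rewrite (_ : (fun p => _) = cos \o h); last by apply/funext => -[].
  exact: (measurableT_comp (continuous_measurable_fun (@continuous_cos R)) mh).
rewrite (_ : (fun p => _) = sin \o h); last by apply/funext => -[].
exact: (measurableT_comp (continuous_measurable_fun (@continuous_sin R)) mh).
Qed.
End ComplexFubini.

(** * The Poisson kernel *)

Section Laplace.
Variable R : realType.
Local Notation mu := (@lebesgue_measure R).

Section Kernel.
Variable e : R.
Hypothesis e0 : 0 < e.

Definition lap (x : R) : R := if 0 <= x then expR (- (e * x)) else 0.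

Lemma lap_ge0 x : 0 <= lap x.
Proof. by rewrite /lap; case: ifP => // _; exact: expR_ge0. Qed.

Lemma lap_restrict (h : R -> R) :
  (fun x => lap x * h x) = ((fun x => expR (- (e * x)) * h x) \_ `[0, +oo[).
Proof.
apply/funext => x; rewrite /lap patchE mem_setE in_itv /= andbT.
by case: ifP => // _; rewrite mul0r.
Qed.

Let g a (x : R) := expR (- (e * x)) * (1 + cos (a * x)).
Let G a (x : R) := expR (- (e * x)) * (- e^-1 + (a * sin (a * x) - e * cos (a * x)) / (e ^+ 2 + a ^+ 2)).

Let den a : 0 < e ^+ 2 + a ^+ 2.
Proof. by rewrite ltr_pwDl ?exprn_gt0 // sqr_ge0. Qed.

Let dG a (x : R) : is_derive x (1 : R) (G a) (g a x).
Proof.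
rewrite /G; apply: is_derive_eq.
rewrite /GRing.scale /= /g !mulr1 !mulr0 !add0r ?addr0 ?subr0.
by field; rewrite gt_eqF ?den //= gt_eqF.
Qed.

Let gc a : continuous (g a).
Proof.
move=> x; apply: cvgM.
  apply: (@continuous_comp _ _ _ (fun x => - (e * x)) (@expR R)); last exact: continuous_expR.
  by apply: cvgN; apply: cvgM; [exact: cvg_cst|exact: cvg_id].
apply: cvgD; first exact: cvg_cst.
apply: (@continuous_comp _ _ _ (fun x => a * x) (@cos R)); last exact: continuous_cos.
by apply: cvgM; [exact: cvg_cst|exact: cvg_id].
Qed.

Let Glim a : G a x @[x --> +oo] --> (0 : R).
Proof.
have E : expR (- (e * x)) @[x --> +oo] --> (0 : R).
  apply: (@cvg_comp _ _ _ (fun x => e * x) (fun y => expR (- y)) _ (+oo%R)); last exact: cvgr_expR.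
  apply/cvgryPge => A; near=> x.
  by rewrite mulrC -ler_pdivrMr //; near: x; apply: nbhs_pinfty_ge; exact: num_real.
pose M := e^-1 + (`|a| + e) / (e ^+ 2 + a ^+ 2).
have M0 : 0 < M.
  have k0 : 0 <= `|a| + e by rewrite addr_ge0 // ltW.
  have k1 : 0 <= (`|a| + e) / (e ^+ 2 + a ^+ 2) by rewrite divr_ge0 // ltW ?den.
  by have ei : 0 < e^-1; [rewrite invr_gt0|rewrite /M; lra].
apply/cvgr0Pnorm_le => d d0.
have dM : 0 < d / M by rewrite divr_gt0.
move/cvgr0Pnorm_le : E => /(_ _ dM) E.
near=> x.
have ex : `|expR (- (e * x))| <= d / M by near: x.
have kM : `|- e^-1 + (a * sin (a * x) - e * cos (a * x)) / (e ^+ 2 + a ^+ 2)| <= M.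
  apply: (le_trans (ler_normD _ _)); rewrite normrN gtr0_norm ?invr_gt0 //.
  rewrite lerD2l normrM normfV (gtr0_norm (den a)) ler_pM2r ?invr_gt0 //.
  apply: (le_trans (ler_normB _ _)); rewrite !normrM (gtr0_norm e0).
  have hs : `|sin (a * x)| <= 1 by rewrite ler_norml sin_le1 sin_geN1.
  have hc : `|cos (a * x)| <= 1 by rewrite ler_norml cos_le1 cos_geN1.
  by apply: lerD; rewrite ler_piMr // ltW.
rewrite /G normrM; apply: (le_trans (ler_pM (normr_ge0 _) (normr_ge0 _) ex kM)).
by rewrite divfK // gt_eqF.
Unshelve. all: by end_near.
Qed.

Let g_int (a : R) : (\int[mu]_(x in `[0%R : R, +oo[) (g a x)%:E = (e^-1 + e / (e ^+ 2 + a ^+ 2))%:E)%E.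
Proof.
rewrite (@ge0_continuous_FTC2y R (g a) (G a) 0 0).
- rewrite -EFinB; congr _%:E; rewrite /G !mulr0 oppr0 expR0 sin0 cos0.
  by field; rewrite gt_eqF ?den //= gt_eqF.
- by move=> x _; rewrite mulr_ge0 ?expR_ge0 //; have := cos_geN1 (a * x); lra.
- by apply/continuous_subspaceT; exact: gc.
- exact: Glim.
- by move=> x _; exact: ex_derive.
- apply: cvg_at_right_filter.
  exact/differentiable_continuous/derivable1_diffP/(@ex_derive _ _ _ _ _ _ _ (dG a 0)).
- by move=> x _; rewrite derive1E (@derive_val _ _ _ _ _ _ _ (dG a x)).
Qed.

Let g_intg a : mu.-integrable `[0%R : R, +oo[ (EFin \o g a).
Proof.
apply/integrableP; split.
  apply/measurable_EFinP; exact: (measurable_funS measurableT (@subsetT _ _) (continuous_measurable_fun (@gc a))).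
rewrite (_ : (\int[mu]_(x in _) _)%E = (e^-1 + e / (e ^+ 2 + a ^+ 2))%:E) ?ltry //.
rewrite -(g_int a); apply: eq_integral => x _ /=; congr _%:E.
by rewrite ger0_norm // mulr_ge0 ?expR_ge0 //; have := cos_geN1 (a * x); lra.
Qed.

Lemma lap_intg : intg lap.
Proof.
rewrite /intg (_ : EFin \o lap = (EFin \o (fun x => 2^-1 * g 0 x)) \_ `[0%R : R, +oo[).
  apply: (proj1 (integrable_mkcond (mu := mu) _ (measurable_itv _))).
  exact: (@integrableZl _ _ R mu _ (measurable_itv _) (2^-1) _ (g_intg 0)).
apply/funext => x; rewrite patchE mem_setE in_itv /= andbT /lap; case: ifP => // _.
by congr _%:E; rewrite /g mul0r cos0; lra.
Qed.

Lemma lap_cos (a : R) : Rintegral mu setT (fun x => lap x * cos (a * x)) = e / (e ^+ 2 + a ^+ 2).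
Proof.
have E a' : Rintegral mu `[0%R : R, +oo[ (g a') = e^-1 + e / (e ^+ 2 + a' ^+ 2).
  by rewrite /Rintegral g_int.
rewrite lap_restrict -Rintegral_mkcond.
have -> : (fun x => expR (- (e * x)) * cos (a * x)) = (fun x => g a x - 2^-1 * g 0 x).
  by apply/funext => x; rewrite /g mul0r cos0; lra.
have X := @integrableZl _ _ R mu _ (measurable_itv _) (2^-1) _ (g_intg 0).
rewrite (@RintegralB _ _ R mu _ _ _ (measurable_itv _) (g_intg a) X).
rewrite (@RintegralZl _ _ R mu _ _ _ (measurable_itv _) (g_intg 0)).
rewrite !E; field.
by rewrite gt_eqF ?den //= gt_eqF.
Qed.

Lemma lap_meas : measurable_fun setT lap.
Proof. exact: intg_meas lap_intg. Qed.

End Kernel.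
End Laplace.

(** * Orthogonality of functions with disjoint frequency supports *)

Section Orthogonality.
Variable R : realType.
Local Notation mu := (@lebesgue_measure R).
Local Notation C := R[i].

Definition rc (r : R) : C := (r +i* 0)%C.

Lemma rcM r s : rc (r * s) = rc r * rc s.
Proof. by apply: complex_ext; rewrite ?cReM ?cImM /= ?mulr0 ?mul0r ?subr0 ?addr0. Qed.
Lemma rcD r s : rc (r + s) = rc r + rc s.
Proof. by apply: complex_ext; rewrite ?cReD ?cImD //= addr0. Qed.
Lemma rcJ r : (rc r)^* = rc r.
Proof. by apply: complex_ext; rewrite ?cReJ ?cImJ //= oppr0. Qed.
Lemma cabs_rc r : cabs (rc r) = `|r|. Proof. exact: cabs_real. Qed.

Lemma cint_rc (h : R -> R) : cint (fun x => rc (h x)) = rc (Rintegral mu setT h).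
Proof. by apply: complex_ext => //=; rewrite /Rintegral integral0. Qed.

Lemma expi_cos t : expi t + expi (- t) = rc (2 * cos t).
Proof.
by apply: complex_ext; rewrite ?cReD ?cImD /= ?cosN ?sinN ?subrr // mulr_natl mulr2n.
Qed.

Definition poisson (e u : R) : R := 2 * (e / (e ^+ 2 + (2 * pi * u) ^+ 2)).

Section PoissonKernel.
Variable e : R.
Hypothesis e0 : 0 < e.

Let den u : 0 < e ^+ 2 + (2 * pi * u) ^+ 2.
Proof. by rewrite ltr_pwDl ?exprn_gt0 // sqr_ge0. Qed.

Lemma poisson_ge0 u : 0 <= poisson e u.
Proof. by rewrite mulr_ge0 // divr_ge0 ?ltW ?den. Qed.

Lemma poissonN u : poisson e (- u) = poisson e u.
Proof. by rewrite /poisson mulrN sqrrN. Qed.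

Lemma pi_gt1 : 1 <= pi :> R.
Proof. by have := @pi_ge2 R; lra. Qed.

Lemma pi_le4 : pi <= 4 :> R.
Proof. by have := @pihalf_lt2 R; lra. Qed.

Lemma dkE u : dk e u = e / (e + `|u|).
Proof. by rewrite /dk -[RHS]invf_div mulrDl divff ?gt_eqF. Qed.

Lemma poisson_le u : poisson e u <= 4 / e * dk e u ^+ 2.
Proof.
rewrite /poisson dkE.
have n0 : 0 < e + `|u| by rewrite ltr_pwDl.
rewrite expr_div_n.
have -> : 4 / e * (e ^+ 2 / (e + `|u|) ^+ 2) = 4 * e / (e + `|u|) ^+ 2.
  by field; rewrite !gt_eqF.
rewrite mulrA ler_pdivrMr // mulrAC ler_pdivlMr ?exprn_gt0 //.
have p1 := pi_gt1.
have H : (e + `|u|) ^+ 2 <= 2 * (e ^+ 2 + (2 * pi * u) ^+ 2).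
  have h : `|u| ^+ 2 = u ^+ 2 by rewrite real_normK ?num_real.
  have := sqr_ge0 (e - `|u|); rewrite sqrrB sqrrD h => h2.
  have : u ^+ 2 <= (2 * pi * u) ^+ 2.
    rewrite !exprMn ler_peMl ?sqr_ge0 //; nra.
  lra.
have e2 : 0 <= 2 * e by rewrite mulr_ge0 // ltW.
by have := ler_wpM2l e2 H; lra.
Qed.

Lemma poisson_ge u : (32 * e)^-1 * dk e u ^+ 2 <= poisson e u.
Proof.
rewrite /poisson dkE.
have n0 : 0 < e + `|u| by rewrite ltr_pwDl.
rewrite expr_div_n.
have -> : (32 * e)^-1 * (e ^+ 2 / (e + `|u|) ^+ 2) = e / (32 * (e + `|u|) ^+ 2).
  by field; rewrite !gt_eqF.
rewrite mulrA ler_pdivlMr // mulrAC ler_pdivrMr ?mulr_gt0 ?exprn_gt0 //.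
have p1 := pi_gt1; have p4 := pi_le4.
have H : e ^+ 2 + (2 * pi * u) ^+ 2 <= 64 * (e + `|u|) ^+ 2.
  have h : `|u| ^+ 2 = u ^+ 2 by rewrite real_normK ?num_real.
  rewrite sqrrD h.
  have h1 : (2 * pi * u) ^+ 2 <= 64 * u ^+ 2.
    by rewrite !exprMn ler_wpM2r ?sqr_ge0 //; nra.
  have h2 : 0 <= e * `|u| by rewrite mulr_ge0 // ltW.
  have h3 := sqr_ge0 e; lra.
by have := ler_wpM2l (ltW e0) H; lra.
Qed.

Lemma poisson_far u d : 0 < d -> d <= `|u| ->
  poisson e u <= e * (1 + d^-1) ^+ 2 * dk 1 u ^+ 2.
Proof.
move=> d0 du; have u0 : 0 < `|u| by exact: lt_le_trans du.
have h : `|u| ^+ 2 = u ^+ 2 by rewrite real_normK ?num_real.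
have p1 := pi_gt1.
have u20 : 0 < u ^+ 2 by rewrite -h exprn_gt0.
apply: (@le_trans _ _ (e / u ^+ 2)).
  rewrite /poisson mulrA ler_pdivrMr // mulrAC ler_pdivlMr //.
  have H : 2 * u ^+ 2 <= (2 * pi * u) ^+ 2.
    by rewrite !exprMn ler_wpM2r ?sqr_ge0 //; nra.
  have H2 : 2 * u ^+ 2 <= e ^+ 2 + (2 * pi * u) ^+ 2 by have := sqr_ge0 e; lra.
  by have := ler_wpM2l (ltW e0) H2; lra.
rewrite -mulrA ler_wpM2l ?(ltW e0) // /dk divr1 -h -exprVn -exprMn.
have i0 : 0 < d^-1 by rewrite invr_gt0.
have k : `|u|^-1 <= (1 + d^-1) * (1 + `|u|)^-1.
  rewrite -[leLHS]mul1r ler_pdivrMr // mulrAC ler_pdivlMr ?ltr_pwDl //.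
  have : 1 <= d^-1 * `|u| by rewrite mulrC ler_pdivlMr // mul1r.
  lra.
have k0 : 0 <= `|u|^-1 by rewrite invr_ge0.
by apply: lerXn2r => //; rewrite nnegrE //; exact: le_trans k.
Qed.

Lemma poisson_continuous : continuous (poisson e).
Proof.
move=> u; apply: cvgM; first exact: cvg_cst.
apply: cvgM; first exact: cvg_cst.
apply: cvgV; first by rewrite gt_eqF.
apply: cvgD; first exact: cvg_cst.
by apply: cvgM; (apply: cvgM; [exact: cvg_cst|exact: cvg_id]).
Qed.

Lemma poisson_intg y : intg (fun x => poisson e (y - x)).
Proof.
apply: (intg_le _ (intgZ (4 / e) (dk2_intg y e0))).
  apply: measurableT_comp; first exact: (continuous_measurable_fun poisson_continuous).
  by apply: measurable_funB.
move=> x; rewrite ger0_norm ?poisson_ge0 // -poissonN opprB; exact: poisson_le.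
Qed.

Lemma poisson_shift y : Rintegral mu setT (fun x => poisson e (y - x)) =
  Rintegral mu setT (poisson e).
Proof.
pose F (x : R) := x - y.
have dF (x : R) : is_derive x (1 : R) F 1.
  by rewrite /F; apply: is_derive_eq; rewrite subr0.
have dF1 : derive1 F = fun=> 1.
  by apply/funext => x; rewrite derive1E (@derive_val _ _ _ _ _ _ _ (dF x)).
have := @increasing_ge0_integration_by_substitutionT R F (poisson e).
rewrite dF1 => H; rewrite /Rintegral H.
- congr fine; apply: eq_integral => x _; congr _%:E; rewrite /= mulr1 /F.
  by rewrite -poissonN opprB.
- by move=> x z xz; rewrite /F ltrD2r.
- by move=> x; exact: cvg_cst.
- exact: is_cvg_cst.
- exact: is_cvg_cst.
- by move=> x.
- by apply/cvgrNyPle => A; near=> x;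
    rewrite /F lerBlDr; near: x; apply: nbhs_ninfty_le; exact: num_real.
- by apply/cvgryPge => A; near=> x;
    rewrite /F lerBrDr; near: x; apply: nbhs_pinfty_ge; exact: num_real.
- exact: poisson_continuous.
- exact: poisson_ge0.
Unshelve. all: by end_near.
Qed.

Lemma poisson_mass : 1 / 16 <= Rintegral mu setT (poisson e) <= 8.
Proof.
rewrite -(poisson_shift 0); apply/andP; split.
  apply: (@le_trans _ _ ((32 * e)^-1 * (2 * e))).
    by rewrite le_eqVlt; apply/orP; left; apply/eqP; field; rewrite gt_eqF.
  rewrite -(dk2_Rint 0 e0) -RintegralZl //; last exact: dk2_intg.
  apply: Rint_le; [exact/intgZ/dk2_intg|exact: poisson_intg|].
  by move=> x; rewrite -poissonN opprB; exact: poisson_ge.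
apply: (@le_trans _ _ (4 / e * (2 * e))).
  rewrite -(dk2_Rint 0 e0) -RintegralZl //; last exact: dk2_intg.
  apply: Rint_le; [exact: poisson_intg|exact/intgZ/dk2_intg|].
  by move=> x; rewrite -poissonN opprB; exact: poisson_le.
by rewrite le_eqVlt; apply/orP; left; apply/eqP; field; rewrite gt_eqF.
Qed.

End PoissonKernel.
End Orthogonality.

Section Orthogonality.
Variable R : realType.
Local Notation mu := (@lebesgue_measure R).
Local Notation C := R[i].
Local Notation Re := complex.Re.
Local Notation Im := complex.Im.

Lemma eq_cint (f g : R -> C) : f =1 g -> cint f = cint g.
Proof. by move=> fg; congr cint; exact/funext. Qed.

Lemma cmeas2D (F G : R -> R -> C) : cmeas2 F -> cmeas2 G -> cmeas2 (fun x y => F x y + G x y).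
Proof.
move=> [r1 i1] [r2 i2]; split.
  rewrite (_ : (fun x => _) = (fun p => Re (F p.1 p.2) + Re (G p.1 p.2))).
    exact: measurable_funD.
  by apply/funext => x; rewrite cReD.
rewrite (_ : (fun x => _) = (fun p => Im (F p.1 p.2) + Im (G p.1 p.2))).
  exact: measurable_funD.
by apply/funext => x; rewrite cImD.
Qed.

Lemma meas_mul2 (c : R) : measurable_fun setT (fun p : R * R => c * (p.1 * p.2)).
Proof.
apply: measurable_funM; first exact: measurable_cst.
by apply: measurable_funM; [exact: measurable_fst|exact: measurable_snd].
Qed.

Lemma cmeas2_expi_mul (c : R) : cmeas2 (fun x y : R => expi (c * (x * y))).
Proof. exact: (cmeas2_expi (h := fun p => c * (p.1 * p.2)) (meas_mul2 c)). Qed.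

Variables (f g : R -> C).
Hypotheses (mf : cmeasurable f) (mg : cmeasurable g).
Hypotheses (if_ : intg (fun x => cabs (f x))) (ig : intg (fun x => cabs (g x))).
Hypothesis fg0 : forall xi, ft f xi * (ft g xi)^* = 0.

Let c1f xi : cintg (fun x => f x * expi (- (2 * pi * x * xi))).
Proof.
apply: cintg_le if_ _ => [|x]; last by rewrite cabsM expi_unit mulr1.
apply: cmeasM => //; apply: cmeas_expi; apply: measurable_funN.
by apply: measurable_funM; [apply: measurable_funM|].
Qed.

Let c1g xi : cintg (fun y => (g y)^* * expi (2 * pi * y * xi)).
Proof.
apply: cintg_le ig _ => [|x]; last by rewrite cabsM expi_unit mulr1 cabsJ.
apply: cmeasM; first exact: cmeasJ.
by apply: cmeas_expi; apply: measurable_funM => //; apply: measurable_funM.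
Qed.

Lemma ft_conj xi : (ft g xi)^* = cint (fun y => (g y)^* * expi (2 * pi * y * xi)).
Proof.
rewrite /ft -cintJ; last first.
  apply: cintg_le ig _ => [|x]; last by rewrite cabsM expi_unit mulr1.
  apply: cmeasM => //; apply: cmeas_expi; apply: measurable_funN.
  by apply: measurable_funM; [apply: measurable_funM|].
by apply: eq_cint => y; rewrite cJM -expiN opprK.
Qed.

Let L := Rintegral mu setT (fun x => cabs (f x)).

Lemma ft_bound xi : cabs (ft f xi) <= 2 * L.
Proof.
apply: cint_le => // [|x]; last by rewrite cabsM expi_unit mulr1.
apply: cmeasM => //; apply: cmeas_expi; apply: measurable_funN.
by apply: measurable_funM; [apply: measurable_funM|].
Qed.

Section Eps.
Variable e : R.
Hypothesis e0 : 0 < e.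

Let lr xi := rc (lap e xi).
Let mlr : cmeasurable lr.
Proof. exact: (cmeasR (lap_meas e0)). Qed.

Lemma lap_ft_meas (s : R) : cmeasurable (fun xi => lr xi * ft f (s * xi)).
Proof.
have E : (fun xi => cint (fun x => lr xi * (f x * expi (- (2 * pi * s) * (xi * x))))) =
   (fun xi => lr xi * ft f (s * xi)).
  apply/funext => xi; rewrite -cintZ; last exact: c1f.
  by apply: eq_cint => x; congr (_ * (_ * expi _)); ring.
rewrite -E; apply: (@cFubini_meas R _ (lap e) (fun x => cabs (f x))) => //.
- apply: cmeas2M; first exact: (cmeas2_fst mlr).
  by apply: cmeas2M; [exact: (cmeas2_snd mf)|exact: cmeas2_expi_mul].
- exact: lap_intg.
- by move=> x y; rewrite !cabsM expi_unit mulr1 cabs_rc ger0_norm ?lap_ge0.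
Qed.

Let A y xi := ft f xi * expi (2 * pi * (y * xi)) + ft f (- xi) * expi (- (2 * pi) * (y * xi)).

Lemma kernel_inner y : cint (fun xi => lr xi * A y xi) =
  cint (fun x => f x * rc (poisson e (y - x))).
Proof.
pose F xi x := f x * rc (lap e xi * (2 * cos (2 * pi * (y - x) * xi))).
have mF : cmeas2 F.
  apply: cmeas2M; first exact: (cmeas2_snd mf).
  have mc : measurable_fun setT (fun p : R * R =>
      lap e p.1 * (2 * cos (2 * pi * (y - p.2) * p.1))).
    apply: measurable_funM.
      by apply: measurableT_comp; [exact: lap_meas|exact: measurable_fst].
    apply: measurable_funM; first exact: measurable_cst.
    apply: (measurableT_comp (continuous_measurable_fun (@continuous_cos R))).
    apply: measurable_funM; last exact: measurable_fst.
    apply: measurable_funM; first exact: measurable_cst.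
    by apply: measurable_funB; [exact: measurable_cst|exact: measurable_snd].
  by split; [exact: mc|exact: measurable_cst].
transitivity (cint (fun xi => cint (F xi))).
  apply: eq_cint => xi.
  have -> : A y xi = cint (fun x => f x * rc (2 * cos (2 * pi * (y - x) * xi))).
    rewrite /A [ft f xi * _]mulrC [ft f (- xi) * _]mulrC /ft -!cintZ //.
    rewrite -cintD; [|exact/cintgZ/c1f|exact/cintgZ/c1f].
    apply: eq_cint => x; rewrite -expi_cos [RHS]mulrDr.
    by congr (_ + _); rewrite mulrCA; congr (_ * _); rewrite -expiD; congr expi; ring.
  rewrite -cintZ; last first.
    apply: (@cintg_le _ _ (fun x => 2 * cabs (f x))); last first.
    - move=> x; rewrite cabsM cabs_rc mulrC ler_wpM2r ?cabs_ge0 // normrM.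
      rewrite ger0_norm // ler_piMr // ler_norml cos_le1 cos_geN1 //.
    - exact: intgZ.
    - apply: cmeasM => //; apply: (cmeasR (R := R)).
      apply: measurable_funM; first exact: measurable_cst.
      apply: (measurableT_comp (continuous_measurable_fun (@continuous_cos R))).
      apply: measurable_funM; last exact: measurable_cst.
      apply: measurable_funM; first exact: measurable_cst.
      by apply: measurable_funB; [exact: measurable_cst|].
  by apply: eq_cint => x; rewrite /F (rcM (lap e xi)) mulrCA.
rewrite (@cFubini R F (fun xi => 2 * lap e xi) (fun x => cabs (f x))) //; last 2 first.
- by apply: intgZ; exact: lap_intg.
- move=> xi x; rewrite cabsM cabs_rc mulrC ler_wpM2r ?cabs_ge0 //.
  rewrite !normrM (ger0_norm (lap_ge0 _ _)) mulrC ler_wpM2r ?lap_ge0 //.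
  by rewrite ger0_norm // ler_piMr // ler_norml cos_le1 cos_geN1.
apply: eq_cint => x; rewrite /F cintZ; last first.
  apply: (@cintg_le _ _ (fun xi => 2 * lap e xi)); last first.
  - move=> xi; rewrite cabs_rc !normrM (ger0_norm (lap_ge0 _ _)) mulrC ler_wpM2r ?lap_ge0 //.
    by rewrite ger0_norm // ler_piMr // ler_norml cos_le1 cos_geN1.
  - by apply: intgZ; exact: lap_intg.
  - apply: (cmeasR (R := R)); apply: measurable_funM; first exact: lap_meas.
    apply: measurable_funM; first exact: measurable_cst.
    apply: (measurableT_comp (continuous_measurable_fun (@continuous_cos R))).
    by apply: measurable_funM; [exact: measurable_cst|].
rewrite cint_rc; congr (_ * rc _).
rewrite /poisson -lap_cos // -RintegralZl //.
  by congr (Rintegral _ _ _); apply/funext => xi; rewrite mulrCA.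
apply: (intg_le _ (lap_intg e0)).
  apply: measurable_funM; first exact: lap_meas.
  apply: (measurableT_comp (continuous_measurable_fun (@continuous_cos R))).
  by apply: measurable_funM; [exact: measurable_cst|].
move=> xi; rewrite normrM (ger0_norm (lap_ge0 _ _)) ler_piMr ?lap_ge0 //.
by rewrite ler_norml cos_le1 cos_geN1.
Qed.

Let F2 xi y := lr xi * A y xi * (g y)^*.

Let mF2 : cmeas2 F2.
Proof.
apply: cmeas2M; last exact: (cmeas2_snd (cmeasJ mg)).
rewrite (_ : (fun xi y => _) = (fun xi y => lr xi * ft f (1 * xi) * expi (2 * pi * (xi * y)) +
   lr xi * ft f (-1 * xi) * expi (- (2 * pi) * (xi * y)))); last first.
  apply/funext => xi; apply/funext => y.
  by rewrite /A (mulrC y xi) mul1r mulN1r mulrDr !mulrA.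
by apply: cmeas2D; (apply: cmeas2M; [exact: (cmeas2_fst (lap_ft_meas _))|exact: cmeas2_expi_mul]).
Qed.

Let le2 xi y : cabs (F2 xi y) <= (4 * L * lap e xi) * cabs (g y).
Proof.
rewrite /F2 cabsM cabsJ ler_wpM2r ?cabs_ge0 // cabsM cabs_rc ger0_norm ?lap_ge0 //.
rewrite mulrC ler_wpM2r ?lap_ge0 //; apply: (le_trans (cabsD _ _)).
rewrite !cabsM !expi_unit !mulr1.
by have := ft_bound xi; have := ft_bound (- xi); lra.
Qed.

Let F2int y : cint (fun xi => F2 xi y) = cint (fun x => f x * rc (poisson e (y - x))) * (g y)^*.
Proof.
rewrite -kernel_inner mulrC -cintZ.
  by apply: eq_cint => xi; rewrite /F2 mulrC.
apply: (@cintg_le _ _ (fun xi => 4 * L * lap e xi)); last first.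
- move=> xi; rewrite cabsM cabs_rc ger0_norm ?lap_ge0 //.
  rewrite mulrC ler_wpM2r ?lap_ge0 //; apply: (le_trans (cabsD _ _)).
  rewrite !cabsM !expi_unit !mulr1.
  by have := ft_bound xi; have := ft_bound (- xi); lra.
- by apply: intgZ; exact: lap_intg.
- rewrite (_ : (fun xi => _) = (fun xi => lr xi * ft f (1 * xi) * expi (2 * pi * (y * xi)) +
   lr xi * ft f (-1 * xi) * expi (- (2 * pi) * (y * xi)))); last first.
    by apply/funext => xi; rewrite /A mul1r mulN1r mulrDr !mulrA.
  by apply: cmeasD; (apply: cmeasM; [exact: lap_ft_meas|apply: cmeas_expi;
    apply: measurable_funM; [exact: measurable_cst|apply: measurable_funM]]).
Qed.

Lemma kernel_zero :
  cint (fun y => cint (fun x => f x * rc (poisson e (y - x))) * (g y)^*) = 0.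
Proof.
have := @cFubini R F2 (fun xi => 4 * L * lap e xi) (fun y => cabs (g y)) mF2
  (intgZ (4 * L) (lap_intg e0)) ig le2.
have -> : cint (fun x => cint (F2 x)) = 0.
  rewrite -[RHS](@cint0 R); apply: eq_cint => xi.
  transitivity (cint (fun y => lr xi * ft f xi * ((g y)^* * expi (2 * pi * y * xi)) +
     lr xi * ft f (- xi) * ((g y)^* * expi (2 * pi * y * - xi)))).
    apply: eq_cint => y; rewrite /F2 /A.
    have -> : 2 * pi * y * - xi = - (2 * pi) * (y * xi) by ring.
    have -> : 2 * pi * y * xi = 2 * pi * (y * xi) by ring.
    ring.
  rewrite cintD; [|exact/cintgZ/c1g|exact/cintgZ/c1g].
  rewrite !cintZ; [|exact: c1g|exact: c1g].
  by rewrite -!ft_conj -!mulrA !fg0 !mulr0 addr0.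
by move=> H; rewrite [RHS]H; apply: eq_cint => y; rewrite F2int.
Qed.

Lemma kernel_meas :
  cmeasurable (fun y => cint (fun x => f x * rc (poisson e (y - x))) * (g y)^*).
Proof.
rewrite (_ : (fun y => _) = (fun y => cint (fun xi => F2 xi y))); last first.
  by apply/funext => y; rewrite F2int.
have sw : cmeas2 (fun y xi => F2 xi y).
  have [m1 m2] := mF2; split.
    exact: (measurableT_comp m1 (@measurable_swap _ _ _ _)).
  exact: (measurableT_comp m2 (@measurable_swap _ _ _ _)).
apply: (cFubini_meas sw ig (intgZ (4 * L) (lap_intg e0))) => y xi.
by rewrite mulrC; exact: le2.
Qed.

End Eps.

Variables (M Lp : R).
Hypotheses (fM : forall x, cabs (f x) <= M)
  (fL : forall x y, cabs (f x - f y) <= Lp * `|x - y|).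

Lemma kernel_err (e d : R) y : 0 < e -> 0 < d ->
  cabs (cint (fun x => f x * rc (poisson e (y - x))) -
        f y * rc (Rintegral mu setT (poisson e))) <=
  2 * (8 * (`|Lp| * d) + 4 * M * (e * (1 + d^-1) ^+ 2)).
Proof.
move=> e0 d0; have M0 : 0 <= M by exact: le_trans (cabs_ge0 _) (fM 0).
have ip := poisson_intg e0 y.
have mp : cmeasurable (fun x => rc (poisson e (y - x))).
  by apply: (cmeasR (R := R)); exact: intg_meas ip.
have cf : cintg (fun x => f x * rc (poisson e (y - x))).
  apply: (@cintg_le _ _ (fun x => M * poisson e (y - x))); last first.
  - by move=> x; rewrite cabsM cabs_rc ger0_norm ?poisson_ge0 // ler_wpM2r ?poisson_ge0.
  - exact: intgZ.
  - exact: cmeasM.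
have cp : cintg (fun x => - f y * rc (poisson e (y - x))).
  apply: cintgZ; apply: (cintg_le mp ip) => x.
  by rewrite cabs_rc ger0_norm ?poisson_ge0.
have -> : cint (fun x => f x * rc (poisson e (y - x))) -
        f y * rc (Rintegral mu setT (poisson e)) =
    cint (fun x => (f x - f y) * rc (poisson e (y - x))).
  rewrite -(poisson_shift e0 y) -cint_rc -mulNr -cintZ; last first.
    by apply: (cintg_le mp ip) => x; rewrite cabs_rc ger0_norm ?poisson_ge0.
  by rewrite -cintD //; apply: eq_cint => x; rewrite -mulrDl.
pose q x := dk 1 (x - y) ^+ 2.
pose H x := `|Lp| * d * poisson e (y - x) + 2 * M * (e * (1 + d^-1) ^+ 2) * q x.
have iH : intg H by apply: intgD; apply: intgZ => //; exact: dk2_intg.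
apply: (@le_trans _ _ (2 * Rintegral mu setT H)).
  apply: cint_le => //.
    by apply: cmeasM => //; apply: cmeasD => //; exact: cmeas_cst.
  move=> x; rewrite cabsM cabs_rc ger0_norm ?poisson_ge0 //.
  have P0 := poisson_ge0 e0 (y - x).
  have q0 : 0 <= q x by rewrite sqr_ge0.
  have c0 : 0 <= e * (1 + d^-1) ^+ 2 by rewrite mulr_ge0 ?sqr_ge0 // ltW.
  case: (lerP d `|y - x|) => dx.
    have h1 := poisson_far e0 d0 dx.
    have h2 : cabs (f x - f y) <= 2 * M.
      apply: (le_trans (cabsD _ _)); rewrite cabsN.
      by have := fM x; have := fM y; lra.
    apply: (@le_trans _ _ (2 * M * (e * (1 + d^-1) ^+ 2 * dk 1 (y - x) ^+ 2))).
      by apply: ler_pM => //; exact: cabs_ge0.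
    have k1 : 0 <= `|Lp| * d * poisson e (y - x).
      by apply: mulr_ge0 => //; apply: mulr_ge0 => //; exact: ltW.
    by rewrite (dkC 1 y x) -/(q x) /H; lra.
  apply: (@le_trans _ _ (`|Lp| * d * poisson e (y - x))).
    rewrite ler_wpM2r //; apply: (le_trans (fL x y)).
    apply: (@le_trans _ _ (`|Lp| * `|x - y|)); first by rewrite ler_wpM2r // ler_norm.
    by rewrite ler_wpM2l // distrC ltW.
  by rewrite lerDl; apply: mulr_ge0 => //; apply: mulr_ge0 => //; apply: mulr_ge0.
rewrite ler_wpM2l //.
have E1 : Rintegral mu setT (fun x => `|Lp| * d * poisson e (y - x)) =
    `|Lp| * d * Rintegral mu setT (poisson e).
  by rewrite -(poisson_shift e0 y) -RintegralZl.
have E2 : Rintegral mu setT (fun x => 2 * M * (e * (1 + d^-1) ^+ 2) * q x) =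
    2 * M * (e * (1 + d^-1) ^+ 2) * (2 * 1).
  by rewrite -(dk2_Rint y (@ltr01 R)) -RintegralZl //; exact: dk2_intg.
have -> : Rintegral mu setT H = `|Lp| * d * Rintegral mu setT (poisson e) +
    2 * M * (e * (1 + d^-1) ^+ 2) * (2 * 1).
  by rewrite -E1 -E2 -RintegralD //; [exact: intgZ|exact/intgZ/dk2_intg].
have /andP[_ m8] := poisson_mass e0.
have l0 : 0 <= `|Lp| * d by rewrite mulr_ge0 // ltW.
have := ler_wpM2l l0 m8; lra.
Qed.

Lemma ip_orth : ip f g = 0.
Proof.
have M0 : 0 <= M by exact: le_trans (cabs_ge0 _) (fM 0).
pose G := Rintegral mu setT (fun x => cabs (g x)).
have G0 : 0 <= G by apply: Rintegral_ge0 => x _; exact: cabs_ge0.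
have key e d : 0 < e -> 0 < d -> cabs (ip f g) <=
    64 * (8 * (`|Lp| * d) + 4 * M * (e * (1 + d^-1) ^+ 2)) * G.
  move=> e0 d0; set B := 8 * _ + _.
  have B0 : 0 <= B.
    have b1 : 0 <= `|Lp| * d by apply: mulr_ge0 => //; exact: ltW.
    have b2 : 0 <= M * (e * (1 + d^-1) ^+ 2).
      by apply: mulr_ge0 => //; apply: mulr_ge0; [exact: ltW|exact: sqr_ge0].
    by rewrite /B; lra.
  pose m := Rintegral mu setT (poisson e).
  have cfg : cintg (fun y => f y * (g y)^*).
    apply: (@cintg_le _ _ (fun y => M * cabs (g y))); last first.
    - by move=> y; rewrite cabsM cabsJ ler_wpM2r ?cabs_ge0.
    - exact: intgZ.
    - by apply: cmeasM => //; exact: cmeasJ.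
  pose K y := cint (fun x => f x * rc (poisson e (y - x))).
  have kE y : cabs (K y - f y * rc m) <= 2 * B by exact: kernel_err.
  have cK : cintg (fun y => K y * (g y)^*).
    apply: (@cintg_le _ _ (fun y => (2 * B + M * `|m|) * cabs (g y))); last first.
    - move=> y; rewrite cabsM cabsJ ler_wpM2r ?cabs_ge0 //.
      have -> : K y = (K y - f y * rc m) + f y * rc m by rewrite subrK.
      apply: (le_trans (cabsD _ _)); apply: lerD => //.
      by rewrite cabsM cabs_rc ler_wpM2r.
    - exact: intgZ.
    - exact: kernel_meas.
  have E : rc m * ip f g = - cint (fun y => (K y - f y * rc m) * (g y)^*).
    have -> : cint (fun y => (K y - f y * rc m) * (g y)^*) =
       cint (fun y => K y * (g y)^* + - rc m * (f y * (g y)^*)).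
      by apply: eq_cint => y; ring.
    rewrite cintD //; last exact: cintgZ.
    by rewrite cintZ // kernel_zero // add0r mulNr opprK.
  have /andP[m16 _] := poisson_mass e0; rewrite -/m in m16.
  have : m * cabs (ip f g) <= 2 * (2 * B * G).
    have m0 : 0 <= m by apply: le_trans m16; rewrite divr_ge0.
    rewrite -[X in X * _]ger0_norm // -cabs_rc -cabsM E cabsN.
    rewrite -RintegralZl //; apply: cint_le.
    - rewrite (_ : (fun y => _) = (fun y => K y * (g y)^* + - rc m * (f y * (g y)^*))); last first.
        by apply/funext => y; ring.
      apply: cmeasD; first exact: kernel_meas.
      apply: cmeasM; first exact: cmeas_cst.
      by apply: cmeasM => //; exact: cmeasJ.
    - exact: intgZ.
    - by move=> y; rewrite cabsM cabsJ ler_wpM2r ?cabs_ge0.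
  have := ler_wpM2r (cabs_ge0 (ip f g)) m16; lra.
suff : cabs (ip f g) <= 0.
  move=> h; have h0 : cabs (ip f g) = 0 by apply/le_anti; rewrite h cabs_ge0.
  by have := Normc.eq0_normc (etrans (esym (cabsE (ip f g))) h0).
apply/ler_addgt0Pr => t t0; rewrite add0r.
have LG : 0 <= `|Lp| * G by rewrite mulr_ge0.
have LG1 : 0 < 1024 * (`|Lp| * G + 1) by lra.
pose d := t / (1024 * (`|Lp| * G + 1)).
have d0 : 0 < d by exact: divr_gt0.
pose c := M * (1 + d^-1) ^+ 2 * G.
have c0 : 0 <= c by rewrite mulr_ge0 // mulr_ge0 // sqr_ge0.
have c1 : 0 < 512 * (c + 1) by lra.
pose e := t / (512 * (c + 1)).
have e0 : 0 < e by exact: divr_gt0.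
apply: (le_trans (key e d e0 d0)).
have h1 : d * (1024 * (`|Lp| * G + 1)) = t by rewrite divfK ?lt0r_neq0.
have h2 : e * (512 * (c + 1)) = t by rewrite divfK ?lt0r_neq0.
have -> : 64 * (8 * (`|Lp| * d) + 4 * M * (e * (1 + d^-1) ^+ 2)) * G =
  512 * (`|Lp| * G * d) + 256 * (c * e) by rewrite /c; ring.
lra.
Qed.

End Orthogonality.

(** * Wave packets *)

Section WavePackets.
Variable R : realType.
Local Notation C := R[i].
Local Notation Re := complex.Re.
Local Notation Im := complex.Im.

Lemma mvt_le0 (h : R -> R) (B x y : R) : x <= y -> (forall z, derivable h z 1) ->
  (forall z, x <= z <= y -> `|derive1 h z| <= B) -> `|h y - h x| <= B * `|y - x|.
Proof.
move=> xy dh hB.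
have [z zI ->] : exists2 z, z \in `[x, y] & h y - h x = derive1 h z * (y - x).
  apply: MVT_segment => // [z _|].
    by rewrite derive1E; exact: derivableP.
  by apply: derivable_within_continuous => z _; exact: dh.
rewrite normrM ler_wpM2r //; apply: hB.
by move: zI; rewrite in_itv.
Qed.

Lemma mvt_le (h : R -> R) (B x y : R) : (forall z, derivable h z 1) ->
  (forall z, `|z - x| <= `|y - x| -> `|derive1 h z| <= B) -> `|h y - h x| <= B * `|y - x|.
Proof.
move=> dh hB; case/orP: (le_total x y) => xy.
  apply: mvt_le0 => // z /andP[z1 z2]; apply: hB.
  by rewrite !ger0_norm; lra.
rewrite distrC (distrC y x); apply: mvt_le0 => // z /andP[z1 z2]; apply: hB.
by rewrite !ler0_norm; lra.
Qed.

Lemma sin_der (z : R) : derivable (sin : R -> R) z 1 /\ derive1 (sin : R -> R) z = cos z.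
Proof. by split; [exact: ex_derive | rewrite derive1E derive_val]. Qed.

Lemma cos_der (z : R) : derivable (cos : R -> R) z 1 /\ derive1 (cos : R -> R) z = - sin z.
Proof. by split; [exact: ex_derive | rewrite derive1E derive_val]. Qed.

Lemma sin_lip (x y : R) : `|sin y - sin x| <= `|y - x|.
Proof.
rewrite -[leRHS]mul1r; apply: mvt_le => [z|z _]; first exact: (sin_der z).1.
by rewrite (sin_der z).2 ler_norml cos_le1 cos_geN1.
Qed.

Lemma cos_lip (x y : R) : `|cos y - cos x| <= `|y - x|.
Proof.
rewrite -[leRHS]mul1r; apply: mvt_le => [z|z _]; first exact: (cos_der z).1.
by rewrite (cos_der z).2 normrN ler_norml sin_le1 sin_geN1.
Qed.

Lemma expi_lip (x y : R) : cabs (expi y - expi x) <= 2 * `|y - x|.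
Proof.
apply: (le_trans (cabs_le_ReIm _)); rewrite cReD cReN cImD cImN /=.
by have := sin_lip x y; have := cos_lip x y; lra.
Qed.

Lemma sin_sub (y : R) : `|sin y - y| <= `|y| ^+ 2.
Proof.
have D (z : R) : is_derive z 1 (fun z : R => sin z - z) (cos z - 1).
  exact: is_deriveB.
have := @mvt_le (fun z => sin z - z) `|y| 0 y; rewrite sin0 !subr0 expr2; apply.
  by move=> z; exact: ex_derive.
move=> z; rewrite !subr0 => zy.
rewrite derive1E derive_val; apply: le_trans zy.
by have := cos_lip 0 z; rewrite cos0 subr0.
Qed.

Lemma cos_sub (y : R) : `|2 - 2 * cos y - y ^+ 2| <= 2 * `|y| ^+ 3.
Proof.
have D (z : R) : is_derive z 1 (fun z : R => 2 - 2 * cos z - z ^+ 2) (2 * (sin z - z)).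
  apply: is_derive_eq; rewrite /GRing.scale /=; ring.
have := @mvt_le (fun z => 2 - 2 * cos z - z ^+ 2) (2 * `|y| ^+ 2) 0 y.
rewrite cos0 !subr0 expr0n /= subr0 mulr1 subrr subr0 -mulrA -exprSr; apply.
  by move=> z; exact: ex_derive.
move=> z; rewrite !subr0 => zy.
rewrite derive1E derive_val normrM ger0_norm // ler_wpM2l //.
by apply: (le_trans (sin_sub z)); rewrite lerXn2r // nnegrE.
Qed.

Lemma cos_sub0 (y : R) : 0 <= 2 - 2 * cos y <= 2 * `|y| ^+ 2.
Proof.
have := cos_le1 y => c1; apply/andP; split; first lra.
have := @mvt_le (fun z => cos z) `|y| 0 y (fun z => (cos_der z).1).
rewrite cos0 !subr0 => H.
have: `|cos y - 1| <= `|y| * `|y|.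
  apply: H => z; rewrite !subr0 (cos_der z).2 normrN => zy.
  by apply: le_trans zy; have := sin_lip 0 z; rewrite sin0 !subr0.
by rewrite -expr2 ler_norml => /andP[]; lra.
Qed.

Lemma wave_packet_lip K L Ck P Phi xi M D x y : 0 < ilen (tI P) -> (0 < K)%N ->
  (forall k, 0 < Ck k) -> @wave_packet R K L Ck P Phi ->
  `|ctr (tw P) - xi| <= M / ilen (tI P) ->
  (forall z, `|z - x| <= `|y - x| -> dk (ilen (tI P)) (z - ctr (tI P)) ^+ L <= D) ->
  cabs (expi (- (2 * pi * xi * y)) * Phi y - expi (- (2 * pi * xi * x)) * Phi x) <=
  (2 * Ck 1 + 16 * M * Ck 0) * D / (ilen (tI P) * Num.sqrt (ilen (tI P))) * `|y - x|.
Proof.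
set r := ilen (tI P) => r0 K0 Ck0 [mP [_ [dP bP]]] xM hD.
set g := fun x => expi (- (2 * pi * ctr (tw P) * x)) * Phi x in dP bP.
have D0 : 0 <= D by apply: le_trans (hD x _); [exact: dkX_ge0 | rewrite subrr normr0].
have M0 : 0 <= M by have := le_trans (normr_ge0 _) xM; rewrite pmulr_lge0 // invr_gt0.
have sr : 0 < Num.sqrt r by rewrite sqrtr_gt0.
have pw0 : r `^ (- (1 / 2) - 0) = (Num.sqrt r)^-1.
  by rewrite subr0 powRN -powR12_sqrt ?(ltW r0) //; congr (_^-1); congr (_ `^ _); lra.
have pw1 : r `^ (- (1 / 2) - 1) = (r * Num.sqrt r)^-1.
  rewrite -opprD powRN powRD ?gt_eqF ?implybT // powRr1 ?(ltW r0) // mulrC.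
  by rewrite -powR12_sqrt ?(ltW r0) //; congr ((_ * _)^-1); congr (_ `^ _); lra.
have b0 z : cabs (g z) <= Ck 0 / Num.sqrt r * dk r (z - ctr (tI P)) ^+ L.
  by have := bP 0%N (leq0n _) z; rewrite pw0.
have b1 z : cabs (derive1 (fun y => Re (g y) : R) z +i* derive1 (fun y => Im (g y) : R) z)%C <=
    Ck 1 / (r * Num.sqrt r) * dk r (z - ctr (tI P)) ^+ L.
  by have := bP 1%N K0 z; rewrite pw1.
have [gr gi] : (forall z, derivable (fun y => Re (g y) : R) z 1) /\
    (forall z, derivable (fun y => Im (g y) : R) z 1).
  by split => z; have [] := dP 0%N K0 z.
have B1 : cabs (g y - g x) <= 2 * (Ck 1 / (r * Num.sqrt r) * D) * `|y - x|.
  have c1 : 0 <= Ck 1%N / (r * Num.sqrt r) by rewrite divr_ge0 ?mulr_ge0 ?ltW.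
  have H z : `|z - x| <= `|y - x| ->
      cabs (derive1 (fun y => Re (g y) : R) z +i* derive1 (fun y => Im (g y) : R) z)%C <=
      Ck 1 / (r * Num.sqrt r) * D.
    by move=> zz; apply: (le_trans (b1 z)); rewrite ler_wpM2l // hD.
  apply: (le_trans (cabs_le_ReIm _)); rewrite cReD cReN cImD cImN -mulrA mulr2n mulrDl mul1r.
  apply: lerD.
    apply: (@mvt_le (fun y => Re (g y))) => // z /H; apply: le_trans.
    exact: (Re_le_cabs (_ +i* _)%C).
  apply: (@mvt_le (fun y => Im (g y))) => // z /H; apply: le_trans.
  exact: (Im_le_cabs (_ +i* _)%C).
have E z : expi (- (2 * pi * xi * z)) * Phi z =
    expi (2 * pi * (ctr (tw P) - xi) * z) * g z.
  rewrite /g mulrA -expiD; congr (expi _ * _); ring.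
rewrite !E; set e := fun z => expi (2 * pi * (ctr (tw P) - xi) * z).
have -> : expi (2 * pi * (ctr (tw P) - xi) * y) * g y -
    expi (2 * pi * (ctr (tw P) - xi) * x) * g x = e y * (g y - g x) + (e y - e x) * g x.
  rewrite -/(e y) -/(e x); ring.
apply: (le_trans (cabsD _ _)); rewrite !(cabsM (e y)) !(cabsM (e y - e x)).
rewrite [cabs (e y)]expi_unit mul1r.
have gx : cabs (g x) <= Ck 0 / Num.sqrt r * D.
  have hx : dk r (x - ctr (tI P)) ^+ L <= D by apply: hD; rewrite subrr normr0.
  apply: (le_trans (b0 x)).
  by rewrite ler_wpM2l // divr_ge0 // ltW.
have ee : cabs (e y - e x) <= 16 * M / r * `|y - x|.
  apply: (le_trans (expi_lip _ _)).
  rewrite -mulrBr normrM mulrA ler_wpM2r // normrM (ger0_norm (_ : 0 <= 2 * pi)); last first.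
    by rewrite mulr_ge0 // pi_ge0.
  rewrite -mulrA; apply: (@le_trans _ _ (2 * (2 * 4 * (M / r)))); last by lra.
  rewrite ler_wpM2l // ; apply: ler_pM => //; first by rewrite mulr_ge0 // pi_ge0.
  by rewrite ler_wpM2l // pi_le4.
apply: (@le_trans _ _ (2 * (Ck 1 / (r * Num.sqrt r) * D) * `|y - x| +
   (16 * M / r * `|y - x|) * (Ck 0 / Num.sqrt r * D))).
  by apply: lerD => //; apply: ler_pM => //; exact: cabs_ge0.
have rn := lt0r_neq0 r0; have sn := lt0r_neq0 sr.
by rewrite le_eqVlt; apply/orP; left; apply/eqP; field; rewrite rn sn.
Qed.

Lemma wave_packet_sup K L Ck P Phi x : 0 < ilen (tI P) -> (forall k, 0 < Ck k) ->
  @wave_packet R K L Ck P Phi -> cabs (Phi x) <= Ck 0 / Num.sqrt (ilen (tI P)).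
Proof.
move=> r0 Ck0 /(wave_packet_packet r0)[_ /(_ x)] h; apply: (le_trans h).
by rewrite ler_piMr ?dkX_le1 // divr_ge0 ?sqrtr_ge0 ?ltW.
Qed.

Lemma wave_packet_intg K L Ck P Phi : 0 < ilen (tI P) -> (2 <= L)%N ->
  @wave_packet R K L Ck P Phi -> intg (fun x => cabs (Phi x)).
Proof.
move=> r0 L2 /(wave_packet_packet r0)[mP h].
apply: intg_le (intgZ (Ck 0 / Num.sqrt (ilen (tI P))) (dk_intg (ctr (tI P)) r0 L2)) _.
  exact: meas_cabs.
by move=> x; rewrite ger0_norm ?cabs_ge0.
Qed.

Lemma ft_mod (f : R -> C) eta xi : ft (fun x => f x * expi (2 * pi * (eta * x))) xi = ft f (xi - eta).
Proof.
apply: eq_cint => x; rewrite -mulrA -expiD; congr (_ * expi _); ring.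
Qed.

Lemma wave_packet_orth_mod K L Ck P P' Phi Phi' eta : 0 < ilen (tI P) -> 0 < ilen (tI P') ->
  (0 < K)%N -> (2 <= L)%N -> (forall k, 0 < Ck k) ->
  @wave_packet R K L Ck P Phi -> @wave_packet R K L Ck P' Phi' ->
  9 / 20 * (ilen (tw P) + ilen (tw P')) + `|eta| <= `|ctr (tw P) - ctr (tw P')| ->
  ip Phi (fun x => Phi' x * expi (2 * pi * (eta * x))) = 0.
Proof.
move=> r0 r0' K0 L2 Ck0 w w' sep.
have me : cmeasurable (fun x => expi (2 * pi * (eta * x))).
  by apply: cmeas_expi; apply: measurable_funM => //; apply: measurable_funM.
have s' := w'.2.1; have s := w.2.1.
apply: (@ip_orth _ Phi _ w.1 (cmeasM w'.1 me) (wave_packet_intg r0 L2 w) _ _ (Ck 0 / Num.sqrt (ilen (tI P)))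
   ((2 * Ck 1 + 16 * (`|ctr (tw P)| * ilen (tI P)) * Ck 0) * 1 /
     (ilen (tI P) * Num.sqrt (ilen (tI P))))).
- have := wave_packet_intg r0' L2 w'; congr intg; apply/funext => x.
  by rewrite cabsM expi_unit mulr1.
- move=> xi; rewrite ft_mod.
  have [/s -> |/contrapT i1] := pselect (~ inI (dil (9 / 10) (tw P)) xi); first by rewrite mul0r.
  have [/s' -> |/contrapT i2] := pselect (~ inI (dil (9 / 10) (tw P')) (xi - eta)).
    by rewrite cJ0 mulr0.
  move: i1 i2; rewrite /inI /dil /= => /andP[i1 i1'] /andP[i2 i2'].
  exfalso; move: sep (ler_norm eta) (ler_norm (- eta)); rewrite normrN => sep e1 e2; move: sep.
  by case: (lerP 0 (ctr (tw P) - ctr (tw P'))) => s0; [rewrite (ger0_norm s0) | rewrite (ltr0_norm s0)]; move: i1 i1' i2 i2' e1 e2; lra.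
- by move=> x; exact: (wave_packet_sup x r0 Ck0 w).
- move=> x y; have := @wave_packet_lip K L Ck P Phi 0 (`|ctr (tw P)| * ilen (tI P)) 1 y x r0 K0 Ck0 w.
  rewrite subr0 mulfK ?gt_eqF // !mulr0 !mul0r oppr0 expi0 !mul1r; apply => // z _.
  exact: dkX_le1.
Qed.

(* The weight [wgt c0 r0 ^ 2] is approached, as [th] tends to 0, by trigonometric
   polynomials of frequency at most [2 th] (replace [y ^ 2] by [(2 - 2 cos (th y)) / th ^ 2]). *)
Lemma weight_orth (F : R -> C) (c0 r0 c1 r1 M eta0 : R) (N : nat) : 0 < r0 -> 0 < r1 -> 0 <= M ->
  0 < eta0 -> (7 <= N)%N -> cmeasurable F ->
  (forall x, cabs (F x) <= M * dk r1 (x - c1) ^+ N) ->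
  (forall eta, `|eta| < eta0 -> cint (fun x => F x * expi (eta * x)) = 0) ->
  cint (fun x => rc (wgt c0 r0 x ^+ 2) * F x) = 0.
Proof.
move=> r00 r10 M0 e0 N7 mF bF hF.
have mexp eta : cmeasurable (fun x => expi (eta * (x - c0))).
  apply: cmeas_expi; apply: measurable_funM => //; exact: measurable_funB.
have N2 : (2 <= N)%N by exact: leq_trans N7.
have cF eta : cintg (fun x => F x * expi (eta * (x - c0))).
  apply: (cintg_le (cmeasM mF (mexp eta)) (intgZ M (dk_intg c1 r10 N2))) => x.
  by rewrite cabsM expi_unit mulr1.
have hF' eta : `|eta| < eta0 -> cint (fun x => F x * expi (eta * (x - c0))) = 0.
  move=> ee; have := cF 0; have c0' : cintg (fun x => F x * expi (eta * x)).
    apply: (cintg_le _ (intgZ M (dk_intg c1 r10 N2))) => [|x].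
      by apply: cmeasM => //; apply: cmeas_expi; exact: measurable_funM.
    by rewrite cabsM expi_unit mulr1.
  move=> _; rewrite (_ : (fun x => _) = (fun x => expi (- (eta * c0)) * (F x * expi (eta * x)))).
    by rewrite cintZ // hF // mulr0.
  apply/funext => x; rewrite [RHS]mulrCA -expiD; congr (_ * expi _); ring.
set p := fun th x => 1 + (2 - 2 * cos (th * (x - c0))) / (th * r0) ^+ 2.
have p0 th : 0 < th -> 2 * th < eta0 -> cint (fun x => rc (p th x ^+ 2) * F x) = 0.
  move=> th0 th1.
  pose k := ((th * r0) ^+ 2)^-1; pose b := 1 + 2 * k.
  pose G eta := fun x => F x * expi (eta * (x - c0)).
  pose z0 := rc b * rc b + 2 * (rc k * rc k); pose z1 := - (2 * (rc b * rc k)).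
  pose z2 := rc k * rc k.
  rewrite (_ : (fun x => _) = (fun x => z0 * G 0 x + (z1 * G th x + (z1 * G (- th) x +
      (z2 * G (2 * th) x + z2 * G (- (2 * th)) x))))); last first.
    apply/funext => x; rewrite /G /p -/k mul0r expi0 mulr1 !(mulNr _ (x - c0)) -(mulrA 2 th).
    set t := th * (x - c0).
    have -> : 2 * t = t + t by ring.
    have Ec : rc (2 * cos t) = expi t + expi (- t) by rewrite expi_cos.
    have E1 : expi t * expi (- t) = 1 by rewrite -expiD subrr expi0.
    have rcN r : rc (- r) = - rc r by apply: complex_ext; rewrite ?cReN ?cImN //= oppr0.
    have Ep : rc ((1 + (2 - 2 * cos t) * k) ^+ 2) = (rc b - (expi t + expi (- t)) * rc k) ^+ 2.
      rewrite -Ec -rcM !expr2.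
      have -> : 1 + (2 - 2 * cos t) * k = b + - (2 * cos t * k) by rewrite /b; ring.
      by set m := 2 * cos t * k; rewrite (rcM (b - m)) (rcD b (- m)) rcN.
    rewrite Ep opprD !expiD /z0 /z1 /z2 expr2.
    set e := expi t in E1 *; set e' := expi (- t) in E1 *.
    move: (rc b) (rc k) (F x) e e' E1 => B k' f e e' E1.
    have -> : (B - (e + e') * k') * (B - (e + e') * k') * f =
      (B * B * f + 2 * (k' * k') * f * (e * e')) +
       (- (2 * (B * k')) * (f * e) + (- (2 * (B * k')) * (f * e') +
         (k' * k' * (f * (e * e)) + k' * k' * (f * (e' * e'))))) by ring.
    rewrite E1; ring.
  have S eta : `|eta| < eta0 -> forall z, cintg (fun x => z * G eta x) /\ cint (fun x => z * G eta x) = 0.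
    by move=> he z; split; [exact/cintgZ/cF | rewrite cintZ ?hF' ?mulr0 //; exact: cF].
  have n0 : `|0 : R| < eta0 by rewrite normr0.
  have n1 : `|th| < eta0 by rewrite gtr0_norm //; lra.
  have n2 : `|2 * th| < eta0 by rewrite gtr0_norm ?mulr_gt0.
  have n1' : `|- th| < eta0 by rewrite normrN.
  have n2' : `|- (2 * th)| < eta0 by rewrite normrN.
  have [S0 S0'] := S _ n0 z0.
  have [S1 S1'] := S _ n1 z1.
  have [S2 S2'] := S _ n1' z1.
  have [S3 S3'] := S _ n2 z2.
  have [S4 S4'] := S _ n2' z2.
  have T3 := cintgD S3 S4; have T2 := cintgD S2 T3; have T1 := cintgD S1 T2.
  by rewrite !cintD // S0' S1' S2' S3' S4' !addr0.
pose B := r1 + `|c1 - c0|.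
have B0 : 0 < B by rewrite ltr_pwDl.
have yB x : `|x - c0| * dk r1 (x - c1) <= B.
  rewrite /dk ler_pdivrMr ?dk_den0 //.
  have -> : B * (1 + `|x - c1| / r1) = B + `|x - c1| + `|c1 - c0| * (`|x - c1| / r1).
    by rewrite /B; field; exact: lt0r_neq0.
  have := norm_tri x c1 c0; rewrite /B.
  have : 0 <= `|c1 - c0| * (`|x - c1| / r1) by rewrite mulr_ge0 // divr_ge0 // ltW.
  lra.
pose W := 1 + (B / r0) ^+ 2.
have wW x : wgt c0 r0 x * dk r1 (x - c1) ^+ 2 <= W.
  rewrite /wgt mulrDl mul1r /W; apply: lerD; first exact: dkX_le1.
  rewrite expr_div_n -real_normK ?num_real // [leRHS]expr_div_n mulrAC -exprMn.
  by rewrite ler_wpM2r ?invr_ge0 ?sqr_ge0 // lerXn2r ?nnegrE ?mulr_ge0 ?dk_ge0 ?(ltW B0).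
pose K := (6 * B ^+ 3 / r0 ^+ 2) * W * M.
have W0 : 0 <= W by rewrite addr_ge0 // sqr_ge0.
have K0 : 0 <= K by rewrite !mulr_ge0 ?invr_ge0 ?exprn_ge0 // ltW.
have mp th : measurable_fun setT (p th).
  apply: measurable_funD => //; apply: measurable_funM => //; apply: measurable_funB => //.
  apply: measurable_funM => //; apply: measurableT_comp.
    exact: continuous_measurable_fun (@continuous_cos R).
  by apply: measurable_funM => //; apply: measurable_funB.
have bnd th : 0 < th -> 2 * th < eta0 -> cabs (cint (fun x => rc (wgt c0 r0 x ^+ 2) * F x)) <=
    2 * (th * (K * (2 * r1))).
  move=> th0 th1.
  have cp : cintg (fun x => rc (p th x ^+ 2) * F x).
    apply: (cintg_le _ (intgZ ((1 + 4 * ((th * r0) ^+ 2)^-1) ^+ 2 * M) (dk_intg c1 r10 N2))) => [|x].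
      apply: cmeasM => //; apply: cmeasR; exact: measurable_funX.
    rewrite cabsM cabs_rc normrX -[leRHS]mulrA.
    apply: ler_pM; [exact: exprn_ge0 | exact: cabs_ge0 | | exact: bF].
    have k4 : 0 <= 4 * ((th * r0) ^+ 2)^-1 by rewrite mulr_ge0 // invr_ge0 sqr_ge0.
    rewrite lerXn2r ?nnegrE ?normr_ge0 ?addr_ge0 //.
    apply: (le_trans (ler_normD _ _)); rewrite normr1 lerD2l normrM.
    rewrite (ger0_norm (_ : 0 <= _^-1)) ?invr_ge0 ?sqr_ge0 //.
    rewrite ler_wpM2r ?invr_ge0 ?sqr_ge0 //.
    by have := cos_le1 (th * (x - c0)); have := cos_geN1 (th * (x - c0)); rewrite ler_norml; lra.
  have hd x : cabs (rc (wgt c0 r0 x ^+ 2 - p th x ^+ 2) * F x) <= th * (K * dk r1 (x - c1) ^+ 2).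
    have [c1' c2'] := andP (cos_sub0 (th * (x - c0))); have c3 := cos_sub (th * (x - c0)).
    set y := x - c0 in c1' c2' c3 *; set q := 2 - 2 * cos (th * y) in c1' c2' c3.
    rewrite cabsM cabs_rc subr_sqr normrM.
    have thr : 0 < (th * r0) ^+ 2 by rewrite exprn_gt0 // mulr_gt0.
    have d1 : `|wgt c0 r0 x - p th x| <= 2 * th * `|y| ^+ 3 / r0 ^+ 2.
      rewrite /wgt /p -/y -/q.
      have -> : 1 + (y / r0) ^+ 2 - (1 + q / (th * r0) ^+ 2) =
         - ((q - (th * y) ^+ 2) / (th * r0) ^+ 2) by field; rewrite ?lt0r_neq0.
      rewrite normrN normrM (ger0_norm (_ : 0 <= _^-1)) ?invr_ge0 ?(ltW thr) //.
      rewrite ler_pdivrMr //; apply: (le_trans c3).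
      rewrite normrM gtr0_norm // le_eqVlt; apply/orP; left; apply/eqP.
      by field; rewrite lt0r_neq0.
    have d2 : `|wgt c0 r0 x + p th x| <= 3 * wgt c0 r0 x.
      have q0 : 0 <= q / (th * r0) ^+ 2 by rewrite divr_ge0 // ltW.
      have q1 : q / (th * r0) ^+ 2 <= 2 * (y / r0) ^+ 2.
        rewrite ler_pdivrMr //; apply: (le_trans c2').
        rewrite real_normK ?num_real // le_eqVlt; apply/orP; left; apply/eqP.
        by field; rewrite lt0r_neq0.
      rewrite /wgt /p -/y -/q.
      by have := sqr_ge0 (y / r0); move: q0 q1 => q0 q1 q3; rewrite ger0_norm; lra.
    set d := dk r1 (x - c1).
    have d0 : 0 <= d by exact: dk_ge0.
    have bF' : cabs (F x) <= M * (d ^+ 3 * d ^+ 2 * d ^+ 2).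
      by rewrite -!exprD; apply: (le_trans (bF x)); rewrite ler_wpM2l // dkX_le.
    apply: (@le_trans _ _ (2 * th * `|y| ^+ 3 / r0 ^+ 2 * (3 * wgt c0 r0 x) *
       (M * (d ^+ 3 * d ^+ 2 * d ^+ 2)))).
      by apply: ler_pM => //; rewrite ?mulr_ge0 ?cabs_ge0 //; apply: ler_pM.
    have -> : 2 * th * `|y| ^+ 3 / r0 ^+ 2 * (3 * wgt c0 r0 x) *
       (M * (d ^+ 3 * d ^+ 2 * d ^+ 2)) = (6 * th / r0 ^+ 2 * M * d ^+ 2) * ((`|y| * d) ^+ 3 *
       (wgt c0 r0 x * d ^+ 2)) by field; rewrite lt0r_neq0.
    have -> : th * (K * d ^+ 2) = (6 * th / r0 ^+ 2 * M * d ^+ 2) * (B ^+ 3 * W).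
      by rewrite /K; field; rewrite lt0r_neq0.
    have yd0 : 0 <= `|y| * d := mulr_ge0 (normr_ge0 _) d0.
    apply: ler_wpM2l.
      apply: mulr_ge0; last exact: exprn_ge0.
      by apply: mulr_ge0 => //; apply: divr_ge0; [lra | exact: sqr_ge0].
    apply: ler_pM; [exact: exprn_ge0 | | | exact: wW].
      by apply: mulr_ge0; [exact/ltW/wgt_gt0 | exact: exprn_ge0].
    by rewrite lerXn2r ?nnegrE // ?(ltW B0) //; exact: yB.
  have mwp : cmeasurable (fun x => rc (wgt c0 r0 x ^+ 2 - p th x ^+ 2) * F x).
    apply: cmeasM => //; apply: cmeasR; apply: measurable_funB.
      exact: measurable_funX (wgt_meas _ _).
    exact: measurable_funX (mp th).
  have ih := intgZ th (intgZ K (dk2_intg c1 r10)).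
  have -> : cint (fun x => rc (wgt c0 r0 x ^+ 2) * F x) =
      cint (fun x => rc (wgt c0 r0 x ^+ 2 - p th x ^+ 2) * F x).
    rewrite -[RHS]addr0 -(p0 th th0 th1) -cintD //; last exact: cintg_le mwp ih hd.
    by apply: eq_cint => x; rewrite -mulrDl -rcD subrK.
  apply: (le_trans (cint_le mwp ih hd)).
  rewrite ler_pM2l // -(dk2_Rint c1 r10).
  rewrite -RintegralZl //; last exact: dk2_intg.
  by rewrite -RintegralZl //; exact/intgZ/dk2_intg.
have [//|nz] := eqVneq (cint (fun x => rc (wgt c0 r0 x ^+ 2) * F x)) 0.
have cz : 0 < cabs (cint (fun x => rc (wgt c0 r0 x ^+ 2) * F x)).
  rewrite lt_neqAle cabs_ge0 andbT eq_sym cabsE; apply: contra nz => /eqP/Normc.eq0_normc -> //.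
set Z := cabs _ in bnd cz.
pose th := Num.min (eta0 / 4) (Z / (8 * (K * r1 + 1))).
have Kr : 0 < K * r1 + 1 by rewrite ltr_wpDl // mulr_ge0 // ltW.
have th0 : 0 < th by rewrite lt_min !divr_gt0 ?mulr_gt0.
have th1 : 2 * th < eta0.
  have : th <= eta0 / 4 by rewrite ge_min lexx.
  lra.
have := bnd th th0 th1.
have : th <= Z / (8 * (K * r1 + 1)) by rewrite ge_min lexx orbT.
by rewrite ler_pdivlMr ?mulr_gt0 // => h1 h2; exfalso; move: h1 h2 th0; lra.
Qed.

Lemma wave_packet_orth_fine K L Ck P P' Phi Phi' : 0 < ilen (tI P) -> 0 < ilen (tI P') ->
  (0 < K)%N -> (2 <= L)%N -> (forall k, 0 < Ck k) ->
  @wave_packet R K L Ck P Phi -> @wave_packet R K L Ck P' Phi' ->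
  9 / 20 * (ilen (tw P) + ilen (tw P')) <= `|ctr (tw P) - ctr (tw P')| -> ip Phi Phi' = 0.
Proof.
move=> l0 l0' K0 L2 Ck0 wp wp' sep.
rewrite -(@wave_packet_orth_mod K L Ck P P' Phi Phi' 0) ?normr0 ?addr0 //.
by apply: eq_cint => x; rewrite mul0r mulr0 expi0 mulr1.
Qed.

Lemma wave_packet_orth K L Ck P P' Phi Phi' c0 r0 : 0 < r0 -> 0 < ilen (tI P) -> 0 < ilen (tI P') ->
  0 < ilen (tw P) -> 0 < ilen (tw P') -> (0 < K)%N -> (7 <= L)%N -> (forall k, 0 < Ck k) ->
  @wave_packet R K L Ck P Phi -> @wave_packet R K L Ck P' Phi' ->
  (ilen (tw P) + ilen (tw P')) / 2 <= `|ctr (tw P) - ctr (tw P')| ->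
  ip Phi Phi' = 0 /\ ip (fun x => rc (wgt c0 r0 x) * Phi x) (fun x => rc (wgt c0 r0 x) * Phi' x) = 0.
Proof.
move=> r00 l0 l0' w0 w0' K0 L7 Ck0 wp wp' sep.
have L2 : (2 <= L)%N by exact: leq_trans L7.
set e0 := (ilen (tw P) + ilen (tw P')) / 20.
have e00 : 0 < e0 by rewrite divr_gt0 // addr_gt0.
have hm eta : `|eta| < e0 -> ip Phi (fun x => Phi' x * expi (2 * pi * (eta * x))) = 0.
  move=> he; apply: (wave_packet_orth_mod l0 l0' K0 L2 Ck0 wp wp').
  by move: he sep; rewrite /e0; lra.
split.
  have := hm 0; rewrite normr0 => /(_ e00); congr (_ = _); apply: eq_cint => x.
  by rewrite mul0r mulr0 expi0 mulr1.
have p0 : 0 < 2 * pi :> R by rewrite mulr_gt0 // pi_gt0.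
have [m b] := wave_packet_packet l0 wp; have [m' b'] := wave_packet_packet l0' wp'.
rewrite -(@weight_orth (fun x => Phi x * (Phi' x)^*) c0 r0 (ctr (tI P)) (ilen (tI P))
   (Ck 0 / Num.sqrt (ilen (tI P)) * (Ck 0 / Num.sqrt (ilen (tI P')))) (2 * pi * e0) L) //.
- apply: eq_cint => x; rewrite cJM rcJ expr2 rcM; ring.
- by rewrite !mulr_ge0 ?invr_ge0 ?sqrtr_ge0 ?ltW.
- exact: mulr_gt0.
- exact/cmeasM/cmeasJ.
- move=> x; rewrite cabsM cabsJ [leRHS]mulrAC; apply: ler_pM; rewrite ?cabs_ge0 //.
  exact: wave_packet_sup wp'.
- move=> eta he; rewrite -(hm (- (eta / (2 * pi)))); last first.
    rewrite normrN normrM (gtr0_norm (_ : 0 < _^-1)) ?invr_gt0 //.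
    by rewrite ltr_pdivrMr // mulrC.
  apply: eq_cint => x; rewrite cJM -expiN mulrA; congr (_ * expi _).
  have pn : pi != 0 :> R := lt0r_neq0 (pi_gt0 R).
  by move: (pi : R) pn => q qn; field.
Qed.

End WavePackets.

(** * Bessel inequality for trees of wave packets *)

Section WaveBessel.
Variable R : realType.
Local Notation mu := (@lebesgue_measure R).
Local Notation C := R[i].
Local Notation Re := complex.Re.

Lemma wgt_inv_dk (c r x : R) : 0 < r -> (wgt c r x)^-1 <= 2 * dk r (x - c) ^+ 2.
Proof.
move=> r0; rewrite /wgt /dk exprVn -[2 * _]mulrC -[leRHS]invrK invrM ?unitfE ?gt_eqF ?invr_gt0 ?exprn_gt0 ?dk_den0 //.
rewrite invrK lef_pV2 ?posrE; last 2 first.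
- by rewrite ltr_pwDl // sqr_ge0.
- by rewrite mulr_gt0 // exprn_gt0 // dk_den0.
rewrite -(real_normK (num_real ((x - c) / r))) normrM (gtr0_norm (_ : 0 < r^-1)) ?invr_gt0 //.
have := sqr_ge0 (`|x - c| / r - 1); nra.
Qed.

Lemma wgt_inv_meas (c r : R) : measurable_fun setT (fun x => (wgt c r x)^-1).
Proof.
apply: continuous_measurable_fun => x; apply: continuousV; last exact: wgt_continuous.
exact/lt0r_neq0/wgt_gt0.
Qed.

Lemma sqi_wgt (c r : R) (f : R -> C) : sqi f -> sqi (fun x => rc (wgt c r x)^-1 * f x).
Proof.
move=> [mf jf]; have m : cmeasurable (fun x => rc (wgt c r x)^-1 * f x).
  by apply: cmeasM => //; apply: cmeasR; exact: wgt_inv_meas.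
split=> //; apply: (intg_le _ jf) => [|x].
  exact: measurable_funX (meas_cabs m).
rewrite ger0_norm ?sqr_ge0 // lerXn2r ?nnegrE ?cabs_ge0 // cabsM cabs_rc.
by rewrite ler_piMl ?cabs_ge0 // ger0_norm ?invr_ge0 ?(ltW (wgt_gt0 _ _ _)) // invf_le1 ?wgt_gt0 // wgt_ge1.
Qed.

Lemma ip_wgt (c r : R) (f g : R -> C) :
  ip (fun x => rc (wgt c r x)^-1 * f x) (fun x => rc (wgt c r x) * g x) = ip f g.
Proof.
apply: eq_cint => x; rewrite cJM rcJ mulrACA -rcM mulVf ?mul1r //.
exact/lt0r_neq0/wgt_gt0.
Qed.

Variable X : finType.
Variable T : X -> tritile R.
Definition qa x := ileft (TI (T x)).
Definition ql x := ilen (TI (T x)).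
Definition qu j x := ctr (tw_of (T x) j).
Local Notation a := qa.
Local Notation l := ql.
Local Notation u := qu.
Hypothesis TS : tilesys a l u.
Local Notation l0 := (ts_gt0 TS).

Lemma tree_forest (Q : {set X}) i j t : j != i ->
  forest a l (u j) [set x in Q | ltt a l u i x t] (fun=> t).
Proof.
move=> ji; split.
- by move=> x _; exact: l0.
- by move=> x; rewrite inE => /andP[_ /ltt_sub].
- move=> x y _ _; exact: (ts_half TS).
- move=> x y; rewrite !inE => /andP[_ hx] /andP[_ hy] _; exact: ltt_same hx hy.
- move=> x y; rewrite !inE => /andP[_ hx] /andP[_ hy] _; exact: (ts_inj TS hx hy).
- by move=> x y _ _; rewrite eqxx.
- move=> x y _ _; exact: (ts_eq TS).
- move=> x y z _ _ _; exact: (ts_grid TS).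
Qed.

Lemma sum_image_cst (U : {set X}) (t : X) : \sum_(y in (fun=> t) @: U) l y <= l t.
Proof.
case: (set_0Vmem U) => [->|[z zU]]; first by rewrite imset0 big_set0; exact: ltW (l0 t).
have -> : (fun=> t) @: U = [set t]%SET.
  by apply/setP => y; rewrite inE; apply/imsetP/eqP => [[z' _ ->]|->]; [|exists z].
by rewrite big_set1.
Qed.

Lemma forest_quad_gen (v : X -> R) (U : {set X}) tau (F : X -> R -> C) (f : R -> C) (w : X -> C)
    (A s t : R) :
  forest a l v U tau -> 0 <= A -> 0 <= s -> sqi f ->
  {in U, forall x, packet A (l x) (cen a l x) 6 (F x)} ->
  {in U &, forall x y, ~~ fmeet l v x y -> ip (F x) (F y) = 0} ->
  {in U, forall x, cabs (w x) <= s * Num.sqrt (l x)} ->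
  2 * t * Re (\sum_(x in U) (w x)^* * ip f (F x)) <= Re (ip f f) + t ^+ 2 *
    (4 * A * A * (8 * (\sum_(x in U) cabs (w x) ^+ 2) +
      512 * s ^+ 2 * \sum_(y in tau @: U) l y)).
Proof.
move=> FU A0 s0 sf pk orth hs.
have sF x : x \in U -> sqi (F x).
  by move=> xU; exact: (packet_sqi (l0 x) A0 (isT : (1 <= 6)%N) (pk _ xU)).
apply: (le_trans (bessel_quad w t sf sF)).
rewrite lerD2l ler_wpM2l ?sqr_ge0 //.
apply: (forest_bessel FU (g := fun x y => cabs (ip (F x) (F y)))).
- by rewrite !mulr_ge0.
- exact: s0.
- by move=> x y xU yU; rewrite -[in RHS]ipJ ?cabsJ //; exact: sF.
- by move=> x y xU yU /orth -> //; rewrite cabs0.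
- move=> x y xU yU le; rewrite cabs_ge0 /= -[in leLHS]ipJ ?cabsJ; try exact: sF.
  apply: (packet_gram (l0 y) le A0 A0) => //; first exact: pk.
  exact: (packet_le (l0 x) A0 (isT : (4 <= 6)%N) (pk _ xU)).
- by move=> x xU; rewrite cabs_ge0 hs.
Qed.

Lemma sum_cabs_sqr (U : {set X}) (w : X -> C) :
  \sum_(x in U) cabs (w x) ^+ 2 = Re (\sum_(x in U) (w x)^* * w x).
Proof. by rewrite cRe_sum; apply: eq_bigr => x _; rewrite cabs_sqr cReM cReJ cImJ; ring. Qed.

Lemma forest_quad (v : X -> R) (U : {set X}) tau (F : X -> R -> C) (f : R -> C) (A s t : R) :
  forest a l v U tau -> 0 <= A -> 0 <= s -> sqi f ->
  {in U, forall x, packet A (l x) (cen a l x) 6 (F x)} ->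
  {in U &, forall x y, ~~ fmeet l v x y -> ip (F x) (F y) = 0} ->
  {in U, forall x, cabs (ip f (F x)) <= s * Num.sqrt (l x)} ->
  2 * t * (\sum_(x in U) cabs (ip f (F x)) ^+ 2) <= Re (ip f f) + t ^+ 2 *
    (4 * A * A * (8 * (\sum_(x in U) cabs (ip f (F x)) ^+ 2) +
      512 * s ^+ 2 * \sum_(y in tau @: U) l y)).
Proof.
move=> FU A0 s0 sf pk orth hs; rewrite [in leLHS]sum_cabs_sqr.
exact: (forest_quad_gen t FU).
Qed.

Variables (K L : nat) (Ck : nat -> R) (Phi : X -> 'I_3 -> R -> C).
Hypotheses (K0 : (0 < K)%N) (L8 : (10 <= L)%N) (Ck0 : forall k, 0 < Ck k).
Hypothesis lw : forall x j, ilen (tw_of (T x) j) = (l x)^-1.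
Hypothesis wp : forall x j, wave_packet K L Ck (tcomp (T x) j) (Phi x j).

Lemma Phi_packet x j N : (N <= 10)%N -> packet (Ck 0%N) (l x) (cen a l x) N (Phi x j).
Proof.
move=> N10; apply: (packet_le (l0 x) (ltW (Ck0 0%N)) (leq_trans N10 L8)).
exact: (wave_packet_packet (P := tcomp (T x) j) (l0 x) (wp x j)).
Qed.

Lemma Phi_sqi x j : sqi (Phi x j).
Proof. exact: (packet_sqi (l0 x) (ltW (Ck0 0%N)) (isT : (1 <= 6)%N) (Phi_packet x j _)). Qed.

Lemma Phi_orth (c r : R) j x y : 0 < r -> ~~ fmeet l (u j) x y -> ip (Phi x j) (Phi y j) = 0 /\
  ip (fun z => rc (wgt c r z) * Phi x j z) (fun z => rc (wgt c r z) * Phi y j z) = 0.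
Proof.
move=> r0; rewrite -leNgt => h.
have i0 z : 0 < (l z)^-1 by rewrite invr_gt0; exact: l0.
apply: (wave_packet_orth c (P := tcomp (T x) j) (P' := tcomp (T y) j) r0 (l0 x) (l0 y) _ _ K0
  (leq_trans (isT : (7 <= 10)%N) L8) Ck0) => //=.
- by rewrite lw.
- by rewrite lw.

- by rewrite !lw.
Qed.

Definition bes := 4 * (10 * Ck 0%N) * (10 * Ck 0%N).

Lemma bes_gt0 : 0 < bes. Proof. by rewrite !mulr_gt0. Qed.

Lemma forest_quad_wgt j (U : {set X}) tau (f : R -> C) (c r s t : R) :
  forest a l (u j) U tau -> 0 < r -> 0 <= s -> sqi f ->
  {in U, forall x, l x <= r /\ `|cen a l x - c| <= 3 * r} ->
  {in U, forall x, cabs (ip f (Phi x j)) <= s * Num.sqrt (l x)} ->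
  2 * t * (\sum_(x in U) cabs (ip f (Phi x j)) ^+ 2) <=
    Rintegral mu setT (fun x => (cabs (f x) / wgt c r x) ^+ 2) + t ^+ 2 *
    (bes * (8 * (\sum_(x in U) cabs (ip f (Phi x j)) ^+ 2) +
      512 * s ^+ 2 * \sum_(y in tau @: U) l y)).
Proof.
move=> FU r0 s0 sf hU hs.
have := @forest_quad (u j) U tau (fun x z => rc (wgt c r z) * Phi x j z)
  (fun z => rc (wgt c r z)^-1 * f z) (10 * Ck 0%N) s t FU _ s0 (sqi_wgt c r sf).
under eq_bigr do rewrite ip_wgt.
rewrite ip_norm; under [X in Rintegral _ _ X]eq_fun => x.
  rewrite cabsM cabs_rc ger0_norm ?invr_ge0 ?(ltW (wgt_gt0 _ _ _)) // mulrC.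
  over.
apply.
- by rewrite mulr_ge0 // ltW.
- move=> x xU; have [h1 h2] := hU x xU.
  by apply: (packet_wgt (ltW (Ck0 0%N)) (l0 x) h1 h2); exact: Phi_packet.
- by move=> x y xU yU nm; exact: (Phi_orth c r0 nm).2.
- by move=> x xU; rewrite ip_wgt; exact: hs.
Qed.

Lemma tree_bessel i j (Q : {set X}) t (f : R -> C) (s N : R) : j != i -> 0 <= s -> sqi f ->
  {in Q, forall x, ltt a l u i x t -> cabs (ip f (Phi x j)) <= s * Num.sqrt (l x)} ->
  Rintegral mu setT (fun x => (cabs (f x) / wgt (cen a l t) (l t) x) ^+ 2) <= N ->
  \sum_(x in Q | ltt a l u i x t) cabs (ip f (Phi x j)) ^+ 2 <= 8 * bes * N + 64 * s ^+ 2 * l t.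
Proof.
move=> ji s0 sf hs hN.
have FU := tree_forest Q t ji; set U := [set x in Q | _] in FU.
have -> : \sum_(x in Q | ltt a l u i x t) cabs (ip f (Phi x j)) ^+ 2 =
    \sum_(x in U) cabs (ip f (Phi x j)) ^+ 2.
  by apply: eq_bigl => x; rewrite inE.
have b0 := bes_gt0.
have := @forest_quad_wgt j U _ f (cen a l t) (l t) s (8 * bes)^-1 FU (l0 t) s0 sf.
have c1 : {in U, forall x, l x <= l t /\ `|cen a l x - cen a l t| <= 3 * l t}.
  move=> x; rewrite inE => /andP[_ h]; have := ltt_sub h; rewrite /isub => /andP[h1 h2].
  have := ltt_len h; have := l0 x; have := l0 t => p1 p2 p3; split; first exact: ltW.
  by rewrite /cen ler_norml; apply/andP; split; lra.
move=> /(_ c1); have c2 : {in U, forall x, cabs (ip f (Phi x j)) <= s * Num.sqrt (l x)}.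
  by move=> x; rewrite inE => /andP[h1 h2]; exact: hs.
move=> /(_ c2).
have := sum_image_cst U t; move: hN.
move: (\sum_(y in _ @: U) _) (\sum_(x in U) _) (Rintegral _ _ _) => M B I hN hM hB.
have s2 : 0 <= s ^+ 2 by exact: sqr_ge0.
have {hB} : 2 / (8 * bes) * B <= N + (8 * bes)^-1 ^+ 2 * (bes * (8 * B + 512 * s ^+ 2 * l t)).
  apply: (le_trans hB); apply: lerD => //; rewrite ler_wpM2l ?sqr_ge0 // ler_pM2l // lerD2l.
  by apply: ler_wpM2l; [lra | exact: hM].
rewrite -(ler_pM2l (_ : 0 < 8 * bes)) ?mulr_gt0 // mulrDr.
have -> : 8 * bes * (2 / (8 * bes) * B) = 2 * B by field; rewrite lt0r_neq0.
have -> : 8 * bes * ((8 * bes)^-1 ^+ 2 * (bes * (8 * B + 512 * s ^+ 2 * l t))) =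
  B + 64 * s ^+ 2 * l t by field; rewrite lt0r_neq0.
lra.
Qed.

Lemma forest_tops_le j (U : {set X}) tau (f : R -> C) (s N : R) : 0 < s ->
  (forall t, 2 * t * (\sum_(x in U) cabs (ip f (Phi x j)) ^+ 2) <= N + t ^+ 2 *
    (bes * (8 * (\sum_(x in U) cabs (ip f (Phi x j)) ^+ 2) +
      512 * s ^+ 2 * \sum_(y in tau @: U) l y))) ->
  {in tau @: U, forall t, s ^+ 2 / 8 * l t <=
    \sum_(x in U | tau x == t) cabs (ip f (Phi x j)) ^+ 2} ->
  \sum_(t in tau @: U) l t <= 64 * 513 * bes * N / s ^+ 2.
Proof.
move=> s0 q ht; have b0 := bes_gt0.
have hB : s ^+ 2 / 8 * \sum_(t in tau @: U) l t <= \sum_(x in U) cabs (ip f (Phi x j)) ^+ 2.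
  rewrite [leRHS](partition_big_imset tau) /= mulr_sumr; apply: ler_sum => t tU.
  exact: ht.
have {q} := q (8 * 513 * bes)^-1; move: hB.
move: (\sum_(t in _ @: U) _) (\sum_(x in U) _) => M B hB.
have s2 : 0 < s ^+ 2 by exact: exprn_gt0.
move=> q.
have {q} : 2 * (8 * 513 * bes)^-1 * B <= N + (8 * 513 * bes)^-1 ^+ 2 * (bes * (8 * 513 * B)).
  apply: (le_trans q); rewrite lerD2l ler_wpM2l ?sqr_ge0 // ler_pM2l //.
  move: hB; set z := s ^+ 2; lra.
have -> : (8 * 513 * bes)^-1 ^+ 2 * (bes * (8 * 513 * B)) = (8 * 513 * bes)^-1 * B.
  by field; rewrite lt0r_neq0.
move=> q; have {q} : B <= 8 * 513 * bes * N.
  have c0 : 0 < 8 * 513 * bes by lra.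
  rewrite -ler_pdivrMl //; move: q; set z := _^-1 * B.
  rewrite -mulrA -/z; lra.
move=> q; rewrite ler_pdivlMr //; move: hB q; set z := s ^+ 2; lra.
Qed.

Lemma forest_quad_flat j (U : {set X}) tau (f : R -> C) (s t : R) :
  forest a l (u j) U tau -> 0 <= s -> sqi f ->
  {in U, forall x, cabs (ip f (Phi x j)) <= s * Num.sqrt (l x)} ->
  2 * t * (\sum_(x in U) cabs (ip f (Phi x j)) ^+ 2) <=
    Rintegral mu setT (fun x => cabs (f x) ^+ 2) + t ^+ 2 *
    (bes * (8 * (\sum_(x in U) cabs (ip f (Phi x j)) ^+ 2) +
      512 * s ^+ 2 * \sum_(y in tau @: U) l y)).
Proof.
move=> FU s0 sf hs; rewrite -ip_norm.
apply: (forest_quad (F := fun x => Phi x j) t FU) => //.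
- by rewrite mulr_ge0 // ltW.
- move=> x _; have [m b] := Phi_packet x j (isT : (6 <= 10)%N); split=> // z.
  apply: (le_trans (b z)); apply: ler_wpM2r; first exact: dkX_ge0 (l0 x).
  apply: ler_wpM2r; first by rewrite invr_ge0 sqrtr_ge0.
  by have := Ck0 0%N; lra.
- move=> x y _ _ nm; exact: (Phi_orth 0 ltr01 nm).1.
Qed.
End WaveBessel.

(** * Averages of a discrete measure *)

Section Covering.
Variable R : realType.

Lemma vitali_cover (I : finType) (S : {set I}) (z r : I -> R) : {in S, forall x, 0 < r x} ->
  exists kap : I -> I,
  {in S, forall x, [/\ kap x \in S, r x <= r (kap x) & `|z x - z (kap x)| <= 2 * r (kap x)]} /\
  {in kap @: S &, forall x y, x != y -> r x + r y < `|z x - z y|}.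
Proof.
have [n] := ubnP #|S|; elim: n S => // n IH S hn r0.
have [->|[x1 x1S]] := set_0Vmem S.
  by exists id; split=> [x|x y]; rewrite ?imset0 inE.
pose x0 := [arg max_(x > x1 in S) r x]%O.
have [x0S x0max] : x0 \in S /\ {in S, forall y, r y <= r x0}.
  by rewrite /x0; case: Order.TotalTheory.arg_maxP => // x xS h; split.
pose S' := [set y in S | r x0 + r y < `|z x0 - z y|].
have S'S : S' \subset S by apply/fintype.subsetP => y; rewrite inE => /andP[].
have cS' : (#|S'| < #|S|)%N.
  apply: proper_card; rewrite properE S'S /=; apply/fintype.subsetPn; exists x0 => //.
  by rewrite inE x0S subrr normr0 -leNgt; have := r0 _ x0S; lra.
have [||kap [k1 k2]] := IH S'; first by rewrite -ltnS; exact: leq_trans cS' _.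
  by move=> x /(fintype.subsetP S'S); exact: r0.
exists (fun y => if y \in S' then kap y else x0); split.
  move=> x xS; case: ifPn => xS'.
    by have [h1 h2 h3] := k1 _ xS'; split=> //; exact: (fintype.subsetP S'S).
  split=> //; first exact: x0max.
  move: xS'; rewrite inE xS /= -leNgt distrC => h.
  by apply: (le_trans h); have := x0max _ xS; lra.
have im y : y \in (fun y => if y \in S' then kap y else x0) @: S ->
    y = x0 \/ (y \in kap @: S' /\ y \in S').
  case/imsetP => w wS ->; case: ifPn => wS'; [right|by left].
  by split; [exact: imset_f | have [] := k1 _ wS'].
move=> x y /im[-> | [xi xS]] /im[-> | [yi yS]]; rewrite ?eqxx //.
- by move=> _; move: yS; rewrite inE => /andP[].
- by move=> _; move: xS; rewrite inE => /andP[_]; rewrite distrC addrC.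
- exact: k2.
Qed.

Variables (Y : finType) (S : {set Y}) (c m : Y -> R).
Hypothesis m0 : forall y, 0 <= m y.

Definition mass (z r : R) := \sum_(y in S | `|c y - z| <= r) m y.
Definition lev (d z r : R) := forall k : nat, mass z (2 ^+ k * r) <= d * (2 ^+ k * r).

Lemma dyadic_radius (r A : R) : 0 < r -> exists k : nat, A <= 2 ^+ k * r.
Proof.
move=> r0; exists (Num.Def.archi_bound (A / r)).
by rewrite -ler_pdivrMr //; exact/ltW/(upper_nthrootP (leqnn _)).
Qed.

Lemma lev_ball d z r z' r' : 0 < r -> 0 <= d -> lev d z r -> r <= r' -> `|z' - z| <= r' ->
  mass z' r' <= 4 * d * r'.
Proof.
move=> r0 d0 h rr zz.
have [k hk kmin] := ex_minnP (dyadic_radius (2 * r') r0).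
apply: (@le_trans _ _ (mass z (2 ^+ k * r))).
  rewrite /mass big_mkcondr [leRHS]big_mkcondr /=; apply: ler_sum => y yS.
  case: ifPn => yz; last by case: ifP.
  by rewrite ifT //; have := norm_tri (c y) z' z; lra.
apply: (le_trans (h k)).
case: k hk kmin {zz} => [|k] hk kmin; first by rewrite expr0 mul1r in hk *; nra.
have : 2 ^+ k * r < 2 * r'.
  by rewrite ltNge; apply/negP => /kmin; rewrite ltnn.
rewrite exprS => hk'; have := ler_wpM2l d0 (ltW hk'); lra.
Qed.

Lemma geo_half (n : nat) : \sum_(k < n) (2 : R) ^- k <= 2.
Proof.
suff -> : \sum_(k < n) (2 : R) ^- k = 2 - 2 * 2 ^- n.
  have : 0 < (2 : R) ^- n by rewrite invr_gt0 exprn_gt0.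
  lra.
elim: n => [|n IH]; first by rewrite big_ord0 expr0 invr1; ring.
have n0 : (2 : R) ^+ n != 0 by rewrite expf_neq0.
by rewrite big_ord_recr /= IH exprS; field.
Qed.

Lemma lev_dk d z r : 0 < r -> 0 <= d -> lev d z r ->
  \sum_(y in S) m y * dk r (c y - z) ^+ 2 <= 8 * d * r.
Proof.
move=> r0 d0 h.
have [n hn] := dyadic_radius (\sum_(y in S) `|c y - z|) r0.
have pt y : y \in S -> dk r (c y - z) ^+ 2 <=
    \sum_(k < n.+1) 4 * (4 ^- k * (`|c y - z| <= 2 ^+ k * r)%R%:R).
  move=> yS.
  have yn : `|c y - z| <= 2 ^+ n * r.
    apply: le_trans hn; rewrite (bigD1 y) //= lerDl; exact: sumr_ge0.
  have [k hk kmin] := ex_minnP (ex_intro (fun k => `|c y - z| <= 2 ^+ k * r) n yn).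
  have kn : (k < n.+1)%N by exact: kmin.
  have p0 (j : nat) : 0 <= (4 : R) ^- j by rewrite invr_ge0 exprn_ge0.
  rewrite (bigD1 (Ordinal kn)) //= hk mulr1; apply: ler_wpDr.
    by apply: sumr_ge0 => j _; rewrite !mulr_ge0.
  case: k hk kmin {kn} => [|k] hk kmin.
    by rewrite expr0 invr1 mulr1; apply: (le_trans (dkX_le1 _ _ r0)); lra.
  have yk : 2 ^+ k * r <= `|c y - z|.
    by rewrite leNgt; apply/negP => /ltW /kmin; rewrite ltnn.
  have k0 : 0 < (2 : R) ^+ k by exact: exprn_gt0.
  have := dk_small r0 (mulr_gt0 k0 r0) yk.
  have -> : r / (2 ^+ k * r) = 2 ^- k by field; rewrite !lt0r_neq0.
  move=> dkk; have -> : 4 * 4 ^- k.+1 = ((2 : R) ^- k) ^+ 2.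
    have -> : (4 : R) = 2 ^+ 2 by ring.
    rewrite -!exprM exprVn -exprM mulnC mulSn addnC exprD; field.
    by rewrite !expf_neq0.
  by rewrite lerXn2r ?nnegrE ?dk_ge0 // invr_ge0 ltW.
apply: (@le_trans _ _ (\sum_(k < n.+1) 4 * (4 ^- k * mass z (2 ^+ k * r)))).
  apply: (@le_trans _ _ (\sum_(y in S) \sum_(k < n.+1)
      4 * (4 ^- k * (m y * (`|c y - z| <= 2 ^+ k * r)%R%:R)))).
    apply: ler_sum => y yS; apply: (le_trans (ler_wpM2l (m0 y) (pt y yS))).
    rewrite mulr_sumr le_eqVlt; apply/orP; left; apply/eqP; apply: eq_bigr => k _; ring.
  rewrite exchange_big /=; apply: ler_sum => k _.
  rewrite -mulr_sumr -mulr_sumr /mass big_mkcondr /=.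
  apply: ler_wpM2l; first lra.
  apply: ler_wpM2l; first by rewrite invr_ge0 exprn_ge0 // ler0n.
  by apply: ler_sum => y yS; case: ifP => _; rewrite ?mulr1 ?mulr0.
apply: (@le_trans _ _ (\sum_(k < n.+1) (4 * d * r) * 2 ^- k)).
  apply: ler_sum => k _; have k0 : 0 < (2 : R) ^+ k by exact: exprn_gt0.
  have k4 : 0 <= 4 * (4 : R) ^- k by rewrite mulr_ge0 ?invr_ge0 ?exprn_ge0 ?ler0n.
  have := ler_wpM2l k4 (h k); rewrite -[leLHS]mulrA => /le_trans; apply.
  have -> : (4 : R) ^- k = 2 ^- k * 2 ^- k.
    by rewrite -invfM -exprMn; congr (_ ^-1 ); congr (_ ^+ _); ring.
  rewrite le_eqVlt; apply/orP; left; apply/eqP; field; exact: lt0r_neq0.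
rewrite -mulr_sumr; have := geo_half n.+1.
have : 0 <= 4 * d * r by rewrite !mulr_ge0 // ltW.
move: (\sum_(k < _) _) => g p q; have := ler_wpM2l p q; lra.
Qed.

Lemma level_function (I : finType) (z r : I -> R) : (forall x, 0 < r x) -> 0 < \sum_(y in S) m y ->
  exists dl : I -> nat, forall x,
   (dl x = 0%N \/ lev (2 ^- dl x) (z x) (r x)) /\ ~ lev (2 ^- (dl x).+1) (z x) (r x).
Proof.
move=> r0 M0; suff H x : exists d : nat, (d = 0%N \/ lev (2 ^- d) (z x) (r x)) /\
    ~ lev (2 ^- d.+1) (z x) (r x).
  have [dl hdl] := choice H; by exists dl.
have [k hk] := dyadic_radius (\sum_(y in S) `|c y - z x|) (r0 x).
have [n hn] := dyadic_radius (2 ^+ k * r x) M0.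
have mk : mass (z x) (2 ^+ k * r x) = \sum_(y in S) m y.
  rewrite /mass big_mkcondr /=; apply: eq_bigr => y yS; rewrite ifT //.
  apply: le_trans hk; rewrite (bigD1 y) //= lerDl; exact: sumr_ge0.
have ex : exists d : nat, `[< ~ lev (2 ^- d.+1) (z x) (r x) >].
  exists n; apply/asboolP => /(_ k); rewrite mk leNgt => /negP; apply.
  have n0 : 0 < (2 : R) ^+ n by exact: exprn_gt0.
  rewrite exprS invfM -mulrA -(ltr_pM2l n0).
  have -> : 2 ^+ n * (2^-1 * (2 ^- n * (2 ^+ k * r x))) = 2^-1 * (2 ^+ k * r x).
    by field; exact: lt0r_neq0.
  apply: lt_le_trans hn; have : 0 < 2 ^+ k * r x by rewrite mulr_gt0 // exprn_gt0.
  lra.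
have [d /asboolP hd dmin] := ex_minnP ex.
exists d; split=> //; case: d hd dmin => [|d] hd dmin; [by left | right].
apply: contrapT => hl; have : (d.+1 <= d)%N by apply: dmin; exact/asboolP.
by rewrite ltnn.
Qed.

Lemma level_cover (I : finType) (D : {set I}) (z r : I -> R) (d : nat) :
  {in D, forall x, 0 < r x /\ ~ lev (2 ^- d.+1) (z x) (r x)} ->
  exists (rho : I -> R) (kap : I -> I),
  {in D, forall x, [/\ kap x \in D, r x <= rho (kap x) & `|z x - z (kap x)| <= 2 * rho (kap x)]} /\
  \sum_(y in kap @: D) rho y <= 2 ^+ d.+1 * \sum_(y in S) m y.
Proof.
move=> hD.
have H x : exists k : nat, x \in D -> 2 ^- d.+1 * (2 ^+ k * r x) < mass (z x) (2 ^+ k * r x).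
  have [xD|xD] := boolP (x \in D); last by exists 0%N.
  have [_ /existsNP[k /negP]] := hD x xD; rewrite -ltNge => h.
  by exists k.
have {H} [k hk] := choice H.
pose rho x := 2 ^+ k x * r x.
have rho0 x : x \in D -> 0 < rho x.
  by move=> xD; rewrite mulr_gt0 ?exprn_gt0 //; have [] := hD x xD.
have [kap [h1 h2]] := @vitali_cover I D z rho rho0.
exists rho, kap; split.
  move=> x xD; have [a1 a2 a3] := h1 x xD; split=> //; apply: le_trans a2.
  by rewrite ler_peMl ?exprn_ege1 ?(ltW (hD x xD).1) // ler1n.
have kD y : y \in kap @: D -> y \in D by case/imsetP => x xD ->; have [] := h1 x xD.
apply: (@le_trans _ _ (\sum_(x in kap @: D) 2 ^+ d.+1 * mass (z x) (rho x))).
  apply: ler_sum => x /kD xD; rewrite -ler_pdivrMl ?exprn_gt0 //.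
  exact/ltW/hk.
rewrite -mulr_sumr ler_wpM2l ?exprn_ge0 // /mass.
rewrite (exchange_big_dep (fun y => y \in S)) //=; last by move=> x y _ /andP[].
apply: ler_sum => y yS.
have [x /andP[xK xy]|none] := pickP (fun x => (x \in kap @: D) && (`|c y - z x| <= rho x)).
  rewrite (bigD1 x) /=; last by rewrite xK yS.
  rewrite big1 ?addr0 // => x' /andP[/andP[x'K /andP[_ x'y]] xx'].
  have := h2 _ _ x'K xK xx'; have := norm_tri (z x') (c y) (z x).
  by move: xy x'y; rewrite (distrC (c y) (z x')) => h h' h3 h4; exfalso; lra.
by rewrite big1 // => x /andP[xK /andP[_ xy]]; have := none x; rewrite xK xy.
Qed.

Lemma sum_len_disj (I : finType) (D : {set I}) (a l : I -> R) (A B : R) : A <= B ->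
  {in D &, forall x y, x != y -> itv_disj a l x y} ->
  {in D, forall x, [/\ 0 < l x, A <= a x & a x + l x <= B]} -> \sum_(x in D) l x <= B - A.
Proof.
move=> AB dj hD.
have := @sum_incr_disj R I (fun t => Num.min t B) a l B D _ _ _ dj A.
have -> : \sum_(x in D) (Num.min (a x + l x) B - Num.min (a x) B) = \sum_(x in D) l x.
  apply: eq_bigr => x xD; have [lx ax bx] := hD x xD.
  by rewrite !min_l // ?(addrC (a x)) ?addrK //; lra.
rewrite (min_l AB); apply.
- by move=> x y xy; rewrite le_min ge_min xy /= ge_min lexx orbT.
- by move=> x; rewrite ge_min lexx orbT.
- by move=> x /hD[].
- exact: AB.
- by move=> x /hD[].
Qed.

Lemma level_len (I : finType) (D : {set I}) (a l : I -> R) (d : nat) :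
  {in D &, forall x y, x != y -> itv_disj a l x y} ->
  {in D, forall x, 0 < l x /\ ~ lev (2 ^- d.+1) (cen a l x) (l x)} ->
  \sum_(x in D) l x <= 10 * 2 ^+ d * \sum_(y in S) m y.
Proof.
move=> dj hD; have [rho [kap [h1 h2]]] := level_cover hD.
rewrite (partition_big_imset kap) /=.
apply: (@le_trans _ _ (\sum_(y in kap @: D) 5 * rho y)).
  apply: ler_sum => y /imsetP[w wD yw].
  have ry : 0 < rho y.
    by rewrite yw; have [_ h _] := h1 w wD; apply: lt_le_trans h; have [] := hD w wD.
  have -> : 5 * rho y = (cen a l y + 5 / 2 * rho y) - (cen a l y - 5 / 2 * rho y) by field.
  have -> : \sum_(x in D | kap x == y) l x = \sum_(x in [set x in D | kap x == y]) l x.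
    by apply: eq_bigl => x; rewrite inE.
  apply: sum_len_disj; first lra.
    by move=> x x'; rewrite !inE => /andP[xD _] /andP[x'D _]; exact: dj.
  move=> x; rewrite inE => /andP[xD /eqP kx].
  have [_ b1 b2] := h1 x xD; rewrite kx in b1 b2; have [lx _] := hD x xD.
  by move: b2; rewrite ler_norml /cen => /andP[]; split; lra.
by rewrite -mulr_sumr; move: h2; rewrite exprS; lra.
Qed.

(* The weak type (1,1) estimate is applied at every dyadic level of [A]. *)
Lemma avg_sqr (I : finType) (D : {set I}) (a l : I -> R) (A : I -> R) :
  {in D &, forall x y, x != y -> itv_disj a l x y} -> (forall x, 0 < l x) ->
  {in D, forall x, 0 <= A x /\ A x * l x <= \sum_(y in S) m y * dk (l x) (c y - cen a l x) ^+ 2} ->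
  {in D, forall x, A x <= 8} ->
  \sum_(x in D) l x * A x ^+ 2 <= 8 * 160 * \sum_(y in S) m y.
Proof.
move=> dj l0 hA A8.
have M0 : 0 <= \sum_(y in S) m y by exact: sumr_ge0.
have [Mz|Mn] := eqVneq (\sum_(y in S) m y) 0.
  rewrite Mz mulr0 big1 // => x xD; have [h1 h2] := hA x xD.
  suff -> : A x = 0 by rewrite expr0n mulr0.
  apply/eqP; rewrite eq_le h1 andbT -(pmulr_lle0 _ (l0 x)); apply: (le_trans h2).
  rewrite -[leRHS]Mz; apply: ler_sum => y _; rewrite ler_piMr //; exact: dkX_le1.
have {Mn} Mp : 0 < \sum_(y in S) m y by rewrite lt_neqAle eq_sym Mn.
have [dl hdl] := level_function (cen a l) l0 Mp.
have hx x : x \in D -> l x * A x ^+ 2 <= 64 * (l x * 4 ^- dl x).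
  move=> xD; have [h1 h2] := hA x xD.
  have : A x <= 8 * 2 ^- dl x.
    have [[-> | h] _] := hdl x; first by rewrite expr0 invr1 mulr1; exact: A8.
    rewrite -(ler_pM2r (l0 x)); apply: (le_trans h2).
    by apply: (lev_dk (l0 x) _ h); rewrite invr_ge0 exprn_ge0 // ler0n.
  move=> h; have : A x ^+ 2 <= (8 * 2 ^- dl x) ^+ 2.
    by rewrite lerXn2r ?nnegrE // (le_trans h1 h).
  have -> : (8 * (2 : R) ^- dl x) ^+ 2 = 64 * 4 ^- dl x.
    have -> : (4 : R) = 2 * 2 by ring.
    by rewrite [in RHS]exprMn; field; rewrite expf_neq0.
  by move=> h'; have := ler_wpM2l (ltW (l0 x)) h'; lra.
pose n := (\max_(x in D) dl x).+1.
have E x : x \in D -> l x * 4 ^- dl x = \sum_(d < n) 4 ^- d * (if dl x == d then l x else 0).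
  move=> xD; have xn : (dl x < n)%N by rewrite ltnS; exact: leq_bigmax_cond.
  rewrite (bigD1 (Ordinal xn)) //= eqxx big1 ?addr0 ?(mulrC (l x)) // => d dx.
  by rewrite ifN ?mulr0 //; apply: contra dx => /eqP e; apply/eqP/val_inj.
apply: (le_trans (ler_sum _ hx)); rewrite -mulr_sumr (eq_bigr _ E) exchange_big /=.
have : \sum_(d < n) \sum_(x in D) 4 ^- d * (if dl x == d then l x else 0) <=
    \sum_(d < n) (10 * \sum_(y in S) m y) * 2 ^- d.
  apply: ler_sum => d _; rewrite -mulr_sumr -big_mkcondr /=.
  have -> : \sum_(x in D | dl x == d) l x = \sum_(x in [set x in D | dl x == d]) l x.
    by apply: eq_bigl => x; rewrite inE.
  have := @level_len I [set x in D | dl x == d] a l d.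
  have -> : (10 * \sum_(y in S) m y) * 2 ^- d = (4 : R) ^- d * (10 * 2 ^+ d * \sum_(y in S) m y).
    have -> : (4 : R) = 2 * 2 by ring.
    by rewrite exprMn; field; rewrite expf_neq0.
  move=> h; rewrite ler_wpM2l ?invr_ge0 ?exprn_ge0 //; apply: h.
    by move=> x y; rewrite !inE => /andP[xD _] /andP[yD _]; exact: dj.
  by move=> x; rewrite inE => /andP[xD /eqP <-]; split=> //; have [] := hdl x.
rewrite -mulr_sumr; have := geo_half n; move: (\sum_(k < n) _) (\sum_(d < n) _) => g s g2 sg.
have := ler_wpM2l (ltW Mp) g2; lra.
Qed.
End Covering.

(** * Model data *)

Section GramNorm.
Variable R : realType.
Local Notation mu := (@lebesgue_measure R).
Local Notation C := R[i].
Local Notation Re := complex.Re.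

Lemma gram_norm (Y : finType) (S : {set Y}) (z : Y -> C) (F : Y -> R -> C) :
  (forall y, y \in S -> sqi (F y)) ->
  Re (ip (fun x => \sum_(y in S) z y * F y x) (fun x => \sum_(y in S) z y * F y x)) <=
  \sum_(y in S) \sum_(y' in S) cabs (z y) * cabs (z y') * cabs (ip (F y) (F y')).
Proof.
move=> sF; have sH : sqi (fun x => \sum_(y in S) z y * F y x).
  by apply: sqi_sum => y yS; exact/sqiZ/sF.
rewrite ip_suml //; apply: (le_trans (ler_norm _)); apply: (le_trans (Re_le_cabs _)).
apply: (le_trans (cabs_sum _ _ _)); apply: ler_sum => y yS.
rewrite ip_sumr ?cabsM //; last exact: sF.
have -> : \sum_(y' in S) cabs (z y) * cabs (z y') * cabs (ip (F y) (F y')) =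
    cabs (z y) * \sum_(y' in S) cabs (z y') * cabs (ip (F y) (F y')).
  by rewrite mulr_sumr; apply: eq_bigr => y' _; rewrite mulrA.
apply: ler_wpM2l; first exact: cabs_ge0.
apply: (le_trans (cabs_sum _ _ _)); apply: ler_sum => y' _.
by rewrite cabsM cabsJ.
Qed.

(* Schur's test, each pair being charged to the longer of its two time intervals. *)
Lemma disjoint_norm (Y : finType) (S : {set Y}) (b lp : Y -> R) (M : rel Y) (w : Y -> R) (A : R)
    (z : Y -> C) (F : Y -> R -> C) :
  (forall y, 0 < lp y) -> 0 <= A -> (forall y, 0 <= w y <= 1) ->
  (forall y, cabs (z y) = Num.sqrt (lp y)) -> (forall y, y \in S -> sqi (F y)) ->
  {in S & &, forall y y1 y2, lp y1 <= lp y -> lp y2 <= lp y -> M y1 y -> M y2 y -> y1 != y2 ->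
     itv_disj b lp y1 y2} ->
  {in S &, forall y y', ~~ M y y' -> ip (F y) (F y') = 0} ->
  {in S &, forall y y', lp y <= lp y' -> cabs (ip (F y) (F y')) <=
     A * w y' * (Num.sqrt (lp y) / Num.sqrt (lp y')) * dk (lp y') (cen b lp y - cen b lp y') ^+ 2} ->
  Re (ip (fun x => \sum_(y in S) z y * F y x) (fun x => \sum_(y in S) z y * F y x)) <=
  16 * A * \sum_(y in S) w y * lp y.
Proof.
move=> lp0 A0 w01 hz sF dj orth gr.
pose G y y' := cabs (z y) * cabs (z y') * cabs (ip (F y) (F y')).
have G0 y y' : 0 <= G y y' by rewrite !mulr_ge0 ?cabs_ge0.
have GC : {in S &, forall y y', G y y' = G y' y}.
  move=> y y' yS y'S; rewrite /G (mulrC (cabs (z y))); congr (_ * _).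
  by rewrite -[in RHS]ipJ ?cabsJ //; exact: sF.
have key y' : y' \in S -> \sum_(y in S | lp y <= lp y') G y y' <= 8 * A * (w y' * lp y').
  move=> y'S; have [w0 w1] := andP (w01 y').
  have sl y : 0 < Num.sqrt (lp y) by rewrite sqrtr_gt0.
  apply: (@le_trans _ _ (\sum_(y in [set y in S | (lp y <= lp y') && M y y'])
      (A * w y') * (lp y * dk (lp y') (b y + lp y / 2 - cen b lp y') ^+ 2))).
    rewrite [leRHS](eq_bigl (fun y => (y \in S) && ((lp y <= lp y') && M y y'))); last first.
      by move=> y; rewrite inE.
    rewrite [leLHS](bigID (fun y => M y y')) /= addrC big1 ?add0r; last first.
      by move=> y /andP[/andP[yS _] nm]; rewrite /G orth // cabs0 mulr0.
    rewrite (eq_bigl (fun y => (y \in S) && ((lp y <= lp y') && M y y'))); last by move=> y; rewrite andbA.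
    apply: ler_sum => y /and3P[yS le _].
    rewrite /G !hz; apply: (le_trans (ler_wpM2l _ (gr y y' yS y'S le))).
      by rewrite mulr_ge0 ?ltW.
    rewrite -/(cen b lp y); set D := dk _ _ ^+ 2.
    have -> : Num.sqrt (lp y) * Num.sqrt (lp y') * (A * w y' * (Num.sqrt (lp y) / Num.sqrt (lp y')) * D) =
      A * w y' * (Num.sqrt (lp y) ^+ 2 * D) by field; rewrite lt0r_neq0.
    by rewrite sqr_sqrtr // ltW.
  rewrite -mulr_sumr.
  have := @sum_dk_disj R Y b lp [set y in S | (lp y <= lp y') && M y y'] (lp y') 1 (cen b lp y') (lp0 _) ler01.
  have -> : 2 * (1 + 1) ^+ 2 * lp y' = 8 * lp y' by ring.
  move=> h; have := ler_wpM2l (mulr_ge0 A0 w0) (h _ _).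
  have -> : A * w y' * (8 * lp y') = 8 * A * (w y' * lp y') by ring.
  apply.
    by move=> y; rewrite inE => /and3P[_ h1 _]; rewrite lp0 mul1r.
  by move=> y1 y2; rewrite !inE => /and3P[? ? ?] /and3P[? ? ?]; exact: (dj y').
apply: (le_trans (gram_norm z sF)).
have -> : \sum_(y in S) \sum_(y' in S) cabs (z y) * cabs (z y') * cabs (ip (F y) (F y')) =
    \sum_(y in S) \sum_(y' in S) G y y' by [].
apply: (@le_trans _ _ (\sum_(y' in S) 2 * \sum_(y in S | lp y <= lp y') G y y')).
  apply: (@le_trans _ _ (\sum_(y in S) \sum_(y' in S) ((if lp y <= lp y' then G y y' else 0) +
      (if lp y' <= lp y then G y' y else 0)))).
    apply: ler_sum => y yS; apply: ler_sum => y' y'S.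
    case: (lerP (lp y) (lp y')) => le; first by rewrite lerDl; case: ifP.
    by rewrite (ltW le) add0r GC.
  have -> : \sum_(y in S) \sum_(y' in S) ((if lp y <= lp y' then G y y' else 0) +
      (if lp y' <= lp y then G y' y else 0)) =
     \sum_(y' in S) \sum_(y in S | lp y <= lp y') G y y' + \sum_(y' in S) \sum_(y in S | lp y <= lp y') G y y'.
    under eq_bigr do rewrite big_split.
    rewrite big_split /= exchange_big /=; congr (_ + _); apply: eq_bigr => y _;
    by rewrite [RHS]big_mkcondr.
  by rewrite -big_split /=; apply: ler_sum => y _; rewrite mulr2n mulrDl mul1r.
rewrite mulr_sumr; apply: ler_sum => y yS; have := key y yS; lra.
Qed.

End GramNorm.

(* [T] enumerates the tri-tiles of [Q] and [TP] those of [P]. [md_end] separates the endpoints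
   of the intervals [9/10 W2] (centred at [pv] with half length [9/20 / pl]) of distinct tiles;
   it is used because the relation [ssubsub] cuts the frequency line at these endpoints. *)
Section Model.
Variable R : realType.
Local Notation C := R[i].
Variables (X Y : finType) (T : X -> tritile R) (TP : Y -> tritile R).
Variables (c : R) (K L : nat) (Ck : nat -> R) (Phi : X -> 'I_3 -> R -> C) (PhiP : Y -> R -> C).

Definition pb y := ileft (TI (TP y)).
Definition pl y := ilen (TI (TP y)).
Definition pv y := ctr (W2 (TP y)).

Record model : Prop := Model {
  md_ts : tilesys (qa T) (ql T) (qu T);
  md_K : (0 < K)%N; md_L : (10 <= L)%N; md_Ck : forall k, 0 < Ck k;
  md_c : 0 < c <= 10 ^- 9;
  md_lw : forall x j, ilen (tw_of (T x) j) = (ql T x)^-1;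
  md_wp : forall x j, wave_packet K L Ck (tcomp (T x) j) (Phi x j);
  md_pl : forall y, 0 < pl y;
  md_plw : forall y, ilen (W2 (TP y)) = (pl y)^-1;
  md_wpP : forall y, wave_packet K L Ck (tcomp (TP y) i1) (PhiP y);
  md_dy : forall x y, pl y <= ql T x \/ 2 * ql T x <= pl y;
  md_disj : forall y y', y != y' -> fmeet pl pv y y' -> itv_disj pb pl y y';
  md_grid : forall y y1 y2, pl y1 <= pl y -> pl y2 <= pl y -> fmeet pl pv y1 y -> fmeet pl pv y2 y ->
    fmeet pl pv y1 y2;
  md_end : forall y y' (b b' : bool),
    `|(pv y + (-1) ^+ b * (9 / 20 * (pl y)^-1)) - (pv y' + (-1) ^+ b' * (9 / 20 * (pl y')^-1))| <
      1 / 100 * (pl y)^-1 ->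
    `|(pv y + (-1) ^+ b * (9 / 20 * (pl y)^-1)) - (pv y' + (-1) ^+ b' * (9 / 20 * (pl y')^-1))| <
      1 / 100 * (pl y')^-1 -> pv y = pv y' /\ pl y = pl y' }.

Hypothesis MD : model.
Local Notation a := (qa T).
Local Notation l := (ql T).
Local Notation u := (qu T).
Let l0 := ts_gt0 (md_ts MD).
Let lp0 := md_pl MD.
Let Ck0 := md_Ck MD.

Definition prel y x := ((l x)^-1 <= c * (pl y)^-1) &&
  (`|u i2 x - pv y| + (l x)^-1 / 2 <= 9 / 20 * (pl y)^-1).

Lemma PhiP_packet y N : (N <= 10)%N -> packet (Ck 0%N) (pl y) (cen pb pl y) N (PhiP y).
Proof.
move=> N10; apply: (packet_le (lp0 y) (ltW (Ck0 0)) (leq_trans N10 (md_L MD))).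
exact: (wave_packet_packet (P := tcomp (TP y) i1) (lp0 y) (md_wpP MD y)).
Qed.

Lemma PhiP_sqi y : sqi (PhiP y).
Proof. exact: (packet_sqi (lp0 y) (ltW (Ck0 0)) (isT : (1 <= 6)%N) (PhiP_packet y _)). Qed.

Definition packet_cst := 4 * Ck 0%N * Ck 0%N.

Lemma packet_cst_gt0 : 0 < packet_cst. Proof. by rewrite !mulr_gt0. Qed.

Lemma ipPQ_le x y j : pl y <= l x -> cabs (ip (PhiP y) (Phi x j)) <=
  packet_cst * (Num.sqrt (pl y) / Num.sqrt (l x)) * dk (l x) (cen pb pl y - cen a l x) ^+ 8.
Proof.
move=> le; apply: (packet_gram (lp0 y) le (ltW (Ck0 0)) (ltW (Ck0 0))); first exact: PhiP_packet.
exact: (Phi_packet (md_ts MD) (md_L MD) Ck0 (md_wp MD)).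
Qed.

Lemma ipPQ_orth x y : 9 / 20 * ((pl y)^-1 + (l x)^-1) <= `|pv y - u i2 x| ->
  ip (PhiP y) (Phi x i2) = 0.
Proof.
move=> h; apply: (wave_packet_orth_fine (P := tcomp (TP y) i1) (P' := tcomp (T x) i2) (lp0 y) (l0 x)
  (md_K MD) (leq_trans (isT : (2 <= 10)%N) (md_L MD)) Ck0 (md_wpP MD y) (md_wp MD x i2)).
by rewrite /= (md_lw MD x i2) (md_plw MD y).
Qed.

Lemma ipPP_orth y y' : ~~ fmeet pl pv y y' -> ip (PhiP y) (PhiP y') = 0.
Proof.
rewrite -leNgt => h.
apply: (wave_packet_orth_fine (P := tcomp (TP y) i1) (P' := tcomp (TP y') i1) (lp0 y) (lp0 y')
  (md_K MD) (leq_trans (isT : (2 <= 10)%N) (md_L MD)) Ck0 (md_wpP MD y) (md_wpP MD y')).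
rewrite /= !(md_plw MD); apply: le_trans h.
have p z : 0 < (pl z)^-1 by rewrite invr_gt0.
by have := p y; have := p y'; lra.
Qed.

(** * Error sums over a tree *)
Section Tree.
Variables (i : 'I_3) (t : X) (Q : {set X}).
Hypothesis ni : i2 != i.
Definition tree := [set x in Q | ltt a l u i x t].

Lemma tree_len x : x \in tree -> l x < l t.
Proof. by rewrite inE => /andP[_ /ltt_len]. Qed.

Lemma tree_sub x : x \in tree -> isub a l x t.
Proof. by rewrite inE => /andP[_ /ltt_sub]. Qed.

Lemma tree_lac x : x \in tree ->
  7 / 5 * (l x)^-1 <= `|u i2 x - u i2 t| <= 5 * 10 ^+ 6 * (l x)^-1.
Proof. by rewrite inE => /andP[_ h]; exact: (ts_lac (md_ts MD) ni h). Qed.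

Lemma tree_inj : {in tree &, forall x x', x != x' -> l x = l x' -> itv_disj a l x x'}.
Proof.
by move=> x x'; rewrite !inE => /andP[_ h] /andP[_ h']; exact: (ts_inj (md_ts MD) h h').
Qed.

Lemma tree_scale (z : R) : {in tree, forall x',
  \sum_(x in tree | l x == l x') dk (l x) (z - cen a l x) ^+ 2 <= 8}.
Proof.
move=> x' x'T; rewrite -(ler_pM2l (l0 x')) mulr_sumr.
have -> : \sum_(x in tree | l x == l x') l x' * dk (l x) (z - cen a l x) ^+ 2 =
    \sum_(x in [set x in tree | l x == l x']) l x * dk (l x') (a x + l x / 2 - z) ^+ 2.
  rewrite [RHS](eq_bigl (fun x => (x \in tree) && (l x == l x'))); last by move=> x; rewrite finset.in_set.
  by apply: eq_bigr => x /andP[_ /eqP e]; rewrite dkC /cen !e.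
have -> : l x' * 8 = 2 * (1 + 1) ^+ 2 * l x' by ring.
apply: sum_dk_disj => //.
  by move=> x; rewrite finset.in_set => /andP[_ /eqP ->]; rewrite mul1r lexx l0.
move=> x1 x2; rewrite finset.in_set => /andP[h1 /eqP e1].
rewrite finset.in_set => /andP[h2 /eqP e2] ne.
exact: (tree_inj h1 h2 ne (etrans e1 (esym e2))).
Qed.

Lemma tree_dk x z : x \in tree -> dk (l x) (z - cen a l x) <= 2 * dk (l t) (z - cen a l t).
Proof.
move=> xT; have lx := tree_len xT; apply: (le_trans (dk_le_scale _ (l0 x) (ltW lx))).
have -> : z - cen a l x = (z - cen a l t) + (cen a l t - cen a l x) by ring.
apply: dk_shift; first exact: l0.
by have := tree_sub xT; rewrite /isub /cen ler_norml => /andP[]; have := l0 x; lra.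
Qed.

(* [k y x] is the relative size of the error committed at [x] on the term of index [y]. *)
Lemma err_sum (S : {set Y}) (k : Y -> X -> R) (e : X -> R) (A B D : R) : 0 <= A -> 0 <= B -> 0 <= D ->
  (forall y x, 0 <= k y x) ->
  {in tree, forall x, 0 <= e x <= B / Num.sqrt (l x) *
     \sum_(y in S) pl y * k y x * dk (l x) (cen pb pl y - cen a l x) ^+ 4} ->
  {in tree, forall x, \sum_(y in S) pl y * k y x * dk (l x) (cen pb pl y - cen a l x) ^+ 4 <= A * l x} ->
  \sum_(y in S) pl y * dk (l t) (cen pb pl y - cen a l t) ^+ 2 <= A * l t ->
  {in S, forall y, \sum_(x in tree) k y x * dk (l x) (cen pb pl y - cen a l x) ^+ 2 <= D} ->
  \sum_(x in tree) e x ^+ 2 <= 4 * B ^+ 2 * A ^+ 2 * D * l t.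
Proof.
move=> A0 B0 D0 k0 he h1 h2 h3.
pose s x := \sum_(y in S) pl y * k y x * dk (l x) (cen pb pl y - cen a l x) ^+ 4.
have s0 x : 0 <= s x.
  by apply: sumr_ge0 => y _; rewrite !mulr_ge0 ?(ltW (lp0 y)) ?exprn_ge0 ?dk_ge0.
have le1 x : x \in tree -> e x ^+ 2 <= B ^+ 2 * A * s x.
  move=> xT; have [e0 ex] := andP (he x xT).
  have sl : 0 < Num.sqrt (l x) by rewrite sqrtr_gt0.
  apply: (@le_trans _ _ ((B / Num.sqrt (l x) * s x) ^+ 2)).
    by rewrite lerXn2r ?nnegrE // ?mulr_ge0 ?invr_ge0 // ?ltW.
  have -> : (B / Num.sqrt (l x) * s x) ^+ 2 = B ^+ 2 * (s x * s x / Num.sqrt (l x) ^+ 2).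
    by field; rewrite lt0r_neq0.
  rewrite sqr_sqrtr ?(ltW (l0 x)) // -[leRHS]mulrA; apply: ler_wpM2l; first exact: sqr_ge0.
  rewrite ler_pdivrMr //; have := ler_wpM2r (s0 x) (h1 x xT); rewrite -/(s x); lra.
apply: (le_trans (ler_sum _ le1)); rewrite -mulr_sumr exchange_big /=.
apply: (@le_trans _ _ (B ^+ 2 * A * \sum_(y in S) (4 * D) * (pl y * dk (l t) (cen pb pl y - cen a l t) ^+ 2))).
  apply: ler_wpM2l; first by rewrite mulr_ge0 ?sqr_ge0.
  apply: ler_sum => y yS.
  have := ler_wpM2l (_ : 0 <= 4 * (pl y * dk (l t) (cen pb pl y - cen a l t) ^+ 2)) (h3 y yS).
  have p4 : 0 <= 4 * (pl y * dk (l t) (cen pb pl y - cen a l t) ^+ 2).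
    by rewrite mulr_ge0 // mulr_ge0 ?exprn_ge0 ?dk_ge0 // ltW.
  move=> /(_ p4); rewrite mulr_sumr => h.
  have -> : 4 * D * (pl y * dk (l t) (cen pb pl y - cen a l t) ^+ 2) =
    4 * (pl y * dk (l t) (cen pb pl y - cen a l t) ^+ 2) * D by ring.
  apply: le_trans h; apply: ler_sum => x xT.
  have := tree_dk (cen pb pl y) xT; set d := dk (l x) _; set d' := dk (l t) _ => dd.
  have d0 : 0 <= d by exact: dk_ge0.
  have : d ^+ 2 <= (2 * d') ^+ 2 by rewrite lerXn2r ?nnegrE // (le_trans d0 dd).
  have pk : 0 <= pl y * k y x * d ^+ 2 by rewrite !mulr_ge0 ?(ltW (lp0 y)) ?exprn_ge0.
  move=> /(ler_wpM2l pk); have -> : d ^+ 4 = d ^+ 2 * d ^+ 2 by ring.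
  rewrite exprMn; lra.
rewrite -mulr_sumr; have p : 0 <= B ^+ 2 * A * (4 * D) by rewrite !mulr_ge0 ?sqr_ge0.
have := ler_wpM2l p h2; lra.
Qed.

Lemma ratio_sum (z lam : R) : 0 < lam ->
  \sum_(x in tree) Num.min (lam / l x) (l x / lam) * dk (l x) (z - cen a l x) ^+ 2 <= 32.
Proof.
move=> lam0.
have d0 x : 0 <= dk (l x) (z - cen a l x) ^+ 2 by exact: dkX_ge0.
rewrite (bigID (fun x => l x < lam)) /=.
have -> : (32 : R) = 2 * (8 / lam) * lam + 2 * (8 * lam) / lam by field; exact: lt0r_neq0.
have q x (P : pred X) : \sum_(y in [set y in tree | P y] | l y == l x) dk (l y) (z - cen a l y) ^+ 2 <=
    \sum_(y in tree | l y == l x) dk (l y) (z - cen a l y) ^+ 2.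
  rewrite big_mkcond [leRHS]big_mkcond; apply: ler_sum => y _; rewrite finset.in_set.
  by case: (y \in tree) => //=; case: (P y) => //=; case: ifP.
apply: lerD.
  rewrite (eq_bigl (fun x => x \in [set x in tree | l x < lam])); last by move=> x; rewrite finset.in_set.
  apply: (geo_sum_up (l := l)); rewrite ?(ltW lam0) ?divr_ge0 ?(ltW lam0) //.
  - by move=> x; rewrite finset.in_set => /andP[_ h]; rewrite (ltW h) ltW.
  - by move=> x y _ _; exact: (ts_half (md_ts MD)).
  - move=> x; rewrite finset.in_set => /andP[xT hx].
    apply: (@le_trans _ _ (l x / lam * \sum_(y in tree | l y == l x) dk (l y) (z - cen a l y) ^+ 2)).
      apply: (le_trans _ (ler_wpM2l _ (q x (fun x => l x < lam)))); last by rewrite divr_ge0 // ltW.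
      rewrite mulr_sumr; apply: ler_sum => y /andP[_ /eqP ->].
      by rewrite ler_wpM2r ?dkX_ge0 // ge_min lexx orbT.
    have p : 0 <= l x / lam by rewrite divr_ge0 // ltW.
    have := ler_wpM2l p (tree_scale z xT); move/le_trans; apply.
    by rewrite le_eqVlt; apply/orP; left; apply/eqP; ring.
rewrite (eq_bigl (fun x => x \in [set x in tree | ~~ (l x < lam)])); last by move=> x; rewrite finset.in_set.
apply: (geo_sum_down (l := l)) => //; first by rewrite mulr_ge0 // ltW.
- by move=> x; rewrite finset.in_set -leNgt => /andP[].
- by move=> x y _ _; exact: (ts_half (md_ts MD)).
- move=> x; rewrite finset.in_set => /andP[xT hx].
  apply: (@le_trans _ _ (lam / l x * \sum_(y in tree | l y == l x) dk (l y) (z - cen a l y) ^+ 2)).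
    apply: (le_trans _ (ler_wpM2l _ (q x (fun x => ~~ (l x < lam))))); last by rewrite divr_ge0 // ltW.
    rewrite mulr_sumr; apply: ler_sum => y /andP[_ /eqP ->].
    by rewrite ler_wpM2r ?dkX_ge0 // ge_min lexx.
  have p : 0 <= lam / l x by rewrite divr_ge0 // ltW.
  have := ler_wpM2l p (tree_scale z xT); move/le_trans; apply.
  by rewrite le_eqVlt; apply/orP; left; apply/eqP; ring.
Qed.

End Tree.
End Model.

(** * Size of the coefficients: truncation errors *)

Section TreeSize.
Variable R : realType.
Local Notation mu := (@lebesgue_measure R).
Local Notation C := R[i].
Variables (X Y : finType) (T : X -> tritile R) (TP : Y -> tritile R).
Variables (c : R) (K L : nat) (Ck : nat -> R) (Phi : X -> 'I_3 -> R -> C) (PhiP : Y -> R -> C).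
Hypothesis MD : model T TP c K L Ck Phi PhiP.
Local Notation a := (qa T).
Local Notation l := (ql T).
Local Notation u := (qu T).
Local Notation pb := (pb TP).
Local Notation pl := (pl TP).
Local Notation pv := (pv TP).
Local Notation rel := (prel T TP c).
Local Notation gc := (packet_cst Ck).
Let l0 := ts_gt0 (md_ts MD).
Let lp0 := md_pl MD.
Let Ck0 := md_Ck MD.

Definition exc y x := [&& ~~ rel y x, pl y <= l x &
  `|pv y - u i2 x| < 9 / 20 * ((pl y)^-1 + (l x)^-1)].

Variable z : Y -> C.
Hypothesis hz : forall y, cabs (z y) = Num.sqrt (pl y).

Definition coef x := \sum_(y | rel y x) z y * ip (PhiP y) (Phi x i2).

Lemma c_gt0 : 0 < c. Proof. by case/andP: (md_c MD). Qed.

Lemma c_le : 10 ^+ 9 * c <= 1.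
Proof. by case/andP: (md_c MD) => _ h; rewrite -ler_pdivlMl ?exprn_gt0 // mulr1. Qed.

Lemma rel_le y x : rel y x -> pl y <= l x.
Proof.
case/andP => h _; have := c_le; have := c_gt0 => c0 c1.
rewrite -lef_pV2 ?posrE //; apply: (le_trans h); rewrite ler_piMl ?invr_ge0 ?(ltW (lp0 y)) //.
move: c1; have : 1 <= 10 ^+ 9 :> R by apply: exprn_ege1; lra.
by set b := 10 ^+ 9 => b1 b2; have := ler_wpM2r (ltW c0) b1; lra.
Qed.

Lemma pair_le y x : pl y <= l x -> cabs (z y * ip (PhiP y) (Phi x i2)) <=
  gc / Num.sqrt (l x) * (pl y * dk (l x) (cen pb pl y - cen a l x) ^+ 4).
Proof.
move=> le; rewrite cabsM hz.
apply: (le_trans (ler_wpM2l (sqrtr_ge0 _) (ipPQ_le MD i2 le))).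
have -> : Num.sqrt (pl y) * (gc * (Num.sqrt (pl y) / Num.sqrt (l x)) *
    dk (l x) (cen pb pl y - cen a l x) ^+ 8) = gc / Num.sqrt (l x) *
    (Num.sqrt (pl y) ^+ 2 * dk (l x) (cen pb pl y - cen a l x) ^+ 8) by rewrite /gc; ring.
rewrite sqr_sqrtr ?(ltW (lp0 y)) //; apply: ler_wpM2l.
  by rewrite divr_ge0 ?sqrtr_ge0 // (ltW (packet_cst_gt0 MD)).
by apply: ler_wpM2l; [exact: ltW | exact: dkX_le].
Qed.

Section Tree.
Variables (i : 'I_3) (t : X) (Q : {set X}).
Hypothesis ni : i2 != i.
Local Notation tree := (tree T i t Q).

Definition tpart : {set Y} :=
  [set y | (`|pv y - u i2 t| < (pl y)^-1 / 2) && (pl y <= l t)]%SET.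

Lemma rel_tpart y x : x \in tree -> rel y x -> y \in tpart.
Proof.
move=> xT r; have le := rel_le r; rewrite inE (le_trans le (ltW (tree_len xT))) andbT.
case/andP: r => h1 h2; have /andP[_ lac] := tree_lac MD ni xT.
have := norm_tri (pv y) (u i2 x) (u i2 t); rewrite (distrC (pv y) (u i2 x)) => tri.
apply: (le_lt_trans tri).
have ip0 : 0 < (pl y)^-1 by rewrite invr_gt0.
have il0 : 0 < (l x)^-1 by rewrite invr_gt0.
have hb : 200 * (5 * 10 ^+ 6 * (l x)^-1) <= (pl y)^-1.
  have -> : 200 * (5 * 10 ^+ 6 * (l x)^-1) = 10 ^+ 9 * (l x)^-1 :> R by ring.
  apply: (@le_trans _ _ (10 ^+ 9 * (c * (pl y)^-1))).
    by rewrite ler_wpM2l // exprn_ge0.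
  by rewrite mulrA ler_piMl ?(ltW ip0) // c_le.
move: lac h2 ip0 il0 hb; set p := (pl y)^-1; set q := (l x)^-1; set v := `|u i2 x - u i2 t|.
set b := 5 * 10 ^+ 6 * q; set w := `|u i2 x - pv y|.
lra.
Qed.

Lemma tpart_meet y x : x \in tree -> y \in tpart ->
  `|pv y - u i2 x| < 9 / 20 * ((pl y)^-1 + (l x)^-1) -> pl y <= l x.
Proof.
move=> xT; rewrite inE => /andP[ny _] h.
have [//|/= h2] := md_dy MD x y; exfalso.
have /andP[lac _] := tree_lac MD ni xT.
have := norm_tri (u i2 x) (pv y) (u i2 t); rewrite (distrC (u i2 x) (pv y)) => tri.
have il0 : 0 < (l x)^-1 by rewrite invr_gt0.
have : (pl y)^-1 <= (l x)^-1 / 2.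
  by rewrite -invfM mulrC lef_pV2 ?posrE ?mulr_gt0.
lra.
Qed.

Lemma tpart_disj : {in tpart &, forall y y', y != y' -> itv_disj pb pl y y'}.
Proof.
move=> y y'; rewrite !inE => /andP[h _] /andP[h' _] ne; apply: (md_disj MD) => //.
have := norm_tri (pv y) (u i2 t) (pv y'); rewrite /fmeet (distrC (u i2 t)); lra.
Qed.

Lemma tpart_sum x (S : {set Y}) : S \subset tpart -> {in S, forall y, pl y <= l x} ->
  \sum_(y in S) pl y * dk (l x) (cen pb pl y - cen a l x) ^+ 2 <= 8 * l x.
Proof.
move=> /fintype.subsetP SS hS; have -> : 8 * l x = 2 * (1 + 1) ^+ 2 * l x by ring.
apply: sum_dk_disj => //; first by move=> y /hS; rewrite lp0 mul1r.
by move=> y y' /SS yS /SS y'S; exact: tpart_disj.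
Qed.

Lemma exc_sum y : y \in tpart ->
  \sum_(x in tree) (exc y x)%:R * dk (l x) (cen pb pl y - cen a l x) ^+ 2 <= 16 / c + 16.
Proof.
move=> yS; set zz := cen pb pl y.
have c0 := c_gt0; have py := lp0 y; have ip0 : 0 < (pl y)^-1 by rewrite invr_gt0.
have d0 x : 0 <= dk (l x) (zz - cen a l x) ^+ 2 by exact: dkX_ge0.
pose A1 := [set x in tree | (pl y <= l x) && (l x < pl y / c)].
pose Ae e := [set x in tree | `|u i2 x - e| <= (l x)^-1 / 2].
pose e1 := pv y + 9 / 20 * (pl y)^-1; pose e2 := pv y - 9 / 20 * (pl y)^-1.
have cover x : x \in tree -> (exc y x)%:R * dk (l x) (zz - cen a l x) ^+ 2 <=
   (if x \in A1 then dk (l x) (zz - cen a l x) ^+ 2 else 0) +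
   ((if x \in Ae e1 then dk (l x) (zz - cen a l x) ^+ 2 else 0) +
    (if x \in Ae e2 then dk (l x) (zz - cen a l x) ^+ 2 else 0)).
  move=> xT; case: (boolP (exc y x)) => [|_]; last first.
    by rewrite mul0r !addr_ge0 //; case: ifP.
  case/and3P => nr le meet; rewrite mul1r.
  have n1 : 0 <= (if x \in A1 then dk (l x) (zz - cen a l x) ^+ 2 else 0) by case: ifP.
  have n2 : 0 <= (if x \in Ae e1 then dk (l x) (zz - cen a l x) ^+ 2 else 0) by case: ifP.
  have n3 : 0 <= (if x \in Ae e2 then dk (l x) (zz - cen a l x) ^+ 2 else 0) by case: ifP.
  have il : 0 < (l x)^-1 by rewrite invr_gt0.
  case: (ltP (l x) (pl y / c)) => h.
    have xA : x \in A1 by rewrite finset.in_set xT le h.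
    by move: n2 n3; rewrite xA; lra.
  have h' : (l x)^-1 <= c * (pl y)^-1.
    have -> : c * (pl y)^-1 = (pl y / c)^-1 by rewrite invfM invrK mulrC.
    by rewrite lef_pV2 ?posrE ?divr_gt0.
  move: nr; rewrite /prel h' /= -ltNge => nr.
  have : x \in Ae e1 \/ x \in Ae e2.
    have inAe e : (x \in Ae e) = (`|u i2 x - e| <= (l x)^-1 / 2).
      by rewrite finset.in_set xT.
    rewrite !inAe /e1 /e2; move: nr meet; rewrite (distrC (u i2 x)).
    case: (lerP 0 (pv y - u i2 x)) => s; [right|left]; move: nr meet.
      by rewrite (ger0_norm s) => nr meet; rewrite ler_norml; apply/andP; split; lra.
    by rewrite (ltr0_norm s) => nr meet; rewrite ler_norml; apply/andP; split; lra.
  move: n1 n2 n3; set D := dk _ _ ^+ 2; set v1 := (if x \in A1 then _ else _).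
  set v2 := (if x \in Ae e1 then _ else _); set v3 := (if x \in Ae e2 then _ else _) => n1 n2 n3.
  by case=> xA; [have v : v2 = D by rewrite /v2 xA | have v : v3 = D by rewrite /v3 xA]; rewrite -v; lra.
have sA (S : {set X}) : S \subset tree ->
    \sum_(x in tree) (if x \in S then dk (l x) (zz - cen a l x) ^+ 2 else 0) =
    \sum_(x in S) dk (l x) (zz - cen a l x) ^+ 2.
  move=> /fintype.subsetP SS; rewrite [RHS]big_mkcond [LHS]big_mkcond /=; apply: eq_bigr => x _.
  by case: (boolP (x \in S)) => [/SS ->//|_]; case: ifP.
have sub (P : pred X) : [set x in tree | P x] \subset tree.
  by apply/fintype.subsetP => x; rewrite finset.in_set => /andP[].
apply: (le_trans (ler_sum _ cover)); rewrite !big_split /= !sA ?sub //.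
have b1 : \sum_(x in A1) dk (l x) (zz - cen a l x) ^+ 2 <= 16 / c.
  have -> : 16 / c = 2 * (8 * (pl y / c)) / pl y by field; rewrite !lt0r_neq0.
  apply: (geo_sum_down (l := l)) => //; first by rewrite mulr_ge0 // divr_ge0 // ltW.
  - by move=> x; rewrite finset.in_set => /and3P[].
  - by move=> x x' _ _; exact: (ts_half (md_ts MD)).
  - move=> x; rewrite finset.in_set => /and3P[xT _ xp].
    apply: (@le_trans _ _ (\sum_(x' in tree | l x' == l x) dk (l x') (zz - cen a l x') ^+ 2)).
      rewrite big_mkcond [leRHS]big_mkcond; apply: ler_sum => x' _; rewrite finset.in_set.
      by case: (x' \in tree) => //=; case: (l x' == l x); rewrite ?andbF ?andbT //; case: ifP.
    apply: (le_trans (tree_scale MD zz xT)); rewrite -mulrA ler_pMr // ler_pdivlMr // mul1r.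
    exact: ltW.
have b2 e : \sum_(x in Ae e) dk (l x) (zz - cen a l x) ^+ 2 <= 8.
  have [->|[x0 x0A]] := set_0Vmem (Ae e); first by rewrite big_set0.
  have lac x : x \in Ae e -> 9 / 10 * (l x)^-1 <= `|u i2 t - e| <= 6 * 10 ^+ 6 * (l x)^-1.
    rewrite finset.in_set => /andP[xT xe]; have /andP[q1 q2] := tree_lac MD ni xT.
    have il : 0 < (l x)^-1 by rewrite invr_gt0.
    have t1 := norm_tri (u i2 x) e (u i2 t); have t2 := norm_tri (u i2 t) (u i2 x) e.
    move: t1 t2; rewrite (distrC e) (distrC (u i2 t) (u i2 x)) => t1 t2.
    move: xe q1 q2 t1 t2; move: `|_ - e| `|_ - _| `|_ - e| => w1 w2 w3.
    have big : 1 <= 10 ^+ 6 :> R by apply: exprn_ege1; lra.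
    move: big; set b := 10 ^+ 6 => big xe q1 q2 t1 t2; have := ler_wpM2r (ltW il) big.
    by move=> bb; apply/andP; split; lra.
  have same x : x \in Ae e -> l x = l x0.
    have lt_abs x1 x2 : x1 \in Ae e -> x2 \in Ae e -> l x1 < l x2 -> False.
      move=> /lac /andP[m1 _] /lac /andP[_ m2] lt; have [q0 q] := ts_inv (md_ts MD) lt.
      have := le_trans m1 m2; move: q.
      have -> : 10 ^+ 9 = 10 * 10 * 10 * 10 ^+ 6 :> R by ring.
      have : 0 < 10 ^+ 6 * (l x2)^-1 by rewrite mulr_gt0 // exprn_gt0.
      set b := 10 ^+ 6; set w' := (l x1)^-1; lra.
    move=> xA; case: (ltgtP (l x) (l x0)) => // lt; exfalso.
      exact: (lt_abs x x0).
    exact: (lt_abs x0 x).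
  have x0T : x0 \in tree by move: x0A; rewrite finset.in_set => /andP[].
  apply: le_trans (tree_scale MD zz x0T).
  rewrite big_mkcond [leRHS]big_mkcond; apply: ler_sum => x _.
  case: (boolP (x \in Ae e)) => xA; last by case: ifP.
  have xT : x \in tree by move: xA; rewrite finset.in_set => /andP[].
  by rewrite xT same // eqxx.
have := b2 e1; have := b2 e2; move: b1.
by move: (16 / c) (\sum_(x in A1) _) (\sum_(x in Ae e1) _) (\sum_(x in Ae e2) _) => *; lra.
Qed.

Lemma coef_exc x : x \in tree ->
  coef x = \sum_(y in tpart) z y * ip (PhiP y) (Phi x i2) -
           \sum_(y in tpart | exc y x) z y * ip (PhiP y) (Phi x i2).
Proof.
move=> xT; apply/eqP; rewrite eq_sym subr_eq; apply/eqP.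
rewrite (bigID (fun y => rel y x)) /=; congr (_ + _).
  rewrite /coef; apply: eq_bigl => y.
  by case: (boolP (rel y x)) => r; rewrite ?andbF // (rel_tpart xT r).
rewrite (bigID (fun y => exc y x)) /= [X in _ + X]big1 ?addr0.
  apply: eq_bigl => y; rewrite -andbA; congr (_ && _).
  by rewrite /exc; case: (rel y x); rewrite //= andbT.
move=> y /andP[/andP[yS nr] ne]; rewrite (ipPQ_orth MD) ?mulr0 // leNgt; apply/negP => meet.
by move: ne; rewrite /exc nr (tpart_meet xT yS meet) meet.
Qed.

Lemma exc_le x : cabs (\sum_(y in tpart | exc y x) z y * ip (PhiP y) (Phi x i2)) <=
  gc / Num.sqrt (l x) * \sum_(y in tpart) pl y * (exc y x)%:R * dk (l x) (cen pb pl y - cen a l x) ^+ 4.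
Proof.
apply: (le_trans (cabs_sum _ _ _)); rewrite big_mkcondr mulr_sumr; apply: ler_sum => y yS.
case: (boolP (exc y x)) => [/and3P[_ le _]|_]; last by rewrite mulr0 mul0r mulr0.
by rewrite mulr1; exact: pair_le.
Qed.

Lemma size_abs (H : R -> C) (k : Y -> X -> R) (s N A B D : R) : 0 <= s -> 0 <= A -> 0 <= B -> 0 <= D ->
  sqi H -> (forall y x, 0 <= k y x) ->
  {in tree, forall x, cabs (ip H (Phi x i2)) <= s * Num.sqrt (l x)} ->
  Rintegral mu setT (fun x => (cabs (H x) / wgt (cen a l t) (l t) x) ^+ 2) <= N ->
  {in tree, forall x, cabs (coef x - ip H (Phi x i2)) <= B / Num.sqrt (l x) *
     \sum_(y in tpart) pl y * k y x * dk (l x) (cen pb pl y - cen a l x) ^+ 4} ->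
  {in tree, forall x, \sum_(y in tpart) pl y * k y x * dk (l x) (cen pb pl y - cen a l x) ^+ 4 <= A * l x} ->
  \sum_(y in tpart) pl y * dk (l t) (cen pb pl y - cen a l t) ^+ 2 <= A * l t ->
  {in tpart, forall y, \sum_(x in tree) k y x * dk (l x) (cen pb pl y - cen a l x) ^+ 2 <= D} ->
  \sum_(x in tree) cabs (coef x) ^+ 2 <=
    2 * (8 * bes Ck * N + 64 * s ^+ 2 * l t) + 2 * (4 * B ^+ 2 * A ^+ 2 * D * l t).
Proof.
move=> s0 A0 B0 D0 sH k0 hs hN he h1 h2 h3.
have e1 : \sum_(x in tree) cabs (ip H (Phi x i2)) ^+ 2 <= 8 * bes Ck * N + 64 * s ^+ 2 * l t.
  have := @tree_bessel R X T (md_ts MD) K L Ck Phi (md_K MD) (md_L MD) Ck0 (md_lw MD) (md_wp MD)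
     i i2 Q t H s N ni s0 sH _ hN.
  rewrite (eq_bigl (fun x => x \in tree)); last by move=> x; rewrite finset.in_set.
  by apply => x xQ xt; apply: hs; rewrite finset.in_set xQ.
have e2 : \sum_(x in tree) cabs (coef x - ip H (Phi x i2)) ^+ 2 <= 4 * B ^+ 2 * A ^+ 2 * D * l t.
  apply: (err_sum MD A0 B0 D0 k0 _ h1 h2 h3) => x xT.
  by rewrite cabs_ge0 he.
apply: (@le_trans _ _ (\sum_(x in tree) (2 * cabs (ip H (Phi x i2)) ^+ 2 + 2 * cabs (coef x - ip H (Phi x i2)) ^+ 2))).
  apply: ler_sum => x _; set q := ip H (Phi x i2); set r := coef x.
  have h : cabs r <= cabs q + cabs (r - q).
    by apply: le_trans (cabsD _ _); rewrite addrC subrK.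
  have : cabs r ^+ 2 <= (cabs q + cabs (r - q)) ^+ 2.
    by rewrite lerXn2r ?nnegrE ?addr_ge0 ?cabs_ge0.
  by have := sqr_ge0 (cabs q - cabs (r - q)); rewrite !expr2; lra.
by rewrite big_split /= -!mulr_sumr; lra.
Qed.

End Tree.
End TreeSize.

(** * Smearing *)

Section Smear.
Variable R : realType.
Local Notation mu := (@lebesgue_measure R).
Local Notation C := R[i].

Lemma dk_peetre (r a b : R) : 0 < r -> dk r b <= dk r a * (1 + `|a - b| / r).
Proof.
move=> r0; have h : dk r (a - b) * dk r b <= dk r a.
  by have := dkM (a - b) b r0 (lexx r); rewrite subrK.
have d0 := dk_den0 (a - b) r0.
by rewrite -ler_pdivrMr // mulrC.
Qed.

Variables (f : R -> C) (A lp cy lam xi : R).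
Hypotheses (A0 : 0 <= A) (lp0 : 0 < lp) (lpl : lp <= lam) (pf : packet A lp cy 10 f).
Let lam0 : 0 < lam. Proof. exact: lt_le_trans lpl. Qed.

Definition box s : R := 2 / lam * \1_(`[cy - lam / 4, cy + lam / 4]) s.
Definition smear s : C := ft f xi * rc (box s) * expi (2 * pi * (xi * s)).

Lemma box_ge0 s : 0 <= box s.
Proof. by rewrite /box mulr_ge0 ?divr_ge0 ?(ltW lam0) // indicE. Qed.

Lemma ind_intg : intg (\1_(`[cy - lam / 4, cy + lam / 4]%classic) : R -> R).
Proof. exact: integrable_indic_itv. Qed.

Lemma box_intg : intg box.
Proof. exact: intgZ ind_intg. Qed.

Lemma box_Rint : Rintegral mu setT box = 1.
Proof.
rewrite /box RintegralZl //; last exact: ind_intg.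
rewrite /Rintegral integral_indic // setIT.
have H : mu (`[cy - lam / 4, cy + lam / 4]%classic : set R) = (lam / 2)%:E.
  have lt : cy - lam / 4 < cy + lam / 4 by have := lam0; lra.
  rewrite lebesgue_measure_itv /= lte_fin lt.
  by rewrite -EFinD; congr (_%:E); field.
transitivity (2 / lam * fine (lam / 2)%:E); first by rewrite -H.
by rewrite /=; field; exact: lt0r_neq0.
Qed.

Lemma box_supp s : box s != 0 -> `|s - cy| <= lam / 4.
Proof.
rewrite /box mulf_eq0 negb_or => /andP[_]; rewrite indicE.
case: (boolP (s \in _)) => [|_]; last by rewrite eqxx.
by rewrite inE /= in_itv /= => /andP[h1 h2] _; rewrite ler_norml; apply/andP; split; lra.
Qed.

Lemma ft_packet : cabs (ft f xi) <= 4 * A * Num.sqrt lp.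
Proof.
have [mf bf] := pf.
have me : cmeasurable (fun x => expi (- (2 * pi * x * xi))).
  apply: cmeas_expi; apply: measurableT_comp => //.
  by apply: measurable_funM => //; apply: measurable_funM.
apply: (le_trans (cint_le (cmeasM mf me) (intgZ (A / Num.sqrt lp) (dk_intg cy lp0 (isT : (2 <= 10)%N))) _)).
  by move=> x; rewrite cabsM expi_unit mulr1.
rewrite RintegralZl //; last exact: dk_intg.
have s0 : 0 < Num.sqrt lp by rewrite sqrtr_gt0.
have := ler_wpM2l (_ : 0 <= 2 * (A / Num.sqrt lp)) (dk_Rint cy lp0 (isT : (2 <= 10)%N)).
rewrite mulr_ge0 ?divr_ge0 ?(ltW s0) // => /(_ isT).
have -> : 2 * (A / Num.sqrt lp) * (2 * lp) = 4 * A * Num.sqrt lp.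
  by rewrite -[X in _ * (2 * X) = _](sqr_sqrtr (ltW lp0)); field; exact: lt0r_neq0.
by rewrite !mulrA.
Qed.

Lemma smear_meas : cmeasurable smear.
Proof.
apply: cmeasM; last first.
  by apply: cmeas_expi; apply: measurable_funM => //; apply: measurable_funM.
apply: cmeasM; first exact: cmeas_cst.
apply: cmeasR; exact: intg_meas box_intg.
Qed.

Lemma smear_le s : cabs (smear s) <= 4 * A * Num.sqrt lp * box s.
Proof.
rewrite /smear !cabsM expi_unit mulr1 cabs_rc (ger0_norm (box_ge0 s)).
by rewrite ler_wpM2r ?box_ge0 // ft_packet.
Qed.

Lemma box_le s : box s <= 2 / lam.
Proof. by rewrite /box ler_piMr ?divr_ge0 ?(ltW lam0) // indicE lern1 leq_b1. Qed.

Lemma smear_sqi : sqi smear.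
Proof.
split; first exact: smear_meas.
apply: (intg_le _ (intgZ ((4 * A * Num.sqrt lp) ^+ 2 * (2 / lam)) box_intg)) => [|s].
  exact: measurable_funX (meas_cabs smear_meas).
rewrite ger0_norm ?sqr_ge0 //.
have c0 : 0 <= 4 * A * Num.sqrt lp by rewrite !mulr_ge0 ?sqrtr_ge0.
apply: (@le_trans _ _ ((4 * A * Num.sqrt lp * box s) ^+ 2)).
  by rewrite lerXn2r ?nnegrE ?cabs_ge0 ?smear_le // mulr_ge0 ?box_ge0.
rewrite exprMn -[leRHS]mulrA; apply: ler_wpM2l; first exact: sqr_ge0.
by rewrite expr2; apply: ler_wpM2r; [exact: box_ge0 | exact: box_le].
Qed.

Variables (g : R -> C) (l cx : R).
Hypotheses (l0 : 0 < l) (pg : packet A l cx 10 g).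
Local Notation d := (dk l (cy - cx)).

Lemma smear_far : lam <= `|cy - cx| ->
  cabs (ip smear g) <= 40 * A ^+ 2 * (Num.sqrt lp / Num.sqrt l) * d ^+ 5.
Proof.
move=> far; have [mg bg] := pg.
have sl : 0 < Num.sqrt l by rewrite sqrtr_gt0.
pose k := 4 * A * Num.sqrt lp * (A / Num.sqrt l * (5 * d ^+ 5)).
have d0 : 0 <= d by exact: dk_ge0.
have k0 : 0 <= k.
  apply: mulr_ge0; first by rewrite !mulr_ge0 ?sqrtr_ge0.
  by rewrite mulr_ge0 ?divr_ge0 ?(ltW sl) // mulr_ge0 // exprn_ge0.
apply: (le_trans (ip_le smear_meas mg (intgZ k box_intg) _)); last first.
  rewrite RintegralZl //; last exact: box_intg.
  by rewrite box_Rint mulr1 /k le_eqVlt; apply/orP; left; apply/eqP; field; exact: lt0r_neq0.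
move=> s; have [bz|/box_supp bs] := eqVneq (box s) 0.
  by rewrite bz mulr0; have := smear_le s; rewrite bz mulr0 => h; rewrite mulr_le0_ge0 ?cabs_ge0.
have dd : dk l (s - cx) <= 4 / 3 * d.
  have far' : 3 / 4 * `|cy - cx| <= `|s - cx|.
    by have := norm_tri cy s cx; rewrite (distrC cy s); lra.
  have n0 : 0 <= `|cy - cx| by exact: normr_ge0.
  rewrite /dk -[4 / 3]invrK -invfM lef_pV2 ?posrE ?dk_den0 ?mulr_gt0 ?invr_gt0 ?dk_den0 ?divr_gt0 //.
  have -> : (4 / 3)^-1 * (1 + `|cy - cx| / l) = 3 / 4 + 3 / 4 * `|cy - cx| / l by field; exact: lt0r_neq0.
  by have := ler_wpM2r (_ : 0 <= l^-1) far'; rewrite invr_ge0 (ltW l0) => /(_ isT); lra.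
have d5 : dk l (s - cx) ^+ 10 <= 5 * d ^+ 5.
  apply: (le_trans (dkX_le _ l0 (isT : (5 <= 10)%N))).
  apply: (@le_trans _ _ ((4 / 3 * d) ^+ 5)).
    by rewrite lerXn2r ?nnegrE ?dk_ge0 ?mulr_ge0 ?divr_ge0.
  rewrite exprMn ler_wpM2r ?exprn_ge0 //.
  have -> : (4 / 3 : R) ^+ 5 = 4 / 3 * (4 / 3 * (4 / 3 * (4 / 3 * (4 / 3)))) by ring.
  lra.
apply: (@le_trans _ _ ((4 * A * Num.sqrt lp * box s) * (A / Num.sqrt l * (5 * d ^+ 5)))).
  apply: ler_pM; rewrite ?cabs_ge0 ?smear_le //; apply: (le_trans (bg s)).
  by rewrite ler_wpM2l // divr_ge0 // ltW.
by rewrite /k; lra.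
Qed.

Lemma smear_near (B : R) : 0 <= B -> lam <= l ->
  (forall s D, (forall w, `|w - cy| <= `|s - cy| -> dk l (w - cx) ^+ 10 <= D) ->
    cabs (expi (- (2 * pi * xi * s)) * g s - expi (- (2 * pi * xi * cy)) * g cy) <=
    B * D / (l * Num.sqrt l) * `|s - cy|) ->
  cabs (ip f g - ip smear g) <= 12 * A * B * (Num.sqrt lp / Num.sqrt l) * (lam / l) * d ^+ 4.
Proof.
move=> B0 laml lip; have [mf bf] := pf; have [mg bg] := pg.
have sl : 0 < Num.sqrt l by rewrite sqrtr_gt0.
have slp : 0 < Num.sqrt lp by rewrite sqrtr_gt0.
have d0 : 0 <= d by exact: dk_ge0.
pose e s := expi (- (2 * pi * xi * s)); pose ph s := e s * g s.
have me : cmeasurable e.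
  by apply: cmeas_expi; apply: measurableT_comp => //; apply: measurable_funM.
have lip' s : cabs (ph s - ph cy) <=
    B * (d ^+ 4 * (1 + `|s - cy| / l) ^+ 4) / (l * Num.sqrt l) * `|s - cy|.
  apply: lip => w hw; apply: (le_trans (dkX_le _ l0 (isT : (4 <= 10)%N))).
  rewrite -exprMn lerXn2r ?nnegrE ?dk_ge0 //.
    by rewrite mulr_ge0 // ltW // dk_den0.
  apply: (le_trans (dk_peetre (cy - cx) (w - cx) l0)); rewrite ler_wpM2l // lerD2l.
  rewrite ler_wpM2r ?invr_ge0 ?(ltW l0) //; apply: le_trans hw.
  by rewrite opprB addrA subrK distrC.
have sf : sqi f by exact: (packet_sqi lp0 A0 (isT : (1 <= 10)%N) pf).
have sg : sqi g by exact: (packet_sqi l0 A0 (isT : (1 <= 10)%N) pg).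
pose G s := (f s - smear s) * e s.
have mG : cmeasurable G.
  apply: cmeasM => //; apply: cmeasD => //.
  rewrite (_ : (fun x => - smear x) = (fun x => (- 1) * smear x)); last first.
    by apply/funext => x; rewrite mulN1r.
  by apply: cmeasM; [exact: cmeas_cst | exact: smear_meas].
have bG s : cabs (G s) <= A / Num.sqrt lp * dk lp (s - cy) ^+ 10 + 4 * A * Num.sqrt lp * box s.
  rewrite /G cabsM expi_unit mulr1; apply: (le_trans (cabsD _ _)); rewrite cabsN.
  by apply: lerD; [exact: bf | exact: smear_le].
have iG : intg (fun s => A / Num.sqrt lp * dk lp (s - cy) ^+ 10 + 4 * A * Num.sqrt lp * box s).
  apply: intgD; apply: intgZ; last exact: box_intg.
  exact: dk_intg.
have cG : cintg G := cintg_le mG iG bG.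
have G0 : cint G = 0.
  have c1 : cintg (fun s => f s * e s).
    apply: (cintg_le (cmeasM mf me) (intgZ (A / Num.sqrt lp) (dk_intg cy lp0 (isT : (2 <= 10)%N)))) => s.
    by rewrite cabsM expi_unit mulr1.
  have cb : cintg (fun s => rc (box s)).
    apply: (cintg_le _ box_intg) => [|s]; first by apply: cmeasR; exact: intg_meas box_intg.
    by rewrite cabs_rc ger0_norm // box_ge0.
  have -> : G = (fun s => f s * e s + (- ft f xi) * rc (box s)).
    apply/funext => s; rewrite /G mulrBl /smear /e; congr (_ + _).
    rewrite -(mulrA (ft f xi * _)) -expiD; have -> : 2 * pi * (xi * s) + - (2 * pi * xi * s) = 0 by ring.
    by rewrite expi0 mulr1 mulNr.
  rewrite cintD //; last exact: cintgZ.
  rewrite cintZ // cint_rc box_Rint.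
  have -> : rc 1 = 1 :> C by [].
  rewrite mulr1; have -> : ft f xi = cint (fun s => f s * e s).
    by apply: eq_cint => s; congr (_ * expi _); ring.
  by rewrite subrr.
have E : ip f g - ip smear g = cint (fun s => G s * (ph s - ph cy)^*).
  have cfs := sqi_prod sf sg; have css := sqi_prod smear_sqi sg.
  have -> : (fun s => G s * (ph s - ph cy)^*) =
      (fun s => (f s * (g s)^* + (- 1) * (smear s * (g s)^*)) + (- (ph cy)^*) * G s).
    apply/funext => s; rewrite /ph cJD cJN cJM /G.
    have -> : (e s)^* = expi (2 * pi * xi * s) by rewrite /e -expiN opprK.
    have ee : e s * expi (2 * pi * xi * s) = 1 by rewrite -expiD addNr expi0.
    rewrite mulrBr; congr (_ + _); last by rewrite mulNr mulrC.
    transitivity ((f s - smear s) * (e s * expi (2 * pi * xi * s)) * (g s)^*); first by ring.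
    by rewrite ee; ring.
  rewrite cintD; [|exact: cintgD cfs (cintgZ (-1) css)|exact: cintgZ].
  rewrite cintD //; last exact: cintgZ.
  by rewrite !cintZ // G0 mulr0 addr0 mulN1r.
have kk : 0 <= B * d ^+ 4 / (l * Num.sqrt l).
  by apply: divr_ge0; [exact: mulr_ge0 B0 (exprn_ge0 _ d0) | exact: mulr_ge0 (ltW l0) (ltW sl)].
have mph : cmeasurable (fun s => (ph s - ph cy)^*).
  by apply: cmeasJ; apply: cmeasD; [exact: cmeasM | exact: cmeas_cst].
have ih := intgZ (B * d ^+ 4 / (l * Num.sqrt l)) (intgD (intgZ (A * Num.sqrt lp) (dk2_intg cy lp0))
  (intgZ (4 * A * Num.sqrt lp * lam) box_intg)).
rewrite E; apply: (le_trans (cint_le (cmeasM mG mph) ih _)).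
  move=> s; rewrite cabsM cabsJ.
  apply: (le_trans (ler_pM (cabs_ge0 _) (cabs_ge0 _) (bG s) (lip' s))).
  set q := `|s - cy|; set w := 1 + q / l.
  have q0 : 0 <= q by exact: normr_ge0.
  have w0 : 0 <= w by rewrite addr_ge0 // divr_ge0 // ltW.
  have -> : (A / Num.sqrt lp * dk lp (s - cy) ^+ 10 + 4 * A * Num.sqrt lp * box s) *
    (B * (d ^+ 4 * w ^+ 4) / (l * Num.sqrt l) * q) = B * d ^+ 4 / (l * Num.sqrt l) *
     (A / Num.sqrt lp * (dk lp (s - cy) ^+ 10 * w ^+ 4 * q) + 4 * A * Num.sqrt lp * (box s * (w ^+ 4 * q))).
    by field; rewrite !lt0r_neq0.
  apply: ler_wpM2l => //; apply: lerD.
    have -> : A * Num.sqrt lp * dk lp (s - cy) ^+ 2 =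
        A / Num.sqrt lp * (lp * dk lp (s - cy) ^+ 2).
      by rewrite -[X in _ = _ * (X * _)](sqr_sqrtr (ltW lp0)); field; exact: lt0r_neq0.
    apply: ler_wpM2l; first by rewrite divr_ge0 // ltW.
    set dd := dk lp (s - cy); have dd0 : 0 <= dd by exact: dk_ge0.
    have dw : dd * w <= 1.
      rewrite /dd /dk mulrC ler_pdivrMr ?dk_den0 // mul1r /w lerD2l /q.
      by rewrite ler_wpM2l // lef_pV2 ?posrE // (le_trans lpl).
    have dq : dd * q <= lp.
      rewrite /dd /dk mulrC ler_pdivrMr ?dk_den0 // mulrDr mulr1 -/q.
      have -> : lp * (q / lp) = q by field; exact: lt0r_neq0.
      by rewrite lerDr ltW.
    have -> : dd ^+ 10 * w ^+ 4 * q = (dd ^+ 3 * (dd * w) ^+ 4 * (dd * q)) * dd ^+ 2 by ring.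
    rewrite ler_wpM2r ?sqr_ge0 //.
    have x0 : 0 <= dd * w by exact: mulr_ge0.
    have x1 : dd ^+ 3 * (dd * w) ^+ 4 <= 1.
      by rewrite mulr_ile1 ?exprn_ge0 ?exprn_ile1 // dk_le1.
    apply: le_trans dq; rewrite ler_piMl ?mulr_ge0 //.
  have [->|/box_supp bs] := eqVneq (box s) 0; first by rewrite !mul0r !mulr0.
  have -> : 4 * A * Num.sqrt lp * lam * box s = 4 * A * Num.sqrt lp * (box s * lam) by ring.
  apply: ler_wpM2l; first by rewrite !mulr_ge0 // ltW.
  apply: ler_wpM2l; first exact: box_ge0.
  have w1 : w <= 5 / 4.
    rewrite /w; have : q / l <= 1 / 4; last by lra.
    rewrite ler_pdivrMr //; move: bs; rewrite -/q; lra.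
  have w4 : w ^+ 4 <= 4.
    apply: (@le_trans _ _ ((5 / 4) ^+ 4)); first by rewrite lerXn2r ?nnegrE ?divr_ge0.
    have -> : (5 / 4 : R) ^+ 4 = 5 / 4 * (5 / 4 * (5 / 4 * (5 / 4))) by ring.
    lra.
  have := ler_pM (exprn_ge0 4 w0) q0 w4 (bs : q <= lam / 4); lra.
rewrite RintegralZl //; last first.
  apply: intgD; apply: intgZ; [exact: dk2_intg | exact: box_intg].
rewrite RintegralD //; [|exact/intgZ/dk2_intg|exact/intgZ/box_intg].
rewrite RintegralZl //; last exact: dk2_intg.
rewrite RintegralZl //; last exact: box_intg.
rewrite dk2_Rint // box_Rint mulr1.
have le2 : A * Num.sqrt lp * (2 * lp) + 4 * A * Num.sqrt lp * lam <= 6 * A * Num.sqrt lp * lam.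
  have : 0 <= A * Num.sqrt lp by rewrite mulr_ge0 // ltW.
  by move/ler_wpM2l => /(_ _ _ lpl); lra.
have := ler_wpM2l kk le2.
have -> : B * d ^+ 4 / (l * Num.sqrt l) * (6 * A * Num.sqrt lp * lam) =
  6 * A * B * (Num.sqrt lp / Num.sqrt l) * (lam / l) * d ^+ 4 by field; rewrite !lt0r_neq0.
lra.
Qed.
End Smear.

(** * Size of the coefficients *)

Section Sizes.
Variable R : realType.
Local Notation mu := (@lebesgue_measure R).
Local Notation C := R[i].
Variables (X Y : finType) (T : X -> tritile R) (TP : Y -> tritile R).
Variables (c : R) (K L : nat) (Ck : nat -> R) (Phi : X -> 'I_3 -> R -> C) (PhiP : Y -> R -> C).
Hypothesis MD : model T TP c K L Ck Phi PhiP.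
Local Notation a := (qa T).
Local Notation l := (ql T).
Local Notation u := (qu T).
Local Notation pb := (pb TP).
Local Notation pl := (pl TP).
Local Notation pv := (pv TP).
Local Notation rel := (prel T TP c).
Local Notation gc := (packet_cst Ck).
Let l0 := ts_gt0 (md_ts MD).
Let lp0 := md_pl MD.
Let Ck0 := md_Ck MD.

Local Notation exc := (exc T TP c).
Variable z : Y -> C.
Hypothesis hz : forall y, cabs (z y) = Num.sqrt (pl y).
Local Notation coef := (coef T TP c Phi PhiP z).
Let A0 : 0 <= Ck 0%N. Proof. exact: ltW. Qed.

Section Tree.
Variables (i : 'I_3) (t : X) (Q : {set X}).
Hypothesis ni : i2 != i.
Local Notation tree := (tree T i t Q).
Local Notation tpart := (tpart T TP t).
Local Notation cp := (cen pb pl).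
Local Notation cq := (cen a l).

Lemma wgt_packet y : packet (2 * Ck 0%N * dk (l t) (cp y - cq t) ^+ 2) (pl y) (cp y) 8
  (fun x => rc (wgt (cq t) (l t) x)^-1 * PhiP y x) \/ l t < pl y.
Proof.
case: (lerP (pl y) (l t)) => le; [left | by right].
have [mf bf] := PhiP_packet MD y (isT : (10 <= 10)%N); split.
  by apply: cmeasM => //; apply: cmeasR; exact: wgt_inv_meas.
move=> x; rewrite cabsM cabs_rc ger0_norm ?invr_ge0 ?(ltW (wgt_gt0 _ _ _)) //.
have w0 : 0 <= (wgt (cq t) (l t) x)^-1 by rewrite invr_ge0 ltW // wgt_gt0.
apply: (le_trans (ler_pM w0 (cabs_ge0 _) (wgt_inv_dk _ _ (l0 t)) (bf x))).
set d1 := dk (l t) _; set d2 := dk (pl y) _; set d3 := dk (l t) _.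
have d10 : 0 <= d1 by exact: dk_ge0. have d20 : 0 <= d2 by exact: dk_ge0.
have : d2 * d1 <= d3.
  have := dkM (cp y - x) (x - cq t) (lp0 y) le.
  by rewrite dkC addrA subrK.
move=> h; have h2 : (d2 * d1) ^+ 2 <= d3 ^+ 2 by rewrite lerXn2r ?nnegrE ?mulr_ge0 // (le_trans _ h) ?mulr_ge0.
have sp : 0 < Num.sqrt (pl y) by rewrite sqrtr_gt0.
have -> : 2 * d1 ^+ 2 * (Ck 0%N / Num.sqrt (pl y) * d2 ^+ 10) =
  2 * Ck 0%N / Num.sqrt (pl y) * d2 ^+ 8 * (d2 * d1) ^+ 2 by field; exact: lt0r_neq0.
have -> : 2 * Ck 0%N * d3 ^+ 2 / Num.sqrt (pl y) * d2 ^+ 8 =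
  2 * Ck 0%N / Num.sqrt (pl y) * d2 ^+ 8 * d3 ^+ 2 by field; exact: lt0r_neq0.
by apply: ler_wpM2l => //; rewrite mulr_ge0 ?exprn_ge0 // divr_ge0 ?mulr_ge0 // ltW.
Qed.

Lemma tpart_le y : y \in tpart -> pl y <= l t.
Proof. by rewrite finset.in_set => /andP[]. Qed.

Lemma flat_norm : Rintegral mu setT (fun x =>
    (cabs (\sum_(y in tpart) z y * PhiP y x) / wgt (cq t) (l t) x) ^+ 2) <= 512 * gc * l t.
Proof.
pose F y := fun x => rc (wgt (cq t) (l t) x)^-1 * PhiP y x.
have -> : (fun x => (cabs (\sum_(y in tpart) z y * PhiP y x) / wgt (cq t) (l t) x) ^+ 2) =
    (fun x => cabs (\sum_(y in tpart) z y * F y x) ^+ 2).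
  apply/funext => x; congr (_ ^+ 2).
  have -> : \sum_(y in tpart) z y * F y x = rc (wgt (cq t) (l t) x)^-1 * \sum_(y in tpart) z y * PhiP y x.
    by rewrite mulr_sumr; apply: eq_bigr => y _; rewrite /F mulrCA.
  by rewrite cabsM cabs_rc ger0_norm ?invr_ge0 ?(ltW (wgt_gt0 _ _ _)) // mulrC.
rewrite -ip_norm.
have pk y : y \in tpart -> packet (2 * Ck 0%N * dk (l t) (cp y - cq t) ^+ 2) (pl y) (cp y) 8 (F y).
  by move=> /tpart_le le; case: (wgt_packet y) => // /(le_lt_trans le); rewrite ltxx.
have w01 y : 0 <= dk (l t) (cp y - cq t) ^+ 2 <= 1 by rewrite dkX_ge0 ?dkX_le1.
have AA y : 0 <= 2 * Ck 0%N * dk (l t) (cp y - cq t) ^+ 2.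
  by apply: mulr_ge0; [apply: mulr_ge0 | exact: dkX_ge0].
have := @disjoint_norm R Y tpart pb pl (fun _ _ => true) (fun y => dk (l t) (cp y - cq t) ^+ 2)
  (4 * gc) z F lp0 _ w01 hz.
move=> H; apply: (le_trans (H _ _ _ _ _)).
- by rewrite mulr_ge0 // ltW // (packet_cst_gt0 MD).
- by move=> y /pk; exact: (packet_sqi (lp0 y) (AA y) (isT : (1 <= 8)%N)).
- by move=> y y1 y2 _ h1 h2 _ _ _ _; exact: (tpart_disj MD h1 h2).
- by [].
- move=> y y' yS y'S le.
  apply: (le_trans (packet_gram (N := 6) (lp0 y) le (AA y) (AA y') (pk y yS) (packet_le (lp0 y') (AA y') (isT : (6 <= 8)%N) (pk y' y'S)))).
  have [w0 w1] := andP (w01 y); have [w0' w1'] := andP (w01 y').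
  set w := dk (l t) (cp y - cq t) ^+ 2 in w0 w1 *; set w' := dk (l t) (cp y' - cq t) ^+ 2 in w0' w1' *.
  set q := _ / _; have q0 : 0 <= q by rewrite divr_ge0 ?sqrtr_ge0.
  have d1 : dk (pl y') (cp y - cp y') ^+ 6 <= dk (pl y') (cp y - cp y') ^+ 2 by exact: dkX_le.
  have -> : 4 * (2 * Ck 0%N * w) * (2 * Ck 0%N * w') * q * dk (pl y') (cp y - cp y') ^+ 6 =
    4 * gc * w' * q * (w * dk (pl y') (cp y - cp y') ^+ 6) by rewrite /gc /packet_cst; ring.
  apply: ler_wpM2l.
    by apply: mulr_ge0 => //; apply: mulr_ge0 => //; rewrite mulr_ge0 // ltW // (packet_cst_gt0 MD).
  by apply: le_trans d1; rewrite ler_piMl // dkX_ge0.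
have := tpart_sum MD (x := t) (fintype.subxx _) tpart_le.
rewrite (eq_bigr (fun y => dk (l t) (cp y - cq t) ^+ 2 * pl y)); last by move=> y _; rewrite mulrC.
have g0 : 0 <= 16 * (4 * gc) by rewrite !mulr_ge0 // ltW // (packet_cst_gt0 MD).
by move/(ler_wpM2l g0); lra.
Qed.

Definition cst_flat := 2 * (8 * bes Ck * (512 * gc) + 64 * (8 * gc) ^+ 2) +
  2 * (4 * gc ^+ 2 * 8 ^+ 2 * (16 / c + 16)).

Lemma size_flat : \sum_(x in tree) cabs (coef x) ^+ 2 <= cst_flat * l t.
Proof.
have g0 := ltW (packet_cst_gt0 MD); have c0 := c_gt0 MD.
pose H x := \sum_(y in tpart) z y * PhiP y x.
have ipH x : ip H (Phi x i2) = \sum_(y in tpart) z y * ip (PhiP y) (Phi x i2).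
  apply: ip_suml; last exact: (Phi_sqi (md_ts MD) (md_L MD) Ck0 (md_wp MD)).
  by move=> y _; exact: (PhiP_sqi MD).
have sub8 x (S : {set Y}) (k : Y -> R) : S \subset tpart -> (forall y, 0 <= k y <= 1) ->
    (forall y, y \in S -> pl y <= l x \/ k y = 0) ->
    \sum_(y in S) pl y * k y * dk (l x) (cp y - cq x) ^+ 4 <= 8 * l x.
  move=> SS k01 hS.
  apply: (@le_trans _ _ (\sum_(y in [set y in S | pl y <= l x]) pl y * dk (l x) (cp y - cq x) ^+ 2)).
    rewrite [leRHS](eq_bigl (fun y => (y \in S) && (pl y <= l x))); last by move=> y; rewrite finset.in_set.
    rewrite [leRHS]big_mkcondr; apply: ler_sum => y yS; have [k0 k1] := andP (k01 y).
    case: (lerP (pl y) (l x)) => le.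
      apply: (@le_trans _ _ (pl y * dk (l x) (cp y - cq x) ^+ 4)).
        by rewrite ler_wpM2r ?dkX_ge0 // ler_piMr // ltW.
      by rewrite ler_wpM2l ?(ltW (lp0 y)) // dkX_le.
    by case: (hS y yS) => [/(lt_le_trans le)|->]; rewrite ?ltxx // mulr0 mul0r.
  apply: (tpart_sum MD).
    apply: fintype.subset_trans SS; apply/fintype.subsetP => y; by rewrite finset.in_set => /andP[].
  by move=> y; rewrite finset.in_set => /andP[].
have := @size_abs R X Y T TP c K L Ck Phi PhiP MD z i t Q ni H (fun y x => (exc y x)%:R)
  (8 * gc) (512 * gc * l t) 8 gc (16 / c + 16).
have -> : 2 * (8 * bes Ck * (512 * gc * l t) + 64 * (8 * gc) ^+ 2 * l t) +
    2 * (4 * gc ^+ 2 * 8 ^+ 2 * (16 / c + 16) * l t) = cst_flat * l t by rewrite /cst_flat; ring.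
apply.
- by rewrite mulr_ge0.
- by [].
- exact: g0.
- by rewrite addr_ge0 // divr_ge0 // ltW.
- by apply: sqi_sum => y _; apply: sqiZ; exact: (PhiP_sqi MD).
- by move=> y x; rewrite ler0n.
- move=> x xT; rewrite ipH; have sl : 0 < Num.sqrt (l x) by rewrite sqrtr_gt0.
  pose k y : R := (pl y <= l x)%R%:R.
  apply: (@le_trans _ _ (gc / Num.sqrt (l x) * \sum_(y in tpart) pl y * k y * dk (l x) (cp y - cq x) ^+ 4)).
    apply: (le_trans (cabs_sum _ _ _)); rewrite mulr_sumr; apply: ler_sum => y yS; rewrite /k.
    case: (lerP (pl y) (l x)) => le; first by rewrite mulr1; exact: (pair_le MD hz le).
    rewrite (ipPQ_orth MD) ?mulr0 ?cabs0 ?mul0r ?mulr0 // leNgt; apply/negP => meet.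
    by have := tpart_meet MD ni xT yS meet; rewrite leNgt le.
  have := sub8 x tpart k (fintype.subxx _) _ _.
  have k1 y : 0 <= k y <= 1 by rewrite /k ler0n lern1 leq_b1.
  have k2 y : y \in tpart -> pl y <= l x \/ k y = 0 by rewrite /k; case: (pl y <= l x); [left | right].
  move=> /(_ k1 k2) h; have gs : 0 <= gc / Num.sqrt (l x) by rewrite divr_ge0 // ltW.
  apply: (le_trans (ler_wpM2l gs h)).
  rewrite -[X in _ * (8 * X)](sqr_sqrtr (ltW (l0 x))) le_eqVlt; apply/orP; left; apply/eqP.
  by field; exact: lt0r_neq0.
- exact: flat_norm.
- move=> x xT; rewrite (coef_exc MD z ni xT) ipH addrAC subrr add0r cabsN.
  exact: (exc_le MD hz).
- move=> x xT; apply: sub8; rewrite ?fintype.subxx //.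
    by move=> y; rewrite ler0n lern1 leq_b1.
  move=> y _; case: (boolP (exc y x)) => [/and3P[_ le _]|_]; [by left | by right].
- exact: (tpart_sum MD (fintype.subxx _) tpart_le).
- by move=> y yS; exact: (exc_sum MD Q ni yS).
Qed.

Definition lipc := 2 * Ck 1%N + 16 * (5 * 10 ^+ 6) * Ck 0%N.
Definition errc := 12 * Ck 0%N * lipc + gc + 40 * Ck 0%N ^+ 2.
Definition cst_smear := 2 * (8 * bes Ck * ((56 * Ck 0%N) ^+ 2 * 8) + 64 * (56 * gc) ^+ 2) +
  2 * (4 * (errc + gc) ^+ 2 * 16 ^+ 2 * (32 + (16 / c + 16))).

Lemma size_smear (d : R) : 0 < d -> d <= 1 / 4 ->
  {in tree, forall x, lev [set: Y]%SET cp pl d (cq x) (l x)} ->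
  lev [set: Y]%SET cp pl d (cq t) (l t) ->
  \sum_(x in tree) cabs (coef x) ^+ 2 <= cst_smear * d ^+ 2 * l t.
Proof.
move=> d0 d4 lvx lvt; have g0 := ltW (packet_cst_gt0 MD); have c0 := c_gt0 MD.
have b0 := bes_gt0 Ck0.
have C10 : 0 <= Ck 1%N by exact: ltW.
have lip0 : 0 <= lipc.
  rewrite addr_ge0 ?mulr_ge0 // exprn_ge0 //.
have err0 : 0 <= errc by rewrite /errc !addr_ge0 ?mulr_ge0 ?sqr_ge0.
have D00 : 0 <= 16 / c + 16 by rewrite addr_ge0 // divr_ge0 // ltW.
have cst0 : 0 <= cst_smear.
  apply: addr_ge0.
    apply: mulr_ge0 => //; apply: addr_ge0; last by rewrite mulr_ge0 ?sqr_ge0.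
    by apply: mulr_ge0; [rewrite mulr_ge0 // ltW | rewrite mulr_ge0 ?sqr_ge0].
  apply: mulr_ge0 => //; apply: mulr_ge0; last by rewrite addr_ge0.
  by rewrite mulr_ge0 ?exprn_ge0 // mulr_ge0 ?exprn_ge0 // addr_ge0.
have [tz|[x1 x1T]] := set_0Vmem tree.
  by rewrite tz big_set0 !mulr_ge0 ?sqr_ge0 // ltW.
pose g y x := Num.max (l x) `|cp y - cq x|.
pose xm y := [arg min_(x < x1 in tree) g y x]%O.
pose lam y := g y (xm y).
have xmP y : xm y \in tree /\ {in tree, forall x, lam y <= g y x}.
  by rewrite /lam /xm; case: Order.TotalTheory.arg_minP => // x xS h; split.
have lam_gt0 y : 0 < lam y by rewrite /lam /g lt_max l0.
have lam_lip y y' : lam y <= lam y' + `|cp y - cp y'|.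
  have [hm _] := xmP y'; have [_ h] := xmP y; apply: (le_trans (h _ hm)).
  rewrite /lam /g ge_max; apply/andP; split.
    by apply: ler_wpDr => //; rewrite le_max lexx.
  have := norm_tri (cp y) (cp y') (cq (xm y')).
  have : `|cp y' - cq (xm y')| <= Num.max (l (xm y')) `|cp y' - cq (xm y')| by rewrite le_max lexx orbT.
  lra.
have lam_mass y : mass [set: Y]%SET cp pl (cp y) (lam y) <= 4 * d * lam y.
  have [hm _] := xmP y.
  apply: (lev_ball (fun y => ltW (lp0 y)) (l0 (xm y)) (ltW d0) (lvx _ hm)).
    by rewrite /lam /g le_max lexx.
  by rewrite /lam /g le_max lexx orbT.
have pl_lam y : pl y <= lam y.
  apply: (@le_trans _ _ (4 * d * lam y)); last first.
    by rewrite ler_piMl ?(ltW (lam_gt0 y)) //; lra.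
  apply: le_trans (lam_mass y); rewrite /mass (bigD1 y) /=; last first.
    by rewrite inE subrr normr0 ltW.
  by rewrite lerDl; apply: sumr_ge0 => y' _; exact: ltW.
pose xi := u i2 t.
have pkP y : packet (Ck 0%N) (pl y) (cp y) 10 (PhiP y) by exact: (PhiP_packet MD).
have pkQ x : packet (Ck 0%N) (l x) (cq x) 10 (Phi x i2).
  exact: (Phi_packet (md_ts MD) (md_L MD) Ck0 (md_wp MD)).
pose sm y := smear (PhiP y) (cp y) (lam y) xi.
have sms y : sqi (sm y) by exact: (smear_sqi xi A0 (lp0 y) (pl_lam y) (pkP y)).
pose H s := \sum_(y in tpart) z y * sm y s.
have sH : sqi H by apply: sqi_sum => y _; exact/sqiZ/sms.
have Hsup s : cabs (H s) <= 56 * Ck 0%N * d.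
  pose B := [set y in tpart | `|s - cp y| <= lam y / 4].
  apply: (@le_trans _ _ (8 * Ck 0%N * \sum_(y in B) pl y / lam y)).
    apply: (le_trans (cabs_sum _ _ _)); rewrite mulr_sumr.
    rewrite [leRHS](eq_bigl (fun y => (y \in tpart) && (`|s - cp y| <= lam y / 4))); last first.
      by move=> y; rewrite finset.in_set.
    rewrite [leRHS]big_mkcondr; apply: ler_sum => y yS.
    have sml := smear_le xi A0 (lp0 y) (pl_lam y) (pkP y) s.
    rewrite cabsM hz; apply: (le_trans (ler_wpM2l (sqrtr_ge0 _) sml)).
    have [bz|/(box_supp) bs] := eqVneq (box (cp y) (lam y) s) 0.
      rewrite bz !mulr0; case: ifP => // _; rewrite !mulr_ge0 ?invr_ge0 ?ltW //.
    rewrite bs; have bl := box_le (cp y) (lp0 y) (pl_lam y) s.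
    have -> : Num.sqrt (pl y) * (4 * Ck 0%N * Num.sqrt (pl y) * box (cp y) (lam y) s) =
      4 * Ck 0%N * (Num.sqrt (pl y) ^+ 2) * box (cp y) (lam y) s by ring.
    rewrite sqr_sqrtr ?(ltW (lp0 y)) //.
    have p : 0 <= 4 * Ck 0%N * pl y by rewrite !mulr_ge0 // ltW.
    by apply: (le_trans (ler_wpM2l p bl)); rewrite le_eqVlt; apply/orP; left; apply/eqP; ring.
  have [->|[y0 y0B]] := set_0Vmem B.
    by rewrite big_set0 mulr0 !mulr_ge0 // ltW.
  have inB y : y \in B -> `|s - cp y| <= lam y / 4 by rewrite finset.in_set => /andP[].
  have close y : y \in B -> `|cp y - cp y0| <= lam y0 /\ 3 / 5 * lam y0 <= lam y.
    move=> /inB h; have h0 := inB _ y0B.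
    have := norm_tri (cp y) s (cp y0); rewrite (distrC (cp y) s) => t1.
    have l1 := lam_lip y y0; have l2 := lam_lip y0 y; rewrite (distrC (cp y0)) in l2.
    by split; lra.
  have : \sum_(y in B) pl y / lam y <= \sum_(y in B) (5 / 3 / lam y0) * pl y.
    apply: ler_sum => y /close[_ h]; rewrite mulrC ler_wpM2r ?(ltW (lp0 y)) //.
    have -> : 5 / 3 / lam y0 = (3 / 5 * lam y0)^-1 by field; exact: lt0r_neq0.
    by rewrite lef_pV2 ?posrE // mulr_gt0.
  rewrite -mulr_sumr => h1.
  have h2 : \sum_(y in B) pl y <= 4 * d * lam y0.
    apply: le_trans (lam_mass y0); rewrite /mass [leLHS]big_mkcond [leRHS]big_mkcond.
    apply: ler_sum => y _; rewrite finset.in_setT /=; case: (boolP (y \in B)) => yB.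
      by rewrite (close _ yB).1.
    by case: ifP => // _; exact: ltW.
  have k0 : 0 <= 5 / 3 / lam y0 by rewrite !mulr_ge0 ?invr_ge0 // ltW.
  have h3 := le_trans h1 (ler_wpM2l k0 h2).
  have k1 : 0 <= 8 * Ck 0%N by rewrite mulr_ge0.
  apply: (le_trans (ler_wpM2l k1 h3)).
  have -> : 8 * Ck 0%N * (5 / 3 / lam y0 * (4 * d * lam y0)) = 160 / 3 * (Ck 0%N * d).
    by field; exact: lt0r_neq0.
  have : 0 <= Ck 0%N * d by rewrite mulr_ge0 // ltW.
  lra.
have err_le x y : x \in tree -> y \in tpart ->
    cabs (z y * ip (PhiP y) (Phi x i2) - z y * ip (sm y) (Phi x i2)) <=
    errc / Num.sqrt (l x) * (pl y * Num.min (lam y / l x) (l x / lam y) * dk (l x) (cp y - cq x) ^+ 4).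
  move=> xT yS; have sl : 0 < Num.sqrt (l x) by rewrite sqrtr_gt0.
  have dx0 : 0 <= dk (l x) (cp y - cq x) by exact: dk_ge0.
  rewrite -mulrBr cabsM hz.
  have mono (e : R) m : 0 <= m -> e <= errc -> 0 <= e ->
     e / Num.sqrt (l x) * (pl y * m * dk (l x) (cp y - cq x) ^+ 4) <=
     errc / Num.sqrt (l x) * (pl y * m * dk (l x) (cp y - cq x) ^+ 4).
    move=> m0 e1 e0; rewrite ler_wpM2r ?mulr_ge0 ?exprn_ge0 ?(ltW (lp0 y)) //.
    by rewrite ler_wpM2r // invr_ge0 ltW.
  case: (lerP (lam y) (l x)) => le.
    have /andP[_ lac] := tree_lac MD ni xT.
    have hL s D : (forall w, `|w - cp y| <= `|s - cp y| -> dk (l x) (w - cq x) ^+ 10 <= D) ->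
        cabs (expi (- (2 * pi * xi * s)) * Phi x i2 s - expi (- (2 * pi * xi * cp y)) * Phi x i2 (cp y)) <=
        lipc * D / (l x * Num.sqrt (l x)) * `|s - cp y|.
      move=> hD; apply: (wave_packet_lip (P := tcomp (T x) i2) (l0 x) (md_K MD) Ck0 (md_wp MD x i2) lac) => w /hD.
      by apply: le_trans; apply: dkX_le; [exact: l0 | exact: (md_L MD)].
    have := smear_near A0 (lp0 y) (pl_lam y) (pkP y) (l0 x) (pkQ x) lip0 le hL.
    move=> h; apply: (le_trans (ler_wpM2l (sqrtr_ge0 _) h)).
    have -> : Num.sqrt (pl y) * (12 * Ck 0%N * lipc * (Num.sqrt (pl y) / Num.sqrt (l x)) * (lam y / l x) *
       dk (l x) (cp y - cq x) ^+ 4) = 12 * Ck 0%N * lipc / Num.sqrt (l x) *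
       (Num.sqrt (pl y) ^+ 2 * (lam y / l x) * dk (l x) (cp y - cq x) ^+ 4) by ring.
    rewrite sqr_sqrtr ?(ltW (lp0 y)) // min_l; last first.
      rewrite ler_pdivlMr // mulrAC ler_pdivrMr // -!expr2.
      by rewrite lerXn2r ?nnegrE ?(ltW (lam_gt0 y)) ?(ltW (l0 x)).
    apply: mono; [by rewrite divr_ge0 ?(ltW (lam_gt0 y)) ?(ltW (l0 x)) | | by rewrite !mulr_ge0].
    rewrite /errc; have c2 : 0 <= Ck 0%N ^+ 2 by exact: sqr_ge0.
    by move: (12 * Ck 0%N * lipc) => w; lra.
  have far : lam y <= `|cp y - cq x|.
    have [_ h] := xmP y; have := h _ xT; rewrite /g le_max => /orP[h'|//].
    by move: le; rewrite ltNge h'.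
  have dd : dk (l x) (cp y - cq x) <= l x / lam y by exact: dk_small.
  have lx0 : 0 <= l x / lam y by rewrite divr_ge0 // ltW.
  rewrite min_r; last first.
    by rewrite ler_pdivlMr // mulrAC ler_pdivrMr // -!expr2 lerXn2r ?nnegrE ?(ltW (lam_gt0 y)) ?(ltW (l0 x)) ?(ltW le).
  have h2 := smear_far xi A0 (lp0 y) (pl_lam y) (pkP y) (l0 x) (pkQ x) far.
  have h1 : cabs (ip (PhiP y) (Phi x i2)) <=
      gc * (Num.sqrt (pl y) / Num.sqrt (l x)) * dk (l x) (cp y - cq x) ^+ 5.
    case: (lerP (pl y) (l x)) => pq.
      apply: (le_trans (ipPQ_le MD i2 pq)); rewrite ler_wpM2l ?dkX_le //.
      by rewrite mulr_ge0 // divr_ge0 ?sqrtr_ge0.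
    rewrite (ipPQ_orth MD) ?cabs0; last first.
      by rewrite leNgt; apply/negP => meet; have := tpart_meet MD ni xT yS meet; rewrite leNgt pq.
    apply: mulr_ge0; last exact: exprn_ge0.
    by apply: mulr_ge0 => //; rewrite divr_ge0 ?sqrtr_ge0.
  have h3 : cabs (ip (PhiP y) (Phi x i2) - ip (sm y) (Phi x i2)) <=
     (gc + 40 * Ck 0%N ^+ 2) * (Num.sqrt (pl y) / Num.sqrt (l x)) * (l x / lam y * dk (l x) (cp y - cq x) ^+ 4).
    apply: (le_trans (cabsD _ _)); rewrite cabsN.
    apply: (le_trans (lerD h1 h2)).
    set q := Num.sqrt (pl y) / Num.sqrt (l x); have q0 : 0 <= q by rewrite divr_ge0 ?sqrtr_ge0.
    set e := dk (l x) _ in dx0 dd *.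
    have -> : gc * q * e ^+ 5 + 40 * Ck 0%N ^+ 2 * q * e ^+ 5 =
      (gc + 40 * Ck 0%N ^+ 2) * q * (e * e ^+ 4) by ring.
    apply: ler_wpM2l; first by rewrite mulr_ge0 // addr_ge0 // mulr_ge0 ?sqr_ge0.
    by rewrite ler_wpM2r ?exprn_ge0.
  apply: (le_trans (ler_wpM2l (sqrtr_ge0 _) h3)).
  have -> : Num.sqrt (pl y) * ((gc + 40 * Ck 0%N ^+ 2) * (Num.sqrt (pl y) / Num.sqrt (l x)) *
     (l x / lam y * dk (l x) (cp y - cq x) ^+ 4)) = (gc + 40 * Ck 0%N ^+ 2) / Num.sqrt (l x) *
     (Num.sqrt (pl y) ^+ 2 * (l x / lam y) * dk (l x) (cp y - cq x) ^+ 4) by ring.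
  rewrite sqr_sqrtr ?(ltW (lp0 y)) //; apply: mono => //.
    by rewrite /errc; have := mulr_ge0 (mulr_ge0 (ler0n R 12) A0) lip0; lra.
  by rewrite addr_ge0 // mulr_ge0 ?sqr_ge0.
have ipH x : ip H (Phi x i2) = \sum_(y in tpart) z y * ip (sm y) (Phi x i2).
  apply: ip_suml; last exact: (Phi_sqi (md_ts MD) (md_L MD) Ck0 (md_wp MD)).
  by move=> y _; exact: sms.
pose k y x := Num.min (lam y / l x) (l x / lam y) + (exc y x)%:R.
have k0 y x : 0 <= k y x.
  by rewrite addr_ge0 ?ler0n // le_min !divr_ge0 // ltW.
have min1 y x : Num.min (lam y / l x) (l x / lam y) <= 1.
  rewrite ge_min; case: (lerP (lam y) (l x)) => h; apply/orP; [left|right];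
  by rewrite ler_pdivrMr // mul1r // ltW.
have lvs x : lev [set: Y]%SET cp pl d (cq x) (l x) ->
    \sum_(y in tpart) pl y * dk (l x) (cp y - cq x) ^+ 2 <= 8 * d * l x.
  move=> lv; apply: le_trans (lev_dk (fun y => ltW (lp0 y)) (l0 x) (ltW d0) lv).
  rewrite [leLHS]big_mkcond [leRHS]big_mkcond; apply: ler_sum => y _; rewrite finset.in_setT.
  by case: ifP => // _; rewrite mulr_ge0 ?dkX_ge0 // ltW.
have := @size_abs R X Y T TP c K L Ck Phi PhiP MD z i t Q ni H k
  (56 * gc * d) ((56 * Ck 0%N * d) ^+ 2 * (8 * l t)) (16 * d) (errc + gc) (32 + (16 / c + 16)).
have -> : 2 * (8 * bes Ck * ((56 * Ck 0%N * d) ^+ 2 * (8 * l t)) + 64 * (56 * gc * d) ^+ 2 * l t) +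
    2 * (4 * (errc + gc) ^+ 2 * (16 * d) ^+ 2 * (32 + (16 / c + 16)) * l t) = cst_smear * d ^+ 2 * l t.
  by rewrite /cst_smear; ring.
apply.
- by rewrite !mulr_ge0 // ltW.
- by rewrite mulr_ge0 // ltW.
- exact: addr_ge0.
- exact: addr_ge0.
- exact: sH.
- exact: k0.
- move=> x xT; have [mg bg] := pkQ x; have sl : 0 < Num.sqrt (l x) by rewrite sqrtr_gt0.
  pose q := 56 * Ck 0%N * d * (Ck 0%N / Num.sqrt (l x)).
  have q0 : 0 <= q by rewrite !mulr_ge0 ?invr_ge0 // ltW.
  have bnd s : cabs (H s) * cabs (Phi x i2 s) <= q * dk (l x) (s - cq x) ^+ 2.
    apply: (le_trans (ler_pM (cabs_ge0 _) (cabs_ge0 _) (Hsup s) (bg s))).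
    rewrite /q -[leRHS]mulrA; apply: ler_wpM2l; first by rewrite !mulr_ge0 // ltW.
    by apply: ler_wpM2l; [rewrite divr_ge0 // ltW | exact: dkX_le].
  apply: (le_trans (ip_le sH.1 mg (intgZ q (dk2_intg (cq x) (l0 x))) bnd)).
  rewrite RintegralZl //; last exact: dk2_intg.
  rewrite dk2_Rint // -[X in _ * (_ * (_ * X)) <= _](sqr_sqrtr (ltW (l0 x))) /q.
  by rewrite le_eqVlt; apply/orP; left; apply/eqP; rewrite /packet_cst; field; exact: lt0r_neq0.
- have mw : measurable_fun setT (fun x => (cabs (H x) / wgt (cq t) (l t) x) ^+ 2).
    apply: measurable_funX; apply: measurable_funM; first exact: meas_cabs sH.1.
    exact: wgt_inv_meas.
  have le x : (cabs (H x) / wgt (cq t) (l t) x) ^+ 2 <=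
      (56 * Ck 0%N * d) ^+ 2 * (4 * dk (l t) (x - cq t) ^+ 2).
    have w0 : 0 <= (wgt (cq t) (l t) x)^-1 by rewrite invr_ge0 ltW // wgt_gt0.
    rewrite exprMn; apply: ler_pM; rewrite ?sqr_ge0 //.
      by rewrite lerXn2r ?nnegrE ?cabs_ge0 // (le_trans (cabs_ge0 _) (Hsup x)).
    have h := wgt_inv_dk (cq t) x (l0 t).
    have : (wgt (cq t) (l t) x)^-1 ^+ 2 <= (2 * dk (l t) (x - cq t) ^+ 2) ^+ 2.
      by rewrite lerXn2r ?nnegrE // (le_trans w0 h).
    have d1 : dk (l t) (x - cq t) ^+ 2 <= 1 by exact: dkX_le1.
    have d2 : 0 <= dk (l t) (x - cq t) ^+ 2 by exact: dkX_ge0.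
    move: d1 d2; set w := dk _ _ ^+ 2 => d1 d2 /le_trans; apply; nra.
  have i4 := intgZ ((56 * Ck 0%N * d) ^+ 2) (intgZ 4 (dk2_intg (cq t) (l0 t))).
  have i5 : intg (fun x => (cabs (H x) / wgt (cq t) (l t) x) ^+ 2).
    by apply: (intg_le mw i4) => x; rewrite ger0_norm ?sqr_ge0.
  apply: (le_trans (Rint_le i5 i4 le)).
  rewrite RintegralZl //; last exact/intgZ/dk2_intg.
  rewrite RintegralZl //; last exact: dk2_intg.
  by rewrite dk2_Rint // ler_wpM2l ?sqr_ge0 //; have := l0 t; lra.
- move=> x xT; rewrite (coef_exc MD z ni xT) ipH.
  have -> : \sum_(y in tpart) z y * ip (PhiP y) (Phi x i2) -
      \sum_(y in tpart | exc y x) z y * ip (PhiP y) (Phi x i2) - \sum_(y in tpart) z y * ip (sm y) (Phi x i2) =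
      \sum_(y in tpart) (z y * ip (PhiP y) (Phi x i2) - z y * ip (sm y) (Phi x i2)) -
      \sum_(y in tpart | exc y x) z y * ip (PhiP y) (Phi x i2).
    by rewrite sumrB addrAC.
  apply: (le_trans (cabsD _ _)); rewrite cabsN.
  have sl : 0 < Num.sqrt (l x) by rewrite sqrtr_gt0.
  have p1 : cabs (\sum_(y in tpart) (z y * ip (PhiP y) (Phi x i2) - z y * ip (sm y) (Phi x i2))) <=
      \sum_(y in tpart) errc / Num.sqrt (l x) *
        (pl y * Num.min (lam y / l x) (l x / lam y) * dk (l x) (cp y - cq x) ^+ 4).
    by apply: (le_trans (cabs_sum _ _ _)); apply: ler_sum => y yS; exact: err_le.
  have p2 := exc_le MD hz t x.
  apply: (le_trans (lerD p1 p2)); rewrite -mulr_sumr.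
  set s1 := \sum_(y in tpart) _; set s2 := \sum_(y in tpart) _.
  have -> : \sum_(y in tpart) pl y * k y x * dk (l x) (cp y - cq x) ^+ 4 = s1 + s2.
    by rewrite -big_split /=; apply: eq_bigr => y _; rewrite /k; ring.
  have s10 : 0 <= s1.
    apply: sumr_ge0 => y _; rewrite mulr_ge0 ?dkX_ge0 // mulr_ge0 ?(ltW (lp0 y)) //.
    by rewrite le_min !divr_ge0 // ltW.
  have s20 : 0 <= s2.
    by apply: sumr_ge0 => y _; rewrite mulr_ge0 ?dkX_ge0 // mulr_ge0 ?(ltW (lp0 y)) ?ler0n.
  have is0 : 0 <= (Num.sqrt (l x))^-1 by rewrite invr_ge0 ltW.
  have := mulr_ge0 (mulr_ge0 err0 is0) s20; have := mulr_ge0 (mulr_ge0 g0 is0) s10; lra.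
- move=> x xT; have -> : 16 * d * l x = 2 * (8 * d * l x) by ring.
  apply: le_trans (ler_wpM2l (ler0n R 2) (lvs x (lvx x xT))); rewrite mulr_sumr.
  apply: ler_sum => y _; have dx : 0 <= dk (l x) (cp y - cq x) by exact: dk_ge0.
  have k2 : k y x <= 2.
    by rewrite /k; have := min1 y x; have : (exc y x)%:R <= 1 :> R; [rewrite lern1 leq_b1 | lra].
  have d42 : dk (l x) (cp y - cq x) ^+ 4 <= dk (l x) (cp y - cq x) ^+ 2 by exact: dkX_le.
  rewrite -mulrA (mulrCA 2); apply: ler_wpM2l; first exact: ltW.
  by apply: ler_pM => //; exact: exprn_ge0.
- apply: (le_trans (lvs t lvt)); rewrite ler_wpM2r ?(ltW (l0 t)) // ler_wpM2r ?(ltW d0) //; lra.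
- move=> y yS; rewrite /k.
  under eq_bigr do rewrite mulrDl.
  rewrite big_split /=; apply: lerD; first exact: (ratio_sum MD _ _ _ _ (lam_gt0 y)).
  exact: (exc_sum MD Q ni yS).
Qed.

End Tree.

Lemma top_flat t : cabs (coef t) ^+ 2 <= (8 * gc) ^+ 2 * l t.
Proof.
have g0 := ltW (packet_cst_gt0 MD); have sl : 0 < Num.sqrt (l t) by rewrite sqrtr_gt0.
suff h : cabs (coef t) <= 8 * gc * Num.sqrt (l t).
  have : cabs (coef t) ^+ 2 <= (8 * gc * Num.sqrt (l t)) ^+ 2.
    by rewrite lerXn2r ?nnegrE ?cabs_ge0 ?mulr_ge0 // ltW.
  move/le_trans; apply; rewrite [leLHS]exprMn sqr_sqrtr //.
  exact: ltW (l0 t).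
apply: (@le_trans _ _ (gc / Num.sqrt (l t) *
   \sum_(y in [set y | rel y t]%SET) pl y * dk (l t) (cen pb pl y - cen a l t) ^+ 2)).
  apply: (le_trans (cabs_sum _ _ _)); rewrite mulr_sumr.
  rewrite [leRHS](eq_bigl (fun y => rel y t)); last by move=> y; rewrite finset.in_set.
  apply: ler_sum => y r; apply: (le_trans (pair_le MD hz (rel_le MD r))).
  by apply: ler_wpM2l; [rewrite divr_ge0 // ltW | rewrite ler_wpM2l ?(ltW (lp0 y)) // dkX_le].
have h : \sum_(y in [set y | rel y t]%SET) pl y * dk (l t) (cen pb pl y - cen a l t) ^+ 2 <= 8 * l t.
  apply: (tpart_sum MD (t := t)); last by move=> y; rewrite finset.in_set => /(rel_le MD).
  apply/fintype.subsetP => y; rewrite !finset.in_set => r; rewrite (rel_le MD r) andbT.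
  case/andP: r => _; rewrite (distrC (u i2 t)).
  have p : 0 < (pl y)^-1 by rewrite invr_gt0.
  have q : 0 < (l t)^-1 by rewrite invr_gt0.
  lra.
have gs : 0 <= gc / Num.sqrt (l t) by rewrite divr_ge0 // ltW.
apply: (le_trans (ler_wpM2l gs h)).
rewrite -[X in _ * (8 * X)](sqr_sqrtr (ltW (l0 t))) le_eqVlt; apply/orP; left; apply/eqP.
by field; exact: lt0r_neq0.
Qed.

Lemma top_lev t d : 0 <= d -> lev [set: Y]%SET (cen pb pl) pl d (cen a l t) (l t) ->
  cabs (coef t) ^+ 2 <= (8 * gc * d) ^+ 2 * l t.
Proof.
move=> d0 lv.
have g0 := ltW (packet_cst_gt0 MD); have sl : 0 < Num.sqrt (l t) by rewrite sqrtr_gt0.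
have h := lev_dk (fun y => ltW (lp0 y)) (l0 t) d0 lv.
suff h' : cabs (coef t) <= 8 * gc * d * Num.sqrt (l t).
  have : cabs (coef t) ^+ 2 <= (8 * gc * d * Num.sqrt (l t)) ^+ 2.
    by rewrite lerXn2r ?nnegrE ?cabs_ge0 ?mulr_ge0 // ltW.
  move/le_trans; apply; rewrite [leLHS]exprMn sqr_sqrtr //.
  exact: ltW (l0 t).
apply: (@le_trans _ _ (gc / Num.sqrt (l t) *
   \sum_(y in [set: Y]%SET) pl y * dk (l t) (cen pb pl y - cen a l t) ^+ 2)).
  apply: (le_trans (cabs_sum _ _ _)); rewrite mulr_sumr [leLHS]big_mkcond [leRHS]big_mkcond.
  apply: ler_sum => y _; rewrite inE; case: ifPn => r.
    apply: (le_trans (pair_le MD hz (rel_le MD r))).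
    by apply: ler_wpM2l; [rewrite divr_ge0 // ltW | rewrite ler_wpM2l ?(ltW (lp0 y)) // dkX_le].
  by rewrite mulr_ge0 ?divr_ge0 ?(ltW sl) // mulr_ge0 ?dkX_ge0 // ltW.
have gs : 0 <= gc / Num.sqrt (l t) by rewrite divr_ge0 // ltW.
apply: (le_trans (ler_wpM2l gs h)).
rewrite -[X in _ * (8 * _ * X)](sqr_sqrtr (ltW (l0 t))) le_eqVlt; apply/orP; left; apply/eqP.
by field; exact: lt0r_neq0.
Qed.

End Sizes.

(** * Energy of the coefficients *)

Section Energy.
Variable R : realType.
Local Notation C := R[i].
Local Notation Re := complex.Re.
Variables (X Y : finType) (T : X -> tritile R) (TP : Y -> tritile R).
Variables (c : R) (K L : nat) (Ck : nat -> R) (Phi : X -> 'I_3 -> R -> C) (PhiP : Y -> R -> C).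
Hypothesis MD : model T TP c K L Ck Phi PhiP.
Local Notation a := (qa T).
Local Notation l := (ql T).
Local Notation u := (qu T).
Local Notation pb := (pb TP).
Local Notation pl := (pl TP).
Local Notation pv := (pv TP).
Local Notation rel := (prel T TP c).
Local Notation gc := (packet_cst Ck).
Let l0 := ts_gt0 (md_ts MD).
Let lp0 := md_pl MD.
Let Ck0 := md_Ck MD.

Variable z : Y -> C.
Hypothesis hz : forall y, cabs (z y) = Num.sqrt (pl y).
Local Notation coef := (coef T TP c Phi PhiP z).
Local Notation cp := (cen pb pl).
Local Notation cq := (cen a l).
Let A0 : 0 <= Ck 0%N. Proof. exact: ltW. Qed.

Lemma full_norm : Re (ip (fun x => \sum_(y in [set: Y]%SET) z y * PhiP y x)
    (fun x => \sum_(y in [set: Y]%SET) z y * PhiP y x)) <= 16 * gc * \sum_y pl y.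
Proof.
have := @disjoint_norm R Y [set: Y]%SET pb pl (fun y y' => fmeet pl pv y y') (fun=> 1) gc z PhiP
  lp0 (ltW (packet_cst_gt0 MD)) _ hz.
have -> : \sum_(y in [set: Y]%SET) 1 * pl y = \sum_y pl y.
  rewrite (eq_bigl predT); last by move=> y; rewrite finset.in_setT.
  by apply: eq_bigr => y _; rewrite mul1r.
apply.
- by move=> y; rewrite ler01 lexx.
- by move=> y _; exact: (PhiP_sqi MD).
- move=> y y1 y2 _ _ _ h1 h2 m1 m2 ne; exact: (md_disj MD ne (md_grid MD h1 h2 m1 m2)).
- by move=> y y' _ _; exact: (ipPP_orth MD).
- move=> y y' _ _ le; rewrite mulr1.
  apply: (packet_gram (lp0 y) le A0 A0); first exact: (PhiP_packet MD).
  exact: (PhiP_packet MD).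
Qed.

Variables (U : {set X}) (tau : X -> X).
Hypothesis FU : forest a l (u i2) U tau.

(** * Frequency intervals of [x] that are not small *)
Definition mesh := (Num.Def.archi_bound (18 / c)).+1.

Definition coarse y x := (c * l x < pl y) && (`|pv y - u i2 x| < 9 / 20 * ((pl y)^-1 + (l x)^-1)).

Lemma coarse_sum y : \sum_(x in U | coarse y x) Num.sqrt (l x) * cabs (ip (PhiP y) (Phi x i2)) <=
  8 * mesh%:R * gc / c * Num.sqrt (pl y).
Proof.
have c0 := c_gt0 MD; have g0 := ltW (packet_cst_gt0 MD).
have sl x : 0 < Num.sqrt (l x) by rewrite sqrtr_gt0.
have sp : 0 < Num.sqrt (pl y) by rewrite sqrtr_gt0.
have ip0 : 0 < (pl y)^-1 by rewrite invr_gt0.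
pose r := pl y / c; have r0 : 0 < r by rewrite divr_gt0.
have lr x : coarse y x -> l x < r by case/andP => h _; rewrite /r ltr_pdivlMr // mulrC.
pose w := 9 / 20 * (pl y)^-1.
pose q x := Num.max (pv y - w) (Num.min (pv y + w) (u i2 x)).
pose k x := Num.Def.truncn ((q x - (pv y - w)) * (20 / c) * pl y).
have w0 : 0 < w by rewrite mulr_gt0.
have q_le x : pv y - w <= q x <= pv y + w.
  by rewrite /q le_max lexx ge_max ge_min lexx /= andbT; lra.
have q_near x : coarse y x -> `|q x - u i2 x| < 9 / 20 * (l x)^-1.
  have il : 0 < (l x)^-1 by rewrite invr_gt0.
  case/andP => _; rewrite /q ltr_norml => /andP[h1 h2].
  rewrite ltr_norml; case: (lerP (pv y + w) (u i2 x)) => h3.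
    by rewrite max_r; [rewrite /w; apply/andP; split; move: h3; rewrite /w; lra | lra].
  by case: (lerP (pv y - w) (u i2 x)) => h4; apply/andP; split; move: h3 h4; rewrite /w; lra.
have arg0 x : 0 <= (q x - (pv y - w)) * (20 / c) * pl y.
  have /andP[h _] := q_le x.
  by rewrite mulr_ge0 ?(ltW (lp0 y)) // mulr_ge0 ?divr_ge0 ?subr_ge0 // ltW.
have k_lt x : (k x < mesh)%N.
  rewrite /mesh ltnS -(ler_nat R).
  have h1 : (k x)%:R <= (q x - (pv y - w)) * (20 / c) * pl y by rewrite truncn_le ?arg0.
  apply: (le_trans h1); have h18 : 0 <= 18 / c by rewrite divr_ge0 // ltW.
  apply: le_trans (ltW (archi_boundP h18)).
  have -> : 18 / c = (9 / 10 * (pl y)^-1) * (20 / c) * pl y by field; rewrite !lt0r_neq0.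
  rewrite ler_wpM2r ?(ltW (lp0 y)) // ler_wpM2r ?divr_ge0 ?(ltW c0) //.
  by have /andP[_ h] := q_le x; move: h; rewrite /w; lra.
pose p (m : nat) := pv y - w + m%:R * (c / 20 * (pl y)^-1).
have p_near x : coarse y x -> `|p (k x) - u i2 x| < (l x)^-1 / 2.
  move=> cx; have il : 0 < (l x)^-1 by rewrite invr_gt0.
  have t1 := norm_tri (p (k x)) (q x) (u i2 x); have t2 := q_near x cx.
  suff : `|p (k x) - q x| <= (l x)^-1 / 20 by lra.
  have /andP[k1 k2] := truncn_itv (arg0 x); rewrite -/(k x) in k1 k2.
  have h : c * (pl y)^-1 <= (l x)^-1.
    have -> : c * (pl y)^-1 = r^-1 by rewrite /r invfM invrK mulrC.
    by rewrite lef_pV2 ?posrE // ltW // lr.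
  have e : (q x - (pv y - w)) = (q x - (pv y - w)) * (20 / c) * pl y * (c / 20 * (pl y)^-1).
    by field; rewrite !lt0r_neq0.
  pose h20 := c / 20 * (pl y)^-1.
  have h200 : 0 < h20 by rewrite mulr_gt0 ?divr_gt0.
  have j1 := ler_wpM2r (ltW h200) k1; have j2 : (q x - (pv y - w)) < (k x).+1%:R * h20.
    by rewrite e ltr_pM2r.
  rewrite -/h20 -e in j1; rewrite -natr1 mulrDl mul1r in j2.
  rewrite /p -/h20 ler_norml; move: j1 j2; rewrite /h20; lra.
rewrite (eq_bigl (fun x => x \in [set x in U | coarse y x])); last by move=> x; rewrite finset.in_set.
have term x : coarse y x -> Num.sqrt (l x) * cabs (ip (PhiP y) (Phi x i2)) <=
    gc / Num.sqrt (pl y) * (l x * dk r (a x + l x / 2 - cp y) ^+ 2).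
  move=> cx; rewrite -/(cq x).
  case: (lerP (pl y) (l x)) => le.
    apply: (le_trans (ler_wpM2l (ltW (sl x)) (ipPQ_le MD i2 le))).
    have -> : Num.sqrt (l x) * (gc * (Num.sqrt (pl y) / Num.sqrt (l x)) * dk (l x) (cp y - cq x) ^+ 8) =
        gc / Num.sqrt (pl y) * (Num.sqrt (pl y) ^+ 2 * dk (l x) (cp y - cq x) ^+ 8).
      by field; rewrite !lt0r_neq0.
    rewrite sqr_sqrtr ?(ltW (lp0 y)) //; apply: ler_wpM2l; first by rewrite divr_ge0 // ltW.
    apply: ler_pM => //; [exact: ltW | exact: dkX_ge0 |].
    apply: (le_trans (dkX_le _ (l0 x) (isT : (2 <= 8)%N))); rewrite dkC.
    by rewrite lerXn2r ?nnegrE ?dk_ge0 // dk_le_scale // ltW // lr.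
  have gr := packet_gram (N := 8) (l0 x) (ltW le) A0 A0
     (Phi_packet (md_ts MD) (md_L MD) Ck0 (md_wp MD) x i2 (isT : (10 <= 10)%N))
     (PhiP_packet MD y (isT : (8 <= 10)%N)).
  rewrite -ipJ ?cabsJ; [|exact: (Phi_sqi (md_ts MD) (md_L MD) Ck0 (md_wp MD))|exact: (PhiP_sqi MD)].
  apply: (le_trans (ler_wpM2l (ltW (sl x)) gr)).
  have -> : Num.sqrt (l x) * (4 * Ck 0%N * Ck 0%N * (Num.sqrt (l x) / Num.sqrt (pl y)) *
      dk (pl y) (cq x - cp y) ^+ 8) = gc / Num.sqrt (pl y) * (Num.sqrt (l x) ^+ 2 * dk (pl y) (cq x - cp y) ^+ 8).
    by rewrite /packet_cst; ring.
  rewrite sqr_sqrtr ?(ltW (l0 x)) //; apply: ler_wpM2l; first by rewrite divr_ge0 // ltW.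
  apply: ler_wpM2l; first exact: ltW.
  apply: (le_trans (dkX_le _ (lp0 y) (isT : (2 <= 8)%N))).
  rewrite lerXn2r ?nnegrE ?dk_ge0 // dk_le_scale // /r ler_pdivlMr // ler_piMr ?(ltW (lp0 y)) //.
  have := c_le MD; have : 1 <= 10 ^+ 9 :> R by apply: exprn_ege1; lra.
  by set b := 10 ^+ 9 => b1 b2; have := ler_wpM2r (ltW c0) b1; lra.
apply: (@le_trans _ _ (\sum_(x in [set x in U | coarse y x])
    gc / Num.sqrt (pl y) * (l x * dk r (a x + l x / 2 - cp y) ^+ 2))).
  by apply: ler_sum => x; rewrite finset.in_set => /andP[_]; exact: term.
rewrite -mulr_sumr.
suff h : \sum_(x in [set x in U | coarse y x]) l x * dk r (a x + l x / 2 - cp y) ^+ 2 <= mesh%:R * (8 * r).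
  have gs : 0 <= gc / Num.sqrt (pl y) by rewrite divr_ge0 // ltW.
  apply: (le_trans (ler_wpM2l gs h)); rewrite /r -[X in X / c](sqr_sqrtr (ltW (lp0 y))).
  by rewrite le_eqVlt; apply/orP; left; apply/eqP; field; rewrite !lt0r_neq0.
rewrite (partition_big (fun x => Ordinal (k_lt x)) predT) //=.
have -> : mesh%:R * (8 * r) = \sum_(m < mesh) 8 * r by rewrite sumr_const card_ord mulr_natl.
apply: ler_sum => m _.
rewrite (eq_bigl (fun x => x \in [set x in U | coarse y x && (k x == m)])); last first.
  by move=> x; rewrite !finset.in_set -andbA.
have -> : 8 * r = 2 * (1 + 1) ^+ 2 * r by ring.
apply: sum_dk_disj => //.
  by move=> x; rewrite finset.in_set => /and3P[_ cx _]; rewrite l0 mul1r ltW // lr.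
move=> x x'; rewrite !finset.in_set => /and3P[xU cx /eqP kx] /and3P[x'U cx' /eqP kx'] ne.
apply: (forest_disj FU) => //; rewrite /fmeet.
have := p_near _ cx; have := p_near _ cx'; rewrite kx kx' => h h'.
by have := norm_tri (u i2 x) (p m) (u i2 x'); rewrite (distrC (u i2 x) (p m)); lra.
Qed.

(** * Frequency intervals of [x] that meet the edge of the support *)
Definition edge y x := [&& ~~ rel y x, pl y <= c * l x &
  `|pv y - u i2 x| < 9 / 20 * ((pl y)^-1 + (l x)^-1)].

Definition edgept y (b : bool) := pv y + (-1) ^+ b * (9 / 20 * (pl y)^-1).

Lemma edge_pt y x : edge y x -> exists b, `|edgept y b - u i2 x| < (l x)^-1 / 2.
Proof.
have c0 := c_gt0 MD; case/and3P => nr le meet.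
have il : 0 < (l x)^-1 by rewrite invr_gt0.
have ip0 : 0 < (pl y)^-1 by rewrite invr_gt0.
have h : (l x)^-1 <= c * (pl y)^-1.
  by rewrite ler_pdivlMr // mulrC ler_pdivrMr.
move: nr; rewrite /prel h /= -ltNge (distrC (u i2 x)) => nr.
case: (lerP 0 (pv y - u i2 x)) => s; [exists true|exists false]; rewrite /edgept ?expr1 ?expr0.
  by move: nr meet; rewrite (ger0_norm s) => nr meet; rewrite ltr_norml; apply/andP; split; lra.
by move: nr meet; rewrite (ltr0_norm s) => nr meet; rewrite ltr_norml; apply/andP; split; lra.
Qed.

Definition eclass y : {set Y} := [set y' | (pv y' == pv y) && (pl y' == pl y)]%SET.

Lemma edge_class x y y' : edge y x -> edge y' x -> eclass y = eclass y'.
Proof.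
move=> e e'; have [b hb] := edge_pt e; have [b' hb'] := edge_pt e'.
have il : 0 < (l x)^-1 by rewrite invr_gt0.
have near w : edge w x -> (l x)^-1 <= 1 / 100 * (pl w)^-1.
  case/and3P => _ le _; have iw : 0 < (pl w)^-1 by rewrite invr_gt0.
  have h1 : (l x)^-1 * pl w <= c.
    by rewrite mulrC ler_pdivrMr.
  rewrite -ler_pdivrMr // invrK; apply: (le_trans h1).
  have := c_le MD; have : 100 <= 10 ^+ 9 :> R.
    have -> : 10 ^+ 9 = 100 * 10 ^+ 7 :> R by ring.
    by rewrite ler_peMr // exprn_ege1 //; lra.
  by set q := 10 ^+ 9 => q1 q2; have := ler_wpM2r (ltW (c_gt0 MD)) q1; lra.
have := norm_tri (edgept y b) (u i2 x) (edgept y' b'); rewrite (distrC (u i2 x)) => t.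
have [|| p1 p2] := md_end MD (y := y) (y' := y') (b := b) (b' := b').
- by apply: (le_lt_trans t); have := near _ e; lra.
- by apply: (le_lt_trans t); have := near _ e'; lra.
by apply/setP => w; rewrite !finset.in_set p1 p2.
Qed.

Lemma edge_le y x : edge y x -> pl y <= l x.
Proof.
case/and3P => _ h _; apply: (le_trans h); rewrite ler_piMl ?(ltW (l0 x)) //.
have := c_le MD; have : 1 <= 10 ^+ 9 :> R by apply: exprn_ege1; lra.
by set b := 10 ^+ 9 => b1 b2; have := ler_wpM2r (ltW (c_gt0 MD)) b1; lra.
Qed.

Lemma class_sum x y0 : pl y0 <= l x ->
  \sum_(y in eclass y0) pl y * dk (l x) (cp y - cq x) ^+ 2 <= 8 * l x.
Proof.
move=> le; have -> : 8 * l x = 2 * (1 + 1) ^+ 2 * l x by ring.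
apply: sum_dk_disj => //.
  by move=> y; rewrite finset.in_set => /andP[_ /eqP ->]; rewrite lp0 mul1r.
move=> y y'; rewrite !finset.in_set => /andP[/eqP v /eqP p] /andP[/eqP v' /eqP p'] ne.
apply: (md_disj MD ne); rewrite /fmeet v v' p p' subrr normr0 divr_gt0 // addr_gt0 // invr_gt0 //;
exact: lp0.
Qed.

Definition eavg x := (\sum_(y | edge y x) pl y * dk (l x) (cp y - cq x) ^+ 2) / l x.

Lemma edge_sqr : \sum_(x in U) l x * eavg x ^+ 2 <= 8 * 320 * \sum_y pl y.
Proof.
have e0 x : 0 <= eavg x.
  by rewrite /eavg divr_ge0 ?(ltW (l0 x)) //; apply: sumr_ge0 => y _; rewrite mulr_ge0 ?dkX_ge0 // ltW.
have ecls x y0 : edge y0 x -> eavg x * l x <= \sum_(y in eclass y0) pl y * dk (l x) (cp y - cq x) ^+ 2.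
  move=> ed; rewrite /eavg divfK ?gt_eqF // big_mkcond [leRHS]big_mkcond; apply: ler_sum => y _.
  case: (boolP (edge y x)) => ey.
    by rewrite (edge_class ed ey) finset.in_set !eqxx.
  by case: ifP => // _; rewrite mulr_ge0 ?dkX_ge0 // ltW.
have e8 x y0 : edge y0 x -> eavg x <= 8.
  move=> ed; rewrite -(ler_pM2r (l0 x)); apply: (le_trans (ecls x y0 ed)).
  exact: class_sum (edge_le ed).
pose D (S : {set Y}) b := [set x in U | [exists y, [&& edge y x, eclass y == S &
  `|edgept y b - u i2 x| < (l x)^-1 / 2]]].
have DP S b x : x \in D S b -> x \in U /\ exists y, [/\ edge y x, eclass y = S &
    `|edgept y b - u i2 x| < (l x)^-1 / 2].
  rewrite finset.in_set => /andP[xU /existsP[y /and3P[e1 /eqP e2 e3]]]; split=> //.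
  by exists y; split.
have DS S b : \sum_(x in D S b) l x * eavg x ^+ 2 <= 8 * 160 * \sum_(y in S) pl y.
  apply: (avg_sqr (c := cp) (m := pl) (a := a) (fun y => ltW (lp0 y))) => //.
  - move=> x x' /DP[xU [y [ey Sy hy]]] /DP[x'U [y' [ey' Sy' hy']]] ne.
    apply: (forest_disj FU) => //; rewrite /fmeet.
    have [pvE plE] : pv y' = pv y /\ pl y' = pl y.
      have : y' \in eclass y by rewrite Sy -Sy' finset.in_set !eqxx.
      by rewrite finset.in_set => /andP[/eqP -> /eqP ->].
    move: hy'; rewrite /edgept pvE plE -/(edgept y b) => hy'.
    by have := norm_tri (u i2 x) (edgept y b) (u i2 x'); rewrite (distrC (u i2 x) (edgept y b)); lra.
  - by move=> x /DP[_ [y [ey <- _]]]; split; [exact: e0 | exact: ecls].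
  - by move=> x /DP[_ [y [ey _ _]]]; exact: e8 ey.
pose CS := [set eclass y | y in [set: Y]%SET]%SET.
have term0 x : 0 <= l x * eavg x ^+ 2 by rewrite mulr_ge0 ?sqr_ge0 // ltW.
apply: (@le_trans _ _ (\sum_(S in CS) \sum_(b : bool) \sum_(x in D S b) l x * eavg x ^+ 2)).
  have -> : \sum_(S in CS) \sum_(b : bool) \sum_(x in D S b) l x * eavg x ^+ 2 =
     \sum_x \sum_(S in CS) \sum_(b : bool) (if x \in D S b then l x * eavg x ^+ 2 else 0).
    rewrite [RHS]exchange_big /=; apply: eq_bigr => S _; rewrite [RHS]exchange_big /=.
    by apply: eq_bigr => b _; rewrite big_mkcond.
  rewrite big_mkcond; apply: ler_sum => x _.
  have pos (S : {set Y}) b : 0 <= (if x \in D S b then l x * eavg x ^+ 2 else 0) by case: ifP.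
  case: ifP => [xU|_]; last by apply: sumr_ge0 => S _; apply: sumr_ge0 => b _.
  have [y ey|none] := pickP (fun y => edge y x); last first.
    rewrite /eavg big_pred0 // mul0r expr0n mulr0.
    by apply: sumr_ge0 => S _; apply: sumr_ge0 => b _; case: ifP.
  have [b hb] := edge_pt ey.
  have yC : eclass y \in CS by apply/imsetP; exists y.
  rewrite (bigD1 (eclass y)) //= (bigD1 b) //=.
  have -> : x \in D (eclass y) b.
    by rewrite finset.in_set xU; apply/existsP; exists y; rewrite ey eqxx hb.
  rewrite -addrA lerDl addr_ge0 //; first exact: sumr_ge0.
  by apply: sumr_ge0 => S _; apply: sumr_ge0.
apply: (@le_trans _ _ (\sum_(S in CS) 8 * 320 * \sum_(y in S) pl y)).
  apply: ler_sum => S _; rewrite big_bool /=.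
  by have := DS S true; have := DS S false; lra.
rewrite -mulr_sumr; apply: ler_wpM2l; first by lra.
have -> : \sum_y pl y = \sum_(y in [set: Y]%SET) pl y.
  by apply: eq_bigl => y; rewrite finset.in_setT.
rewrite [leRHS](partition_big_imset eclass) /=.
apply: ler_sum => S /imsetP[y0 _ ->]; rewrite le_eqVlt; apply/orP; left; apply/eqP.
apply: eq_bigl => y; rewrite finset.in_setT /=; apply/idP/eqP => [|<-]; last first.
  by rewrite finset.in_set !eqxx.
rewrite finset.in_set => /andP[/eqP v /eqP p].
by apply/setP => w; rewrite !finset.in_set v p.
Qed.

Lemma coef_split x : coef x = ip (fun s => \sum_(y in [set: Y]%SET) z y * PhiP y s) (Phi x i2) -
  (\sum_(y | coarse y x) z y * ip (PhiP y) (Phi x i2) +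
   \sum_(y | edge y x) z y * ip (PhiP y) (Phi x i2)).
Proof.
rewrite ip_suml; [|by move=> y _; exact: (PhiP_sqi MD)|exact: (Phi_sqi (md_ts MD) (md_L MD) Ck0 (md_wp MD))].
rewrite (eq_bigl predT); last by move=> y; rewrite finset.in_setT.
apply/eqP; rewrite eq_sym subr_eq; apply/eqP.
rewrite (bigID (fun y => rel y x)) /=; congr (_ + _).
have c0 := c_gt0 MD.
have nrc y : rel y x -> coarse y x = false.
  case/andP => h _; apply/negP => /andP[h' _]; move: h'; rewrite ltNge => /negP; apply.
  by move: h; rewrite ler_pdivlMr // mulrC ler_pdivrMr.
rewrite [LHS](bigID (fun y => coarse y x)) /=; congr (_ + _).
  by apply: eq_bigl => y; case: (boolP (rel y x)) => //= r; rewrite nrc.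
rewrite (bigID (fun y => edge y x)) /= [X in _ + X]big1 ?addr0.
  apply: eq_bigl => y; case: (boolP (rel y x)) => //= r; first by rewrite /edge r.
  case: (boolP (edge y x)) => //= e; rewrite ?andbF // andbT.
  apply/negP => /andP[h _]; case/and3P: e => _ h' _.
  by move: h; rewrite ltNge h'.
move=> y /andP[/andP[nr nc] ne]; rewrite (ipPQ_orth MD) ?mulr0 // leNgt; apply/negP => meet.
case: (lerP (pl y) (c * l x)) => h.
  by move: ne; rewrite /edge nr h meet.
by move: nc; rewrite /coarse h meet.
Qed.

Definition enc := 8 * gc * (8 * 513 * gc) + 8 * gc * (8 * mesh%:R * gc / c) + 2 * gc ^+ 2 * (8 * 320).

Lemma energy_tops (s : R) : 0 < s ->
  {in U, forall x, cabs (coef x) ^+ 2 <= s ^+ 2 * l x} ->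
  {in tau @: U, forall t, s ^+ 2 / 8 * l t <= \sum_(x in U | tau x == t) cabs (coef x) ^+ 2} ->
  \sum_(t in tau @: U) l t <= 64 / 3 * enc * (\sum_y pl y) / s ^+ 2.
Proof.
move=> s0 hs ht; have g0 := packet_cst_gt0 MD; have c0 := c_gt0 MD.
have s2 : 0 < s ^+ 2 by exact: exprn_gt0.
have hB : s ^+ 2 / 8 * \sum_(t in tau @: U) l t <= \sum_(x in U) cabs (coef x) ^+ 2.
  rewrite [leRHS](partition_big_imset tau) /= mulr_sumr; apply: ler_sum => t tU.
  exact: ht.
set B := \sum_(x in U) cabs (coef x) ^+ 2 in hB *.
set M := \sum_(t in tau @: U) l t in hB *.
set XX := \sum_y pl y.
have X0 : 0 <= XX by apply: sumr_ge0 => y _; exact: ltW.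
have M0 : 0 <= M.
  by apply: sumr_ge0 => t /imsetP[x xU ->]; exact: ltW (tree_top_gt0 FU xU).
pose H s := \sum_(y in [set: Y]%SET) z y * PhiP y s.
have sH : sqi H by apply: sqi_sum => y _; apply: sqiZ; exact: (PhiP_sqi MD).
pose sg := Num.min s (8 * gc).
have sg0 : 0 <= sg by rewrite le_min (ltW s0) mulr_ge0 // ltW.
have asg x : x \in U -> cabs (coef x) <= sg * Num.sqrt (l x).
  move=> xU.
  have q (e : R) : 0 <= e -> cabs (coef x) ^+ 2 <= e ^+ 2 * l x -> cabs (coef x) <= e * Num.sqrt (l x).
    move=> e0 h; rewrite -(ler_pXn2r (isT : (0 < 2)%N)) ?nnegrE ?cabs_ge0 ?mulr_ge0 ?sqrtr_ge0 //.
    by apply: (le_trans h); rewrite exprMn (sqr_sqrtr (ltW (l0 x))).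
  have q1 := q s (ltW s0) (hs x xU).
  have q2 : cabs (coef x) <= 8 * gc * Num.sqrt (l x).
    by apply: q; [rewrite mulr_ge0 // ltW | exact: (top_flat MD hz)].
  by rewrite /sg; case: (leP s (8 * gc)).
pose r1 := \sum_(x in U) (coef x)^* * ip H (Phi x i2).
pose r2 := \sum_(x in U) (coef x)^* * \sum_(y | coarse y x) z y * ip (PhiP y) (Phi x i2).
pose r3 := \sum_(x in U) (coef x)^* * \sum_(y | edge y x) z y * ip (PhiP y) (Phi x i2).
have EB : B = Re r1 - (Re r2 + Re r3).
  rewrite /B sum_cabs_sqr -cReD -cReN -cReD; congr (Re _).
  rewrite /r1 /r2 /r3 -big_split /= -sumrB; apply: eq_bigr => x _.
  by rewrite -mulrDr -mulrBr -coef_split.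
have R1 : Re r1 <= 8 * gc * (8 * 513 * gc) * XX + B / 2.
  pose t := (8 * 513 * gc)^-1.
  have k0 : 0 < 8 * 513 * gc by lra.
  have t0 : 0 < t by rewrite invr_gt0.
  have pkU : {in U, forall x, packet (Ck 0%N) (l x) (cq x) 6 (Phi x i2)}.
    by move=> x _; exact: (Phi_packet (md_ts MD) (md_L MD) Ck0 (md_wp MD)).
  have orU : {in U &, forall x y, ~~ fmeet l (u i2) x y -> ip (Phi x i2) (Phi y i2) = 0}.
    move=> x y _ _ nm.
    exact: (Phi_orth (md_ts MD) (md_K MD) (md_L MD) Ck0 (md_lw MD) (md_wp MD) 0 ltr01 nm).1.
  have := forest_quad_gen (md_ts MD) t FU A0 sg0 sH pkU orU asg.
  rewrite -/r1 -/B -/M -/gc => h.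
  have h2 : 512 * sg ^+ 2 * M <= 8 * 512 * B.
    have sgs : sg ^+ 2 <= s ^+ 2.
      by rewrite lerXn2r ?nnegrE ?(ltW s0) // /sg ge_min lexx.
    by have := ler_wpM2r M0 sgs; move: hB; set w := s ^+ 2; set w' := sg ^+ 2; lra.
  have h3 : Re (ip H H) <= 16 * gc * XX := full_norm.
  have h4 : t ^+ 2 * (gc * (8 * B + 512 * sg ^+ 2 * M)) <= t * B.
    apply: (@le_trans _ _ (t ^+ 2 * (gc * (8 * 513 * B)))).
      by apply: ler_wpM2l; [exact: sqr_ge0 | apply: ler_wpM2l; [exact: ltW | lra]].
    have -> : t ^+ 2 * (gc * (8 * 513 * B)) = t * B * (8 * 513 * gc * t) by ring.
    by rewrite (mulfV (lt0r_neq0 k0)) mulr1.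
  have h5 : 2 * t * Re r1 <= 16 * gc * XX + t * B.
    by apply: (le_trans h); apply: lerD.
  rewrite -(ler_pM2l (_ : 0 < 2 * t)) ?mulr_gt0 //; apply: (le_trans h5).
  rewrite le_eqVlt; apply/orP; left; apply/eqP; rewrite /t; field.
  by rewrite lt0r_neq0.
have R2 : - Re r2 <= 8 * gc * (8 * mesh%:R * gc / c) * XX.
  apply: (@le_trans _ _ (cabs r2)).
    by apply: le_trans (Re_le_cabs _); rewrite -normrN; exact: ler_norm.
  have h1 : cabs r2 <= \sum_(x in U) \sum_(y | coarse y x)
      sg * Num.sqrt (pl y) * (Num.sqrt (l x) * cabs (ip (PhiP y) (Phi x i2))).
    apply: (le_trans (cabs_sum _ _ _)); apply: ler_sum => x xU; rewrite cabsM cabsJ.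
    apply: (le_trans (ler_wpM2l (cabs_ge0 _) (cabs_sum _ _ _))); rewrite mulr_sumr.
    apply: ler_sum => y _; rewrite cabsM hz.
    have := ler_wpM2r (mulr_ge0 (sqrtr_ge0 (pl y)) (cabs_ge0 (ip (PhiP y) (Phi x i2)))) (asg x xU).
    lra.
  apply: (le_trans h1); rewrite (exchange_big_dep predT) //= mulr_sumr.
  apply: ler_sum => y _; rewrite -mulr_sumr.
  have w0 : 0 <= sg * Num.sqrt (pl y) by rewrite mulr_ge0 ?sqrtr_ge0.
  apply: (le_trans (ler_wpM2l w0 (coarse_sum y))).
  have -> : sg * Num.sqrt (pl y) * (8 * mesh%:R * gc / c * Num.sqrt (pl y)) =
     sg * (8 * mesh%:R * gc / c) * Num.sqrt (pl y) ^+ 2 by ring.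
  rewrite sqr_sqrtr ?(ltW (lp0 y)) //; apply: ler_wpM2r; first exact: ltW.
  apply: ler_wpM2r; last by rewrite /sg ge_min lexx orbT.
  by rewrite divr_ge0 ?(ltW c0) // mulr_ge0 ?(ltW g0) // mulr_ge0 ?ler0n.
have R3 : - Re r3 <= B / 8 + 2 * gc ^+ 2 * (8 * 320) * XX.
  apply: (@le_trans _ _ (cabs r3)).
    by apply: le_trans (Re_le_cabs _); rewrite -normrN; exact: ler_norm.
  have h1 : cabs r3 <= \sum_(x in U) (cabs (coef x) ^+ 2 / 8 + 2 * gc ^+ 2 * (l x * eavg x ^+ 2)).
    apply: (le_trans (cabs_sum _ _ _)); apply: ler_sum => x xU; rewrite cabsM cabsJ.
    have sl : 0 < Num.sqrt (l x) by rewrite sqrtr_gt0.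
    have h : cabs (\sum_(y | edge y x) z y * ip (PhiP y) (Phi x i2)) <= gc * Num.sqrt (l x) * eavg x.
      apply: (le_trans (cabs_sum _ _ _)).
      have -> : gc * Num.sqrt (l x) * eavg x = gc / Num.sqrt (l x) *
          \sum_(y | edge y x) pl y * dk (l x) (cp y - cq x) ^+ 2.
        rewrite /eavg -[X in _ / X](sqr_sqrtr (ltW (l0 x))).
        by field; exact: lt0r_neq0.
      rewrite mulr_sumr; apply: ler_sum => y ey.
      apply: (le_trans (pair_le MD hz (edge_le ey))).
      apply: ler_wpM2l; first by rewrite divr_ge0 // ltW.
      by rewrite ler_wpM2l ?dkX_le // ltW.
    have h2 := ler_wpM2l (cabs_ge0 (coef x)) h; apply: (le_trans h2).
    have -> : 2 * gc ^+ 2 * (l x * eavg x ^+ 2) = 2 * (gc * Num.sqrt (l x) * eavg x) ^+ 2.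
      by rewrite !exprMn sqr_sqrtr ?(ltW (l0 x)) //; ring.
    have := sqr_ge0 (cabs (coef x) - 4 * (gc * Num.sqrt (l x) * eavg x)).
    set w := gc * _ * _; set w' := cabs (coef x); rewrite !expr2; lra.
  apply: (le_trans h1); rewrite big_split /= -mulr_suml -mulr_sumr -/B lerD2l.
  have gg : 0 <= 2 * gc ^+ 2 by rewrite mulr_ge0 ?sqr_ge0.
  by have := ler_wpM2l gg edge_sqr; rewrite -/XX; lra.
have BB : B <= 8 / 3 * (enc * XX).
  rewrite /enc; move: EB R1 R2 R3; set v1 := 8 * gc * (8 * 513 * gc).
  set v2 := 8 * gc * (_ / c); set v3 := 2 * _ * (8 * 320); lra.
by rewrite ler_pdivlMr //; move: hB BB; set w := s ^+ 2; set e := enc; lra.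
Qed.

End Energy.

(** * Size and energy of bounded functions *)

Section FunctionSizes.
Variable R : realType.
Local Notation mu := (@lebesgue_measure R).
Local Notation C := R[i].
Variables (X : finType) (T : X -> tritile R).
Variables (K L : nat) (Ck : nat -> R) (Phi : X -> 'I_3 -> R -> C).
Local Notation a := (qa T).
Local Notation l := (ql T).
Local Notation u := (qu T).
Hypothesis TS : tilesys a l u.
Hypotheses (K0 : (0 < K)%N) (L8 : (10 <= L)%N) (Ck0 : forall k, 0 < Ck k).
Hypothesis lw : forall x j, ilen (tw_of (T x) j) = (l x)^-1.
Hypothesis wp : forall x j, wave_packet K L Ck (tcomp (T x) j) (Phi x j).
Let l0 := ts_gt0 TS.
Variables (E : set R) (f : R -> C).
Hypotheses (mE : measurable E) (fE : (mu E < +oo)%E) (mf : cmeasurable f).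
Hypothesis bf : forall x, cabs (f x) <= \1_E x.
Variable j : 'I_3.
Variable al : 'I_3 -> X -> R.
Hypothesis alE : forall x, al j x = cabs (ip f (Phi x j)).

Lemma indic_intg : intg (\1_E : R -> R).
Proof.
apply/integrableP; split.
  by apply/measurable_EFinP; exact: measurable_indic.
have -> : (\int[mu]_x `|(EFin \o (\1_E : R -> R)) x| = \int[mu]_x (\1_E x)%:E)%E.
  by apply: eq_integral => x _; rewrite gee0_abs // lee_fin indicE.
by rewrite integral_indic // setIT.
Qed.

Lemma bounded1 x : cabs (f x) <= 1.
Proof. by apply: (le_trans (bf x)); rewrite indicE lern1 leq_b1. Qed.

Lemma sqr_le_indic x : cabs (f x) ^+ 2 <= \1_E x.
Proof.
apply: le_trans (bf x); rewrite expr2 ler_piMl ?cabs_ge0 //; exact: bounded1.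
Qed.

Lemma f_sqi : sqi f.
Proof.
split=> //; apply: (intg_le (measurable_funX 2 (meas_cabs mf)) indic_intg) => x.
by rewrite ger0_norm ?sqr_ge0 // sqr_le_indic.
Qed.

Lemma f_mass : Rintegral mu setT (fun x => cabs (f x) ^+ 2) <= fine (mu E).
Proof.
have := Rint_le f_sqi.2 indic_intg sqr_le_indic; rewrite /Rintegral.
by rewrite integral_indic // setIT.
Qed.

Lemma f_local (c r : R) : 0 < r ->
  Rintegral mu setT (fun x => (cabs (f x) / wgt c r x) ^+ 2) <= 8 * r.
Proof.
move=> r0.
have mw : measurable_fun setT (fun x => (cabs (f x) / wgt c r x) ^+ 2).
  apply: measurable_funX; apply: measurable_funM; first exact: meas_cabs.
  exact: wgt_inv_meas.
have le x : (cabs (f x) / wgt c r x) ^+ 2 <= 4 * dk r (x - c) ^+ 2.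
  have w0 : 0 <= (wgt c r x)^-1 by rewrite invr_ge0 ltW // wgt_gt0.
  have h := wgt_inv_dk c x r0.
  have d1 : dk r (x - c) ^+ 2 <= 1 by exact: dkX_le1.
  have d2 : 0 <= dk r (x - c) ^+ 2 by exact: dkX_ge0.
  have : cabs (f x) / wgt c r x <= 2 * dk r (x - c) ^+ 2.
    by apply: le_trans h; rewrite ler_piMl // bounded1.
  move=> h2; have h3 : (cabs (f x) / wgt c r x) ^+ 2 <= (2 * dk r (x - c) ^+ 2) ^+ 2.
    have p2 := mulr_ge0 (ler0n R 2) d2.
    by rewrite lerXn2r ?nnegrE // mulr_ge0 ?cabs_ge0.
  by apply: (le_trans h3); move: d1 d2; set w := dk _ _ ^+ 2 => d1 d2; nra.
have i4 := intgZ 4 (dk2_intg c r0).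
have i5 : intg (fun x => (cabs (f x) / wgt c r x) ^+ 2).
  by apply: (intg_le mw i4) => x; rewrite ger0_norm ?sqr_ge0.
apply: (le_trans (Rint_le i5 i4 le)); rewrite RintegralZl //; last exact: dk2_intg.
by rewrite dk2_Rint //; lra.
Qed.

Lemma f_coef x : cabs (ip f (Phi x j)) <= 4 * Ck 0%N * Num.sqrt (l x).
Proof.
have [mP bP] := Phi_packet TS L8 Ck0 wp x j (isT : (2 <= 10)%N).
have sl : 0 < Num.sqrt (l x) by rewrite sqrtr_gt0 l0.
apply: (le_trans (ip_le mf mP (intgZ (Ck 0%N / Num.sqrt (l x)) (dk2_intg (cen a l x) (l0 x))) _)).
  move=> y; apply: le_trans (bP y); rewrite ler_piMl ?cabs_ge0 //; exact: bounded1.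
rewrite RintegralZl //; last exact: dk2_intg.
rewrite dk2_Rint // -[X in _ * (_ * (_ * X)) <= _](sqr_sqrtr (ltW (l0 x))).
by rewrite le_eqVlt; apply/orP; left; apply/eqP; field; exact: lt0r_neq0.
Qed.

Definition fsizec := 64 * bes Ck + 64 * (4 * Ck 0%N) ^+ 2.

Lemma fsizec_gt0 : 0 < fsizec.
Proof. by rewrite /fsizec ltr_wpDr ?mulr_gt0 ?bes_gt0 // mulr_ge0 ?sqr_ge0. Qed.

Lemma f_size (Q : {set X}) : has_size a l u al j Q (Num.sqrt fsizec).
Proof.
have s0 := ltW fsizec_gt0; have b0 := bes_gt0 Ck0.
move=> t tQ; rewrite sqr_sqrtr //; split.
  rewrite alE; apply: (@le_trans _ _ ((4 * Ck 0%N * Num.sqrt (l t)) ^+ 2)).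
    by rewrite lerXn2r ?nnegrE ?cabs_ge0 ?f_coef // !mulr_ge0 ?sqrtr_ge0 // ltW.
  rewrite exprMn (sqr_sqrtr (ltW (l0 t))) ler_wpM2r ?(ltW (l0 t)) // /fsizec.
  by have := sqr_ge0 (4 * Ck 0%N); lra.
move=> i ij; under eq_bigr do rewrite alE.
have ji : j != i by rewrite eq_sym.
have c4 : 0 <= 4 * Ck 0%N by rewrite mulr_ge0 // ltW.
have := tree_bessel TS K0 L8 Ck0 lw wp (Q := Q) (t := t) ji c4 f_sqi
  (fun x _ _ => f_coef x) (f_local (cen a l t) (l0 t)).
by rewrite /fsizec; lra.
Qed.

Lemma forestS (v : X -> R) (U U' : {set X}) tau : U' \subset U -> forest a l v U tau ->
  forest a l v U' tau.
Proof.
move=> /fintype.subsetP S [h1 h2 h3 h4 h5 h6 h7 h8]; split.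
- by move=> x /S /h1.
- by move=> x /S /h2.
- by move=> x y /S xU /S yU; exact: h3.
- by move=> x y /S xU /S yU; exact: h4.
- by move=> x y /S xU /S yU; exact: h5.
- by move=> x y /S xU /S yU; exact: h6.
- by move=> x y /S xU /S yU; exact: h7.
- by move=> x y z /S xU /S yU /S zU; exact: h8.
Qed.

Lemma al_sqrt (Q : {set X}) (s : R) : 0 < s -> {in Q, forall x, al j x ^+ 2 <= s ^+ 2 * l x} ->
  {in Q, forall x, cabs (ip f (Phi x j)) <= s * Num.sqrt (l x)}.
Proof.
move=> s0 h x xQ; have := h x xQ; rewrite alE => h'.
rewrite -(ler_pXn2r (isT : (0 < 2)%N)) ?nnegrE ?cabs_ge0 ?mulr_ge0 ?sqrtr_ge0 ?(ltW s0) //.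
by apply: (le_trans h'); rewrite exprMn (sqr_sqrtr (ltW (l0 x))).
Qed.

Lemma f_energy (Q : {set X}) : has_energy a l u al j Q (Num.sqrt (64 * 513 * bes Ck * fine (mu E))).
Proof.
have b0 := bes_gt0 Ck0.
have m0 : 0 <= fine (mu E) by apply: fine_ge0.
move=> s s0 hs U tau UQ tQ FU ht; rewrite sqr_sqrtr; last first.
  by apply: mulr_ge0 m0; apply: mulr_ge0; [lra | exact: ltW].
have aU := al_sqrt s0 hs; move/fintype.subsetP: UQ => UQ.
apply: (forest_tops_le (f := f) (Phi := Phi) (j := j) Ck0 s0).
  move=> t; have aU' : {in U, forall x, cabs (ip f (Phi x j)) <= s * Num.sqrt (l x)}.
    by move=> x /UQ; exact: aU.
  have := forest_quad_flat TS K0 L8 Ck0 lw wp t FU (ltW s0) f_sqi aU'.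
  by move/le_trans; apply; rewrite lerD2r f_mass.
by move=> t tU; have := ht t tU; under eq_bigr do rewrite alE.
Qed.

Lemma f_energy_local (Q : {set X}) (kap : X -> X) (rho : X -> R) (M : R) :
  {in Q, forall x, [/\ kap x \in Q, l x <= rho (kap x) &
     `|cen a l x - cen a l (kap x)| <= 2 * rho (kap x)]} ->
  \sum_(y in kap @: Q) rho y <= M ->
  forall Q' : {set X}, Q' \subset Q ->
  has_energy a l u al j Q' (Num.sqrt (64 * 513 * bes Ck * (8 * M))).
Proof.
move=> hk hM Q' QQ; have b0 := bes_gt0 Ck0; move/fintype.subsetP: QQ => QQ.
have r0 y : y \in kap @: Q -> 0 < rho y.
  by case/imsetP => x xQ ->; have [_ h _] := hk x xQ; exact: lt_le_trans (l0 x) h.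
have M0 : 0 <= M.
  by apply: le_trans hM; apply: sumr_ge0 => y /r0 /ltW.
have b1 : 0 < 64 * 513 * bes Ck by lra.
move=> s s0 hs U tau UQ tQ FU ht; rewrite sqr_sqrtr; last first.
  by rewrite mulr_ge0 ?(ltW b1) // mulr_ge0.
have aU := al_sqrt s0 hs; move/fintype.subsetP: UQ => UQ.
have s2 : 0 < s ^+ 2 by exact: exprn_gt0.
pose V y := [set x in U | kap (tau x) == y].
have VU y : V y \subset U by apply/fintype.subsetP => x; rewrite finset.in_set => /andP[].
have key y : y \in kap @: Q -> \sum_(t in tau @: V y) l t <= 64 * 513 * bes Ck * (8 * rho y) / s ^+ 2.
  move=> yK; apply: (forest_tops_le (f := f) (Phi := Phi) (j := j) Ck0 s0).
    move=> t; have aV : {in V y, forall x, cabs (ip f (Phi x j)) <= s * Num.sqrt (l x)}.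
      by move=> x /(fintype.subsetP (VU y)) /UQ; exact: aU.
    have hV : {in V y, forall x, l x <= rho y /\ `|cen a l x - cen a l y| <= 3 * rho y}.
      move=> x; rewrite finset.in_set => /andP[xU /eqP ky].
      have [_ h1 h2] := hk (tau x) (QQ _ (tQ x xU)); rewrite ky in h1 h2.
      have sb := forest_sub FU xU; have le := isub_len sb; split; first exact: le_trans le h1.
      have := norm_tri (cen a l x) (cen a l (tau x)) (cen a l y).
      have : `|cen a l x - cen a l (tau x)| <= l (tau x) / 2.
        by move: sb; rewrite /isub /cen ler_norml => /andP[]; have := l0 x; lra.
      by have := r0 y yK; lra.
    have := forest_quad_wgt TS K0 L8 Ck0 lw wp t (forestS (VU y) FU) (r0 y yK) (ltW s0) f_sqi hV aV.
    by move/le_trans; apply; rewrite lerD2r f_local // r0.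
  move=> t tV; have [x xV tx] := imsetP tV.
  have xU := fintype.subsetP (VU y) _ xV.
  have tU : t \in tau @: U by rewrite tx imset_f.
  apply: (le_trans (ht t tU)).
  rewrite le_eqVlt; apply/orP; left; apply/eqP.
  rewrite (eq_bigl (fun x => (x \in V y) && (tau x == t))); last first.
    move=> x'; rewrite finset.in_set; case: (eqVneq (tau x') t) => [e|]; rewrite ?andbF // !andbT e tx.
    by move: xV; rewrite finset.in_set => /andP[_ ->]; rewrite andbT.
  by apply: eq_bigr => x' _; rewrite alE.
have -> : \sum_(t in tau @: U) l t = \sum_(y in kap @: Q) \sum_(t in tau @: V y) l t.
  rewrite (partition_big kap (fun y => y \in kap @: Q)) /=; last first.
    by move=> t /imsetP[x xU ->]; apply: imset_f; exact: QQ (tQ x xU).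
  apply: eq_bigr => y _; apply: eq_bigl => t; apply/andP/imsetP.
    by case=> /imsetP[x xU ->] ky; exists x => //; rewrite finset.in_set xU.
  by case=> x; rewrite finset.in_set => /andP[xU ky] ->; rewrite imset_f.
apply: (le_trans (ler_sum _ key)); rewrite -mulr_suml -mulr_sumr -mulr_sumr.
rewrite ler_pM2r ?invr_gt0 // ler_pM2l // ler_pM2l //.
Qed.

End FunctionSizes.

(** * Sparse rank-1 collections as combinatorial data *)

Section Grids.
Variable R : realType.
Implicit Types I J : itv R.

Lemma itv_subP I J : 0 < ilen I ->
  itv_sub I J <-> ileft J <= ileft I /\ ileft I + ilen I <= ileft J + ilen J.
Proof.
move=> i0; split=> [h|[h1 h2] x /andP[x1 x2]]; last by rewrite /inI; apply/andP; split; lra.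
have /andP[h1 h2] : ileft J <= ileft I < ileft J + ilen J by apply: h; rewrite /inI lexx ltrDl.
split=> //; rewrite leNgt; apply/negP => h3.
have : inI J (ileft J + ilen J) by apply: h; rewrite /inI (ltW h2) h3.
by rewrite /inI ltxx andbF.
Qed.

Lemma dyadic_gt0 s I : dyadic s I -> 0 < ilen I.
Proof. by case=> j [k [-> _]]; exact: exprz_gt0. Qed.

Lemma dyadic_int s I J : shift_ok s -> dyadic s I -> dyadic s J -> ilen I <= ilen J ->
  exists (N : int) (m : nat), ileft J - ileft I = ilen I * N%:~R /\ ilen J = ilen I * 2 ^+ m.
Proof.
move=> hs [j [k [Ij Ik]]] [j' [k' [Jj Jk]]] le.
have jj : j <= j' by move: le; rewrite Ij Jj ler_eXz2l // ltr1n.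
have [m jm] : exists m : nat, j' = j + m%:Z.
  by exists `|j' - j|%N; rewrite gez0_abs ?subr_ge0 //; ring.
have e2 : (2 : R) ^ j' = 2 ^ j * 2 ^+ m by rewrite jm expfzDr // ?pnatr_eq0.
have e1 : (-1 : R) ^ j' = (-1) ^ j * (-1) ^+ m by rewrite jm expfzDr // ?oppr_eq0 ?oner_eq0.
have [q hq] : exists q : int, (-2 : R) ^+ m - 1 = 3 * q%:~R.
  elim: m {jm e1 e2} => [|m [q IH]]; first by exists 0; rewrite expr0 subrr mulr0.
  exists (-2 * q - 1); have : (-2 : R) ^+ m = 3 * q%:~R + 1 by rewrite -IH subrK.
  by rewrite exprS => ->; rewrite intrD intrM !mulrNz; ring.
have [p hp] : exists p : int, 3 * s = p%:~R.
  case: hs => [->|[->|->]]; [by exists 0; rewrite mulr0|exists 1|exists 2].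
    by field.
  by field.
have [e he] : exists e : int, (-1 : R) ^ j = e%:~R.
  case: j {Ij Ik jj jm e2 e1} => n; [exists ((-1) ^+ n)|exists ((-1) ^+ n.+1)].
    by rewrite -exprnP rmorphXn /= rmorphN1.
  by rewrite NegzE -exprnN -exprVn invrN1 rmorphXn /= rmorphN1.
exists (2 ^+ m * k' - k + e * p * q), m; split; last by rewrite Ij Jj e2.
rewrite Ij Ik Jk e2 e1 he.
have -> : (2 ^+ m * k' - k + e * p * q)%:~R = 2 ^+ m * k'%:~R - k%:~R + e%:~R * p%:~R * q%:~R :> R.
  by rewrite !(intrD, intrM, mulrNz) rmorphXn.
have -> : (2 : R) ^+ m = (-1) ^+ m * (-2) ^+ m by rewrite -exprMn mulN1r opprK.
have h2 : (-2 : R) ^+ m = 1 + 3 * q%:~R by rewrite -hq addrC subrK.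
rewrite h2 -hp.
have sq : (-1 : R) ^+ m * (-1) ^+ m = 1 by rewrite -exprMn mulN1r opprK expr1n.
have -> : 2 ^ j * ((-1) ^+ m * (1 + 3 * q%:~R)) * (k'%:~R + e%:~R * (-1) ^+ m * s) -
   2 ^ j * (k%:~R + e%:~R * s) = 2 ^ j * ((-1) ^+ m * (1 + 3 * q%:~R) * k'%:~R +
   ((-1) ^+ m * (-1) ^+ m) * (1 + 3 * q%:~R) * e%:~R * s - k%:~R - e%:~R * s) by ring.
by rewrite sq; ring.
Qed.

Definition overlap I J := `|ctr I - ctr J| < (ilen I + ilen J) / 2.

Lemma overlapC I J : overlap I J = overlap J I.
Proof. by rewrite /overlap distrC (addrC (ilen I)). Qed.

Lemma overlapE I J : overlap I J = (ileft I < ileft J + ilen J) && (ileft J < ileft I + ilen I).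
Proof.
rewrite /overlap /ctr ltr_norml; apply/andP/andP => -[h1 h2]; split; lra.
Qed.

Lemma dyadic_nested s I J : shift_ok s -> dyadic s I -> dyadic s J -> ilen I <= ilen J ->
  overlap I J -> ileft J <= ileft I /\ ileft I + ilen I <= ileft J + ilen J.
Proof.
move=> hs dI dJ le; rewrite overlapE => /andP[h1 h2].
have [N [m [e1 e2]]] := dyadic_int hs dI dJ le; have i0 := dyadic_gt0 dI.
have N1 : N%:~R < 1 :> R.
  by rewrite -(ltr_pM2l i0) mulr1 -e1; lra.
have N0 : N <= 0 by move: N1; rewrite -[1]/(1%:~R) ltr_int; lia.
have M1 : - N%:~R < 2 ^+ m :> R.
  by rewrite -(ltr_pM2l i0) mulrN -e1 -e2; lra.
have M0 : - N + 1 <= 2 ^+ m.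
  have : (- N)%:~R < (2 ^+ m : int)%:~R :> R by rewrite mulrNz rmorphXn.
  by rewrite ltr_int; lia.
have M2 : - N%:~R + 1 <= 2 ^+ m :> R.
  have : (- N + 1)%:~R <= (2 ^+ m : int)%:~R :> R by rewrite ler_int.
  by rewrite intrD mulrNz rmorphXn.
have N2 : N%:~R <= 0 :> R by rewrite -[0]/(0%:~R) ler_int.
split.
  by rewrite -subr_le0 e1 pmulr_rle0.
rewrite -subr_ge0; have -> : ileft J + ilen J - (ileft I + ilen I) =
   ilen I * (2 ^+ m - (- N%:~R + 1)) by rewrite mulrBr -e2 mulrDr mulrN -e1; ring.
by rewrite mulr_ge0 ?(ltW i0) // subr_ge0.
Qed.

Lemma dyadic_same s I J : shift_ok s -> dyadic s I -> dyadic s J -> ilen I = ilen J ->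
  overlap I J -> I = J.
Proof.
move=> hs dI dJ e ov.
have le : ilen I <= ilen J by rewrite e.
have [h1 _] := dyadic_nested hs dI dJ le ov.
have [h2 _] : ileft I <= ileft J /\ ileft J + ilen J <= ileft I + ilen I.
  by apply: (dyadic_nested hs dJ dI); [rewrite e | rewrite overlapC].
by move: e h1 h2; case: (I) => a b; case: (J) => c d /= -> h1 h2; congr Itv; lra.
Qed.

Lemma dyadic_grid s I J1 J2 : shift_ok s -> dyadic s I -> dyadic s J1 -> dyadic s J2 ->
  ilen I <= ilen J1 -> ilen I <= ilen J2 -> overlap I J1 -> overlap I J2 -> overlap J1 J2.
Proof.
move=> hs dI d1 d2 l1 l2 o1 o2; have i0 := dyadic_gt0 dI.
have [a1 b1] := dyadic_nested hs dI d1 l1 o1; have [a2 b2] := dyadic_nested hs dI d2 l2 o2.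
by rewrite overlapE; apply/andP; split; lra.
Qed.

Lemma dyadic_edge s I J (b b' : bool) : shift_ok s -> dyadic s I -> dyadic s J -> ilen I <= ilen J ->
  `|(ctr I + (-1) ^+ b * (9 / 20 * ilen I)) - (ctr J + (-1) ^+ b' * (9 / 20 * ilen J))| < 1 / 100 * ilen I ->
  I = J.
Proof.
move=> hs dI dJ le; have [N [m [e1 e2]]] := dyadic_int hs dI dJ le; have i0 := dyadic_gt0 dI.
pose q (b : bool) : int := if b then 1 else 19.
have hq (c : bool) (x : R) : x / 2 + (-1) ^+ c * (9 / 20 * x) = (q c)%:~R / 20 * x.
  by case: c; rewrite /q /= ?expr1 ?expr0; field.
move=> h; have : `|(20 * N + 2 ^+ m * q b' - q b)%:~R| < 1 :> R.
  have e3 : (ctr I + (-1) ^+ b * (9 / 20 * ilen I)) - (ctr J + (-1) ^+ b' * (9 / 20 * ilen J)) =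
     - (ilen I / 20 * (20 * N + 2 ^+ m * q b' - q b)%:~R).
    have cE (A : itv R) (c : bool) : ctr A + (-1) ^+ c * (9 / 20 * ilen A) =
        ileft A + (q c)%:~R / 20 * ilen A by rewrite /ctr -addrA hq.
    rewrite !cE e2.
    have -> : (20 * N + 2 ^+ m * q b' - q b)%:~R = 20 * N%:~R + 2 ^+ m * (q b')%:~R - (q b)%:~R :> R.
      by rewrite !(intrD, intrM, mulrNz) rmorphXn.
    have -> : ileft J = ileft I + ilen I * N%:~R by rewrite -e1 addrC subrK.
    by field.
  move: h; rewrite e3 normrN normrM ger0_norm ?divr_ge0 ?(ltW i0) //.
  move=> h; rewrite -(ltr_pM2l (_ : 0 < ilen I / 20)) ?divr_gt0 //; apply: (lt_le_trans h); lra.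
rewrite -[1]/(1%:~R) -intr_norm ltr_int => h1.
have z : 20 * N + 2 ^+ m * q b' - q b = 0 by lia.
have [m0 N0] : m = 0%N /\ N = 0.
  case: m {e2 h1} z => [|m] z; last by exfalso; move: z; rewrite exprS /q; case: (b); case: (b'); lia.
  by split=> //; move: z; rewrite expr0 /q; case: (b); case: (b'); lia.
move: e1 e2; rewrite m0 N0 mulr0 expr0 mulr1 => /eqP; rewrite subr_eq0.
by case: (I) => a1 b1; case: (J) => a2 b2 /= /eqP -> ->.
Qed.

End Grids.

Section Sequences.

Lemma In_nth (A : Type) (x0 : A) (s : seq A) k : (k < size s)%N -> List.In (nth x0 s k) s.
Proof. by elim: s k => [//|y s IH] [|k] /= h; [left | right; exact: IH]. Qed.

Lemma In_tnth (A : Type) (s : seq A) (i : 'I_(size s)) : List.In (tnth (in_tuple s) i) s.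
Proof.
have x0 : A by case: s i => [[]//|x0 _ _]; exact: x0.
by rewrite (tnth_nth x0); exact: In_nth.
Qed.

Lemma nth_NoDup (A : Type) (x0 : A) (s : seq A) i j : List.NoDup s ->
  (i < size s)%N -> (j < size s)%N -> nth x0 s i = nth x0 s j -> i = j.
Proof.
elim: s i j => [//|y s IH] [|i] [|j] //= nd hi hj e; inversion nd as [|? ? H1 H2].
- by case: H1; rewrite e; exact: In_nth.
- by case: H1; rewrite -e; exact: In_nth.
- by rewrite (IH i j).
Qed.

Lemma tnth_inj (A : Type) (s : seq A) : List.NoDup s -> injective (tnth (in_tuple s)).
Proof.
move=> nd i j; have x0 : A by exact: tnth (in_tuple s) i.
by rewrite !(tnth_nth x0) => e; apply/val_inj/(nth_NoDup nd (ltn_ord i) (ltn_ord j) e).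
Qed.

Lemma NoDup_sieve (A : Type) (p : pred A) (s : seq A) : List.NoDup s ->
  List.NoDup [seq x <- s | p x] /\ forall x, List.In x [seq x <- s | p x] -> p x /\ List.In x s.
Proof.
elim: s => [|x s IH] nd; first by split=> //; constructor.
inversion nd as [|? ? H1 H2]; subst; have [h1 h2] := IH H2; rewrite /=; case: ifP => px; split=> //=.
- by constructor => // /h2[].
- by move=> y [<-|/h2[? ?]]; split=> //; [left | right].
- by move=> y /h2[? ?]; split=> //; right.
Qed.

End Sequences.

Section Tilings.
Variable R : realType.
Variables (K L : nat) (Ck : nat -> R) (c : R).

Lemma tritile_len (s : 'I_3 -> R) (T : tritile R) j : is_tritile s T ->
  0 < ilen (TI T) /\ ilen (tw_of T j) = (ilen (TI T))^-1.
Proof.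
move=> h; have [_ [d0 [_ e]]] := h j; have i0 := dyadic_gt0 d0; split=> //.
by apply: (mulfI (lt0r_neq0 i0)); rewrite mulfV ?lt0r_neq0.
Qed.

Lemma side_len (s : 'I_3 -> R) (T : tritile R) : is_tritile s T -> side T = (ilen (TI T))^-1.
Proof. by move=> h; exact: (tritile_len i0 h).2. Qed.

Lemma same_cube (s : 'I_3 -> R) (T T' : tritile R) : is_tritile s T -> is_tritile s T' ->
  in_cube T = in_cube T' -> forall j, tw_of T j = tw_of T' j.
Proof.
move=> h h' e j.
have pos (U : tritile R) i : is_tritile s U -> 0 < ilen (tw_of U i).
  by move=> hU; have [p ->] := tritile_len i hU; rewrite invr_gt0.
have sub (U U' : tritile R) : is_tritile s U -> is_tritile s U' -> in_cube U = in_cube U' ->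
    itv_sub (tw_of U j) (tw_of U' j).
  move=> hU hU' eU x xU.
  have : in_cube U (fun i => if i == j then x else ileft (tw_of U i)).
    move=> i; case: eqP => [->//|_]; rewrite /inI lexx /= ltrDl; exact: pos.
  by rewrite eU => /(_ j); rewrite eqxx.
have /(itv_subP _ (pos T j h)) [a1 b1] := sub T T' h h' e.
have /(itv_subP _ (pos T' j h')) [a2 b2] := sub T' T h' h (esym e).
by move: a1 b1 a2 b2; case: (tw_of T j) (tw_of T' j) => [p q] [p' q'] /= *; congr Itv; lra.
Qed.

Variables (Q Qt : seq (tritile R)) (sQ : 'I_3 -> R).
Hypotheses (spQ : sparse sQ Q) (r1 : rank1 Q).
Hypotheses (ndQ : List.NoDup Qt) (QtQ : forall T, List.In T Qt -> List.In T Q).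
Let X := 'I_(size Qt).
Let T (x : X) := tnth (in_tuple Qt) x.
Local Notation a := (qa T).
Local Notation l := (ql T).
Local Notation u := (qu T).

Let TQ x : List.In (T x) Q. Proof. exact/QtQ/In_tnth. Qed.
Let tT x : is_tritile sQ (T x). Proof. exact: spQ.1. Qed.
Let l0 x : 0 < l x. Proof. exact: (tritile_len i0 (tT x)).1. Qed.
Let lwT x j : ilen (tw_of (T x) j) = (l x)^-1. Proof. exact: (tritile_len j (tT x)).2. Qed.
Let dI x : dyadic 0 (TI (T x)). Proof. by have [_ []] := tT x i0. Qed.
Let dW x j : dyadic (sQ j) (tw_of (T x) j). Proof. by have [_ [_ []]] := tT x j. Qed.
Let sh j (x : X) : shift_ok (sQ j). Proof. by have [] := tT x j. Qed.
Let ok0 : shift_ok (0 : R). Proof. by left. Qed.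

Let overT x y : overlap (TI (T x)) (TI (T y)) = ~~ itv_disj a l x y.
Proof. by rewrite overlapE /itv_disj negb_or -!ltNge andbC. Qed.

Let overW j x y : overlap (tw_of (T x) j) (tw_of (T y) j) = fmeet l (u j) x y.
Proof. by rewrite /overlap !lwT. Qed.

Let dyad x y : l x <= l y -> isub a l x y || itv_disj a l x y.
Proof.
move=> le; case: (boolP (itv_disj a l x y)); rewrite ?orbT // orbF => nd.
have ov : overlap (TI (T x)) (TI (T y)) by rewrite overT.
by have [h1 h2] := dyadic_nested ok0 (dI x) (dI y) le ov; rewrite /isub h1 h2.
Qed.

Let eq_time x y : l x = l y -> TI (T x) <> TI (T y) -> itv_disj a l x y.
Proof.
move=> e ne; apply/negPn/negP; rewrite -overT => ov; apply: ne.
exact: (dyadic_same ok0 (dI x) (dI y) e ov).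
Qed.

Let eq_tile j x y : x != y -> l x = l y -> tw_of (T x) j = tw_of (T y) j -> itv_disj a l x y.
Proof.
move=> ne e eW; apply: eq_time => // eT.
have nT : T x <> T y by move=> /(tnth_inj ndQ) /eqP; rewrite (negbTE ne).
by apply: (r1.1 _ _ (TQ x) (TQ y) nT j); rewrite /tcomp eT eW.
Qed.

Let gap x y : l x < l y -> 10 ^+ 9 * l x < l y.
Proof.
move=> lt.
have ix : 0 < (l x)^-1 by rewrite invr_gt0. have iy : 0 < (l y)^-1 by rewrite invr_gt0.
have lti : (l y)^-1 < (l x)^-1 by rewrite ltf_pV2 ?posrE.
have ne : in_cube (T y) <> in_cube (T x).
  move=> /(same_cube (tT y) (tT x)) /(_ i0) e; have := lwT y i0; rewrite e lwT => e'.
  by move: lti; rewrite e' ltxx.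
have [h _] := spQ.2 _ _ (TQ y) (TQ x) ne; move: h; rewrite !(side_len (tT _)) => /(_ lti) h.
have h' : 10 ^+ 9 * (l y)^-1 < (l x)^-1 := h.
have nx := lt0r_neq0 (l0 x); have ny := lt0r_neq0 (l0 y).
have e1 : 10 ^+ 9 * l x = 10 ^+ 9 * (l y)^-1 * (l x * l y) by field; rewrite ny.
have e2 : l y = (l x)^-1 * (l x * l y) by field; rewrite nx.
by rewrite e1 [ltRHS]e2 ltr_pM2r // mulr_gt0.
Qed.

Let dil_sub k x y j : 0 < k -> itv_sub (dil k (tw_of (T y) j)) (dil k (tw_of (T x) j)) <->
  `|u j x - u j y| <= k / 2 * ((l x)^-1 - (l y)^-1).
Proof.
move=> k0; have iy : 0 < (l y)^-1 by rewrite invr_gt0.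
have p : 0 < ilen (dil k (tw_of (T y) j)) by rewrite /dil /= lwT mulr_gt0.
rewrite (itv_subP _ p) /dil /= !lwT -/(u j x) -/(u j y) ler_norml.
by split=> [[h1 h2]|/andP[h1 h2]]; [apply/andP; split|split]; lra.
Qed.

Let lsub x y : isub a l x y <-> itv_sub (TI (T x)) (TI (T y)).
Proof. by rewrite (itv_subP _ (l0 x)); split=> [/andP|[h1 h2]] //; apply/andP. Qed.

Let ltt_tle i x t : ltt a l u i x t -> tle (tcomp (T x) i) (tcomp (T t) i).
Proof.
case/and3P => lt sb h; right; split=> /=.
  split; first exact/lsub.
  by move=> /lsub /isub_len; rewrite leNgt lt.
exact/dil_sub.
Qed.

Let tlsim_dist x t j : tlsim (tcomp (T x) j) (tcomp (T t) j) ->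
  `|u j x - u j t| <= 10 ^+ 7 / 2 * ((l x)^-1 - (l t)^-1).
Proof. by case=> _ h; apply/dil_sub => //; rewrite exprn_gt0. Qed.

Let half7 : 10 ^+ 7 / 2 = 5 * 10 ^+ 6 :> R. Proof. by field. Qed.

Lemma tilesys_of : tilesys a l u.
Proof.
split.
- exact: l0.
- exact: dyad.
- exact: gap.
- move=> i j x t ji h; have lt := ltt_len h.
  have ix : 0 < (l x)^-1 by rewrite invr_gt0. have it : 0 < (l t)^-1 by rewrite invr_gt0.
  have [h1 h2] := r1.2 _ _ (TQ t) (TQ x) i (ltt_tle h).
  have [h3 h4] := h2 (gap lt) j ji.
  have := tlsim_dist h3; rewrite half7 => h5.
  have big : 0 < 5 * 10 ^+ 6 :> R by rewrite mulr_gt0 // exprn_gt0.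
  apply/andP; split; last first.
    by apply: (le_trans h5); rewrite ler_pM2l //; lra.
  rewrite leNgt; apply/negP => h6; apply: h4; right; split=> /=.
    by case/and3P: h => _ sb _; split; [exact/lsub | move=> /lsub /isub_len; rewrite leNgt lt].
  apply/dil_sub => //.
  have : 10 ^+ 9 * (l t)^-1 <= (l x)^-1.
    by rewrite -(ler_pM2r (l0 x)) mulVf ?lt0r_neq0 // mulrAC ler_pdivrMr // mul1r ltW // gap.
  have : 100 <= 10 ^+ 9 :> R.
    have -> : 10 ^+ 9 = 100 * 10 ^+ 7 :> R by ring.
    by rewrite ler_peMr // exprn_ege1 //; lra.
  set b := 10 ^+ 9 => b1 b2; have := ler_wpM2r (ltW it) b1; lra.
- move=> i x y t hx hy ne e.
  have [h1 _] := r1.2 _ _ (TQ t) (TQ x) i (ltt_tle hx).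
  have [h2 _] := r1.2 _ _ (TQ t) (TQ y) i (ltt_tle hy).
  have ix : 0 < (l x)^-1 by rewrite invr_gt0. have it : 0 < (l t)^-1 by rewrite invr_gt0.
  have near j : `|u j x - u j y| <= 10 ^+ 7 * (l x)^-1.
    have d1 := tlsim_dist (h1 j); have d2 := tlsim_dist (h2 j); rewrite -e in d2.
    have p7 : 0 < 10 ^+ 7 :> R by rewrite exprn_gt0.
    have := norm_tri (u j x) (u j t) (u j y); rewrite (distrC (u j t)).
    have := mulr_gt0 p7 it; move: d1 d2; set b := 10 ^+ 7; lra.
  have [eq|ne'] := pselect (in_cube (T x) = in_cube (T y)).
    exact: (eq_tile ne e (same_cube (tT x) (tT y) eq i0)).
  have [_ h] := spQ.2 _ _ (TQ x) (TQ y) ne'; case: h.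
    by rewrite !(side_len (tT _)) -/(l x) -/(l y) e.
  have p9 : 0 < 10 ^+ 9 * (l x)^-1 by rewrite mulr_gt0 // exprn_gt0.
  have b9 : 4 * (10 ^+ 7 * (l x)^-1) <= 10 ^+ 9 * (l x)^-1.
    have -> : 10 ^+ 9 = 100 * 10 ^+ 7 :> R by ring.
    have : 0 <= 10 ^+ 7 * (l x)^-1 by rewrite mulr_ge0 ?exprn_ge0 // ltW.
    set b := 10 ^+ 7; lra.
  exists (fun j => u j x); split=> j; rewrite /inI /dil /= lwT.
    by rewrite -/(u j x); move: p9; set b := 10 ^+ 9 => p9; apply/andP; split; lra.
  rewrite -e -/(u j y); have := near j; rewrite ler_norml => /andP[n1 n2].
  by move: p9 b9 n1 n2; set b := 10 ^+ 9; set b' := 10 ^+ 7 => p9 b9 n1 n2; apply/andP; split; lra.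
- move=> j x y ne e; rewrite -overW => ov.
  apply: (eq_tile (j := j) ne e); apply: (dyadic_same (sh j x) (dW x j) (dW y j)) => //.
  by rewrite !lwT e.
- move=> j x y z ly lz; rewrite -!overW; apply: (dyadic_grid (sh j x) (dW x j) (dW y j) (dW z j));
  by rewrite !lwT lef_pV2 ?posrE.
Qed.

Variables (P cP : seq (tritile R)) (sP : 'I_3 -> R).
Hypotheses (spP : sparse sP P) (ndP : List.NoDup cP) (cPP : forall U, List.In U cP -> List.In U P).
Hypothesis disjP : forall U U', List.In U cP -> List.In U' cP -> U <> U' ->
  ~ exists x xi, inI (TI U) x /\ inI (W2 U) xi /\ inI (TI U') x /\ inI (W2 U') xi.
Let Y := 'I_(size cP).
Let TP (y : Y) := tnth (in_tuple cP) y.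
Variables (Phi : X -> 'I_3 -> R -> R[i]) (PhiP : Y -> R -> R[i]).
Hypotheses (K0 : (0 < K)%N) (L0 : (10 <= L)%N) (Ck0 : forall k, 0 < Ck k) (c0 : 0 < c <= 10 ^- 9).
Hypothesis wpQ : forall x j, wave_packet K L Ck (tcomp (T x) j) (Phi x j).
Hypothesis wpP : forall y, wave_packet K L Ck (tcomp (TP y) i1) (PhiP y).

Let tP y : is_tritile sP (TP y). Proof. exact/spP.1/cPP/In_tnth. Qed.
Let lp0 y : 0 < pl TP y. Proof. exact: (tritile_len i0 (tP y)).1. Qed.
Let lwP y : ilen (W2 (TP y)) = (pl TP y)^-1. Proof. exact: (tritile_len i1 (tP y)).2. Qed.
Let dV y : dyadic (sP i1) (W2 (TP y)). Proof. by have [_ [_ []]] := tP y i1. Qed.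
Let shP (y : Y) : shift_ok (sP i1). Proof. by have [] := tP y i1. Qed.

Let overP y y' : overlap (W2 (TP y)) (W2 (TP y')) = fmeet (pl TP) (pv TP) y y'.
Proof. by rewrite /overlap !lwP. Qed.

Lemma model_of : model T TP c K L Ck Phi PhiP.
Proof.
split=> //; try exact: tilesys_of.
- move=> x y; have [j [k [e1 _]]] := dI x.
  have [_ [[j' [k' [e2 _]]] _]] := tP y i0.
  rewrite /pl /ql e1 e2; case: (leP j' j) => h; [left|right].
    by rewrite ler_eXz2l // ltr1n.
  have -> : 2 * (2 : R) ^ j = 2 ^ (j + 1) by rewrite expfzDr ?pnatr_eq0 // expr1z mulrC.
  by rewrite ler_eXz2l ?ltr1n //; lia.
- move=> y y' ne m.
  have nT : TP y <> TP y' by move=> /(tnth_inj ndP) /eqP; rewrite (negbTE ne).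
  apply/negPn/negP; rewrite /itv_disj negb_or -!ltNge => /andP[d1 d2].
  apply: (disjP (In_tnth _) (In_tnth _) nT).
  move: m; rewrite -overP overlapE => /andP[m1 m2].
  have py := lp0 y; have py' := lp0 y'.
  have wy : 0 < ilen (W2 (TP y)) by rewrite lwP invr_gt0.
  have wy' : 0 < ilen (W2 (TP y')) by rewrite lwP invr_gt0.
  exists (Num.max (ileft (TI (TP y))) (ileft (TI (TP y')))).
  exists (Num.max (ileft (W2 (TP y))) (ileft (W2 (TP y')))).
  rewrite /inI !le_max !gt_max !lexx !orbT /=; rewrite /pb /pl in d1 d2 py py'.
  by repeat split; apply/andP; split => //; lra.
- move=> y y1 y2 l1 l2; rewrite -!overP (overlapC (W2 (TP y1))) (overlapC (W2 (TP y2))).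
  by apply: (dyadic_grid (shP y) (dV y) (dV y1) (dV y2)); rewrite !lwP lef_pV2 ?posrE.
- move=> y y' b b'; rewrite -!lwP => h1 h2.
  suff e : W2 (TP y) = W2 (TP y').
    by rewrite /pv e; split=> //; apply: invr_inj; rewrite -!lwP e.
  case: (lerP (ilen (W2 (TP y))) (ilen (W2 (TP y')))) => le.
    exact: (dyadic_edge (shP y) (dV y) (dV y') le h1).
  apply/esym; apply: (dyadic_edge (shP y) (dV y') (dV y) (ltW le)); rewrite distrC; exact: h2.
Qed.

Lemma rel_of y x : prel T TP c y x = `[< ssubsub c (W3 (T x)) (W2 (TP y)) >].
Proof.
have w3 : ilen (W3 (T x)) = (l x)^-1 := lwT x i2.
have p : 0 < ilen (W3 (T x)) by rewrite w3 invr_gt0.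
apply/andP/asboolP; rewrite /ssubsub (itv_subP _ p) /dil /= w3 lwP.
  move=> [h1 h2]; split=> //; rewrite /qu /tw_of /= /ctr w3 in h2; rewrite /ctr lwP.
  have := ler_norm (ileft (W3 (T x)) + (l x)^-1 / 2 - pv TP y).
  have := ler_norm (- (ileft (W3 (T x)) + (l x)^-1 / 2 - pv TP y)); rewrite normrN.
  by move: h2; rewrite /pv /ctr lwP => *; split; lra.
move=> [h1 [h2 h3]]; split=> //; rewrite /qu /tw_of /= /pv /ctr w3 lwP.
move: h2 h3; rewrite /ctr lwP => h2 h3.
by rewrite -lerBrDr ler_norml; apply/andP; split; lra.
Qed.

End Tilings.

(** * The core estimate *)

Section Exponents.
Variable R : realType.

Lemma powR_expR (x r : R) : expR x `^ r = expR (r * x).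
Proof. by rewrite /powR gt_eqF ?expR_gt0 // expRK. Qed.

Lemma sqrt_expR (x : R) : Num.sqrt (expR x) = expR (x / 2).
Proof.
have -> : expR x = expR (x / 2) ^+ 2 by rewrite expr2 -expRD; congr expR; field.
by rewrite sqrtr_sqr ger0_norm // expR_ge0.
Qed.

Lemma exp2_expR (d : nat) : (2 : R) ^+ d = expR (d%:R * ln 2).
Proof. by rewrite expRM_natl lnK // posrE. Qed.

Lemma min_expR (x y : R) : Num.min (expR x) (expR y) = expR (Num.min x y).
Proof. by case: (leP x y) => h; [rewrite min_l // ler_expR | rewrite min_r // ltW // ltr_expR]. Qed.

Lemma interp_numeric (F C1 CS C2 m2 m3 X q th : R) (d : nat) :
  0 < F -> 0 < C1 -> 0 < CS -> 0 < C2 -> 0 < m2 -> 0 < m3 -> 0 < X -> 0 < q -> 0 < th -> th + q <= 1 ->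
  (Num.sqrt F `^ th * Num.sqrt (C1 * Num.min m2 (8 * (2 ^+ d.+1 * X))) `^ (1 - th)) *
  (Num.sqrt F `^ th * Num.sqrt (C1 * Num.min m3 (8 * (2 ^+ d.+1 * X))) `^ (1 - th)) *
  ((Num.sqrt CS * 2 ^- d) `^ (1 - 2 * th) * Num.sqrt (C2 * X) `^ (2 * th)) <=
  (F `^ th * (16 * C1) `^ (1 - th) * CS `^ ((1 - 2 * th) / 2) * C2 `^ th) *
  ((m2 * m3) `^ (q / 2) * X `^ (1 - q)) * (2 `^ (th - q)) ^+ d.
Proof.
move=> F0 C10 CS0 C20 m20 m30 X0 q0 th0 thq.
have K (x : R) : 0 < x -> x = expR (ln x) by move=> x0; rewrite lnK // posrE.
have l2 : 0 < ln 2 :> R by rewrite ln_gt0 // ltr1n.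
have e8 : 8 = expR (3 * ln 2) :> R by rewrite -(exp2_expR 3); ring.
have e16 : 16 = expR (4 * ln 2) :> R by rewrite -(exp2_expR 4); ring.
have e2 : 2 `^ (th - q) = expR ((th - q) * ln 2) by rewrite [X in X `^ _](K 2) // powR_expR.
rewrite (K F F0) (K C1 C10) (K CS CS0) (K C2 C20) (K m2 m20) (K m3 m30) (K X X0) e8 e16 e2.
move: (ln F) (ln C1) (ln CS) (ln C2) (ln m2) (ln m3) (ln X) => f c1 cs c2 a2 a3 x.
rewrite !exp2_expR -expRN -!expRD !min_expR -!expRD !sqrt_expR -!expRD !powR_expR -expRM_natl -!expRD ler_expR.
rewrite -(natr1 d); set n := d%:R; set b := 3 * ln 2 + _.
have mn (a : R) : (1 - th) * Num.min a b <= q * a + (1 - th - q) * b.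
  have h1 : Num.min a b <= a by rewrite ge_min lexx.
  have h2 : Num.min a b <= b by rewrite ge_min lexx orbT.
  have := ler_wpM2l (ltW q0) h1; have t0 : 0 <= 1 - th - q by lra.
  by have := ler_wpM2l t0 h2; move: (Num.min a b) => w; lra.
have h2 := mn a2; have h3 := mn a3; move: h2 h3; move: (Num.min a2 b) (Num.min a3 b) => w2 w3.
have := mulr_gt0 q0 l2; rewrite /b; lra.
Qed.

Lemma geo_le (r : R) n : 0 <= r < 1 -> \sum_(d < n) r ^+ d <= (1 - r)^-1.
Proof.
case/andP => r0 r1; have p : 0 < 1 - r by lra.
rewrite -[leRHS]mulr1 ler_pdivlMl //.
have -> : (1 - r) * \sum_(d < n) r ^+ d = 1 - r ^+ n.
  elim: n => [|n IH]; first by rewrite big_ord0 mulr0 expr0 subrr.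
  by rewrite big_ord_recr /= mulrDr IH exprS; ring.
by rewrite lerBlDr lerDl exprn_ge0.
Qed.

End Exponents.

Section Core.
Variable R : realType.
Local Notation mu := (@lebesgue_measure R).
Local Notation C := R[i].
Variables (c : R) (Ck : nat -> R) (q th : R).

Definition ckF := 64 * 513 * bes Ck.
Definition ckS := 4 * (cst_flat c Ck + (8 * packet_cst Ck) ^+ 2 + cst_smear c Ck).
Definition ckE := 64 / 3 * enc c Ck.
Definition core_cst := 168 / (1 - 2 `^ (- th)) *
  (fsizec Ck `^ th * (16 * ckF) `^ (1 - th) * ckS `^ ((1 - 2 * th) / 2) * ckE `^ th) *
  (1 - 2 `^ (th - q))^-1.

Hypotheses (Ck0 : forall k, 0 < Ck k) (c0 : 0 < c).
Hypotheses (q01 : 0 < q < 1) (th0 : 0 < th <= 1 / 3) (thq : th < q) (th1 : th + q <= 1).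

Let gc0 : 0 < packet_cst Ck. Proof. by rewrite !mulr_gt0. Qed.
Let bes0 : 0 < bes Ck. Proof. exact: bes_gt0. Qed.
Let D0 : 0 < 16 / c + 16. Proof. by rewrite addr_gt0 // divr_gt0. Qed.

Lemma cst_flat_gt0 : 0 < cst_flat c Ck.
Proof.
rewrite /cst_flat; set g := packet_cst Ck; set D := 16 / c + 16.
have g0 : 0 < g by exact: gc0.
have b0 : 0 < bes Ck by exact: bes0.
have h1 : 0 < 8 * bes Ck * (512 * g) by apply: mulr_gt0; lra.
have h2 : 0 <= 64 * (8 * g) ^+ 2 by apply: mulr_ge0; [lra | exact: sqr_ge0].
have h3 : 0 <= 4 * g ^+ 2 * 8 ^+ 2 * D.
  apply: mulr_ge0; last exact: ltW D0.
  by apply: mulr_ge0; [apply: mulr_ge0; [lra | exact: sqr_ge0] | exact: sqr_ge0].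
by move: h1 h2 h3; move: (_ * (512 * g)) (64 * _) (_ * D) => w1 w2 w3; lra.
Qed.

Lemma cst_smear_ge0 : 0 <= cst_smear c Ck.
Proof.
rewrite /cst_smear; set g := packet_cst Ck; set D := 16 / c + 16.
have g0 : 0 < g by exact: gc0. have D00 : 0 < D by exact: D0.
have h1 : 0 <= 8 * bes Ck * ((56 * Ck 0%N) ^+ 2 * 8).
  apply: mulr_ge0; first by have := bes0; lra.
  by apply: mulr_ge0; [exact: sqr_ge0 | lra].
have h2 : 0 <= 64 * (56 * g) ^+ 2 by apply: mulr_ge0; [lra | exact: sqr_ge0].
have h3 : 0 <= 4 * (errc Ck + g) ^+ 2 * 16 ^+ 2 * (32 + D).
  apply: mulr_ge0; last by lra.
  by apply: mulr_ge0; [apply: mulr_ge0; [lra | exact: sqr_ge0] | exact: sqr_ge0].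
by move: h1 h2 h3; move: (_ * (_ * 8)) (64 * _) (_ * (32 + D)) => w1 w2 w3; lra.
Qed.

Lemma ckS_gt0 : 0 < ckS.
Proof.
have := cst_flat_gt0; have := cst_smear_ge0; have := sqr_ge0 (8 * packet_cst Ck); rewrite /ckS.
by move: (_ ^+ 2) (cst_flat _ _) (cst_smear _ _) => w1 w2 w3; lra.
Qed.

Lemma ckE_gt0 : 0 < ckE.
Proof.
rewrite /ckE /enc; set g := packet_cst Ck; have g0 : 0 < g by exact: gc0.
have h1 : 0 < 8 * g * (8 * 513 * g) by apply: mulr_gt0; lra.
have h2 : 0 <= 8 * g * (8 * (mesh c)%:R * g / c).
  apply: mulr_ge0; first by lra.
  apply: divr_ge0; last exact: ltW c0.
  by apply: mulr_ge0; [apply: mulr_ge0; [lra | exact: ler0n] | exact: ltW].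
have h3 : 0 <= 2 * g ^+ 2 * (8 * 320).
  by apply: mulr_ge0; [apply: mulr_ge0; [lra | exact: sqr_ge0] | lra].
apply: mulr_gt0; first by lra.
by move: h1 h2 h3; move: (_ * (8 * 513 * g)) (_ * (_ / c)) (_ * (8 * 320)) => w1 w2 w3; lra.
Qed.

Lemma ckF_gt0 : 0 < ckF. Proof. by have := bes0; rewrite /ckF; lra. Qed.

Lemma two_pow_lt1 (r : R) : r < 0 -> 2 `^ r < 1.
Proof.
move=> r0; rewrite /powR ifF; last by apply/eqP/eqP; rewrite pnatr_eq0.
rewrite -[ltRHS](@expR0 R) ltr_expR pmulr_llt0 //; by rewrite ln_gt0 // ltr1n.
Qed.

Lemma core_cst_gt0 : 0 < core_cst.
Proof.
have [t0 _] := andP th0.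
have a168 : 0 < 168 :> R by lra.
rewrite /core_cst; apply: mulr_gt0; last by rewrite invr_gt0 subr_gt0 two_pow_lt1 // subr_lt0.
apply: mulr_gt0; first by apply: (divr_gt0 a168); rewrite subr_gt0 two_pow_lt1 // oppr_lt0.
have kF := ckF_gt0; have kS := ckS_gt0; have kE := ckE_gt0; have fs := fsizec_gt0 Ck0.
have k16 : 0 < 16 * ckF by lra.
by rewrite !mulr_gt0 // powR_gt0.
Qed.

Variables (X Y : finType) (T : X -> tritile R) (TP : Y -> tritile R).
Variables (K L : nat) (Phi : X -> 'I_3 -> R -> C) (PhiP : Y -> R -> C).
Hypothesis MD : model T TP c K L Ck Phi PhiP.
Local Notation a := (qa T).
Local Notation l := (ql T).
Local Notation u := (qu T).
Local Notation pl := (pl TP).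
Local Notation cp := (cen (pb TP) pl).
Local Notation cq := (cen a l).
Let l0 := ts_gt0 (md_ts MD).
Let lp0 := md_pl MD.
Variable z : Y -> C.
Hypothesis hz : forall y, cabs (z y) = Num.sqrt (pl y).
Variables (E2 E3 : set R) (f2 f3 : R -> C).
Hypotheses (mE2 : measurable E2) (fE2 : (mu E2 < +oo)%E) (mf2 : cmeasurable f2).
Hypotheses (mE3 : measurable E3) (fE3 : (mu E3 < +oo)%E) (mf3 : cmeasurable f3).
Hypothesis bf2 : forall x, cabs (f2 x) <= \1_E2 x.
Hypothesis bf3 : forall x, cabs (f3 x) <= \1_E3 x.

Definition size3 (j : 'I_3) (x : X) : R := match val j with
  | 0%N => cabs (ip f2 (Phi x i0)) | 1%N => cabs (ip f3 (Phi x i1))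
  | _ => cabs (coef T TP c Phi PhiP z x) end.

Lemma size3_ge0 j x : 0 <= size3 j x.
Proof. by case: j => [[|[|?]] ?]; exact: cabs_ge0. Qed.

Lemma ord3 (j : 'I_3) : [\/ j = i0, j = i1 | j = i2].
Proof.
by case: j => [[|[|[|//]]] h]; [apply: Or31|apply: Or32|apply: Or33]; apply/val_inj.
Qed.

Variable dl : X -> nat.
Hypothesis hdl : forall x, (dl x = 0%N \/ lev [set: Y]%SET cp pl (2 ^- dl x) (cq x) (l x)) /\
  ~ lev [set: Y]%SET cp pl (2 ^- (dl x).+1) (cq x) (l x).
Definition level (d : nat) : {set X} := [set x | dl x == d]%SET.
Let XX := \sum_y pl y.

Lemma size_coef d : has_size a l u size3 i2 (level d) (Num.sqrt ckS * 2 ^- d).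
Proof.
have kS := ltW ckS_gt0; have fl := cst_flat_gt0; have sm := cst_smear_ge0.
have g2 := sqr_ge0 (8 * packet_cst Ck).
have p2 : 0 < (2 : R) ^- d by rewrite invr_gt0 exprn_gt0.
move=> t tQ; rewrite exprMn (sqr_sqrtr kS).
have lv x : x \in level d -> (d != 0)%N -> lev [set: Y]%SET cp pl (2 ^- d) (cq x) (l x).
  by rewrite inE => /eqP e d0; have [[h|h] _] := hdl x; [move: d0; rewrite -e h | rewrite -e].
have W (w v : R) : v <= ckS * (2 ^- d) ^+ 2 -> w <= v * l t -> w <= ckS * (2 ^- d) ^+ 2 * l t.
  by move=> h1 h2; apply: (le_trans h2); rewrite ler_wpM2r ?(ltW (l0 t)).
have small : (d <= 1)%N -> 4^-1 <= ((2 : R) ^- d) ^+ 2.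
  case: d {tQ p2 lv W} => [|[|//]] _; rewrite ?expr0 ?expr1 ?invr1 ?expr1n; first by lra.
  by rewrite exprVn; lra.
have ck4 : (d <= 1)%N -> ckS / 4 <= ckS * (2 ^- d) ^+ 2.
  by move=> d1; apply: ler_wpM2l => //; exact: small.
split.
  rewrite /size3 /=; have [d1|d1] := leqP d 1.
    apply: (W _ _ _ (top_flat MD hz t)); apply: le_trans (ck4 d1).
    by rewrite /ckS; move: (_ ^+ 2) (cst_flat _ _) (cst_smear _ _) g2 fl sm => w1 w2 w3; lra.
  have dn : d != 0%N by case: (d) d1.
  apply: (W _ _ _ (top_lev MD hz (ltW p2) (lv t tQ dn))).
  rewrite exprMn; apply: ler_wpM2r; first exact: sqr_ge0.
  by rewrite /ckS; move: (_ ^+ 2) (cst_flat _ _) (cst_smear _ _) g2 fl sm => w1 w2 w3; lra.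
move=> i ij; have ni : i2 != i by rewrite eq_sym.
have -> : \sum_(x in level d | ltt a l u i x t) size3 i2 x ^+ 2 =
    \sum_(x in tree T i t (level d)) cabs (coef T TP c Phi PhiP z x) ^+ 2.
  rewrite [RHS](eq_bigl (fun x => (x \in level d) && ltt a l u i x t)) //.
  by move=> x; rewrite finset.in_set.
have [d1|d1] := leqP d 1.
  apply: (W _ _ _ (size_flat MD hz t (level d) ni)); apply: le_trans (ck4 d1).
  by rewrite /ckS; move: (_ ^+ 2) (cst_flat _ _) (cst_smear _ _) g2 fl sm => w1 w2 w3; lra.
have dn : d != 0%N by case: (d) d1.
have d4 : (2 : R) ^- d <= 1 / 4.
  rewrite div1r lef_pV2 ?posrE ?exprn_gt0 //.
  have -> : (4 : R) = 2 ^+ 2 by ring.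
  by rewrite ler_eXn2l // ltr1n.
have tr x : x \in tree T i t (level d) -> x \in level d by rewrite finset.in_set => /andP[].
apply: (W _ _ _ (size_smear MD hz ni p2 d4 (fun x xT => lv x (tr x xT) dn) (lv t tQ dn))).
apply: ler_wpM2r; first exact: sqr_ge0.
by rewrite /ckS; move: (_ ^+ 2) (cst_flat _ _) (cst_smear _ _) g2 fl sm => w1 w2 w3; lra.
Qed.

Lemma energy_coef (Q : {set X}) : has_energy a l u size3 i2 Q (Num.sqrt (ckE * XX)).
Proof.
have X0 : 0 <= XX by apply: sumr_ge0 => y _; exact: ltW.
move=> s s0 hs U tau UQ tQ FU ht; rewrite (sqr_sqrtr (mulr_ge0 (ltW ckE_gt0) X0)).
by apply: (energy_tops MD hz FU s0) => // x /(fintype.subsetP UQ) /hs.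
Qed.

Hypotheses (m2 : 0 < fine (mu E2)) (m3 : 0 < fine (mu E3)) (X0 : 0 < XX).

Lemma energy_fun d j (f : R -> C) (E : set R) : measurable E -> (mu E < +oo)%E -> cmeasurable f ->
  (forall x, cabs (f x) <= \1_E x) -> (forall x, size3 j x = cabs (ip f (Phi x j))) ->
  forall Q : {set X}, Q \subset level d ->
  has_energy a l u size3 j Q (Num.sqrt (ckF * Num.min (fine (mu E)) (8 * (2 ^+ d.+1 * XX)))).
Proof.
move=> mE fE mf bf sE Q QQ.
case: (leP (fine (mu E)) (8 * (2 ^+ d.+1 * XX))) => _.
  exact: (f_energy (md_ts MD) (md_K MD) (md_L MD) Ck0 (md_lw MD) (md_wp MD) mE fE mf bf sE).
have hD : {in level d, forall x, 0 < l x /\ ~ lev [set: Y]%SET cp pl (2 ^- d.+1) (cq x) (l x)}.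
  by move=> x; rewrite inE => /eqP <-; split; [exact: l0 | exact: (hdl x).2].
have [rho [kap [h1 h2]]] := level_cover (fun y => ltW (lp0 y)) hD.
apply: (f_energy_local (md_ts MD) (md_K MD) (md_L MD) Ck0 (md_lw MD) (md_wp MD) mE fE mf bf sE h1 _ QQ).
apply: (le_trans h2); rewrite le_eqVlt; apply/orP; left; apply/eqP; congr (_ * _).
by apply: eq_bigl => y; rewrite finset.in_setT.
Qed.

Lemma level_est d : \sum_(x in level d) lam l size3 x <=
  168 / (1 - 2 `^ (- th)) *
  ((fsizec Ck `^ th * (16 * ckF) `^ (1 - th) * ckS `^ ((1 - 2 * th) / 2) * ckE `^ th) *
   ((fine (mu E2) * fine (mu E3)) `^ (q / 2) * XX `^ (1 - q)) * (2 `^ (th - q)) ^+ d).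
Proof.
have kF := ckF_gt0; have kS := ckS_gt0; have kE := ckE_gt0; have fs := fsizec_gt0 Ck0.
have [t0 t1] := andP th0; have [q0 q1] := andP q01.
pose S (j : 'I_3) : R := if (val j < 2)%N then Num.sqrt (fsizec Ck) else Num.sqrt ckS * 2 ^- d.
pose m (j : 'I_3) := if (val j == 0)%N then fine (mu E2) else fine (mu E3).
pose E (j : 'I_3) : R := if (val j < 2)%N
  then Num.sqrt (ckF * Num.min (m j) (8 * (2 ^+ d.+1 * XX))) else Num.sqrt (ckE * XX).
have M0 : 0 < 8 * (2 ^+ d.+1 * XX) by rewrite !mulr_gt0 ?exprn_gt0.
have S0 j : 0 < S j.
  by rewrite /S; case: ifP => _; rewrite ?mulr_gt0 ?sqrtr_gt0 ?invr_gt0 ?exprn_gt0.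
have m0 j : 0 < m j by rewrite /m; case: ifP.
have E0 j : 0 < E j.
  by rewrite /E; case: ifP => _; rewrite sqrtr_gt0 mulr_gt0 // lt_min m0 M0.
have hS j : has_size a l u size3 j (level d) (S j).
  case: (ord3 j) => ->; rewrite /S /=.
  - exact: (f_size (md_ts MD) (md_K MD) (md_L MD) Ck0 (md_lw MD) (md_wp MD) mE2 fE2 mf2 bf2).
  - exact: (f_size (md_ts MD) (md_K MD) (md_L MD) Ck0 (md_lw MD) (md_wp MD) mE3 fE3 mf3 bf3).
  - exact: size_coef.
have hE j (Q' : {set X}) : Q' \subset level d -> has_energy a l u size3 j Q' (E j).
  move=> QQ; case: (ord3 j) => ->; rewrite /E /=.
  - exact: (energy_fun mE2 fE2 mf2 bf2).
  - exact: (energy_fun mE3 fE3 mf3 bf3).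
  - exact: energy_coef.
have := model_interp (md_ts MD) size3_ge0 S0 E0 th0 hS hE.
move/le_trans; apply; apply: ler_wpM2l.
  by apply: divr_ge0; [lra | rewrite subr_ge0 ltW // two_pow_lt1 // oppr_lt0].
rewrite /interp /S /E /m /=.
exact: interp_numeric.
Qed.

Lemma core_pos : \sum_x lam l size3 x <=
  core_cst * ((fine (mu E2) * fine (mu E3)) `^ (q / 2) * XX `^ (1 - q)).
Proof.
pose n := (\max_x dl x).+1.
have [t0 t1] := andP th0.
pose r := 2 `^ (th - q); have r01 : 0 <= r < 1.
  by rewrite powR_ge0 two_pow_lt1 // subr_lt0.
have -> : \sum_x lam l size3 x = \sum_(d < n) \sum_(x in level d) lam l size3 x.
  have E x : lam l size3 x = \sum_(d < n) (if x \in level d then lam l size3 x else 0).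
    have xn : (dl x < n)%N by rewrite ltnS; exact: leq_bigmax.
    rewrite (bigD1 (Ordinal xn)) //= inE eqxx big1 ?addr0 // => d dx.
    by rewrite inE ifN //; apply: contra dx => /eqP e; apply/eqP/val_inj.
  rewrite (eq_bigr _ (fun x _ => E x)) exchange_big /=; apply: eq_bigr => d _.
  by rewrite -big_mkcond.
apply: (le_trans (ler_sum _ (fun (d : 'I_n) _ => level_est d))).
rewrite -mulr_sumr -mulr_sumr.
have := geo_le n r01; rewrite -/r /core_cst -/r.
set A := 168 / _; set B := _ * ckE `^ th; set D := _ `^ (q / 2) * _; set s := \sum_(d < n) _ => hs.
have A0 : 0 <= A.
  by apply: divr_ge0; [lra | rewrite subr_ge0 ltW // two_pow_lt1 // oppr_lt0].
have B0 : 0 <= B by rewrite !mulr_ge0 ?powR_ge0.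
have DD0 : 0 <= D by rewrite mulr_ge0 ?powR_ge0.
have := ler_wpM2l (mulr_ge0 (mulr_ge0 A0 B0) DD0) hs; lra.
Qed.

End Core.

(** * Dualization and integration over the parameter *)

Section Duality.
Variable R : realType.
Local Notation mu := (@lebesgue_measure R).
Local Notation C := R[i].
Local Notation Re := complex.Re.
Local Notation Im := complex.Im.
Variables (c : R) (Ck : nat -> R) (q th : R).
Hypotheses (Ck0 : forall k, 0 < Ck k) (c0 : 0 < c).
Hypotheses (q01 : 0 < q < 1) (th0 : 0 < th <= 1 / 3) (thq : th < q) (th1 : th + q <= 1).
Variables (E2 E3 : set R) (f2 f3 : R -> C).
Hypotheses (mE2 : measurable E2) (fE2 : (mu E2 < +oo)%E) (mf2 : cmeasurable f2).
Hypotheses (mE3 : measurable E3) (fE3 : (mu E3 < +oo)%E) (mf3 : cmeasurable f3).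
Hypothesis bf2 : forall x, cabs (f2 x) <= \1_E2 x.
Hypothesis bf3 : forall x, cabs (f3 x) <= \1_E3 x.
Variables (X Y : finType) (T : X -> tritile R) (TP : Y -> tritile R) (K L : nat).
Local Notation l := (ql T).
Local Notation pl := (pl TP).
Let XX := \sum_y pl y.
Local Notation bound := (core_cst c Ck q th *
  ((fine (mu E2) * fine (mu E3)) `^ (q / 2) * XX `^ (1 - q))).

Lemma ip_null (E : set R) (f g : R -> C) (M : R) : measurable E -> (mu E < +oo)%E ->
  cmeasurable f -> cmeasurable g -> (forall x, cabs (f x) <= \1_E x) -> (forall x, cabs (g x) <= M) ->
  cabs (ip f g) <= 2 * M * fine (mu E).
Proof.
move=> mE fE mf mg bf bg; have iE := indic_intg mE fE.
have -> : 2 * M * fine (mu E) = 2 * Rintegral mu setT (fun x => M * \1_E x).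
  by rewrite RintegralZl // /Rintegral integral_indic // setIT mulrA.
apply: ip_le => //; first exact: intgZ.
move=> x; rewrite mulrC; apply: ler_pM; rewrite ?cabs_ge0 //.
Qed.

Let lam3E (Phi : X -> 'I_3 -> R -> C) (PhiP : Y -> R -> C) (z : Y -> C) x :
  lam l (size3 c T TP Phi PhiP z f2 f3) x = cabs (ip f2 (Phi x i0)) * cabs (ip f3 (Phi x i1)) *
    cabs (coef T TP c Phi PhiP z x) / Num.sqrt (l x).
Proof. by rewrite /lam !big_ord_recl big_ord0 /size3 /= mulr1 mulrA. Qed.

Lemma core_bound (Phi : X -> 'I_3 -> R -> C) (PhiP : Y -> R -> C) (z : Y -> C) :
  model T TP c K L Ck Phi PhiP -> (forall y, cabs (z y) = Num.sqrt (pl y)) -> 0 < XX ->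
  \sum_x lam l (size3 c T TP Phi PhiP z f2 f3) x <= bound.
Proof.
move=> MD hz X0.
have cst0 := ltW (core_cst_gt0 Ck0 c0 th0 thq).
have pos : 0 <= bound := mulr_ge0 cst0 (mulr_ge0 (powR_ge0 _ _) (powR_ge0 _ _)).
have null (m : R) : 0 <= m -> m <> 0 -> 0 < m.
  by move=> m0 mn; rewrite lt_neqAle m0 andbT eq_sym; apply/eqP.
have sup x j s := wave_packet_sup (P := tcomp (T x) j) s (ts_gt0 (md_ts MD) x) Ck0 (md_wp MD x j).
have [m2|n2] := pselect (fine (mu E2) = 0).
  rewrite big1 // => x _; rewrite lam3E.
  have := ip_null mE2 fE2 mf2 (md_wp MD x i0).1 bf2 (sup x i0).
  rewrite m2 mulr0 => h; have -> : cabs (ip f2 (Phi x i0)) = 0.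
    by apply/eqP; rewrite eq_le h cabs_ge0.
  by rewrite !mul0r.
have [m3|n3] := pselect (fine (mu E3) = 0).
  rewrite big1 // => x _; rewrite lam3E.
  have := ip_null mE3 fE3 mf3 (md_wp MD x i1).1 bf3 (sup x i1).
  rewrite m3 mulr0 => h; have -> : cabs (ip f3 (Phi x i1)) = 0.
    by apply/eqP; rewrite eq_le h cabs_ge0.
  by rewrite mulr0 !mul0r.
have X0' : 0 < \sum_(y in [set: Y]%SET) pl y.
  by rewrite (eq_bigl predT) // => y; rewrite finset.in_setT.
have [dl hdl] := level_function (cen (pb TP) pl) (cen (qa T) l) (ts_gt0 (md_ts MD)) X0'.
apply: (core_pos Ck0 c0 q01 th0 thq th1 MD hz mE2 fE2 mf2 mE3 fE3 mf3 bf2 bf3 hdl _ _ X0);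
by apply: null => //; exact: fine_ge0.
Qed.

Lemma cint_onE (g : R -> C) :
  cint_on `[0, 1] g = cint (fun x => rc (\1_(`[0, 1]%classic : set R) x) * g x).
Proof.
have H (h : R -> R) : Rintegral mu `[0, 1] h =
    Rintegral mu setT (fun x => \1_(`[0, 1]%classic : set R) x * h x).
  rewrite /Rintegral integral_mkcond; congr fine; apply: eq_integral => x _.
  rewrite /patch indicE; case: ifP => xI; by rewrite ?mul1r ?mul0r.
rewrite /cint /cint_on !H; congr (_ +i* _)%C; congr (Rintegral _ _ _); apply/funext => x;
by rewrite ?cReM ?cImM /= !mul0r ?subr0 ?addr0.
Qed.

Variables (PhA : R -> X -> 'I_3 -> R -> C) (PhP : Y -> R -> C).
Hypothesis mPhA : forall x j, cmeas2 (fun al s => PhA al x j s).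
Hypothesis MD : forall al, 0 <= al <= 1 -> model T TP c K L Ck (PhA al) PhP.

Definition pcoef y : C := cint (fun s => cint_on `[0, 1] (fun al =>
   \sum_(x | prel T TP c y x) (rc (Num.sqrt (l x))^-1 * ip f2 (PhA al x i0) * ip f3 (PhA al x i1)
       * PhA al x i2 s)) * (PhP y s)^*).

Let I01 (al : R) : R := \1_(`[0, 1]%classic : set R) al.
Let Psi al x j s := rc (I01 al) * PhA al x j s.

Let I01P al : (I01 al = 1 /\ 0 <= al <= 1) \/ I01 al = 0.
Proof.
rewrite /I01 indicE; case: (boolP (al \in _)) => h; [left | by right].
by split=> //; move: h; rewrite inE /= in_itv.
Qed.

Let I01_intg : intg I01. Proof. exact: integrable_indic_itv. Qed.

Let I01_Rint : Rintegral mu setT I01 = 1.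
Proof.
rewrite /Rintegral integral_indic // setIT.
have H : mu (`[0, 1]%classic : set R) = 1%:E.
  by rewrite lebesgue_measure_itv /= lte_fin ltr01 -EFinD oppr0 addr0.
by transitivity (fine (1%:E : \bar R)); first by rewrite -H.
Qed.

Let MD0 : model T TP c K L Ck (PhA 0) PhP.
Proof. by apply: MD; rewrite lexx ler01. Qed.
Let l0 x : 0 < l x := ts_gt0 (md_ts MD0) x.
Let lp0 := md_pl MD0.

Let Psi_meas x j : cmeas2 (fun al s => Psi al x j s).
Proof.
apply: cmeas2M => //; apply: cmeas2_fst; apply: cmeasR; exact: intg_meas I01_intg.
Qed.

Let M := \sum_x Ck 0%N / Num.sqrt (l x).

Let Psi_le al x j s : cabs (Psi al x j s) <= I01 al * M.
Proof.
rewrite /Psi cabsM cabs_rc; have [[-> h]|->] := I01P al; last by rewrite normr0 !mul0r.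
rewrite normr1 !mul1r.
apply: (le_trans (wave_packet_sup (P := tcomp (T x) j) s (l0 x) Ck0 (md_wp (MD h) x j))).
rewrite /M (bigD1 x) //= lerDl; apply: sumr_ge0 => x' _.
by rewrite divr_ge0 ?sqrtr_ge0 // ltW.
Qed.

Let M0 : 0 <= M.
Proof. by apply: sumr_ge0 => x _; rewrite divr_ge0 ?sqrtr_ge0 // ltW. Qed.

Let A2 x al := ip f2 (Psi al x i0).
Let A3 x al := ip f3 (Psi al x i1).

Let A_meas (E : set R) (f : R -> C) x j : measurable E -> (mu E < +oo)%E -> cmeasurable f ->
  (forall s, cabs (f s) <= \1_E s) -> cmeasurable (fun al => ip f (Psi al x j)) /\
  forall al, cabs (ip f (Psi al x j)) <= 2 * M * fine (mu E).
Proof.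
move=> mE fE mf bf; split.
  have mF : cmeas2 (fun al s => f s * (Psi al x j s)^*).
    apply: cmeas2M; first exact: cmeas2_snd.
    have [r i] := Psi_meas x j; split.
      by rewrite (_ : (fun p => _) = (fun p : R * R => Re (Psi p.1 x j p.2))) //; apply/funext => p; rewrite cReJ.
    rewrite (_ : (fun p => _) = (fun p : R * R => - Im (Psi p.1 x j p.2))).
      exact: measurable_funN.
    by apply/funext => p; rewrite cImJ.
  apply: (cFubini_meas mF I01_intg (intgZ M (indic_intg mE fE))) => al s.
  rewrite cabsM cabsJ mulrC; apply: (le_trans (ler_pM (cabs_ge0 _) (cabs_ge0 _) (Psi_le al x j s) (bf s))).
  by rewrite mulrA.
move=> al; apply: (ip_null mE fE mf (cmeas2_1 al (Psi_meas x j)) bf) => s.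
apply: (le_trans (Psi_le al x j s)); rewrite ler_piMl //.
by rewrite /I01 indicE lern1 leq_b1.
Qed.

Let F' y al s := \sum_(x | prel T TP c y x)
  rc (Num.sqrt (l x))^-1 * A2 x al * A3 x al * Psi al x i2 s.
Let F y al s := F' y al s * (PhP y s)^*.

Let cst x := (Num.sqrt (l x))^-1 * (2 * M * fine (mu E2)) * (2 * M * fine (mu E3)) * M.

Let cmeas2_sum (P : pred X) (G : X -> R -> R -> C) : (forall x, cmeas2 (G x)) ->
  cmeas2 (fun al s => \sum_(x | P x) G x al s).
Proof.
move=> mG; elim: (index_enum X) => [|x r IH].
  rewrite (_ : (fun al s : R => _) = (fun _ _ => 0)); last first.
    by apply/funext => al; apply/funext => s; rewrite big_nil.
  by split; exact: measurable_cst.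
case: (boolP (P x)) => Px.
  rewrite (_ : (fun al s : R => _) = (fun al s => G x al s + \sum_(x <- r | P x) G x al s)).
    exact: cmeas2D.
  by apply/funext => al; apply/funext => s; rewrite big_cons Px.
rewrite (_ : (fun al s : R => _) = (fun al s => \sum_(x <- r | P x) G x al s)) //.
by apply/funext => al; apply/funext => s; rewrite big_cons (negbTE Px).
Qed.

Let F'_meas y : cmeas2 (F' y).
Proof.
apply: cmeas2_sum => x; apply: cmeas2M => //; apply: cmeas2M; last first.
  apply: cmeas2_fst; exact: (A_meas x i1 mE3 fE3 mf3 bf3).1.
apply: cmeas2M; first exact/cmeas2_fst/cmeas_cst.
apply: cmeas2_fst; exact: (A_meas x i0 mE2 fE2 mf2 bf2).1.
Qed.

Let F_meas y : cmeas2 (F y).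
Proof.
apply: cmeas2M; first exact: F'_meas.
apply: cmeas2_snd; apply: cmeasJ; exact: (md_wpP MD0 y).1.
Qed.

Let PhP_intg y : intg (fun s => cabs (PhP y s)).
Proof.
apply: (wave_packet_intg (P := tcomp (TP y) i1) (lp0 y) _ (md_wpP MD0 y)).
exact: leq_trans (md_L MD0).
Qed.

Let cst_ge0 x : 0 <= cst x.
Proof.
have a0 : 0 <= 2 * M * fine (mu E2) by rewrite mulr_ge0 ?fine_ge0 // mulr_ge0.
have b0 : 0 <= 2 * M * fine (mu E3) by rewrite mulr_ge0 ?fine_ge0 // mulr_ge0.
have is0 : 0 <= (Num.sqrt (l x))^-1 by rewrite invr_ge0 sqrtr_ge0.
exact: (mulr_ge0 (mulr_ge0 (mulr_ge0 is0 a0) b0) M0).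
Qed.

Let F'_le y al s : cabs (F' y al s) <= I01 al * \sum_x cst x.
Proof.
have i0' : 0 <= I01 al by rewrite /I01 indicE.
apply: (le_trans (cabs_sum _ _ _)); rewrite mulr_sumr big_mkcond; apply: ler_sum => x _.
case: ifP => _; last by apply: mulr_ge0 i0' (cst_ge0 x).
rewrite cabsM (cabsM (_ * A2 x al)) (cabsM (rc _)) cabs_rc ger0_norm ?invr_ge0 ?sqrtr_ge0 //.
have -> : I01 al * cst x = (Num.sqrt (l x))^-1 * (2 * M * fine (mu E2)) * (2 * M * fine (mu E3)) * (I01 al * M).
  by rewrite /cst; ring.
have is0 : 0 <= (Num.sqrt (l x))^-1 by rewrite invr_ge0 sqrtr_ge0.
have a2 := (A_meas x i0 mE2 fE2 mf2 bf2).2 al; have a3 := (A_meas x i1 mE3 fE3 mf3 bf3).2 al.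
apply: ler_pM (Psi_le al x i2 s); [|exact: cabs_ge0|].
  by rewrite !mulr_ge0 ?cabs_ge0.
by apply: ler_pM a3; [rewrite mulr_ge0 ?cabs_ge0|exact: cabs_ge0|apply: ler_wpM2l].
Qed.

Let F_le y al s : cabs (F y al s) <= I01 al * ((\sum_x cst x) * cabs (PhP y s)).
Proof. by rewrite /F cabsM cabsJ mulrA ler_wpM2r ?cabs_ge0 // F'_le. Qed.

Let G y al := cint (F y al).

Let G_intg y : cintg (G y).
Proof.
have iq := intgZ (\sum_x cst x) (PhP_intg y).
have mG := cFubini_meas (F_meas y) I01_intg iq (F_le y).
pose k := 2 * Rintegral mu setT (fun s => (\sum_x cst x) * cabs (PhP y s)).
apply: (cintg_le mG (intgZ k I01_intg)) => al.
apply: (le_trans (cint_le (cmeas2_1 al (F_meas y)) (intgZ (I01 al) iq) (F_le y al))).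
have e : Rintegral mu setT (fun s => I01 al * ((\sum_x cst x) * cabs (PhP y s))) =
    I01 al * Rintegral mu setT (fun s => (\sum_x cst x) * cabs (PhP y s)).
  by rewrite RintegralZl //; exact: iq.
apply: (@le_trans _ _ (2 * (I01 al * Rintegral mu setT (fun s => (\sum_x cst x) * cabs (PhP y s))))).
  by rewrite -e.
by rewrite /k -[leRHS]mulrA [I01 al * _]mulrC.
Qed.

Let Psi1 al x j : I01 al = 1 -> Psi al x j = PhA al x j.
Proof. by move=> e; apply/funext => s; rewrite /Psi e; have -> : rc 1 = 1 :> C by []; rewrite mul1r. Qed.

Let Psi0 al x j : I01 al = 0 -> Psi al x j = (fun=> 0).
Proof. by move=> e; apply/funext => s; rewrite /Psi e; have -> : rc 0 = 0 :> C by []; rewrite mul0r. Qed.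

Lemma pcoefE y : pcoef y = cint (G y).
Proof.
have iq := intgZ (\sum_x cst x) (PhP_intg y).
rewrite /G (cFubini (F_meas y) I01_intg iq (F_le y)); apply: eq_cint => s.
have E al : rc (I01 al) * (\sum_(x | prel T TP c y x) (rc (Num.sqrt (l x))^-1 * ip f2 (PhA al x i0) *
    ip f3 (PhA al x i1) * PhA al x i2 s)) = F' y al s.
  rewrite /F' /A2 /A3; have [[e h]|e] := I01P al; rewrite e.
    have -> : rc 1 = 1 :> C by []; rewrite mul1r.
    by apply: eq_bigr => x _; rewrite !Psi1.
  have -> : rc 0 = 0 :> C by []; rewrite mul0r big1 // => x _.
  by rewrite (Psi0 x i2 e) mulr0.
rewrite cint_onE -/I01 (eq_cint E) mulrC -cintZ.
  by apply: eq_cint => al; rewrite mulrC.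
apply: (cintg_le (cmeas2_2 s (F'_meas y)) (intgZ (\sum_x cst x) I01_intg)) => al.
by rewrite mulrC; exact: F'_le.
Qed.

Let Psi_sqi al x j : sqi (Psi al x j).
Proof.
have [[e h]|e] := I01P al; last by rewrite Psi0 //; exact: sqi0.
rewrite Psi1 //; exact: (Phi_sqi (md_ts (MD h)) (md_L (MD h)) Ck0 (md_wp (MD h))).
Qed.

Let GE y al : G y al = \sum_(x | prel T TP c y x)
  rc (Num.sqrt (l x))^-1 * A2 x al * A3 x al * ip (Psi al x i2) (PhP y).
Proof.
rewrite /G -/(ip (F' y al) (PhP y)) /F' ip_suml //; exact: (PhiP_sqi MD0).
Qed.

Let cint_lin (r : seq Y) (w : Y -> C) (g : Y -> R -> C) : (forall y, cintg (g y)) ->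
  cintg (fun s => \sum_(y <- r) w y * g y s) /\
  cint (fun s => \sum_(y <- r) w y * g y s) = \sum_(y <- r) w y * cint (g y).
Proof.
move=> ig; elim: r => [|y r [IH1 IH2]].
  have -> : (fun s : R => \sum_(y <- [::]) w y * g y s) = (fun=> 0).
    by apply/funext => s; rewrite big_nil.
  by rewrite big_nil cint0; split=> //; exact: cintg0.
have -> : (fun s => \sum_(y <- y :: r) w y * g y s) =
    (fun s => w y * g y s + \sum_(y <- r) w y * g y s).
  by apply/funext => s; rewrite big_cons.
rewrite big_cons cintD //; last exact: cintgZ.
by rewrite cintZ // IH2; split=> //; apply: cintgD => //; exact: cintgZ.
Qed.

Lemma dual_bound : 0 < XX -> \sum_y Num.sqrt (pl y) * cabs (pcoef y) <= 2 * bound.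
Proof.
move=> X0.
have unit y : exists w : C, cabs w = Num.sqrt (pl y) /\
    rc (Num.sqrt (pl y) * cabs (pcoef y)) = w * pcoef y.
  have [e|ne] := eqVneq (cabs (pcoef y)) 0.
    exists (rc (Num.sqrt (pl y))); rewrite cabs_rc ger0_norm ?sqrtr_ge0 //; split=> //.
    have -> : pcoef y = 0 by move: e; rewrite cabsE => /Normc.eq0_normc.
    by rewrite cabs0 !mulr0.
  have p : 0 < cabs (pcoef y) by rewrite lt_neqAle eq_sym ne cabs_ge0.
  exists (rc (Num.sqrt (pl y) / cabs (pcoef y)) * (pcoef y)^*); split.
    rewrite cabsM cabsJ cabs_rc ger0_norm ?divr_ge0 ?sqrtr_ge0 ?cabs_ge0 //.
    by rewrite divfK.
  rewrite -mulrA; have -> : (pcoef y)^* * pcoef y = rc (cabs (pcoef y) ^+ 2).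
    move: (pcoef y) => v; rewrite cabs_sqr.
    apply: complex_ext; first by rewrite cReM cReJ cImJ /=; ring.
    by rewrite cImM cReJ cImJ /=; ring.
  by rewrite -rcM; congr rc; field.
have [w hw] := choice unit.
have E : rc (\sum_y Num.sqrt (pl y) * cabs (pcoef y)) = cint (fun al => \sum_y w y * G y al).
  have -> : rc (\sum_y Num.sqrt (pl y) * cabs (pcoef y)) = \sum_y w y * pcoef y.
    have -> : \sum_y w y * pcoef y = \sum_y rc (Num.sqrt (pl y) * cabs (pcoef y)).
      by apply: eq_bigr => y _; rewrite (hw y).2.
    by apply: complex_ext; rewrite ?cRe_sum ?cIm_sum //= big1.
  have [_ ->] := cint_lin (index_enum Y) w G_intg.
  by apply: eq_bigr => y _; rewrite pcoefE.
have s0 : 0 <= \sum_y Num.sqrt (pl y) * cabs (pcoef y).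
  by apply: sumr_ge0 => y _; rewrite mulr_ge0 ?sqrtr_ge0 ?cabs_ge0.
rewrite -[leLHS]ger0_norm // -cabs_rc E.
have mG : cmeasurable (fun al => \sum_y w y * G y al).
  by have [[r i] _] := cint_lin (index_enum Y) w G_intg; split; exact: intg_meas.
have -> : 2 * bound = 2 * Rintegral mu setT (fun al => bound * I01 al).
  by rewrite RintegralZl // I01_Rint mulr1.
apply: (cint_le mG (intgZ _ I01_intg)) => al.
have [[e h]|e] := I01P al; last first.
  rewrite e mulr0 big1 ?cabs0 // => y _; rewrite GE big1 ?mulr0 // => x _.
  by rewrite (Psi0 x i2 e) ip0l mulr0.
rewrite e mulr1.
pose z y := (w y)^*.
have hz y : cabs (z y) = Num.sqrt (pl y) by rewrite /z cabsJ (hw y).1.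
apply: le_trans (core_bound (MD h) hz X0).
have -> : \sum_y w y * G y al = \sum_x rc (Num.sqrt (l x))^-1 * A2 x al * A3 x al *
    (coef T TP c (PhA al) PhP z x)^*.
  under eq_bigr do rewrite GE mulr_sumr.
  rewrite (exchange_big_dep predT) //=; apply: eq_bigr => x _.
  rewrite /coef cJ_sum mulr_sumr; apply: eq_bigr => y _.
  rewrite Psi1 // cJM /z cJK ipJ; first by ring.
    exact: (PhiP_sqi MD0).
  exact: (Phi_sqi (md_ts (MD h)) (md_L (MD h)) Ck0 (md_wp (MD h))).
apply: (le_trans (cabs_sum _ _ _)); apply: ler_sum => x _.
rewrite !cabsM cabsJ cabs_rc ger0_norm ?invr_ge0 ?sqrtr_ge0 // /A2 /A3 !Psi1 //.
by rewrite lam3E le_eqVlt; apply/orP; left; apply/eqP; ring.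
Qed.

End Duality.

Lemma absorb (R : realType) (A m2 m3 X q : R) : 0 < A -> 0 < q -> 0 <= m2 -> 0 <= m3 -> 0 < X ->
  X <= A * ((m2 * m3) `^ (q / 2) * X `^ (1 - q)) -> X <= A `^ q^-1 * (Num.sqrt m2 * Num.sqrt m3).
Proof.
move=> A0 q0 m20 m30 X0 h.
have h1 : X `^ q <= A * (m2 * m3) `^ (q / 2).
  rewrite -(ler_pM2r (powR_gt0 (1 - q) X0)) -powRD; last by apply/implyP => _; rewrite gt_eqF.
  by rewrite addrC subrK powRr1 ?(ltW X0) // -mulrA.
have h2 : (X `^ q) `^ q^-1 <= (A * (m2 * m3) `^ (q / 2)) `^ q^-1.
  apply: ge0_ler_powR; rewrite ?nnegrE ?powR_ge0 //; first by rewrite invr_ge0 ltW.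
  by rewrite mulr_ge0 ?powR_ge0 // ltW.
move: h2; rewrite -powRrM mulfV ?gt_eqF // powRr1 ?(ltW X0) // powRM ?powR_ge0 ?(ltW A0) //.
rewrite -powRrM (_ : q / 2 / q = 2^-1); last by field; rewrite gt_eqF.
by rewrite powR12_sqrt ?mulr_ge0 // sqrtrM.
Qed.

Lemma pow_half (R : realType) (x : R) : 0 < x -> x `^ (- (1 / 2%:R)) = (Num.sqrt x)^-1.
Proof. by move=> x0; rewrite powRN mul1r powR12_sqrt // ltW. Qed.

Theorem theorem4 (R : realType) (a1 a2 : R) :
  0 < a1 -> a1 <= a2 ->
  exists (c0 : R) (K0 L0 : nat), 0 < c0 /\
  forall (c : R) (K L : nat) (Ck : nat -> R) (eps : R),
  0 < c -> c <= c0 -> (K0 <= K)%N -> (L0 <= L)%N ->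
  (forall k, 0 < Ck k) -> 0 < eps < 1 ->
  exists Cst : R, 0 < Cst /\
  forall (b : int) (E2 E3 : set R) (f2 f3 : R -> R[i])
         (sP sQ : 'I_3 -> R) (P P0 Q Qt : seq (tritile R))
         (PhiP : tritile R -> R -> R[i])
         (PhiQ : R -> tritile R -> 'I_3 -> R -> R[i]),
    (* the functions f2, f3 *)
    measurable E2 -> (lebesgue_measure E2 < +oo)%E ->
    measurable E3 -> (lebesgue_measure E3 < +oo)%E ->
    cmeasurable f2 -> cmeasurable f3 ->
    (forall x, cabs (f2 x) <= \1_E2 x) ->
    (forall x, cabs (f3 x) <= \1_E3 x) ->
    (* the Lambda_2-model: the collection P *)
    List.NoDup P -> sparse sP P ->
    (forall T, List.In T P -> adapted a1 a2 (@Gamma1 R) T) ->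
    (forall T, List.In T P -> wave_packet K L Ck (tcomp T i1) (PhiP T)) ->
    (* the collection Q *)
    List.NoDup Q -> sparse sQ Q -> rank1 Q ->
    (forall T, List.In T Q -> adapted a1 a2 (@Gamma2 R) T) ->
    (* the subcollection P0 with pairwise disjoint tiles P2 *)
    List.NoDup P0 -> (forall T, List.In T P0 -> List.In T P) ->
    (forall T T', List.In T P0 -> List.In T' P0 -> T <> T' ->
       ~ exists x xi, inI (TI T) x /\ inI (W2 T) xi /\
                      inI (TI T') x /\ inI (W2 T') xi) ->
    (* the subcollection Qt and its wave packets *)
    List.NoDup Qt -> (forall T, List.In T Qt -> List.In T Q) ->
    (forall a, 0 <= a <= 1 -> forall T, List.In T Qt -> forall i,
       wave_packet K L Ck (tcomp T i) (PhiQ a T i)) ->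
    (forall T i,
       measurable_fun setT (fun p : R * R => complex.Re (PhiQ p.1 T i p.2)) /\
       measurable_fun setT (fun p : R * R => complex.Im (PhiQ p.1 T i p.2))) ->
    \sum_(T <- P0 | `[< 2%:R `^ (- b%:~R - 1) <
          ilen (TI T) `^ (- (1 / 2%:R)) * cabs (coefP c Qt PhiQ f2 f3 T (PhiP T))
          <= 2%:R `^ (- b%:~R) >]) ilen (TI T)
    <= Cst * 2%:R `^ (b%:~R / (1 - eps))
         * Num.sqrt (fine (lebesgue_measure E2)) * Num.sqrt (fine (lebesgue_measure E3)).
Proof.
move=> a1_gt0 a12; exists (10 ^- 9), 1%N, 10%N; split; first by rewrite invr_gt0 exprn_gt0.
move=> c K L Ck eps c_gt0 cle K0 L0 Ck0 /andP[eps0 eps1].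
pose q := 1 - eps; pose th := Num.min eps (1 - eps) / 2.
have [th0 thq th1] : [/\ 0 < th <= 1 / 3, th < q & th + q <= 1].
  by rewrite /th /q; case: (leP eps (1 - eps)) => h; split; try (apply/andP; split); lra.
have q01 : 0 < q < 1 by rewrite /q; apply/andP; split; lra.
have q0 : 0 < q by case/andP: q01.
pose A := core_cst c Ck q th; have A0 : 0 < A := core_cst_gt0 Ck0 c_gt0 th0 thq.
have A40 : 0 < 4 * A by rewrite mulr_gt0.
exists ((4 * A) `^ q^-1); split; first exact: powR_gt0.
move=> b E2 E3 f2 f3 sP sQ P P0 Q Qt PhiP PhiQ mE2 fE2 mE3 fE3 mf2 mf3 bf2 bf3 _ spP _ wpP _ spQ r1 _
  nd0 P0P disj ndt QtQ wpQ mPhi.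
pose cond (T : tritile R) := `[< 2%:R `^ (- b%:~R - 1) <
  ilen (TI T) `^ (- (1 / 2%:R)) * cabs (coefP c Qt PhiQ f2 f3 T (PhiP T)) <= 2%:R `^ (- b%:~R) >].
have [ndc cP0] := NoDup_sieve cond nd0.
set cP := [seq T <- P0 | cond T] in ndc cP0.
pose T (x : 'I_(size Qt)) := tnth (in_tuple Qt) x; pose TP (y : 'I_(size cP)) := tnth (in_tuple cP) y.
have cPP U : List.In U cP -> List.In U P by move/cP0 => [_ /P0P].
pose PhA al x j := PhiQ al (T x) j; pose PhP y := PhiP (TP y).
have MD al : 0 <= al <= 1 -> model T TP c K L Ck (PhA al) PhP.
  move=> h; apply: (model_of spQ r1 ndt QtQ spP ndc cPP) => //.
  - by move=> U U' /cP0[_ hU] /cP0[_ hU']; exact: disj.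
  - by apply/andP; split.
  - by move=> x j; apply: wpQ => //; exact: In_tnth.
  - by move=> y; apply: wpP; apply: cPP; exact: In_tnth.
have MD0 : model T TP c K L Ck (PhA 0) PhP by apply: MD; rewrite lexx ler01.
have rel := rel_of c spQ QtQ spP cPP.
rewrite -big_filter -/cP big_tnth -/(pl TP).
set X := \sum_y _.
have m2 : 0 <= fine (lebesgue_measure E2) by rewrite fine_ge0.
have m3 : 0 <= fine (lebesgue_measure E3) by rewrite fine_ge0.
have -> : (4 * A) `^ q^-1 * 2 `^ (b%:~R / (1 - eps)) = (4 * A * 2 `^ b%:~R) `^ q^-1.
  by rewrite [RHS]powRM ?powR_ge0 ?(ltW A40) // -powRrM.
rewrite -mulrA.
have [X0|X0] := leP X 0.
  by apply: le_trans X0 _; rewrite !mulr_ge0 ?powR_ge0 ?sqrtr_ge0.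
apply: absorb => //; first by rewrite mulr_gt0 // powR_gt0.
have dual := dual_bound Ck0 c_gt0 q01 th0 thq th1 mE2 fE2 mf2 mE3 fE3 mf3 bf2 bf3
  (fun x j => mPhi (T x) j) MD X0.
have E y : coefP c Qt PhiQ f2 f3 (TP y) (PhP y) = pcoef c f2 f3 T TP PhA PhP y.
  rewrite /coefP /pcoef /ip; apply: eq_cint => s; congr (cint_on _ _ * _); apply/funext => al.
  rewrite /BHT big_tnth; apply: eq_big => [x|x _]; first by rewrite rel.
  by rewrite pow_half //; exact: (ts_gt0 (md_ts MD0) x).
have pt y : pl TP y <= 2 `^ (b%:~R + 1) * (Num.sqrt (pl TP y) * cabs (pcoef c f2 f3 T TP PhA PhP y)).
  have p0 := md_pl MD0 y; have s0 : 0 < Num.sqrt (pl TP y) by rewrite sqrtr_gt0.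
  have [/asboolP/andP[lo _] _] := cP0 _ (In_tnth (s := cP) y).
  move: lo; rewrite -/(TP y) -/(PhP y) E pow_half //.
  have -> : 2 `^ (- b%:~R - 1) = (2 `^ (b%:~R + 1))^-1 :> R by rewrite -powRN opprD.
  have B0 : 0 < 2 `^ (b%:~R + 1) :> R by exact: powR_gt0.
  move: (cabs _) => v lo.
  have lo' : Num.sqrt (pl TP y) < 2 `^ (b%:~R + 1) * v.
    by move: lo; rewrite mulrC ltr_pdivlMr // mulrC ltr_pdivrMr // mulrC.
  rewrite -[leLHS](sqr_sqrtr (ltW p0)) expr2 mulrCA ler_wpM2l ?sqrtr_ge0 //; exact: ltW.
apply: (@le_trans _ _ (2 `^ (b%:~R + 1) * (\sum_y Num.sqrt (pl TP y) * cabs (pcoef c f2 f3 T TP PhA PhP y)))).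
  by rewrite mulr_sumr; apply: ler_sum => y _; exact: pt.
apply: (le_trans (ler_wpM2l (powR_ge0 _ _) dual)).
rewrite powRD ?pnatr_eq0 ?implybT // powRr1 //.
by rewrite le_eqVlt; apply/orP; left; apply/eqP; rewrite /A /X; ring.
Qed.
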